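(* Let $\Bbbk$ be an algebraically closed field of arbitrary characteristic, let $X=X_\Sigma$ be an $n$-dimensional smooth projective toric variety over $\Bbbk$, and let $\mathcal L$ be an ample line bundle on $X$. Suppose that $$H^0\left(X,\bigwedge^pT_X\otimes\mathcal L^{-p}\right)\neq0$$ for some integer $1\leq p\leq n$. Then one of the following holds: (i) $(X,\mathcal L)\simeq(\mathbb P^n_\Bbbk,\mathcal O_{\mathbb P^n_\Bbbk}(1))$; (ii) $p=n=1$ and $(X,\mathcal L)\simeq(\mathbb P^1_\Bbbk,\mathcal O_{\mathbb P^1_\Bbbk}(2))$; (iii) $p=n=2$ and $(X,\mathcal L)\simeq(\mathbb P^1_\Bbbk\times\mathbb P^1_\Bbbk,\mathcal O(1,1))$. Conversely, the polarized variety in case (i) satisfies the nonvanishing condition for every $1\leq p\leq n$, whereas the polarized varieties in cases (ii) and (iii) satisfy it for $p=n$.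
   Context: $X_\Sigma$ denotes the toric variety over $\Bbbk$ associated with a fan $\Sigma$, $T_X$ is its tangent bundle, and $\mathcal L^{-p}=(\mathcal L^{\otimes p})^{-1}$. An isomorphism of pairs $(X,\mathcal L)\simeq(Y,\mathcal M)$ means an isomorphism $X\simeq Y$ under which $\mathcal L$ corresponds to a line bundle isomorphic to $\mathcal M$. On $\mathbb P^1_\Bbbk\times\mathbb P^1_\Bbbk$, $\mathcal O(1,1)$ is the tensor product of the pullbacks of $\mathcal O_{\mathbb P^1_\Bbbk}(1)$ from the two factors. *)

(* Defs.v *)
From HB Require Import structures.
From mathcomp Require Import all_boot all_order all_algebra.
From mathcomp Require Import boolp classical_sets cardinality topology.

Set Implicit Arguments.
Unset Strict Implicit.
Unset Printing Implicit Defensive.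

Import Order.TTheory GRing.Theory Num.Theory.

Local Open Scope classical_set_scope.
Local Open Scope ring_scope.

(** Varieties over an algebraically closed field [k] are treated classically:
    a variety is the topological space of its closed points together with its
    sheaf of [k]-valued regular functions, and a morphism is a continuous map
    that pulls regular functions back to regular functions.  For reduced
    schemes of finite type over [k] this is the same category as in the
    language of schemes. *)

(** Functions are total, and [regular U f] says that the restriction of [f] to
    [U] is a section over [U] of the structure sheaf; it is only meaningful
    when [U] is open, and it ignores the values of [f] outside [U]. *)
Record kspace (k : fieldType) := KSpace {
  kcarrier :> topologicalType;
  regular : set kcarrier -> (kcarrier -> k) -> Prop;
  regular_cst : forall U (c : k), regular U (fun=> c);
  regularD : forall U f g, open U -> regular U f -> regular U g ->
    regular U (fun x => f x + g x);
  regularM : forall U f g, open U -> regular U f -> regular U g ->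
    regular U (fun x => f x * g x);
  regularV : forall U f, open U -> regular U f ->
    (forall x, U x -> f x != 0) -> regular U (fun x => (f x)^-1);
  open_regular_neq0 : forall U f, open U -> regular U f ->
    open (U `&` [set x | f x != 0]);
  regular_ext : forall U f g, {in U, f =1 g} -> regular U f -> regular U g;
  regular_sub : forall U V f, open U -> open V -> V `<=` U ->
    regular U f -> regular V f;
  regular_local : forall U f, open U ->
    (forall x, U x -> exists V : set kcarrier,
       [/\ open V, V x, V `<=` U & regular V f]) -> regular U f
}.
Arguments regular {k} X U f : rename.

Record morph (k : fieldType) (X Y : kspace k) := Morph {
  mfun :> X -> Y;
  morph_continuous : continuous mfun;
  morph_regular : forall (V : set Y) (f : Y -> k), open V ->
    regular Y V f -> regular X (mfun @^-1` V) (f \o mfun)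
}.

Definition is_iso (k : fieldType) (X Y : kspace k) (f : morph X Y) :=
  exists g : morph Y X, cancel f g /\ cancel g f.

(** The last clause is the surjectivity of [O_Y -> f_* O_X] on stalks. *)
Definition closed_embedding (k : fieldType) (X Y : kspace k)
    (f : morph X Y) :=
  [/\ injective f,
      forall A : set X, closed A -> closed (f @` A) &
      forall (U : set X) (g : X -> k) (x : X), open U -> regular X U g ->
        U x -> exists (V : set Y) (h : Y -> k),
          [/\ open V, V (f x), regular Y V h, f @^-1` V `<=` U &
              forall y, V (f y) -> g y = h (f y)]].

Inductive gen_alg (k : fieldType) (T : Type) (G : set (T -> k)) :
    (T -> k) -> Prop :=
| gen_alg_gen f : G f -> gen_alg G f
| gen_alg_cst c : gen_alg G (fun=> c)
| gen_algD f g : gen_alg G f -> gen_alg G g -> gen_alg G (fun x => f x + g x)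
| gen_algM f g : gen_alg G f -> gen_alg G g -> gen_alg G (fun x => f x * g x).

Section Fractions.
Variables (k : fieldType) (T I : Type).
Variables (D : I -> set T) (G : I -> set (T -> k)).

Definition frac_compat :=
  (forall x, exists i, D i x) /\
  (forall i j, exists l, [/\ D l = D i `&` D j, G i `<=` gen_alg (G l) &
     G j `<=` gen_alg (G l)]).

(** The sets [D i `&` [set x | b x != 0]], with [b] in the algebra generated
    by [G i], are a basis of the topology. *)
Definition frac_open (W : set T) :=
  forall x, W x -> exists i b, [/\ gen_alg (G i) b, D i x, b x != 0 &
    forall y, D i y -> b y != 0 -> W y].

Definition frac_regular (W : set T) (f : T -> k) :=
  forall x, W x -> exists i a b,
    [/\ gen_alg (G i) a, gen_alg (G i) b, D i x, b x != 0 &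
        forall y, W y -> D i y -> b y != 0 -> f y = a y / b y].

Lemma gen_alg_sub (G1 G2 : set (T -> k)) f :
  G1 `<=` gen_alg G2 -> gen_alg G1 f -> gen_alg G2 f.
Proof.
move=> sG; elim=> {f}[f /sG//|c|f g _ Hf _ Hg|f g _ Hf _ Hg].
- exact: gen_alg_cst.
- exact: gen_algD.
- exact: gen_algM.
Qed.

Hypothesis H : frac_compat.

Lemma frac_meet i j : exists l, [/\ D l = D i `&` D j,
  forall f, gen_alg (G i) f -> gen_alg (G l) f &
  forall f, gen_alg (G j) f -> gen_alg (G l) f].
Proof.
have [l [Dl Gi Gj]] := H.2 i j.
by exists l; split=> // f; apply: gen_alg_sub.
Qed.

Lemma frac_openT : frac_open setT.
Proof.
move=> x _; have [i Dx] := H.1 x; exists i, (fun=> 1).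
by split=> //; [exact: gen_alg_cst|exact: oner_neq0].
Qed.

Lemma frac_openI : setI_closed frac_open.
Proof.
move=> A B oA oB x [/oA[i [a [Ga Dx ax sA]]] /oB[j [b [Gb Dx' bx sB]]]].
have [l [Dl Gi Gj]] := frac_meet i j.
exists l, (fun y => a y * b y); split.
- by apply: gen_algM; [exact: Gi|exact: Gj].
- by rewrite Dl.
- by rewrite mulf_neq0.
- move=> y; rewrite Dl => -[Diy Djy]; rewrite mulf_eq0 negb_or.
  by case/andP=> ay by'; split; [exact: sA|exact: sB].
Qed.

Lemma frac_open_bigU (J : Type) (F : J -> set T) :
  (forall j, frac_open (F j)) -> frac_open (\bigcup_j F j).
Proof.
move=> oF x [j _ Fx]; have [i [b [Gb Dx bx sF]]] := oF j x Fx.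
by exists i, b; split=> // y Dy by'; exists j => //; exact: sF.
Qed.

Definition fracT of frac_compat : Type := T.

End Fractions.

HB.instance Definition _ k T I D G H :=
  gen_eqMixin (@fracT k T I D G H).
HB.instance Definition _ k T I D G H :=
  gen_choiceMixin (@fracT k T I D G H).
HB.instance Definition _ k T I D G H :=
  isOpenTopological.Build (@fracT k T I D G H)
    (frac_openT H) (frac_openI H) (@frac_open_bigU k T I D G).

Section FractionSpace.
Variables (k : fieldType) (T I : Type).
Variables (D : I -> set T) (G : I -> set (T -> k)) (H : frac_compat D G).
Let X : topologicalType := fracT H.
Let reg : set X -> (X -> k) -> Prop := frac_regular D G.

Let regC U (c : k) : reg U (fun=> c).
Proof.
move=> x _; have [i Dx] := H.1 x; exists i, (fun=> c), (fun=> 1).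
split=> //; [exact: gen_alg_cst|exact: gen_alg_cst|exact: oner_neq0|].
by move=> y _ _ _; rewrite divr1.
Qed.

Let regD U f g : open U -> reg U f -> reg U g -> reg U (fun x => f x + g x).
Proof.
move=> _ rf rg x Ux.
have [i [a [b [Ga Gb Dx bx Ef]]]] := rf x Ux.
have [j [c [d [Gc Gd Dx' dx Eg]]]] := rg x Ux.
have [l [Dl Gi Gj]] := frac_meet H i j.
exists l, (fun y => a y * d y + c y * b y), (fun y => b y * d y); split.
- by apply: gen_algD; apply: gen_algM; auto.
- by apply: gen_algM; auto.
- by rewrite Dl.
- by rewrite mulf_neq0.
- move=> y Uy; rewrite Dl => -[Diy Djy]; rewrite mulf_eq0 negb_or.
  by case/andP=> by' dy; rewrite (Ef y)// (Eg y)// addf_div.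
Qed.

Let regM U f g : open U -> reg U f -> reg U g -> reg U (fun x => f x * g x).
Proof.
move=> _ rf rg x Ux.
have [i [a [b [Ga Gb Dx bx Ef]]]] := rf x Ux.
have [j [c [d [Gc Gd Dx' dx Eg]]]] := rg x Ux.
have [l [Dl Gi Gj]] := frac_meet H i j.
exists l, (fun y => a y * c y), (fun y => b y * d y); split.
- by apply: gen_algM; auto.
- by apply: gen_algM; auto.
- by rewrite Dl.
- by rewrite mulf_neq0.
- move=> y Uy; rewrite Dl => -[Diy Djy]; rewrite mulf_eq0 negb_or.
  by case/andP=> by' dy; rewrite (Ef y)// (Eg y)// mulf_div.
Qed.

Let regV U f : open U -> reg U f -> (forall x, U x -> f x != 0) ->
  reg U (fun x => (f x)^-1).
Proof.
move=> _ rf f0 x Ux.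
have [i [a [b [Ga Gb Dx bx Ef]]]] := rf x Ux.
exists i, (fun y => b y * b y), (fun y => a y * b y); split => //.
- exact: gen_algM.
- exact: gen_algM.
- rewrite mulf_neq0//; move: (f0 x Ux); rewrite (Ef x)//.
  by rewrite mulf_eq0 negb_or => /andP[].
- move=> y Uy Dy; rewrite mulf_eq0 negb_or => /andP[ay by'].
  by rewrite (Ef y)// invf_div -mulf_div divff ?mulr1.
Qed.

Let oE (W : set X) : open W = frac_open D G W.
Proof. by []. Qed.

Let regO U f : open U -> reg U f -> open (U `&` [set x | f x != 0]).
Proof.
rewrite !oE => oU rf x [Ux /= fx].
have [i [a [b [Ga Gb Dx bx Ef]]]] := rf x Ux.
have [j [c [Gc Dx' cx sU]]] := oU x Ux.
have [l [Dl Gi Gj]] := frac_meet H i j.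
have ax : a x != 0.
  by move: fx; rewrite (Ef x)// mulf_eq0 negb_or => /andP[].
exists l, (fun y => c y * (a y * b y)); split.
- by apply: gen_algM; [|apply: gen_algM]; auto.
- by rewrite Dl.
- by rewrite !mulf_neq0.
- move=> y; rewrite Dl => -[Diy Djy]; rewrite !mulf_eq0 !negb_or.
  case/and3P=> cy ay by'; have Uy : U y by exact: sU.
  by split=> //=; rewrite (Ef y)// mulf_neq0// invr_eq0.
Qed.

Let regE U f g : {in U, f =1 g} -> reg U f -> reg U g.
Proof.
move=> fg rf x Ux; have [i [a [b [Ga Gb Dx bx Ef]]]] := rf x Ux.
exists i, a, b; split=> // y Uy Dy by'; rewrite -fg ?inE//; exact: Ef.
Qed.

Let regS U V f : open U -> open V -> V `<=` U -> reg U f -> reg V f.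
Proof.
move=> _ _ sVU rf x /sVU Ux; have [i [a [b [Ga Gb Dx bx Ef]]]] := rf x Ux.
by exists i, a, b; split=> // y /sVU; exact: Ef.
Qed.

Let regL U f : open U -> (forall x, U x -> exists V : set X,
  [/\ open V, V x, V `<=` U & reg V f]) -> reg U f.
Proof.
move=> _ loc x /loc[V [+ Vx sVU rf]]; rewrite oE => oV.
have [i [a [b [Ga Gb Dx bx Ef]]]] := rf x Vx.
have [j [c [Gc Dx' cx sV]]] := oV x Vx.
have [l [Dl Gi Gj]] := frac_meet H i j.
exists l, (fun y => a y * c y), (fun y => b y * c y); split.
- by apply: gen_algM; auto.
- by apply: gen_algM; auto.
- by rewrite Dl.
- by rewrite mulf_neq0.
- move=> y Uy; rewrite Dl => -[Diy Djy]; rewrite mulf_eq0 negb_or.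
  case/andP=> by' cy; rewrite -mulf_div divff// mulr1 Ef//; exact: sV.
Qed.

Definition frac_space : kspace k :=
  @KSpace k X reg regC regD regM regV regO regE regS regL.

Lemma frac_space_open (W : set frac_space) : open W = frac_open D G W.
Proof. by []. Qed.

Lemma frac_space_regular (W : set frac_space) f :
  regular frac_space W f = frac_regular D G W f.
Proof. by []. Qed.

End FractionSpace.

(** [T] with the functions in [G] as coordinates.  When [T] is in bijection
    with the [k]-points of an affine variety whose coordinate ring is generated
    by [G], this is that affine variety. *)
Lemma affine_compat (k : fieldType) (T : Type) (G : set (T -> k)) :
  frac_compat (fun _ : unit => setT) (fun _ : unit => G).
Proof.
split=> [x|_ _]; exists tt => //.
by rewrite setIT; split=> // f; exact: gen_alg_gen.
Qed.

Definition affine_space (k : fieldType) (T : Type) (G : set (T -> k)) :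
  kspace k := frac_space (affine_compat G).

Section Product.
Variables (k : fieldType) (X Y : kspace k).

Definition open_pair : Type :=
  ({U : set X | open U} * {V : set Y | open V})%type.

Definition rectangle (UV : open_pair) : set (X * Y) :=
  sval UV.1 `*` sval UV.2.

(** These generate the image of [O(U) (x) O(V)] in the functions on
    [U * V]. *)
Definition rectangle_fun (UV : open_pair) : set (X * Y -> k) :=
  [set h | (exists2 f, regular X (sval UV.1) f & h = f \o fst) \/
           (exists2 g, regular Y (sval UV.2) g & h = g \o snd)].

Lemma prod_compat : frac_compat rectangle rectangle_fun.
Proof.
split=> [x|[[U oU] [V oV]] [[U' oU'] [V' oV']]].
  by exists (exist _ setT openT, exist _ setT openT).
exists (exist _ _ (openI oU oU'), exist _ _ (openI oV oV')); split.
- by apply/seteqP; split=> -[x y] /= => [[[? ?] [? ?]]|[[? ?] [? ?]]].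
- move=> _ [[f rf ->]|[f rf ->]]; apply: gen_alg_gen; [left|right];
    exists f => //=; apply: regular_sub rf => //; exact: openI || exact: subIsetl.
- move=> _ [[f rf ->]|[f rf ->]]; apply: gen_alg_gen; [left|right];
    exists f => //=; apply: regular_sub rf => //; exact: openI || exact: subIsetr.
Qed.

Definition prod_space : kspace k := frac_space prod_compat.

Lemma fst_continuous : continuous (fst : prod_space -> X).
Proof.
apply/continuousP => U oU; rewrite frac_space_open => -[x y] /= Ux.
exists (exist _ U oU, exist _ setT openT), (fun=> 1).
split=> //; [exact: gen_alg_cst|exact: oner_neq0|by move=> ? []].
Qed.

Lemma snd_continuous : continuous (snd : prod_space -> Y).
Proof.
apply/continuousP => V oV; rewrite frac_space_open => -[x y] /= Vy.
exists (exist _ setT openT, exist _ V oV), (fun=> 1).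
split=> //; [exact: gen_alg_cst|exact: oner_neq0|by move=> ? []].
Qed.

Lemma fst_regular (U : set X) (f : X -> k) : open U -> regular X U f ->
  regular prod_space ((fst : prod_space -> X) @^-1` U) (f \o fst).
Proof.
rewrite frac_space_regular => oU rf [x y] Ux.
exists (exist _ U oU, exist _ setT openT), (f \o fst), (fun=> 1).
split=> //; [|exact: gen_alg_cst|exact: oner_neq0|].
- by apply: gen_alg_gen; left; exists f.
- by move=> z _ _ _; rewrite divr1.
Qed.

Lemma snd_regular (V : set Y) (f : Y -> k) : open V -> regular Y V f ->
  regular prod_space ((snd : prod_space -> Y) @^-1` V) (f \o snd).
Proof.
rewrite frac_space_regular => oV rf [x y] Vy.
exists (exist _ setT openT, exist _ V oV), (f \o snd), (fun=> 1).
split=> //; [|exact: gen_alg_cst|exact: oner_neq0|].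
- by apply: gen_alg_gen; right; exists f.
- by move=> z _ _ _; rewrite divr1.
Qed.

Definition pr1 : morph prod_space X := Morph fst_continuous fst_regular.
Definition pr2 : morph prod_space Y := Morph snd_continuous snd_regular.

End Product.

Section Glue.
Variables (k : fieldType) (I T : Type) (C : I -> kspace k).

Definition glueT of (forall i, C i -> T) : Type := T.

Variable j : forall i, C i -> T.

Definition glue_open (W : set T) := forall i, open (j (i:=i) @^-1` W).

Lemma glue_openT : glue_open setT.
Proof. by move=> i; rewrite preimage_setT; exact: openT. Qed.

Lemma glue_openI : setI_closed glue_open.
Proof. by move=> A B oA oB i; rewrite preimage_setI; exact: openI. Qed.

Lemma glue_open_bigU (J : Type) (F : J -> set T) :
  (forall l, glue_open (F l)) -> glue_open (\bigcup_l F l).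
Proof.
by move=> oF i; rewrite preimage_bigcup; apply: bigcup_open => l _; exact: oF.
Qed.

End Glue.

HB.instance Definition _ k I T C j := gen_eqMixin (@glueT k I T C j).
HB.instance Definition _ k I T C j := gen_choiceMixin (@glueT k I T C j).
HB.instance Definition _ k I T C j :=
  isOpenTopological.Build (@glueT k I T C j)
    (glue_openT j) (glue_openI (j:=j)) (@glue_open_bigU k I T C j).

Section GlueSpace.
Variables (k : fieldType) (I T : Type) (C : I -> kspace k).
Variable j : forall i, C i -> T.
Let X : topologicalType := glueT j.
Let reg (W : set X) (f : X -> k) :=
  forall i, regular (C i) (j (i:=i) @^-1` W) (f \o j (i:=i)).

Let regC U (c : k) : reg U (fun=> c).
Proof. by move=> i; exact: regular_cst. Qed.

Let regD U f g : open U -> reg U f -> reg U g -> reg U (fun x => f x + g x).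
Proof. by move=> oU rf rg i; exact: (regularD (oU i) (rf i) (rg i)). Qed.

Let regM U f g : open U -> reg U f -> reg U g -> reg U (fun x => f x * g x).
Proof. by move=> oU rf rg i; exact: (regularM (oU i) (rf i) (rg i)). Qed.

Let regV U f : open U -> reg U f -> (forall x, U x -> f x != 0) ->
  reg U (fun x => (f x)^-1).
Proof. by move=> oU rf f0 i; apply: (regularV (oU i) (rf i)) => x; exact: f0. Qed.

Let oE (W : set X) : open W = forall i, open (j (i:=i) @^-1` W).
Proof. by []. Qed.

Let regO U f : open U -> reg U f -> open (U `&` [set x | f x != 0]).
Proof.
by rewrite !oE => oU rf i; exact: (open_regular_neq0 (oU i) (rf i)).
Qed.

Let regE U f g : {in U, f =1 g} -> reg U f -> reg U g.
Proof.
move=> fg rf i; apply: regular_ext (rf i) => x.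
by rewrite inE => Ux; apply: fg; rewrite inE.
Qed.

Let regS U V f : open U -> open V -> V `<=` U -> reg U f -> reg V f.
Proof.
move=> oU oV sVU rf i; apply: (regular_sub (oU i) (oV i)) (rf i).
by move=> x; exact: sVU.
Qed.

Let regL U f : open U -> (forall x, U x -> exists V : set X,
  [/\ open V, V x, V `<=` U & reg V f]) -> reg U f.
Proof.
move=> oU loc i; apply: (regular_local (oU i)) => x /loc[V [oV Vx sVU rf]].
exists (j (i:=i) @^-1` V); split; [exact: oV|exact: Vx| |exact: rf].
by move=> y; exact: sVU.
Qed.

Definition glue_space : kspace k :=
  @KSpace k X reg regC regD regM regV regO regE regS regL.

Lemma glue_space_open (W : set glue_space) :
  open W = forall i, open (j (i:=i) @^-1` W).
Proof. by []. Qed.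

Lemma glue_space_regular (W : set glue_space) f :
  regular glue_space W f =
  forall i, regular (C i) (j (i:=i) @^-1` W) (f \o j (i:=i)).
Proof. by []. Qed.

End GlueSpace.

(** A line bundle is given by a cocycle: a section is a family of regular
    functions [s i] on [lb_cover i] with [s i = lb_trans i j * s j] on
    overlaps. *)
Record line_bundle (k : fieldType) (X : kspace k) := LineBundle {
  lb_index : Type;
  lb_cover : lb_index -> set X;
  lb_trans : lb_index -> lb_index -> X -> k;
  lb_open : forall i, open (lb_cover i);
  lb_covers : forall x, exists i, lb_cover i x;
  lb_regular : forall i j,
    regular X (lb_cover i `&` lb_cover j) (lb_trans i j);
  lb_neq0 : forall i j x, lb_cover i x -> lb_cover j x ->
    lb_trans i j x != 0;
  lb_cocycle : forall i j l x, lb_cover i x -> lb_cover j x ->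
    lb_cover l x -> lb_trans i j x * lb_trans j l x = lb_trans i l x
}.
Arguments lb_index {k X} L : rename.
Arguments lb_cover {k X} L i : rename.
Arguments lb_trans {k X} L i j : rename.

Section LineBundleTheory.
Variables (k : fieldType).

(** A nowhere vanishing section of the bundle of local isomorphisms: sections
    [s] of [L] and [t] of [M] correspond when [s i = a i j * t j]. *)
Definition lb_iso (X : kspace k) (L M : line_bundle X) :=
  exists a : lb_index L -> lb_index M -> X -> k,
    [/\ forall i j, regular X (lb_cover L i `&` lb_cover M j) (a i j),
        forall i j x, lb_cover L i x -> lb_cover M j x -> a i j x != 0 &
        forall i i' j j' x,
          lb_cover L i x -> lb_cover L i' x ->
          lb_cover M j x -> lb_cover M j' x ->
          lb_trans L i i' x * a i' j' x = a i j x * lb_trans M j j' x].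

Lemma regularXz (X : kspace k) (U : set X) (f : X -> k) (m : int) :
  open U -> regular X U f -> (forall x, U x -> f x != 0) ->
  regular X U (fun x => f x ^ m).
Proof.
move=> oU rf f0.
have rX p : regular X U (fun x => f x ^+ p).
  elim: p => [|p IH]; first exact: regular_cst.
  have -> : (fun x => f x ^+ p.+1) = (fun x => f x * f x ^+ p).
    by apply/funext => x; rewrite exprS.
  exact: regularM.
case: m => p; first exact: rX.
by apply: (regularV oU (rX _)) => x Ux; rewrite expf_neq0// f0.
Qed.

Section Exponent.
Variables (X : kspace k) (L : line_bundle X) (m : int).

Let T (i j : lb_index L) (x : X) : k := lb_trans L i j x ^ m.

Let Treg i j : regular X (lb_cover L i `&` lb_cover L j) (T i j).
Proof.
apply: regularXz; [apply: openI; exact: lb_open|exact: lb_regular|].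
by move=> x [? ?]; exact: lb_neq0.
Qed.

Let Tneq0 i j x : lb_cover L i x -> lb_cover L j x -> T i j x != 0.
Proof. by move=> *; rewrite expfz_neq0// lb_neq0. Qed.

Let Tcocycle i j l x : lb_cover L i x -> lb_cover L j x -> lb_cover L l x ->
  T i j x * T j l x = T i l x.
Proof. by move=> *; rewrite /T -expfzMl lb_cocycle. Qed.

Definition lb_exp : line_bundle X :=
  LineBundle (@lb_open _ _ L) (@lb_covers _ _ L) Treg Tneq0 Tcocycle.

End Exponent.

Section Tensor.
Variables (X : kspace k) (L M : line_bundle X).

Let C (i : lb_index L * lb_index M) : set X :=
  lb_cover L i.1 `&` lb_cover M i.2.
Let T (i j : lb_index L * lb_index M) (x : X) : k :=
  lb_trans L i.1 j.1 x * lb_trans M i.2 j.2 x.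

Let Copen i : open (C i).
Proof. by apply: openI; exact: lb_open. Qed.

Let Ccovers x : exists i, C i x.
Proof.
have [i Ci] := lb_covers L x; have [j Cj] := lb_covers M x.
by exists (i, j).
Qed.

Let Treg i j : regular X (C i `&` C j) (T i j).
Proof.
have oC : open (C i `&` C j) by apply: openI; exact: Copen.
have oL : open (lb_cover L i.1 `&` lb_cover L j.1).
  by apply: openI; exact: lb_open.
have oM : open (lb_cover M i.2 `&` lb_cover M j.2).
  by apply: openI; exact: lb_open.
have rL : regular X (C i `&` C j) (lb_trans L i.1 j.1).
  apply: (@regular_sub _ _ _ _ _ oL oC _ (@lb_regular _ _ L _ _)).
  by move=> x [[? ?] [? ?]].
have rM : regular X (C i `&` C j) (lb_trans M i.2 j.2).
  apply: (@regular_sub _ _ _ _ _ oM oC _ (@lb_regular _ _ M _ _)).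
  by move=> x [[? ?] [? ?]].
exact: (regularM oC rL rM).
Qed.

Let Tneq0 i j x : C i x -> C j x -> T i j x != 0.
Proof. by move=> [? ?] [? ?]; rewrite mulf_neq0// lb_neq0. Qed.

Let Tcocycle i j l x : C i x -> C j x -> C l x ->
  T i j x * T j l x = T i l x.
Proof. by move=> [? ?] [? ?] [? ?]; rewrite /T mulrACA !lb_cocycle. Qed.

Definition lb_tensor : line_bundle X :=
  LineBundle Copen Ccovers Treg Tneq0 Tcocycle.

End Tensor.

Section Pullback.
Variables (X Y : kspace k) (f : morph X Y) (L : line_bundle Y).

Let C i : set X := f @^-1` lb_cover L i.
Let T i j (x : X) : k := lb_trans L i j (f x).

Let Copen i : open (C i).
Proof.
have /continuousP := @morph_continuous _ _ _ f.
by apply; exact: lb_open.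
Qed.

Let Ccovers x : exists i, C i x.
Proof. exact: lb_covers. Qed.

Let Treg i j : regular X (C i `&` C j) (T i j).
Proof.
have oV : open (lb_cover L i `&` lb_cover L j).
  by apply: openI; exact: lb_open.
exact: (morph_regular f oV (@lb_regular _ _ L i j)).
Qed.

Let Tneq0 i j x : C i x -> C j x -> T i j x != 0.
Proof. exact: lb_neq0. Qed.

Let Tcocycle i j l x : C i x -> C j x -> C l x ->
  T i j x * T j l x = T i l x.
Proof. exact: lb_cocycle. Qed.

Definition lb_pullback : line_bundle X :=
  LineBundle Copen Ccovers Treg Tneq0 Tcocycle.

End Pullback.

Definition polarized_iso (X Y : kspace k) (L : line_bundle X)
    (M : line_bundle Y) :=
  exists2 f : morph X Y, is_iso f & lb_iso L (lb_pullback f M).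

End LineBundleTheory.

Section Tangent.
Variables (k : fieldType) (X : kspace k).
Implicit Types (x : X) (U V : set X) (f g : X -> k).

Definition regular_at x f := exists U, [/\ open U, U x & regular X U f].

(** A [k]-linear derivation of the local ring at [x] into [k], presented as a
    functional on the functions that are regular near [x]; its values on other
    functions are irrelevant. *)
Definition tangent_vector x (t : (X -> k) -> k) :=
  [/\ forall f g, regular_at x f -> regular_at x g ->
        (exists U, [/\ open U, U x & {in U, f =1 g}]) -> t f = t g,
      forall (c : k) f g, regular_at x f -> regular_at x g ->
        t (fun y => c * f y + g y) = c * t f + t g &
      forall f g, regular_at x f -> regular_at x g ->
        t (fun y => f y * g y) = f x * t g + g x * t f].

Definition tangent_dim x (n : nat) :=
  exists t : 'I_n -> (X -> k) -> k,
    [/\ forall i, tangent_vector x (t i),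
        forall c : 'I_n -> k,
          (forall f, regular_at x f -> \sum_i c i * t i f = 0) ->
          forall i, c i = 0 &
        forall v, tangent_vector x v -> exists c : 'I_n -> k,
          forall f, regular_at x f -> v f = \sum_i c i * t i f].

(** To be used only for varieties of pure dimension [n]. *)
Definition smooth_of_dim (n : nat) := forall x, tangent_dim x n.

Definition vector_field U (v : X -> (X -> k) -> k) :=
  (forall x, U x -> tangent_vector x (v x)) /\
  (forall V f, open V -> V `<=` U -> regular X V f ->
     regular X V (fun x => v x f)).

Section Polyvectors.
Variable p : nat.

Definition wedge (v : 'I_p -> X -> (X -> k) -> k) (x : X)
    (F : 'I_p -> X -> k) : k :=
  \det (\matrix_(i, j) v i x (F j)).

(** Sections over [U] of the [p]-th exterior power of the tangent sheaf:
    locally, finite sums of wedge products of vector fields.  At a point [x],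
    an element of the [p]-th exterior power of a finite-dimensional [T_x] is
    represented by the multilinear functional on [p]-tuples of regular germs
    that it defines, with [v_1 /\ ... /\ v_p] sent to [\det (v_i (F_j))]; this
    representation is injective in every characteristic. *)
Definition polyvector_field U (P : X -> ('I_p -> X -> k) -> k) :=
  forall x, U x -> exists V (N : nat) (a : 'I_N -> X -> k)
      (v : 'I_N -> 'I_p -> X -> (X -> k) -> k),
    [/\ [/\ open V, V x & V `<=` U],
        forall l, regular X V (a l),
        forall l i, vector_field V (v l i) &
        forall y (F : 'I_p -> X -> k), V y ->
          (forall i, regular_at y (F i)) ->
          P y F = \sum_l a l y * wedge (v l) y F].

(** The global sections of the tensor product of the [p]-th exterior power of
    the tangent sheaf with the line bundle [M]. *)
Definition twisted_polyvector (M : line_bundle X)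
    (s : lb_index M -> X -> ('I_p -> X -> k) -> k) :=
  (forall i, polyvector_field (lb_cover M i) (s i)) /\
  (forall i j x (F : 'I_p -> X -> k), lb_cover M i x -> lb_cover M j x ->
     (forall l, regular_at x (F l)) ->
     s i x F = lb_trans M i j x * s j x F).

Definition H0_polyvector_neq0 (M : line_bundle X) :=
  exists2 s, twisted_polyvector (M:=M) s &
    exists i x (F : 'I_p -> X -> k),
      [/\ lb_cover M i x, forall l, regular_at x (F l) & s i x F != 0].

End Polyvectors.
End Tangent.

Section ProjectiveSpace.
Variables (k : fieldType) (n : nat).

Definition proj_point : Type :=
  {V : {vspace 'rV[k]_n.+1} | \dim V == 1%N}.

Definition affine_nspace : kspace k :=
  affine_space [set f : 'rV[k]_n -> k | exists i, f = fun y => y 0 i].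

Definition chart_vec (i : 'I_n.+1) (y : 'rV[k]_n) : 'rV[k]_n.+1 :=
  \row_j (if unlift i j is Some l then y 0 l else 1).

Lemma chart_vec1 i y : chart_vec i y 0 i = 1.
Proof. by rewrite mxE unlift_none. Qed.

Lemma chart_vec_dim i y : \dim <[chart_vec i y]> == 1%N.
Proof.
rewrite dim_vline; have -> // : chart_vec i y != 0.
apply/eqP => /rowP/(_ i); rewrite chart_vec1 mxE => /eqP.
by rewrite oner_eq0.
Qed.

Definition proj_chart (i : 'I_n.+1) (y : affine_nspace) : proj_point :=
  exist (fun V : {vspace 'rV[k]_n.+1} => \dim V == 1%N) _ (chart_vec_dim i y).

Definition proj_space : kspace k := glue_space proj_chart.

(** Homogeneous coordinates, well defined up to a common nonzero factor. *)
Definition hcoord (V : proj_space) (i : 'I_n.+1) : k :=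
  vpick (sval (V : proj_point)) 0 i.

Definition hcover (i : 'I_n.+1) : set proj_space :=
  [set V | hcoord V i != 0].
Definition htrans (i j : 'I_n.+1) (V : proj_space) : k :=
  hcoord V j / hcoord V i.

Lemma hcoord_chart l (y : affine_nspace) : exists2 c : k, c != 0 &
  forall i, hcoord (proj_chart l y) i = c * chart_vec l y 0 i.
Proof.
rewrite /hcoord /=; set V := <[_]>%VS.
have /vlineP[c Ec] : vpick V \in V by exact: memv_pick.
exists c => [|i]; last by rewrite Ec mxE.
apply/eqP => c0; move: Ec; rewrite c0 scale0r => /eqP; rewrite vpick0.
by rewrite -dimv_eq0 (eqP (chart_vec_dim l y)).
Qed.

Lemma chart_vec_alg l i :
  gen_alg [set f : 'rV[k]_n -> k | exists i, f = fun y => y 0 i]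
    (fun y => chart_vec l y 0 i).
Proof.
have -> : (fun y => chart_vec l y 0 i) =
  (fun y : 'rV[k]_n => if unlift l i is Some j then y 0 j else 1).
  by apply/funext => y; rewrite mxE.
case: (unlift l i) => [j|]; last exact: gen_alg_cst.
by apply: gen_alg_gen; exists j.
Qed.

Lemma hcover_open i : open (hcover i).
Proof.
rewrite glue_space_open => l; rewrite frac_space_open => y; rewrite /hcover /=.
have [c c0 ->] := hcoord_chart l y => cy.
exists tt, (fun y => chart_vec l y 0 i); split=> //.
- exact: chart_vec_alg.
- by apply: contraNneq cy => ->; rewrite mulr0.
- by move=> z _ z0 /=; have [d d0 ->] := hcoord_chart l z; rewrite mulf_neq0.
Qed.

Lemma hcover_covers V : exists i, hcover i V.
Proof.
have V0 : vpick (sval (V : proj_point)) != 0.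
  by rewrite vpick0 -dimv_eq0 (eqP (svalP (V : proj_point))).
apply: contrapT => /forallNP H; case/eqP: V0; apply/rowP => i.
by rewrite mxE; apply/eqP; apply: contrapT => /negP; exact: H.
Qed.

Lemma htrans_regular i j :
  regular proj_space (hcover i `&` hcover j) (htrans i j).
Proof.
rewrite glue_space_regular => l; rewrite frac_space_regular => y [/= Hi Hj].
exists tt, (fun y => chart_vec l y 0 j), (fun y => chart_vec l y 0 i).
split=> //; [exact: chart_vec_alg|exact: chart_vec_alg| |].
- move: Hi; rewrite /hcover /=; have [c c0 ->] := hcoord_chart l y.
  by apply: contraNneq => ->; rewrite mulr0.
- move=> z _ _ z0; rewrite /htrans /=.
  by have [d d0 E] := hcoord_chart l z; rewrite !E -mulf_div divff// mul1r.
Qed.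

Lemma htrans_neq0 i j V : hcover i V -> hcover j V -> htrans i j V != 0.
Proof. by move=> Hi Hj; rewrite mulf_neq0// invr_eq0. Qed.

Lemma htrans_cocycle i j l V : hcover i V -> hcover j V -> hcover l V ->
  htrans i j V * htrans j l V = htrans i l V.
Proof. by move=> Hi Hj Hl; rewrite /htrans mulrC mulrA divfK. Qed.

(** A linear form [f] is the section [f / x_i] on [x_i != 0], hence the
    transition functions [x_j / x_i]. *)
Definition O1 : line_bundle proj_space :=
  LineBundle hcover_open hcover_covers htrans_regular htrans_neq0
    htrans_cocycle.

Definition Od (d : int) : line_bundle proj_space := lb_exp O1 d.

End ProjectiveSpace.

Definition O11 (k : fieldType) :
    line_bundle (prod_space (proj_space k 1) (proj_space k 1)) :=
  lb_tensor (lb_pullback (pr1 _ _) (O1 k 1)) (lb_pullback (pr2 _ _) (O1 k 1)).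

Definition projective (k : fieldType) (X : kspace k) :=
  exists (N : nat) (f : morph X (proj_space k N)), closed_embedding f.

Definition very_ample (k : fieldType) (X : kspace k) (L : line_bundle X) :=
  exists (N : nat) (f : morph X (proj_space k N)),
    closed_embedding f /\ lb_iso L (lb_pullback f (O1 k N)).

Definition ample (k : fieldType) (X : kspace k) (L : line_bundle X) :=
  exists2 m : nat, (0 < m)%N & very_ample (lb_exp L m%:Z).

(** The lattice [N] is ['rV[int]_n], its dual [M] is ['rV[int]_n] with the
    standard pairing.  A rational polyhedral cone in [N_R] is determined by its
    rational points, and cones are taken in [N_Q]. *)

Section Fans.
Variable n : nat.

Definition toQ (m : 'rV[int]_n) : 'rV[rat]_n := map_mx intr m.

Definition pairing (m u : 'rV[rat]_n) : rat := \sum_i m 0 i * u 0 i.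

Definition rational_polyhedral (sigma : set 'rV[rat]_n) :=
  exists (r : nat) (u : 'I_r -> 'rV[int]_n),
    sigma = [set x | exists2 c : 'I_r -> rat,
      forall i, 0 <= c i & x = \sum_i c i *: toQ (u i)].

Definition strongly_convex (sigma : set 'rV[rat]_n) :=
  forall x, sigma x -> sigma (- x) -> x = 0.

Definition dual_cone (sigma : set 'rV[rat]_n) : set 'rV[rat]_n :=
  [set m | forall u, sigma u -> 0 <= pairing m u].

Definition is_face (tau sigma : set 'rV[rat]_n) :=
  exists2 m, dual_cone sigma m &
    tau = sigma `&` [set u | pairing m u = 0].

Record fan := Fan {
  cones :> set (set 'rV[rat]_n);
  fan_finite : finite_set cones;
  fan_nonempty : cones !=set0;
  fan_rational : forall sigma, cones sigma -> rational_polyhedral sigma;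
  fan_convex : forall sigma, cones sigma -> strongly_convex sigma;
  fan_face : forall sigma tau, cones sigma -> is_face tau sigma -> cones tau;
  fan_meet : forall sigma tau, cones sigma -> cones tau ->
    is_face (sigma `&` tau) sigma /\ is_face (sigma `&` tau) tau
}.

Definition dual_monoid (sigma : set 'rV[rat]_n) : set 'rV[int]_n :=
  [set m | dual_cone sigma (toQ m)].

Section ToricVariety.
Variable k : fieldType.

(** Monoid homomorphisms from [dual_monoid sigma] to the multiplicative monoid
    [k], extended by zero to the whole lattice. *)
Definition monoid_hom (sigma : set 'rV[rat]_n) (g : 'rV[int]_n -> k) :=
  [/\ g 0 = 1,
      forall m m', dual_monoid sigma m -> dual_monoid sigma m' ->
        g (m + m') = g m * g m' &
      forall m, ~ dual_monoid sigma m -> g m = 0].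

Definition chart_point (sigma : set 'rV[rat]_n) : Type :=
  {g : 'rV[int]_n -> k | monoid_hom sigma g}.

Definition toric_chart (sigma : set 'rV[rat]_n) : kspace k :=
  affine_space [set f : chart_point sigma -> k |
    exists2 m, dual_monoid sigma m & f = fun g => sval g m].

Variable Sigma : fan.

Definition chart_index : Type := {sigma | cones Sigma sigma}.

Definition pretoric : Type :=
  {sigma : chart_index & chart_point (sval sigma)}.

(** Points of two charts are identified when both are images of the same point
    of the chart of the common face. *)
Definition glued (x y : pretoric) :=
  exists d : chart_point (sval (tag x) `&` sval (tag y)),
    (forall m, dual_monoid (sval (tag x)) m ->
       sval (tagged x) m = sval d m) /\
    (forall m, dual_monoid (sval (tag y)) m ->
       sval (tagged y) m = sval d m).

Definition toric_point : Type :=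
  {A : set pretoric | exists x, A = glued x}.

Definition toric_class (x : pretoric) : toric_point :=
  exist (fun A : set pretoric => exists x, A = glued x) (glued x)
    (ex_intro _ x erefl).

Definition toric_inj (sigma : chart_index) (g : toric_chart (sval sigma)) :
    toric_point :=
  toric_class (Tagged (fun s : chart_index => chart_point (sval s)) g).

Definition toric_variety : kspace k := glue_space toric_inj.

End ToricVariety.
End Fans.

(* Main.v *)
(* Since line bundles on affine spaces are trivial, L is described on the chart
   of each maximal cone s by a character m_s; ampleness says that
   <m_s - m_t, u> >= 0 for the rays u of s, with equality only if u lies in t.
   On the torus, a section of the p-th exterior power of the tangent bundle
   twisted by L^-p is a Laurent polynomial whose coefficients are alternating
   p-forms on the character lattice.  A nonzero coefficient w of weight mu
   extends over the chart of s only if Y_s = mu - p m_s satisfies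
   <Y_s, u> >= -1 on the rays u of s, and w must vanish on the hyperplane
   orthogonal to u when equality holds.  The Y_s glue to a strictly convex
   piecewise linear function psi on N, whose defect of linearity takes values
   in p Z.  Hence a minimal relation sum_C u = 0 between rays has
   - sum_C psi(u) >= p, whereas w <> 0 allows at most p rays with psi = -1 in
   one cone.  Either C consists of n + 1 rays, which forces the fan of P^n, or
   a second relation modulo C exists and the count leaves only two pairs of
   opposite rays, the fan of P^1 x P^1.  The polarization is then read off the
   degree - sum_C psi(u), and Cox coordinates give the isomorphism.

   Conversely, the fields x_i d/dx_a on the charts x_i <> 0 of P^n scale by
   x_i / x_j from one chart to the other, so that wedge products of p of them
   are sections twisted by O(-p); on P^1 the field d/dy vanishes doubly at
   infinity, whence a section twisted by O(-2) and, on P^1 x P^1, one twisted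
   by O(-2,-2). *)

Require Import Defs.
From mathcomp Require Import all_boot all_order all_algebra.
From mathcomp Require Import boolp classical_sets cardinality topology.
From mathcomp Require Import zify ring lra.

Set Implicit Arguments.
Unset Strict Implicit.
Unset Printing Implicit Defensive.

Import Order.TTheory GRing.Theory Num.Theory.

Local Open Scope classical_set_scope.
Local Open Scope ring_scope.

(** The hypotheses speak only of points, regular functions and tangent vectors, so the combinatorial
    input has to be extracted from geometry. Completeness of the fan comes from the closed
    embedding: the image of a one-parameter subgroup has a limit in projective space, hence in some
    chart. Unimodularity of the maximal cones comes from the tangent space at a torus-fixed point,
    where the irreducible elements of the dual monoid give independent tangent vectors. Neither the
    bundle nor the section is assumed equivariant: trivializations over two charts differ by a
    character because an invertible function on the torus is a scalar times a character, and a
    single nonzero coefficient of the section is enough. In the fan, relations modulo a cone are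
    needed, but the quotient fan is never built: a vector is moved into the star of a cone by adding
    a large multiple of the sum of its rays. The bound p arises because psi is a minimum of linear
    functions, so that a relation not contained in one cone has a strictly positive defect, and a
    positive multiple of p is at least p. *)

Section Pairing.
Variable n : nat.
Implicit Types (m u v x : 'rV[rat]_n) (l : 'rV[int]_n).

Lemma pairingDl m m' u : pairing (m + m') u = pairing m u + pairing m' u.
Proof.
by rewrite /pairing -big_split; apply: eq_bigr => i _; rewrite mxE mulrDl.
Qed.

Lemma pairingZl c m u : pairing (c *: m) u = c * pairing m u.
Proof. by rewrite /pairing mulr_sumr; apply: eq_bigr => i _; rewrite mxE mulrA. Qed.

Lemma pairingC m u : pairing m u = pairing u m.
Proof. by apply: eq_bigr => i _; rewrite mulrC. Qed.

Lemma pairingDr m u v : pairing m (u + v) = pairing m u + pairing m v.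
Proof. by rewrite pairingC pairingDl !(pairingC m). Qed.

Lemma pairingZr c m u : pairing m (c *: u) = c * pairing m u.
Proof. by rewrite pairingC pairingZl (pairingC m). Qed.

Lemma pairingNr m u : pairing m (- u) = - pairing m u.
Proof. by rewrite -scaleN1r pairingZr mulN1r. Qed.

Lemma pairing0r m : pairing m 0 = 0.
Proof. by rewrite -[X in pairing _ X](scale0r 0) pairingZr mul0r. Qed.

Lemma pairing0l u : pairing 0 u = 0.
Proof. by rewrite pairingC pairing0r. Qed.

Lemma pairing_sumr (I : Type) (r : seq I) (P : pred I) (F : I -> 'rV[rat]_n) m :
  pairing m (\sum_(i <- r | P i) F i) = \sum_(i <- r | P i) pairing m (F i).
Proof. exact: (big_morph _ (pairingDr m) (pairing0r m)). Qed.

Lemma pairing_norm_gt0 u : u != 0 -> 0 < pairing u u.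
Proof.
move=> u0; have ge0 i : 0 <= u 0 i * u 0 i by rewrite -expr2 sqr_ge0.
rewrite lt_def sumr_ge0 ?andbT// psumr_eq0//.
apply: contra u0 => /allP H; apply/eqP/rowP => i; rewrite mxE.
by have /eqP := H i (mem_index_enum i); rewrite -expr2 => /eqP; rewrite sqrf_eq0 => /eqP.
Qed.

Lemma farkas_rat (r : nat) (a : 'I_r -> 'rV[rat]_n) x :
  (exists2 c : 'I_r -> rat, forall i, 0 <= c i & x = \sum_i c i *: a i) \/
  (exists2 m, forall i, 0 <= pairing m (a i) & pairing m x < 0).
Proof.
elim: r a x => [|r IH] a x.
  have [->|x0] := eqVneq x 0.
    by left; exists (fun=> 0) => [[]//|]; rewrite big_ord0.
  by right; exists (- x) => [[]//|]; rewrite pairingC pairingNr oppr_lt0 pairing_norm_gt0.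
pose b i := a (widen_ord (leqnSn r) i); pose e := a ord_max.
have [[c c0 ->]|[m m0 mx]] := IH b x.
  left; exists (fun i => if unlift ord_max i is Some j then c j else 0).
    by move=> i; case: unlift.
  rewrite big_ord_recr /= unlift_none scale0r addr0; apply: eq_bigr => i _.
  have -> : widen_ord (leqnSn r) i = lift ord_max i.
    by apply: val_inj; rewrite /= /bump leqNgt ltn_ord.
  by rewrite liftK /b; congr (_ *: a _); apply: val_inj; rewrite /= /bump leqNgt ltn_ord.
have [me|me] := leP 0 (pairing m e).
  right; exists m => // i; case: (unliftP ord_max i) => [j ->|->//].
  have := m0 j; congr (_ <= pairing _ (a _)).
  by apply: val_inj; rewrite /= /bump leqNgt ltn_ord.
(* Projection along [e] onto the hyperplane [m = 0]. Since [m] is negative on [e] and [x] and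
   nonnegative on the other generators, the coefficient [d] of [e] found below is nonnegative. *)
pose pr y := y - (pairing m y / pairing m e) *: e.
have e0 : pairing m e != 0 by rewrite lt_eqF.
have [[c c0 Ec]|[m' m'0 m'x]] := IH (fun i => pr (b i)) (pr x).
  left; pose d := \sum_i c i * - (pairing m (b i) / pairing m e) +
     pairing m x / pairing m e.
  exists (fun i => if unlift ord_max i is Some j then c j else d).
    move=> i; case: unlift => [//|]; rewrite /d addr_ge0//.
      apply: sumr_ge0 => j _; apply: mulr_ge0 => //.
      by rewrite -mulrN mulr_ge0// oppr_ge0 invr_le0 ltW.
    by rewrite -mulrNN mulr_ge0// oppr_ge0 ?invr_le0 ltW.
  rewrite big_ord_recr /= unlift_none.
  have -> : x = pr x + (pairing m x / pairing m e) *: e by rewrite subrK.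
  rewrite Ec /d scalerDl addrA scaler_suml -/e; congr (_ + _).
  rewrite -big_split /=; apply: eq_bigr => i _.
  have -> : widen_ord (leqnSn r) i = lift ord_max i.
    by apply: val_inj; rewrite /= /bump leqNgt ltn_ord.
  rewrite liftK /pr scalerBr mulrN scaleNr scalerA; congr (_ *: a _ - _).
  by apply: val_inj; rewrite /= /bump leqNgt ltn_ord.
(* Composing [m'] with the projection is again a functional, and it vanishes on [e]. *)
have key y : pairing (m' - (pairing m' e / pairing m e) *: m) y = pairing m' (pr y).
  rewrite pairingDl -scaleNr pairingZl /pr pairingDr pairingNr pairingZr.
  by ring.
right; exists (m' - (pairing m' e / pairing m e) *: m); last by rewrite key.
move=> i; rewrite key; case: (unliftP ord_max i) => [j ->|->].
  have := m'0 j; congr (_ <= pairing _ (pr (a _))).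
  by apply: val_inj; rewrite /= /bump leqNgt ltn_ord.
by rewrite /pr -/e divff// scale1r subrr pairing0r.
Qed.

Definition ipair (l l' : 'rV[int]_n) : int := \sum_i l 0 i * l' 0 i.

Lemma pairing_toQ (l l' : 'rV[int]_n) : pairing (toQ l) (toQ l') = (ipair l l')%:~R.
Proof.
rewrite /pairing /ipair rmorph_sum /=; apply: eq_bigr => i _.
by rewrite !mxE rmorphM.
Qed.

Lemma clear_denominators x : exists2 N : nat, (0 < N)%N & exists l, toQ l = N%:R *: x.
Proof.
pose N := (\prod_i `|denq (x 0%R i)|)%N.
have dN i : (`|denq (x 0%R i)| %| N)%N by rewrite /N (bigD1 i)//= dvdn_mulr.
have N0 : (0 < N)%N by apply: prodn_gt0 => i; rewrite absz_gt0 denq_neq0.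
exists N => //; exists (\row_i (numq (x 0 i) * (N %/ `|denq (x 0%R i)|)%N%:Z)).
apply/rowP => i; rewrite !mxE rmorphM /=.
have d0 : (denq (x 0 i))%:~R != 0 :> rat by rewrite intr_eq0 denq_neq0.
rewrite -[X in _ = _ * X]divq_num_den mulrA; apply: (canRL (mulfK d0)).
have -> : (denq (x 0 i))%:~R = `|denq (x 0%R i)|%N%:R :> rat.
  by rewrite pmulrn gez0_abs// ltW// denq_gt0.
rewrite -mulrA mulrC; congr (_ * _).
by rewrite -pmulrn -natrM divnK.
Qed.

End Pairing.

(** * Factorial rings and line bundles on affine space *)

Section Factorial.
Variable R : idomainType.
Implicit Types a b c d p q u : R.

Definition divides a b := exists c, b = a * c.

Definition prime_elt p :=
  [/\ p != 0, p \isn't a GRing.unit &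
      forall a b, divides p (a * b) -> divides p a \/ divides p b].

Definition factored a u (s : seq R) :=
  [/\ u \is a GRing.unit, forall q, q \in s -> prime_elt q &
      a = u * \prod_(q <- s) q].

Definition coprime_elt a b :=
  forall p, prime_elt p -> divides p a -> divides p b -> False.

Lemma dividesMr a b c : divides a b -> divides a (b * c).
Proof. by case=> d ->; exists (d * c); rewrite mulrA. Qed.

Lemma dividesMl a b c : divides a b -> divides a (c * b).
Proof. by rewrite mulrC; exact: dividesMr. Qed.

Lemma prime_divides_unit p u : prime_elt p -> u \is a GRing.unit ->
  ~ divides p u.
Proof.
case=> _ pU _ uU [c E]; case/negP: pU.
by move: uU; rewrite E unitrM => /andP[].
Qed.

Lemma prime_divides_prod p u s : prime_elt p -> u \is a GRing.unit ->
  divides p (u * \prod_(q <- s) q) -> exists2 q, q \in s & divides p q.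
Proof.
move=> Pp uU; elim: s => [|q s IH].
  by rewrite big_nil mulr1 => /(prime_divides_unit Pp uU).
rewrite big_cons mulrCA; case: (Pp) => _ _ H /H [pq|/IH[r rs pr]].
  by exists q; rewrite ?mem_head.
by exists r; rewrite // inE rs orbT.
Qed.

Lemma prime_associate p q : prime_elt p -> prime_elt q -> divides p q ->
  exists2 v, v \is a GRing.unit & q = p * v.
Proof.
move=> [p0 pU _] [q0 qU qP] [v E]; exists v => //.
have /qP : divides q (p * v) by exists 1; rewrite mulr1.
case=> -[c Ec].
  have : q * (c * v) = q * 1 by rewrite mulrA -Ec -E mulr1.
  by move/(mulfI q0)/eqP => cv; apply/unitrPr; exists c; rewrite mulrC; apply/eqP.
have : q * (p * c) = q * 1 by rewrite mulrCA -Ec -E mulr1.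
move/(mulfI q0) => pc; case/negP: pU; apply/unitrPr; by exists c.
Qed.

(** The length of a factorization serves as the measure for all later inductions; cancelling a prime
    makes it drop. *)
Lemma factored_div p a u s : prime_elt p -> factored (p * a) u s ->
  exists v t, factored a v t /\ (size t < size s)%N.
Proof.
move=> Pp [uU sP E]; have pE : divides p (u * \prod_(q <- s) q).
  by rewrite -E; exists a.
have [q qs pq] := prime_divides_prod Pp uU pE.
have [v vU Eq] := prime_associate Pp (sP q qs) pq.
exists (u * v), (rem q s); split; last first.
  by rewrite size_rem// ltn_predL lt0n size_eq0; apply: contraTneq qs => ->.
split=> [|r /mem_rem /sP//|]; first by rewrite unitrM uU.
case: (Pp) => p0 _ _; apply: (mulfI p0); rewrite E (big_rem q)//=.
by rewrite {1}Eq; ring.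
Qed.

(** Existence is enough because the factors are prime elements and not merely irreducible, which
    forces uniqueness. *)
Definition ufd := forall a, a != 0 -> exists u s, factored a u s.

Hypothesis Rufd : ufd.

Lemma nonunit_prime_divisor a : a != 0 -> a \isn't a GRing.unit ->
  exists2 p, prime_elt p & divides p a.
Proof.
move=> /Rufd [u [[|p s] [uU sP ->]]]; first by rewrite big_nil mulr1 uU.
move=> _; exists p; first by apply: sP; rewrite mem_head.
by exists (u * \prod_(q <- s) q); rewrite big_cons mulrCA.
Qed.

(** Reduction to lowest terms: a common prime is cancelled as long as there is one, and the number
    of prime factors of the denominator decreases. *)
Lemma coprime_repr a b : b != 0 -> exists c d,
  [/\ d != 0, coprime_elt c d & a * d = c * b].
Proof.
move=> b0; have [u [s]] := Rufd b0.
have [m] := ubnP (size s); elim: m => // m IH in a b b0 u s *.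
rewrite ltnS => sm F.
have [[p [Pp [a' Ea] [b' Eb]]]|H] :=
    pselect (exists p, [/\ prime_elt p, divides p a & divides p b]).
  have [p0 _ _] := Pp.
  have b'0 : b' != 0 by apply: contraNneq b0 => E; rewrite Eb E mulr0.
  have [v [t [Ft lt]]] : exists v t, factored b' v t /\ (size t < size s)%N.
    by apply: (factored_div (u := u) Pp); rewrite -Eb.
  have [c [d [d0 cop E]]] := IH a' b' b'0 v t (leq_trans lt sm) Ft.
  by exists c, d; split=> //; rewrite Ea Eb -mulrA E; ring.
by exists a, b; split=> // p Pp pa pb; apply: H; exists p.
Qed.

(** Euclid's lemma, one prime of [b] at a time: such a prime divides [a * c] but not [a], hence
    [c]. *)
Lemma coprime_divides a b c : b != 0 -> coprime_elt a b ->
  divides b (a * c) -> divides b c.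
Proof.
move=> b0; have [u [s [uU sP ->]]] := Rufd b0.
elim: s sP c => [|q s IH] sP c.
  by rewrite big_nil mulr1 => _ _; exists (u^-1 * c); rewrite mulVKr.
rewrite big_cons mulrCA => cop [d E].
have Pq : prime_elt q by apply: sP; rewrite mem_head.
have [q0 _ qP] := Pq.
have qac : divides q (a * c) by rewrite E -mulrA; eexists; reflexivity.
case: (qP _ _ qac) => [qa|[c' Ec]].
  by case: (cop q Pq qa); exists (u * \prod_(r <- s) r).
have [r rs|p Pp pa pb||e Ee] := IH _ c'.
- by apply: sP; rewrite inE rs orbT.
- exact: (cop p Pp pa (dividesMl q pb)).
- exists d; by apply: (mulfI q0); rewrite mulrCA -Ec E -!mulrA.
by exists e; rewrite Ec Ee mulrA.
Qed.

End Factorial.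

(** * Gauss's lemma and factoriality of polynomial rings *)

Section Gauss.
Variable R : idomainType.
Hypothesis Rufd : ufd R.
Implicit Types (a b c p q u : R).

Lemma prime_dividesC p (A : {poly R}) :
  divides p%:P A <-> forall i, divides p A`_i.
Proof.
split=> [[B ->] i|H]; first by exists B`_i; rewrite coefCM.
have [f Hf] := choice H; exists (\poly_(i < size A) f i).
apply/polyP => i; rewrite coefCM coef_poly; case: ltnP => [_|le]; first exact: Hf.
by rewrite mulr0 nth_default.
Qed.

(** Gauss's argument: if [i] and [j] are the first indices where the coefficients of [A] and [B]
    escape [p], every other term of the coefficient [i + j] of the product is divisible by [p]. *)
Lemma prime_eltC p : prime_elt p -> @prime_elt {poly R} p%:P.
Proof.
move=> [p0 pU pP]; split; first by rewrite polyC_eq0.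
  by apply: contra pU; rewrite poly_unitE coefC eqxx => /andP[].
move=> A B /prime_dividesC H; apply: contrapT => /not_orP[nA nB].
have ex (C : {poly R}) : ~ divides p%:P C -> exists i, `[< ~ divides p C`_i >].
  move=> nC; apply: contrapT => /forallNP H'; apply: nC; apply/prime_dividesC => i.
  by apply: contrapT => Hi; apply: (H' i); apply/asboolP.
have [i /asboolP Hi mi] := ex_minnP (ex _ nA).
have [j /asboolP Hj mj] := ex_minnP (ex _ nB).
have /pP[] // : divides p (A`_i * B`_j).
have [c] := H (i + j)%N; rewrite coefM.
have lti : (i < (i + j).+1)%N by rewrite ltnS leq_addr.
rewrite (bigD1 (Ordinal lti)) //= addKn => Ec.
suff [d Ed] : divides p (\sum_(l < (i + j).+1 | l != Ordinal lti) A`_l * B`_(i + j - l)).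
  by exists (c - d); rewrite mulrBr -Ed -Ec addrK.
apply: big_ind => [|x y [x' ->] [y' ->]|l].
- by exists 0; rewrite mulr0.
- by exists (x' + y'); rewrite mulrDr.
- rewrite -val_eqE /= neq_ltn => /orP[ltl|gtl].
    apply: dividesMr; apply: contrapT => /asboolP /mi.
    by rewrite leqNgt ltl.
  apply: dividesMl; apply: contrapT => /asboolP /mj.
  have := ltn_ord l; lia.
Qed.

Lemma prime_eltX : @prime_elt {poly R} 'X.
Proof.
have dX (A : {poly R}) : divides 'X A <-> A`_0 = 0.
  split=> [[B ->]|A0]; first by rewrite coefXM.
  exists (\poly_(i < size A) A`_i.+1); apply/polyP => -[|i]; rewrite coefXM//=.
  by rewrite coef_poly; case: ltnP => // /leqW ?; rewrite nth_default.
split; first by rewrite polyX_eq0.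
  by rewrite poly_unitE size_polyX.
move=> A B; rewrite !dX coef0M => /eqP; rewrite mulf_eq0 => /orP[]/eqP; tauto.
Qed.

Definition primitive_poly (A : {poly R}) :=
  forall p, prime_elt p -> ~ divides p%:P A.

(** The primes of [c] are removed one by one: each divides [Q * B] and not the primitive [Q], hence
    [B]. This turns divisibility over the fraction field into divisibility in the ring. *)
Lemma gauss_divides c (A B Q : {poly R}) : primitive_poly Q -> c != 0 ->
  c *: A = Q * B -> divides Q A.
Proof.
move=> primQ /Rufd [u [s [uU sP ->]]].
elim: s sP B => [|q s IH] sP B.
  rewrite big_nil mulr1 => E; exists (u^-1 *: B).
  by rewrite -scalerAr -E scalerA mulVr// scale1r.
rewrite big_cons mulrCA -scalerA => E.
have Pq : prime_elt q by apply: sP; rewrite mem_head.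
have [q0 _ qP] := prime_eltC Pq.
have /qP[/(primQ q Pq)//|[B' EB]] : divides q%:P (Q * B).
  by rewrite -E -mul_polyC; eexists; reflexivity.
apply: (IH _ B') => [r rs|]; first by apply: sP; rewrite inE rs orbT.
by apply: (mulfI q0); rewrite mul_polyC E EB mulrCA.
Qed.

Lemma primitive_part (A : {poly R}) : A != 0 ->
  exists c B, [/\ c != 0, primitive_poly B & A = c *: B].
Proof.
move=> A0; have := A0; rewrite -lead_coef_eq0 => /Rufd [u [s]].
have [m] := ubnP (size s); elim: m => // m IH in A A0 u s *.
rewrite ltnS => sm F.
have [[p [Pp [B EB]]]|H] := pselect (exists p, prime_elt p /\ divides p%:P A).
  have [p0 _ _] := Pp.
  have B0 : B != 0 by apply: contraNneq A0 => E; rewrite EB E mulr0.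
  have [v [t [Ft lt]]] : exists v t, factored (lead_coef B) v t /\ (size t < size s)%N.
    apply: (factored_div (u := u) Pp).
    by rewrite -(lead_coefC p) -lead_coefM -EB.
  have [c [D [c0 primD E]]] := IH B B0 v t (leq_trans lt sm) Ft.
  exists (p * c), D; split=> //; first by rewrite mulf_neq0.
  by rewrite EB E mul_polyC scalerA.
exists 1, A; split; rewrite ?oner_neq0 ?scale1r// => p Pp pA.
by apply: H; exists p.
Qed.

Lemma irreducible_coprimep (Q A : {poly R}) :
  irreducible_poly Q -> ~~ (Q %| A) -> coprimep Q A.
Proof.
move=> irrQ; apply: contraR; rewrite Pdiv.Idomain.coprimep_def => H.
have := irrQ.2 _ H (Pdiv.Idomain.dvdp_gcdl Q A) => /Pdiv.Idomain.eqp_dvdl <-.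
exact: Pdiv.Idomain.dvdp_gcdr.
Qed.

Lemma irreducible_primitive_prime (Q : {poly R}) :
  irreducible_poly Q -> primitive_poly Q -> @prime_elt {poly R} Q.
Proof.
move=> irrQ primQ; have [sQ _] := irrQ.
split; first exact: irredp_neq0.
  by rewrite poly_unitE gtn_eqF.
move=> A B [D E].
(* Over an integral domain [%|] is divisibility up to a nonzero scalar; primitivity of [Q] removes
   the scalar. *)
have toD C : Q %| C -> divides Q C.
  move=> /Pdiv.Idomain.dvdpP [[c D'] /= c0 E']; apply: (gauss_divides primQ c0 (B := D')).
  by rewrite E' mulrC.
have [QA|nQA] := boolP (Q %| A); first by left; exact: toD.
right; apply: toD.
have cop : coprimep Q A by exact: irreducible_coprimep.
by rewrite -(Pdiv.Idomain.Gauss_dvdpr _ cop) E; apply: Pdiv.Idomain.dvdp_mulIl.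
Qed.

(** Induction on the degree. A nonconstant divisor of least degree, made primitive, is irreducible
    over the fraction field, hence prime by Gauss's lemma, and can be split off. *)
Lemma ufd_poly : ufd {poly R}.
Proof.
move=> A; have [m] := ubnP (size A); elim: m => // m IH in A *.
rewrite ltnS => sA A0.
have [le1|gt1] := leqP (size A) 1.
  have EA := size1_polyC le1.
  have a0 : A`_0 != 0 by apply: contraNneq A0 => E; rewrite EA E.
  have [u [s [uU sP E]]] := Rufd a0.
  exists u%:P, [seq q%:P | q <- s]; split.
  - by rewrite poly_unitE coefC eqxx size_polyC (memPn _ u uU) ?unitr0.
  - by move=> _ /mapP [q qs ->]; apply: prime_eltC; exact: sP.
  - by rewrite EA E rmorphM /= rmorph_prod big_map.
pose P i := `[< exists Q : {poly R}, [/\ size Q = i, (1 < i)%N & Q %| A] >].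
have [|i /asboolP [Q [sQ i1 QA]] mi] := @ex_minnP P.
  by exists (size A); apply/asboolP; exists A.
have Q0 : Q != 0 by rewrite -size_poly_gt0 sQ ltnW.
have [c [B [c0 primB EQ]]] := primitive_part Q0.
have sB : size B = i by rewrite -sQ EQ size_scale.
have BA : B %| A by rewrite -(Pdiv.Idomain.dvdpZl _ _ c0) -EQ.
have irrB : irreducible_poly B.
  split=> [|D sD DB]; first by rewrite sB.
  have B0 : B != 0 by rewrite -size_poly_gt0 sB ltnW.
  have D0 : D != 0 by apply: contraNneq B0 => E; rewrite -Pdiv.Idomain.dvd0p -E.
  rewrite -Pdiv.Idomain.dvdp_size_eqp// eqn_leq Pdiv.Idomain.dvdp_leq//= sB.
  apply: mi; apply/asboolP; exists D; split=> //.
    by rewrite ltn_neqAle eq_sym sD size_poly_gt0.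
  exact: Pdiv.Idomain.dvdp_trans DB BA.
have /Pdiv.Idomain.dvdpP [[d D] /= d0 E] := BA.
have [|D' ED] := @gauss_divides d A D B primB d0; first by rewrite E mulrC.
have D'0 : D' != 0 by apply: contraNneq A0 => E'; rewrite ED E' mulr0.
have B0 : B != 0 by rewrite -size_poly_gt0 sB ltnW.
have [|u [s [uU sP ED']]] := IH D' _ D'0.
  apply: leq_trans sA; rewrite ED size_mul// -(prednK (n := size B)) ?size_poly_gt0//.
  by rewrite addSn /= -[X in (X < _)%N]add0n ltn_add2r sB; case: (i) i1.
exists u, (B :: s); split=> //.
- move=> q; rewrite inE => /predU1P [->|/sP//].
  exact: irreducible_primitive_prime.
- by rewrite big_cons ED ED' mulrCA.
Qed.

End Gauss.

Lemma ufd_field (F : fieldType) : ufd F.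
Proof.
move=> a a0; exists a, [::]; split=> //; first by rewrite unitfE.
by rewrite big_nil mulr1.
Qed.

(** * Polynomials in several variables and their zeros *)

Section IteratedPoly.
Variable k : closedFieldType.

(** The nested form makes each induction on the number of variables a statement about polynomials in
    one variable, the last one, over a factorial ring. *)
Fixpoint mpol (n : nat) : idomainType :=
  if n is m.+1 then {poly (mpol m)} else k.

Lemma ufd_mpol n : ufd (mpol n).
Proof. by elim: n => [|n IH]; [exact: ufd_field|exact: ufd_poly]. Qed.

Fixpoint mev n (y : nat -> k) : {rmorphism mpol n -> k} :=
  if n is m.+1 return {rmorphism mpol n -> k} then
    [the {rmorphism _ -> _} of horner_eval (y m) \o map_poly (mev m y)]
  else [the {rmorphism k -> k} of idfun].

Lemma mevS n y (P : mpol n.+1) :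
  mev n.+1 y P = (map_poly (mev n y) P).[y n].
Proof. by []. Qed.

Lemma eq_mev n y z : (forall i, (i < n)%N -> y i = z i) -> mev n y =1 mev n z.
Proof.
elim: n => [//|n IH] E P; rewrite !mevS E//; congr (_.[_]).
by apply: eq_map_poly; apply: IH => i /leqW; exact: E.
Qed.

Definition upd (y : nat -> k) n c : nat -> k := fun i => if i == n then c else y i.

Lemma mev_upd n y c (P : mpol n.+1) :
  mev n.+1 (upd y n c) P = (map_poly (mev n y) P).[c].
Proof.
rewrite mevS /upd eqxx; congr (_.[_]); apply: eq_map_poly; apply: eq_mev.
by move=> i lt; rewrite ltn_eqF.
Qed.

Lemma mev_neq0 n (P : mpol n) : P != 0 -> exists y, mev n y P != 0.
Proof.
elim: n P => [|n IH] P P0; first by exists (fun=> 0).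
have := P0; rewrite -lead_coef_eq0 => /IH [y Hy].
have : map_poly (mev n y) P != 0.
  by apply: contraNneq Hy => /polyP /(_ (size P).-1); rewrite coef_map coef0 => /= <-.
move=> /closed_nonrootP [c Hc]; exists (upd y n c).
by rewrite mev_upd.
Qed.

Lemma mev_inj n (P Q : mpol n) : (forall y, mev n y P = mev n y Q) -> P = Q.
Proof.
move=> E; apply/eqP; rewrite -subr_eq0; apply: contraT => /mev_neq0 [y].
by rewrite rmorphB /= E subrr eqxx.
Qed.

Lemma mpol_unit n (u : mpol n) : u \is a GRing.unit ->
  exists2 c : k, c != 0 & forall y, mev n y u = c.
Proof.
elim: n u => [|n IH] u; first by rewrite unitfE => u0; exists u.
rewrite poly_unitE => /andP [/eqP su /IH [c c0 Hc]]; exists c => // y.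
rewrite mevS (size1_polyC (eq_leq su)) map_polyC hornerC; exact: Hc.
Qed.

Lemma prime_divides_constr n (p : mpol n) (b : mpol n.+1) :
  @prime_elt (mpol n.+1) p%:P -> @prime_elt (mpol n) p.
Proof.
move=> [p0 pU pP]; rewrite polyC_eq0 in p0; split=> //.
  by apply: contra pU => pU; rewrite poly_unitE coefC eqxx size_polyC p0.
move=> a c [d E]; have [] := pP a%:P c%:P.
- by exists d%:P; rewrite -!polyCM E.
- by move/prime_dividesC => /(_ 0%N); rewrite coefC; left.
- by move/prime_dividesC => /(_ 0%N); rewrite coefC; right.
Qed.

Lemma prime_irreducible (R : idomainType) (p : {poly R}) :
  prime_elt p -> (1 < size p)%N -> irreducible_poly p.
Proof.
move=> [p0 _ pP] sp; split=> // q sq /Pdiv.Idomain.dvdpP [[c h] /= c0 E].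
have q0 : q != 0.
  apply: contraNneq p0 => Eq; move/eqP: E.
  by rewrite Eq mulr0 scale_poly_eq0 (negPf c0).
rewrite -Pdiv.Idomain.dvdp_size_eqp; last first.
  by apply/Pdiv.Idomain.dvdpP; exists (c, h).
have h0 : h != 0.
  apply: contraNneq p0 => Eh; move/eqP: E.
  by rewrite Eh mul0r scale_poly_eq0 (negPf c0).
have sz : (size p + 1 = size h + size q)%N.
  have := size_mul h0 q0; rewrite -E size_scale//.
  by have := size_poly_gt0 h; rewrite h0; lia.
have [|[d Ed]|[d Ed]] := pP h q.
- by rewrite -E; exists c%:P; rewrite -mul_polyC mulrC.
- have d0 : d != 0 by apply: contraNneq h0 => E'; rewrite Ed E' mulr0.
  have := size_mul p0 d0; rewrite -Ed.
  have := size_poly_gt0 d; rewrite d0; have := size_poly_gt0 q; rewrite q0.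
  by move: sq; rewrite neq_ltn; lia.
- have d0 : d != 0 by apply: contraNneq q0 => E'; rewrite Ed E' mulr0.
  have := size_mul p0 d0; rewrite -Ed.
  have := size_poly_gt0 d; rewrite d0; have := size_poly_gt0 h; rewrite h0.
  by lia.
Qed.

(** The Nullstellensatz for one prime [p]. If [p] does not involve the last variable, some
    coefficient of [b] is not divisible by it and induction applies. Otherwise [p] and [b] are
    coprime over the fraction field, and a Bezout relation produces a nonzero [r] in the remaining
    variables such that [p] and [b] have no common zero where [r] does not vanish. *)
Lemma prime_vanishing_point n (p b : mpol n) : prime_elt p -> ~ divides p b ->
  exists y, mev n y p = 0 /\ mev n y b != 0.
Proof.
elim: n p b => [|n IH] p b Pp npb.
  by case: Pp => p0; rewrite unitfE p0.
have [p0 pU _] := Pp.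
have [le1|gt1] := leqP (size p) 1.
  have Ep := size1_polyC le1; move: Pp npb; rewrite Ep => Pp npb.
  have Pc := prime_divides_constr b Pp.
  have [i Hi] : exists i, ~ divides p`_0 b`_i.
    apply: contrapT => /forallNP H; apply: npb; apply/prime_dividesC => i.
    by apply: contrapT; exact: H.
  have [y [y0 yb]] := IH _ _ Pc Hi.
  have : map_poly (mev n y) b != 0.
    by apply: contraNneq yb => /polyP /(_ i); rewrite coef_map coef0 => /= <-.
  move=> /closed_nonrootP [c Hc]; exists (upd y n c).
  by rewrite !mev_upd map_polyC hornerC.
have irr := prime_irreducible Pp gt1.
have ndv : ~~ (p %| b).
  apply/negP => /Pdiv.Idomain.dvdpP [[c h] /= c0 E].
  have [_ _ pP] := Pp; have [|[d Ed]|//] := pP c%:P b.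
    by exists h; rewrite mul_polyC E mulrC.
  have d0 : d != 0.
    by apply: contraNneq c0 => E'; rewrite -polyC_eq0 Ed E' mulr0.
  have := size_mul p0 d0; rewrite -Ed size_polyC c0.
  by have := size_poly_gt0 d; rewrite d0; lia.
have /Pdiv.Idomain.Bezout_coprimepP [[u v] /= uv] := irreducible_coprimep irr ndv.
have sz1 : size (u * p + v * b) = 1%N by rewrite (Pdiv.Idomain.eqp_size uv) size_poly1.
have Er := size1_polyC (eq_leq sz1); set r := (u * p + v * b)`_0 in Er.
have r0 : r != 0 by rewrite -polyC_eq0 -Er -size_poly_gt0 sz1.
(* The leading coefficient is kept nonzero so that [p] specialized at [y] keeps its positive degree
   and has a root. *)
have /mev_neq0 [y] : r * lead_coef p != 0 by rewrite mulf_neq0// lead_coef_eq0.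
rewrite rmorphM /= mulf_eq0 negb_or => /andP [yr yl].
have smap : size (map_poly (mev n y) p) = size p by rewrite size_map_poly_id0.
have /closed_rootP [c /rootP Hc] : size (map_poly (mev n y) p) != 1%N.
  by rewrite smap gtn_eqF.
have fp : mev n.+1 (upd y n c) p = 0 by rewrite mev_upd.
have fr : mev n.+1 (upd y n c) r%:P = mev n y r.
  by rewrite mev_upd map_polyC hornerC.
exists (upd y n c); split=> //; apply/negP => /eqP fb0.
have fb : mev n.+1 (upd y n c) b = 0 := fb0.
case/eqP: yr; rewrite -fr -Er; move: fp fb; move: (mev n.+1 _) => f fp fb.
by rewrite rmorphD !rmorphM fp fb !mulr0 addr0.
Qed.

Lemma mvar n i : (i < n)%N -> exists x : mpol n,
  prime_elt x /\ forall y, mev n y x = y i.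
Proof.
elim: n => // n IH; rewrite ltnS leq_eqVlt => /predU1P [->|/IH [x [Px Hx]]].
  exists ('X : {poly mpol n}); split; first exact: prime_eltX.
  by move=> y; rewrite mevS map_polyX hornerX.
exists (x%:P : {poly mpol n}); split; first exact: prime_eltC.
by move=> y; rewrite mevS map_polyC hornerC /= Hx.
Qed.

Lemma mcst n c : exists x : mpol n, forall y, mev n y x = c.
Proof.
elim: n => [|n [x Hx]]; first by exists c.
by exists (x%:P : {poly mpol n}) => y; rewrite mevS map_polyC hornerC /= Hx.
Qed.

Lemma gen_alg_mev (T : Type) (G : set (T -> k)) (phi : T -> nat -> k) n :
  (forall i, (i < n)%N -> gen_alg G (fun t => phi t i)) ->
  forall P : mpol n, gen_alg G (fun t => mev n (phi t) P).
Proof.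
elim: n => [|n IH] H P; first exact: gen_alg_cst.
elim/poly_ind: P => [|P c IHP].
  by under eq_fun do rewrite rmorph0; exact: gen_alg_cst.
have -> : (fun t => mev n.+1 (phi t) (P * 'X + c%:P)) =
    (fun t => mev n.+1 (phi t) P * phi t n + mev n (phi t) c).
  apply/funext => t; rewrite !mevS rmorphD rmorphM /= map_polyX map_polyC.
  by rewrite hornerD hornerM hornerX hornerC.
apply: gen_algD; first by apply: gen_algM => //; exact: H.
by apply: IH => i /leqW; exact: H.
Qed.

End IteratedPoly.

(** * Regular functions on affine space *)

Section AffineSpace.
Variables (k : closedFieldType) (n : nat).
Local Notation An := (affine_nspace k n).
Local Notation pol := (mpol k n).
Implicit Types (y z : 'rV[k]_n) (U : set An) (f : An -> k).

Definition row_fun y : nat -> k := fun i => if insub i is Some j then y 0 j else 0.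

Definition peval (P : pol) y : k := mev n (row_fun y) P.

Lemma row_fun_ord y (i : 'I_n) : row_fun y i = y 0 i.
Proof. by rewrite /row_fun insubT//= => lt; congr (y 0 _); apply: val_inj. Qed.

Lemma mev_peval (v : nat -> k) (P : pol) : mev n v P = peval P (\row_i v i).
Proof.
by apply: eq_mev => i lt; rewrite (row_fun_ord _ (Ordinal lt)) mxE.
Qed.

Lemma pevalD P Q y : peval (P + Q) y = peval P y + peval Q y.
Proof. exact: rmorphD. Qed.

Lemma pevalM P Q y : peval (P * Q) y = peval P y * peval Q y.
Proof. exact: rmorphM. Qed.

Lemma peval_neq0 P : P != 0 -> exists y, peval P y != 0.
Proof. by move=> /mev_neq0 [v]; rewrite mev_peval => ?; exists (\row_i v i). Qed.

Lemma peval_inj P Q : (forall y, peval P y = peval Q y) -> P = Q.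
Proof. by move=> E; apply: mev_inj => v; rewrite !mev_peval. Qed.

Lemma peval_nz P y : peval P y != 0 -> P != 0.
Proof. by apply: contraNneq => ->; rewrite /peval rmorph0. Qed.

Lemma divides_peval (p q : pol) y : divides p q -> peval p y = 0 -> peval q y = 0.
Proof. by case=> c -> E; rewrite pevalM E mul0r. Qed.

Lemma prime_vanishing (p b : pol) : prime_elt p -> ~ divides p b ->
  exists y, peval p y = 0 /\ peval b y != 0.
Proof.
move=> Pp /(prime_vanishing_point Pp) [v]; rewrite !mev_peval => ?.
by exists (\row_i v i).
Qed.

Lemma alg_peval f : gen_alg [set f | exists i, f = fun y : 'rV[k]_n => y 0 i] f ->
  exists P, forall y, f y = peval P y.
Proof.
elim=> {f}[f [i ->]|c|f g _ [P HP] _ [Q HQ]|f g _ [P HP] _ [Q HQ]].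
- have [x [_ Hx]] := mvar k (ltn_ord i).
  by exists x => y; rewrite /peval Hx row_fun_ord.
- by have [x Hx] := mcst n c; exists x => y; rewrite /peval Hx.
- by exists (P + Q) => y; rewrite pevalD HP HQ.
- by exists (P * Q) => y; rewrite pevalM HP HQ.
Qed.

Lemma peval_alg P : gen_alg [set f | exists i, f = fun y : 'rV[k]_n => y 0 i]
  (peval P).
Proof.
apply: (@gen_alg_mev _ _ _ row_fun) => i lt.
have -> : (fun t => row_fun t i) = (fun t : 'rV[k]_n => t 0 (Ordinal lt)).
  by apply/funext => y; rewrite (row_fun_ord y (Ordinal lt)).
by apply: gen_alg_gen; exists (Ordinal lt).
Qed.

Lemma affine_openP U y : open U -> U y ->
  exists2 c, peval c y != 0 & forall z, peval c z != 0 -> U z.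
Proof.
rewrite frac_space_open => oU /oU [_ [b [/alg_peval [c Hc] _ b0 sU]]].
by exists c => [|z cz]; rewrite -?Hc//; apply: sU; rewrite ?Hc.
Qed.

Lemma affine_regularP U f y : regular An U f -> U y ->
  exists a b, peval b y != 0 /\
    forall z, U z -> peval b z != 0 -> f z = peval a z / peval b z.
Proof.
rewrite frac_space_regular => rf /rf [_ [a' [b' [/alg_peval [a Ha] /alg_peval [b Hb] _ b0 E]]]].
exists a, b; split=> [|z Uz bz]; first by rewrite -Hb.
by rewrite -Ha -Hb; apply: E; rewrite // Hb.
Qed.

Lemma regular_quotient U a b : (forall y, U y -> peval b y != 0) ->
  regular An U (fun y => peval a y / peval b y).
Proof.
move=> b0; rewrite frac_space_regular => y Uy.
exists tt, (peval a), (peval b); split=> //; [exact: peval_alg|exact: peval_alg|].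
exact: b0.
Qed.

Lemma affine_irreducible U (V : set An) : open U -> open V ->
  U !=set0 -> V !=set0 -> (U `&` V) !=set0.
Proof.
move=> oU oV [y /(affine_openP oU) [c cy sU]] [z /(affine_openP oV) [d dz sV]].
have /peval_neq0 [x] : c * d != 0 by rewrite mulf_neq0 ?(peval_nz cy) ?(peval_nz dz).
by rewrite pevalM mulf_eq0 negb_or => /andP [? ?]; exists x; split; [exact: sU|exact: sV].
Qed.

Lemma peval_dense U P Q : open U -> U !=set0 ->
  (forall y, U y -> peval P y = peval Q y) -> P = Q.
Proof.
move=> oU [y /(affine_openP oU) [c cy sU]] E.
apply: (mulfI (peval_nz cy)); apply: peval_inj => z; rewrite !pevalM.
have [->|cz] := eqVneq (peval c z) 0; first by rewrite !mul0r.
by rewrite E//; exact: sU.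
Qed.

(* In a factorial ring the reduced denominator divides every local one, so it vanishes nowhere on U. *)
Lemma regular_coprime U f : open U -> U !=set0 -> regular An U f ->
  exists a b, [/\ b != 0, coprime_elt a b &
    forall y, U y -> peval b y != 0 /\ f y = peval a y / peval b y].
Proof.
move=> oU [y0 Uy0] rf; have [a0 [b0 [b0y E0]]] := affine_regularP rf Uy0.
have [a [b [bn0 cop Eab]]] := coprime_repr (@ufd_mpol k n) a0 (peval_nz b0y).
exists a, b; split=> // y Uy; have [a1 [b1 [b1y E1]]] := affine_regularP rf Uy.
have [c cy sU] := affine_openP oU Uy0.
have E : a1 * b0 = a0 * b1.
  apply: (mulfI (mulf_neq0 (peval_nz cy) (mulf_neq0 (peval_nz b0y) (peval_nz b1y)))).
  apply: peval_inj => z; rewrite !pevalM.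
  have [->|cz] := eqVneq (peval c z) 0; first by rewrite !mul0r.
  have [->|b0z] := eqVneq (peval b0 z) 0; first by rewrite !(mul0r, mulr0).
  have [->|b1z] := eqVneq (peval b1 z) 0; first by rewrite !(mul0r, mulr0).
  have := E0 z (sU z cz) b0z; rewrite (E1 z (sU z cz) b1z) => /eqP.
  by rewrite eqr_div// => /eqP ->.
have E2 : a * b1 = a1 * b.
  apply: (mulfI (peval_nz b0y)); transitivity (a0 * b * b1); last first.
    by rewrite mulrAC -E; ring.
  by rewrite Eab; ring.
have [d Ed] : divides b b1.
  by apply: (coprime_divides (@ufd_mpol k n) bn0 cop); exists a1; rewrite E2 mulrC.
have by0 : peval b y != 0.
  by apply: contraNneq b1y => H; rewrite Ed pevalM H mul0r.
split=> //; rewrite E1//; apply/eqP; rewrite eqr_div//.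
by rewrite -!pevalM E2.
Qed.

(** A polynomial that is not a unit has a prime factor, and a prime has a zero: take [b = 1] in
    [prime_vanishing]. *)
Lemma nonvanishing_unit (b : pol) : (forall y, peval b y != 0) -> b \is a GRing.unit.
Proof.
move=> H; apply: contraT => bU.
have b0 : b != 0 by apply: (peval_nz (H 0)).
have [p Pp pb] := nonunit_prime_divisor (@ufd_mpol k n) b0 bU.
have [|y [py _]] := @prime_vanishing p 1 Pp.
  by apply: prime_divides_unit => //; exact: unitr1.
by have := H y; rewrite (divides_peval pb py) eqxx.
Qed.

Lemma affine_regularT f : regular An setT f ->
  gen_alg [set f | exists i, f = fun y : 'rV[k]_n => y 0 i] f.
Proof.
move=> rf; have [|a [b [b0 _ H]]] := regular_coprime openT _ rf; first by exists 0.
have bU : b \is a GRing.unit by apply: nonvanishing_unit => y; case: (H y I).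
have [c c0 Hc] := mpol_unit bU.
have -> : f = (fun y => peval a y * c^-1).
  by apply/funext => y; case: (H y I) => _ ->; rewrite /peval Hc.
by apply: gen_algM; [exact: peval_alg|exact: gen_alg_cst].
Qed.

Definition big_torus : set An := [set y | forall i, y 0 i != 0].

(** A prime factor without zeros on the torus vanishes only where the product of the coordinates
    does, so it divides that product and is associate to one coordinate. *)
Lemma monomial_factor (a : pol) : a != 0 ->
  (forall y, big_torus y -> peval a y != 0) ->
  exists (c : k) (e : 'I_n -> nat), c != 0 /\
    forall y, peval a y = c * \prod_i y 0 i ^+ e i.
Proof.
move=> a0 Ha; have [u [s [uU sP Ea]]] := @ufd_mpol k n a a0.
have [X HX] := choice (fun i : 'I_n => mvar k (ltn_ord i)).
have Xy i y : peval (X i) y = y 0 i by rewrite /peval (HX i).2 row_fun_ord.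
have sub q : q \in s -> divides q a.
  move=> qs; exists (u * \prod_(r <- rem q s) r).
  by rewrite Ea (big_rem q)//= mulrCA.
have {Ha} : forall q, q \in s -> forall y, big_torus y -> peval q y != 0.
  move=> q qs y Ty; apply: contraNneq (Ha y Ty) => qy.
  by rewrite (divides_peval (sub q qs) qy).
rewrite {}Ea {a a0 sub}; elim: s sP => [|q s IH] sP Hs.
  have [c c0 Hc] := mpol_unit uU; exists c, (fun=> 0%N); split=> // y.
  by rewrite big_nil mulr1 /peval Hc big1 ?mulr1.
have [r rs|r rs|c [e [c0 He]]] := IH; [by apply: sP; rewrite inE rs orbT|
  by apply: Hs; rewrite inE rs orbT|].
have Pq : prime_elt q by apply: sP; rewrite mem_head.
have [i qX] : exists i, divides q (X i).
  have [x /mapP [i _ ->] ?] : exists2 x, x \in [seq X i | i <- enum 'I_n] & divides q x.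
    apply: (prime_divides_prod Pq (unitr1 _)); rewrite mul1r.
    apply: contrapT => /(prime_vanishing Pq) [y [q0 Xy0]].
    have := Hs q (mem_head _ _) y; rewrite q0 eqxx => /(_ _)/negP; apply=> // i.
    apply: contraNneq Xy0 => yi; apply/eqP.
    apply: (@divides_peval (X i)); last by rewrite Xy.
    exists (\prod_(j <- rem (X i) [seq X i | i <- enum 'I_n]) j).
    by rewrite (big_rem (X i))//= map_f// mem_enum.
  by exists i.
have [v vU Ev] := prime_associate Pq (HX i).1 qX.
have [d d0 Hd] := mpol_unit vU.
exists (d^-1 * c), (fun j => (e j + (j == i))%N); split.
  by rewrite mulf_neq0// invr_eq0.
move=> y; rewrite big_cons mulrCA pevalM He.
have -> : peval q y = d^-1 * y 0 i.
  by rewrite -Xy Ev pevalM (Hd _ : peval v y = d) mulrC mulfK.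
under [in RHS]eq_bigr do rewrite exprD.
rewrite big_split /= -[in RHS](mulrA d^-1) -!mulrA; congr (_ * _).
rewrite mulrC -!mulrA; congr (_ * (_ * _)).
rewrite (bigD1 i)//= eqxx expr1 big1 ?mulr1// => j /negPf ->.
by rewrite expr0.
Qed.

Lemma torus_unit U f : open U -> (forall y, big_torus y -> U y) ->
  regular An U f -> (forall y, big_torus y -> f y != 0) ->
  exists (c : k) (e : 'I_n -> int), c != 0 /\
    forall y, big_torus y -> f y = c * \prod_i y 0 i ^ e i.
Proof.
move=> oU sU rf f0.
have T1 : big_torus (const_mx 1) by move=> i; rewrite mxE oner_neq0.
have [|a [b [b0 _ H]]] := regular_coprime oU _ rf.
  by exists (const_mx 1); exact: sU.
have Hb y : big_torus y -> peval b y != 0 by move=> /sU /H [].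
have Ha y : big_torus y -> peval a y != 0.
  move=> Ty; have := f0 y Ty; have [_ ->] := H y (sU y Ty).
  by rewrite mulf_eq0 negb_or => /andP [].
have [c [e [c0 He]]] := monomial_factor (peval_nz (Ha _ T1)) Ha.
have [c' [e' [c'0 He']]] := monomial_factor b0 Hb.
exists (c / c'), (fun i => (e i)%:Z - (e' i)%:Z); split.
  by rewrite mulf_neq0// invr_eq0.
move=> y Ty; have [_ ->] := H y (sU y Ty); rewrite He He' -mulf_div; congr (_ * _).
rewrite -prodf_div; apply: eq_bigr => i _.
by rewrite expfzDr ?Ty// exprnN.
Qed.

End AffineSpace.

(** * Triviality of line bundles on affine space *)

Section AffinePicard.
Variables (k : closedFieldType) (n : nat).
Local Notation An := (affine_nspace k n).
Local Notation pol := (mpol k n).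
Variable L : line_bundle An.
Let C := lb_cover L.
Let I := lb_index L.
Implicit Types (i j : I) (g : I -> pol * pol) (p q a b : pol).

Let overlap i j : C i !=set0 -> C j !=set0 -> open (C i `&` C j) /\ (C i `&` C j) !=set0.
Proof.
move=> Li Lj; split; first by apply: openI; exact: lb_open.
by apply: affine_irreducible => //; exact: lb_open.
Qed.

Let trans_repr i j : C i !=set0 -> C j !=set0 -> exists a b, [/\ a != 0, b != 0 &
  forall y, C i y -> C j y -> [/\ peval a y != 0, peval b y != 0 &
    lb_trans L i j y = peval a y / peval b y]].
Proof.
move=> Li Lj; have [oC [y0 Cy0]] := overlap Li Lj.
have [a [b [b0 _ H]]] := regular_coprime oC (ex_intro _ y0 Cy0) (@lb_regular _ _ L i j).
have H' y : C i y -> C j y -> [/\ peval a y != 0, peval b y != 0 &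
    lb_trans L i j y = peval a y / peval b y].
  move=> Ciy Cjy; have [by0 E] := H y (conj Ciy Cjy); split=> //.
  have := lb_neq0 Ciy Cjy; rewrite E.
  by apply: contraNneq => ->; rewrite mul0r.
exists a, b; split=> //; have [ay0 _ _] := H' _ Cy0.1 Cy0.2.
exact: peval_nz ay0.
Qed.

(* [g i = (a, b)] stands for the rational function a / b; the condition says that the family is a rational section. *)
Let rational_section g :=
  (forall i, C i !=set0 -> (g i).1 != 0 /\ (g i).2 != 0) /\
  (forall i j a b, C i !=set0 -> C j !=set0 ->
    (forall y, C i y -> C j y -> [/\ peval a y != 0, peval b y != 0 &
      lb_trans L i j y = peval a y / peval b y]) ->
    (g i).1 * (g j).2 * b = a * (g i).2 * (g j).1).

(** The rational function [x.1 / x.2] has order zero along the hypersurface of [p]. *)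
Let unit_along p (x : pol * pol) := exists a b,
  [/\ ~ divides p a, ~ divides p b & x.1 * b = x.2 * a].

(** The section equal to 1 over one member [C i0] of the cover, read elsewhere through the
    transition functions. Its divisor avoids [C i0], hence is supported in the zeros of a polynomial
    [b0] whose nonvanishing locus lies in [C i0]. *)
Let rational_section_ex : exists2 g, rational_section g & exists b0,
  b0 != 0 /\ forall i p y, prime_elt p -> C i y -> peval p y = 0 -> ~ divides p b0 ->
    unit_along p (g i).
Proof.
have [i0 Ci0] := lb_covers L 0.
have Li0 : C i0 !=set0 by exists 0.
have /choice [g Hg] : forall i, exists g : pol * pol, C i !=set0 ->
  [/\ g.1 != 0, g.2 != 0 & forall y, C i y -> C i0 y -> [/\ peval g.1 y != 0,
    peval g.2 y != 0 & lb_trans L i i0 y = peval g.1 y / peval g.2 y]].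
  move=> i; have [Li|nL] := pselect (C i !=set0); last by exists 0.
  by have [a [b ?]] := trans_repr Li Li0; exists (a, b).
exists g.
  split=> [i /Hg [] //|i j a b Li Lj H].
  have [a0 b0 Hi] := Hg i Li; have [c0 d0 Hj] := Hg j Lj.
  have [oij nij] := overlap Li Lj.
  have oW := openI oij (lb_open i0).
  have nW := affine_irreducible oij (lb_open i0) nij Li0.
  apply: (peval_dense oW nW) => y [[Ciy Cjy] C0y].
  have [ay by0 E] := H y Ciy Cjy.
  have [ay1 by1 E1] := Hi y Ciy C0y; have [ay2 by2 E2] := Hj y Cjy C0y.
  have := lb_cocycle Ciy Cjy C0y; rewrite E E1 E2 mulf_div => /eqP.
  rewrite eqr_div ?mulf_neq0// !pevalM => /eqP E'.
  transitivity (peval (g i).1 y * (peval b y * peval (g j).2 y)); first by ring.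
  by rewrite -E'; ring.
have [c c0 sC] := affine_openP (lb_open i0) Ci0.
exists c; split=> [|i p y Pp Ciy py pc]; first exact: peval_nz c0.
have [d d0 sD] := affine_openP (lb_open i) Ciy.
have [|z [pz]] := @prime_vanishing _ _ p (c * d) Pp.
  case: (Pp) => _ _ pP /pP [//|/divides_peval /(_ py) /eqP].
  by rewrite (negPf d0).
rewrite pevalM mulf_eq0 negb_or => /andP [/sC C0z /sD Ciz].
have [|_ _ /(_ z Ciz C0z) [gz1 gz2 _]] := Hg i; first by exists y.
exists (g i).1, (g i).2; split; last exact: mulrC.
  by move/divides_peval => /(_ z pz) /eqP; rewrite (negPf gz1).
by move/divides_peval => /(_ z pz) /eqP; rewrite (negPf gz2).
Qed.

(** The list [l] bounds the divisor of [g]: outside the primes divisible by a member of [l] the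
    order is zero. *)
Let good g (l : seq pol) := forall i p y, prime_elt p -> C i y ->
  peval p y = 0 -> (forall q, q \in l -> ~ divides q p) -> unit_along p (g i).

Let split_prime p a : prime_elt p -> a != 0 ->
  exists e b, ~ divides p b /\ a = p ^+ e * b.
Proof.
move=> Pp a0; have [u [s]] := @ufd_mpol k n a a0.
have [m] := ubnP (size s); elim: m => // m IH in a a0 u s *.
rewrite ltnS => sm F; have [[b Eb]|nd] := pselect (divides p a); last first.
  by exists 0%N, a; rewrite expr0 mul1r.
have b0 : b != 0 by apply: contraNneq a0 => E; rewrite Eb E mulr0.
have [v [t [Ft lt]]] : exists v t, factored b v t /\ (size t < size s)%N.
  by apply: (factored_div (u := u) Pp); rewrite -Eb.
have [e [c [nc Ec]]] := IH b b0 v t (leq_trans lt sm) Ft.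
by exists e.+1, c; split=> //; rewrite Eb Ec exprS mulrA.
Qed.

Let prime_ndivM p a b : prime_elt p -> ~ divides p a -> ~ divides p b ->
  ~ divides p (a * b).
Proof. by case=> _ _ H na nb /H []. Qed.

(** The order along [q] can be computed in a single member of the cover that meets the hypersurface
    of [q], because the transition functions are units along it; a power of [q] then cancels this
    order without changing the order along other primes. *)
Let remove_prime g q l : rational_section g -> prime_elt q -> good g (q :: l) ->
  exists2 g', rational_section g' & good g' l.
Proof.
move=> [g0 gE] Pq gg.
have [|y1 [qy1 _]] := @prime_vanishing k n q 1 Pq.
  by apply: prime_divides_unit => //; exact: unitr1.
have [i1 Ci1] := lb_covers L y1.
have Li1 : C i1 !=set0 by exists y1.
have [e1 [a1 [na1 Ea1]]] := split_prime Pq (g0 i1 Li1).1.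
have [e2 [a2 [na2 Ea2]]] := split_prime Pq (g0 i1 Li1).2.
have q0 : q != 0 by case: Pq.
(* The numerator and the denominator of [g i1] have orders [e1] and [e2] along [q], so the factor
   [q ^+ e2 / q ^+ e1] brings the order to zero. *)
pose g' i := ((g i).1 * q ^+ e2, (g i).2 * q ^+ e1).
exists g'.
  split=> [i /g0 [? ?]|i j a b Li Lj H] /=.
    by rewrite !mulf_neq0// expf_neq0.
  have := gE i j a b Li Lj H => E.
  transitivity (q ^+ e1 * q ^+ e2 * ((g i).1 * (g j).2 * b)); first by ring.
  by rewrite E; ring.
move=> i p y Pp Ciy py npl.
have npow (e : nat) : ~ divides p q -> ~ divides p (q ^+ e).
  move=> pq; elim: e => [|e IH].
    by apply: prime_divides_unit => //; rewrite expr0 unitr1.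
  by rewrite exprS; exact: prime_ndivM.
have [pq|npq] := pselect (divides p q); last first.
  have [|a [b [na nb E]]] := gg i p y Pp Ciy py.
    move=> r; rewrite inE => /predU1P [->|/npl//] qp.
    have [v vU Ev] := prime_associate Pq Pp qp.
    by apply: npq; exists v^-1; rewrite Ev mulrK.
  exists (a * q ^+ e2), (b * q ^+ e1); split.
  - by apply: prime_ndivM => //; exact: npow.
  - by apply: prime_ndivM => //; exact: npow.
  - rewrite /=; transitivity (q ^+ e1 * q ^+ e2 * ((g i).1 * b)); first by ring.
    by rewrite E; ring.
have [v vU Ev] := prime_associate Pp Pq pq.
have nd a : ~ divides q a -> ~ divides p a.
  by move=> H [c E]; apply: H; exists (v^-1 * c); rewrite Ev E -mulrA mulVKr.
have qy : peval q y = 0 := divides_peval pq py.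
have Li : C i !=set0 by exists y.
have [a [b [a0 b0 H]]] := trans_repr Li Li1.
have [c cy sC] := affine_openP (lb_open i) Ciy.
have [d dy sD] := affine_openP (lb_open i1) Ci1.
have [|z [qz]] := @prime_vanishing _ _ q (c * d) Pq.
  apply: prime_ndivM => //.
    by move/divides_peval => /(_ y qy) /eqP; rewrite (negPf cy).
  by move/divides_peval => /(_ y1 qy1) /eqP; rewrite (negPf dy).
rewrite pevalM mulf_eq0 negb_or => /andP [/sC Ciz /sD Ci1z].
have [az bz _] := H z Ciz Ci1z.
have na : ~ divides q a by move/divides_peval => /(_ z qz) /eqP; rewrite (negPf az).
have nb : ~ divides q b by move/divides_peval => /(_ z qz) /eqP; rewrite (negPf bz).
have E := gE i i1 a b Li Li1 H.
exists (a * a1), (b * a2); split; [by apply/nd/prime_ndivM|by apply/nd/prime_ndivM|].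
rewrite /=; have : (g i).1 * (q ^+ e2 * a2) * b = a * (g i).2 * (q ^+ e1 * a1).
  by rewrite -Ea1 -Ea2.
move=> E'; transitivity ((g i).1 * (q ^+ e2 * a2) * b); first by ring.
by rewrite E'; ring.
Qed.

(** Removing the primes of [b0] one after the other leaves a rational section whose divisor is zero.
    In lowest terms its numerators and denominators have no zeros on their members of the cover, so
    it is a frame. *)
Lemma affine_picard : exists e : lb_index L -> An -> k,
  [/\ forall i, regular An (lb_cover L i) (e i),
      forall i y, lb_cover L i y -> e i y != 0 &
      forall i j y, lb_cover L i y -> lb_cover L j y ->
        lb_trans L i j y * e j y = e i y].
Proof.
have [g rg [b0 [b00 Hb]]] := rational_section_ex.
have [u [s [uU sP Eb]]] := @ufd_mpol k n b0 b00.
have gg : good g s.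
  move=> i p y Pp Ciy py H; apply: (Hb i p y) => //.
  rewrite Eb => /(prime_divides_prod Pp uU) [q qs pq]; apply: (H q qs).
  have [v vU Ev] := prime_associate Pp (sP q qs) pq.
  by exists v^-1; rewrite Ev mulrK.
clear b0 b00 Hb Eb.
have [h rh gh] : exists2 h, rational_section h & good h [::].
  elim: s sP g rg gg => [|q s IH] sP g rg gg; first by exists g.
  have [|g' rg' gg'] := remove_prime rg _ gg; first by apply: sP; rewrite mem_head.
  by apply: (IH _ g') => // r rs; apply: sP; rewrite inE rs orbT.
have [h0 hE] := rh.
have /choice [r Hr] : forall i, exists r : pol * pol, C i !=set0 ->
  [/\ r.1 != 0, r.2 != 0, coprime_elt r.1 r.2 & (h i).1 * r.2 = r.1 * (h i).2].
  move=> i; have [Li|nL] := pselect (C i !=set0); last by exists 0.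
  have [h1 h2] := h0 i Li.
  have [c [d [d0 cop E]]] := coprime_repr (@ufd_mpol k n) (h i).1 h2.
  exists (c, d) => _; split=> //=; apply: contraNneq h1 => c0.
  by move/eqP: E; rewrite c0 mul0r mulf_eq0 (negPf d0) orbF.
have nv i y : C i y -> peval (r i).1 y != 0 /\ peval (r i).2 y != 0.
  move=> Ciy; have Li : C i !=set0 by exists y.
  have [r1 r2 cop E] := Hr i Li; have [h1 h2] := h0 i Li.
  (* Order zero along [p] means that [p] divides the numerator exactly when it divides the
     denominator; in lowest terms it divides neither. *)
  have key p a b : prime_elt p -> ~ divides p a -> ~ divides p b ->
      (h i).1 * b = (h i).2 * a -> (divides p (r i).1 <-> divides p (r i).2).
    move=> Pp na nb Eab; have E' : (r i).1 * b = a * (r i).2.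
      apply: (mulfI h2); transitivity ((h i).1 * b * (r i).2); last by rewrite Eab; ring.
      by rewrite mulrAC E; ring.
    case: (Pp) => _ _ pP; split=> H.
      have /pP [] // : divides p (a * (r i).2) by rewrite -E'; exact: dividesMr.
    have /pP [] // : divides p ((r i).1 * b) by rewrite E'; exact: dividesMl.
  have uz q : q != 0 -> peval q y = 0 ->
      exists p, [/\ prime_elt p, divides p q & peval p y = 0].
    move=> qn0 qy; have [v [t [vU tP Eq]]] := @ufd_mpol k n q qn0.
    have [c c0 Hc] := mpol_unit vU.
    move: qy; rewrite Eq pevalM (Hc _ : peval v y = c) => /eqP.
    rewrite mulf_eq0 (negPf c0) /= /peval rmorph_prod => /eqP/eqP.
    rewrite prodf_seq_eq0 => /hasP [p pt /eqP py]; exists p; split=> //.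
      exact: tP.
    by exists (v * \prod_(x <- rem p t) x); rewrite (big_rem p)//= mulrCA.
  split; apply/negP => /eqP ry.
    have [p [Pp pr py]] := uz _ r1 ry.
    have [//|a [b [na nb Eab]]] := gh i p y Pp Ciy py.
    by apply: (cop p) => //; apply/(key p a b Pp na nb Eab).
  have [p [Pp pr py]] := uz _ r2 ry.
  have [//|a [b [na nb Eab]]] := gh i p y Pp Ciy py.
  by apply: (cop p) => //; apply/(key p a b Pp na nb Eab).
exists (fun i y => peval (r i).1 y / peval (r i).2 y); split.
- by move=> i; apply: regular_quotient => y /nv [].
- by move=> i y /nv [? ?]; rewrite mulf_neq0// invr_eq0.
move=> i j y Ciy Cjy.
have Li : C i !=set0 by exists y.
have Lj : C j !=set0 by exists y.
have [a [b [a0 b0 H]]] := trans_repr Li Lj.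
have [ay by0 ->] := H y Ciy Cjy.
have [ri1 ri2] := nv i y Ciy; have [rj1 rj2] := nv j y Cjy.
have E := hE i j a b Li Lj H.
have [_ _ _ Ei] := Hr i Li; have [_ _ _ Ej] := Hr j Lj.
have [hi1 hi2] := h0 i Li; have [hj1 hj2] := h0 j Lj.
rewrite mulf_div; apply/eqP; rewrite eqr_div ?mulf_neq0// -!pevalM; apply/eqP.
congr (peval _ y); apply: (mulfI (mulf_neq0 hi2 hj1)).
transitivity (a * (h i).2 * (h j).1 * (r j).1 * (r i).2); first by ring.
rewrite -E; transitivity (((h i).1 * (r i).2) * b * ((r j).1 * (h j).2)); first by ring.
by rewrite Ei -Ej; ring.
Qed.

End AffinePicard.

(** * Combinatorics of the fan *)

Section SlotInduction.
Variables (T : Type) (p : nat).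
Implicit Types (F : 'I_p -> T) (j : 'I_p) (x : T).

Definition put F j x : 'I_p -> T := fun l => if l == j then x else F l.

Lemma put_id F j : put F j (F j) = F.
Proof. by apply/funext => l; rewrite /put; case: eqP => [->|]. Qed.

(** The entries of a tuple are replaced one at a time, keeping [P]. A multilinear statement is
    thereby reduced to the expansion of a single slot. *)
Lemma slot_induction (P : ('I_p -> T) -> Prop) (G : 'I_p -> T -> Prop) F0 :
  (forall F j, P F -> F j = F0 j -> exists2 x, G j x & P (put F j x)) ->
  P F0 -> exists2 F, forall j, G j (F j) & P F.
Proof.
move=> step P0.
suff H q : (q <= p)%N -> exists F, [/\ forall j, (j < q)%N -> G j (F j),
    forall j, (q <= j)%N -> F j = F0 j & P F].
  by have [F [GF _ PF]] := H p (leqnn p); exists F => // j; exact: GF.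
elim: q => [|q IH] qp; first by exists F0.
have [F [GF EF PF]] := IH (ltnW qp).
have [x Gx Px] := step F (Ordinal qp) PF (EF (Ordinal qp) (leqnn q)).
exists (put F (Ordinal qp) x); split=> // j; rewrite /put.
  case: eqP => [-> //|ne] lt; apply: GF; rewrite ltn_neqAle -ltnS lt andbT.
  by apply/eqP => E; apply: ne; exact: val_inj.
case: eqP => [->|_ lt]; first by rewrite ltnn.
by apply: EF; exact: ltnW.
Qed.

End SlotInduction.

Section Combinatorics.
Variables (n p : nat) (I : finType) (U : I -> 'M[int]_n) (Y : I -> 'rV[int]_n).
Local Notation vec := 'rV[int]_n.
Implicit Types (s t : I) (i j : 'I_n) (u v z : vec) (A r : seq vec).

Lemma ipairDl (l l' u : vec) : ipair (l + l') u = ipair l u + ipair l' u.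
Proof. by rewrite /ipair -big_split; apply: eq_bigr => i _; rewrite mxE mulrDl. Qed.

Lemma ipairC (l l' : vec) : ipair l l' = ipair l' l.
Proof. by apply: eq_bigr => i _; rewrite mulrC. Qed.

Lemma ipairZl c (l u : vec) : ipair (c *: l) u = c * ipair l u.
Proof. by rewrite /ipair mulr_sumr; apply: eq_bigr => i _; rewrite mxE mulrA. Qed.

Lemma ipairDr (l u v : vec) : ipair l (u + v) = ipair l u + ipair l v.
Proof. by rewrite ipairC ipairDl !(ipairC l). Qed.

Lemma ipairZr c (l u : vec) : ipair l (c *: u) = c * ipair l u.
Proof. by rewrite ipairC ipairZl ipairC. Qed.

Lemma ipairNl (l u : vec) : ipair (- l) u = - ipair l u.
Proof. by rewrite -scaleN1r ipairZl mulN1r. Qed.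

Lemma ipairNr (l u : vec) : ipair l (- u) = - ipair l u.
Proof. by rewrite -scaleN1r ipairZr mulN1r. Qed.

Lemma ipairBl (l l' u : vec) : ipair (l - l') u = ipair l u - ipair l' u.
Proof. by rewrite ipairDl ipairNl. Qed.

Lemma ipairBr (l u v : vec) : ipair l (u - v) = ipair l u - ipair l v.
Proof. by rewrite ipairDr ipairNr. Qed.

Lemma ipair0r (l : vec) : ipair l 0 = 0.
Proof. by rewrite -(scale0r 0) ipairZr mul0r. Qed.

Lemma ipair_sumr (J : Type) (r : seq J) (P : pred J) (F : J -> vec) (l : vec) :
  ipair l (\sum_(a <- r | P a) F a) = \sum_(a <- r | P a) ipair l (F a).
Proof. exact: (big_morph _ (ipairDr l) (ipair0r l)). Qed.

Definition ray s i : vec := row i (U s).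

(** The basis dual to the rays of [s]; its members generate the dual cone. *)
Definition cocone s i : vec := row i (invmx (U s))^T.

Hypothesis unimodular : forall s, U s \in unitmx.

Lemma cocone_ray s i j : ipair (cocone s i) (ray s j) = (i == j)%:R.
Proof.
have /matrixP /(_ j i) := mulmxV (unimodular s).
rewrite !mxE (eq_sym i) => <-; apply: eq_bigr => l _.
by rewrite !mxE mulrC.
Qed.

Lemma ray_expand s u : u = \sum_i ipair (cocone s i) u *: ray s i.
Proof.
rewrite -[LHS]mulmx1 -(mulVmx (unimodular s)) mulmxA mulmx_sum_row.
apply: eq_bigr => i _; congr (_ *: _); rewrite mxE; apply: eq_bigr => l _.
by rewrite !mxE mulrC.
Qed.

Lemma cocone_expand s u : u = \sum_i ipair u (ray s i) *: cocone s i.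
Proof.
have E : u *m ((U s)^T *m (invmx (U s))^T) = u.
  by rewrite -trmx_mul mulVmx// trmx1 mulmx1.
rewrite -[LHS]E mulmxA mulmx_sum_row; apply: eq_bigr => i _; congr (_ *: _).
by rewrite mxE; apply: eq_bigr => l _; rewrite !mxE.
Qed.

Hypothesis cover : forall u, exists s, forall i, 0 <= ipair (cocone s i) u.
(** Together with [Y_strict] this is strict convexity in the form of a minimum: on its own cone each
    linear piece lies below all the others, with equality at a ray only if that ray belongs to the
    other cone. *)
Hypothesis Y_min : forall s t i, ipair (Y s) (ray s i) <= ipair (Y t) (ray s i).
Hypothesis Y_strict : forall s t i, ipair (Y s) (ray s i) = ipair (Y t) (ray s i) ->
  forall j, 0 <= ipair (cocone t j) (ray s i).

Definition incone s u := [forall i, 0 <= ipair (cocone s i) u].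

Lemma incone_ex u : exists s, incone s u.
Proof. by have [s Hs] := cover u; exists s; apply/forallP. Qed.

(* The piecewise linear function equal to Y s on the cone of s. *)
Definition psi u : int := ipair (Y (xchoose (incone_ex u))) u.

Lemma Y_cone_le s t u : incone s u -> ipair (Y s) u <= ipair (Y t) u.
Proof.
move=> /forallP su; rewrite (ray_expand s u) !ipair_sumr; apply: ler_sum => i _.
by rewrite !ipairZr ler_wpM2l.
Qed.

Lemma psi_in s u : incone s u -> psi u = ipair (Y s) u.
Proof.
move=> su; apply/eqP; rewrite eq_le /psi; have tu := xchooseP (incone_ex u).
by rewrite !Y_cone_le.
Qed.

Lemma psi_le s u : psi u <= ipair (Y s) u.
Proof. by have [t tu] := incone_ex u; rewrite (psi_in tu) Y_cone_le. Qed.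

Definition is_ray u := exists s i, u = ray s i.

Lemma ray_incone s i : incone s (ray s i).
Proof. by apply/forallP => j; rewrite cocone_ray; case: eqP. Qed.

Lemma psi_eq_in s u : is_ray u -> psi u = ipair (Y s) u -> incone s u.
Proof.
move=> [t [i ->]]; rewrite (psi_in (ray_incone t i)) => E.
by apply/forallP => j; apply: Y_strict E j.
Qed.

(** The ray of [t] is a nonnegative combination of rays of [s]. As [Y t] agrees with [psi] on the
    sum, it agrees on every ray that occurs, so all these rays lie in the cone of [t]. Their
    combination is a basis vector of [t], so each is a multiple of it, and integrality makes the
    multiple 1. *)
Lemma ray_row s u : is_ray u -> incone s u -> exists i, u = ray s i.
Proof.
move=> [t [i ->]] su.
pose c j := ipair (cocone s j) (ray t i).
have c0 j : 0 <= c j by have /forallP := su; apply.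
have E : ray t i = \sum_j c j *: ray s j := ray_expand s _.
have tin j : 0 < c j -> incone t (ray s j).
  move=> cj; apply: psi_eq_in; first by exists s, j.
  have : \sum_l c l * (ipair (Y t) (ray s l) - psi (ray s l)) = 0.
    transitivity (ipair (Y t) (ray t i) - ipair (Y s) (ray t i)).
      rewrite E !ipair_sumr -sumrB; apply: eq_bigr => l _.
      by rewrite !ipairZr (psi_in (ray_incone s l)) mulrBr.
    by rewrite -(psi_in su) -(psi_in (ray_incone t i)) subrr.
  have ge l : 0 <= c l * (ipair (Y t) (ray s l) - psi (ray s l)).
    by rewrite mulr_ge0// subr_ge0 psi_le.
  move/eqP; rewrite psumr_eq0// => /allP /(_ j (mem_index_enum _)) /=.
  by rewrite mulf_eq0 gt_eqF//= subr_eq0 => /eqP.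
have E1 l : (i == l)%:R = \sum_j c j * ipair (cocone t l) (ray s j).
  rewrite eq_sym -(cocone_ray t l i) [in LHS]E ipair_sumr; apply: eq_bigr => j _.
  by rewrite ipairZr.
have d0 l j : 0 <= c j * ipair (cocone t l) (ray s j).
  have [cj|] := ltP 0 (c j); first by rewrite mulr_ge0//; have /forallP := tin j cj; apply.
  by rewrite le_eqVlt ltNge c0 orbF => /eqP ->; rewrite mul0r.
have [j /andP [cj dj]] : exists j, (0 < c j) && (0 < ipair (cocone t i) (ray s j)).
  apply: contrapT => /forallNP H; have := E1 i; rewrite eqxx big1// => j _.
  have := d0 i j; have := H j; have := c0 j; rewrite le_eqVlt.
  case: eqP => [<-|_ /= cj]; first by rewrite mul0r.
  move/negP; rewrite cj /= -leNgt => le; rewrite pmulr_rge0// => ge.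
  by have -> : ipair (cocone t i) (ray s j) = 0; [lia|rewrite mulr0].
have dz l : i != l -> ipair (cocone t l) (ray s j) = 0.
  move=> il; have := E1 l; rewrite (negPf il) => /esym/eqP.
  rewrite psumr_eq0// => /allP /(_ j (mem_index_enum _)) /=.
  by rewrite mulf_eq0 gt_eqF//= => /eqP.
have Ej : ray s j = ipair (cocone t i) (ray s j) *: ray t i.
  rewrite {1}(ray_expand t (ray s j)) (bigD1 i)//= big1 ?addr0// => l li.
  by rewrite dz ?scale0r// eq_sym.
(* Two integers, one of them positive, with product 1: both are 1. *)
have cc : ipair (cocone t i) (ray s j) * c j = 1.
  by have := cocone_ray s j j; rewrite eqxx {1}Ej ipairZr.
exists j; rewrite Ej.
by have -> : ipair (cocone t i) (ray s j) = 1; [nia|rewrite scale1r].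
Qed.

(** * Relations modulo the span of a cone *)

Hypothesis Y_mod : forall s t, exists D, Y s - Y t = p%:Z *: D.
Hypothesis p_gt0 : (0 < p)%N.

Definition zspan A z := exists c : vec -> int, z = \sum_(a <- A) c a *: a.

Lemma zspan0 A : zspan A 0.
Proof. by exists (fun=> 0); rewrite big1// => a _; rewrite scale0r. Qed.

Lemma zspanD A z z' : zspan A z -> zspan A z' -> zspan A (z + z').
Proof.
move=> [c ->] [d ->]; exists (fun a => c a + d a); rewrite -big_split /=.
by apply: eq_bigr => a _; rewrite scalerDl.
Qed.

Lemma zspanN A z : zspan A z -> zspan A (- z).
Proof.
move=> [c ->]; exists (fun a => - c a); rewrite -sumrN.
by apply: eq_bigr => a _; rewrite scaleNr.
Qed.

Lemma zspanB A z z' : zspan A z -> zspan A z' -> zspan A (z - z').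
Proof. by move=> Az Az'; apply: zspanD => //; exact: zspanN. Qed.

Lemma zspan_sum A (J : Type) (r : seq J) (P : pred J) (F : J -> vec) :
  (forall x, P x -> zspan A (F x)) -> zspan A (\sum_(x <- r | P x) F x).
Proof. by move=> H; apply: big_ind => //; [exact: zspan0|exact: zspanD]. Qed.

Lemma zspanZ A c z : zspan A z -> zspan A (c *: z).
Proof.
move=> [d ->]; exists (fun a => c * d a); rewrite scaler_sumr.
by apply: eq_bigr => a _; rewrite scalerA.
Qed.

Lemma zspan_mem A a : uniq A -> a \in A -> zspan A a.
Proof.
move=> uA aA; exists (fun b => (b == a)%:R); rewrite (bigD1_seq a)//= eqxx scale1r.
by rewrite big1 ?addr0// => b /negPf ->; rewrite scale0r.
Qed.

Definition rays A := forall u, u \in A -> is_ray u.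

Definition in_star A s := all (incone s) A.

Lemma zspan_cocone A s i z : rays A -> in_star A s -> ray s i \notin A ->
  zspan A z -> ipair (cocone s i) z = 0.
Proof.
move=> rA /allP As iA [c ->]; rewrite ipair_sumr big_seq big1// => a aA.
have [j Ej] := ray_row (rA a aA) (As a aA).
rewrite ipairZr Ej cocone_ray; case: eqP => [ij|]; last by rewrite mulr0.
by rewrite ij -Ej aA in iA.
Qed.

(** The dual vector of a ray of [r] vanishes on the span of [A], is 1 on that ray and nonnegative on
    the others, so a nonempty sum cannot lie in the span. *)
Lemma star_independent A r s : rays A -> in_star A s -> rays r -> in_star r s ->
  (forall u, u \in r -> u \notin A) -> zspan A (\sum_(u <- r) u) -> r = [::].
Proof.
case: r => [//|u r] rA As rr rs nA Az.
have [i Ei] := ray_row (rr u (mem_head _ _)) (allP rs u (mem_head _ _)).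
have iA : ray s i \notin A by rewrite -Ei nA ?mem_head.
have := zspan_cocone rA As iA Az; rewrite big_cons ipairDr {1}Ei cocone_ray eqxx.
rewrite ipair_sumr; suff : 0 <= \sum_(j <- r) ipair (cocone s i) j by lia.
rewrite big_seq; apply: sumr_ge0 => v vr.
have vr' : v \in u :: r by rewrite inE vr orbT.
by have /forallP := allP rs v vr'; apply.
Qed.

(** Completeness of the star of [A]. If the cone reached by adding [T] times the sum of [A] missed a
    ray of [A], its linear function would exceed [psi] there by at least 1, and [T] is too large for
    the contribution of [v] to compensate this. *)
Lemma push A v : rays A -> (exists s, in_star A s) ->
  exists s (T : nat), in_star A s /\ incone s (v + T%:Z *: \sum_(a <- A) a).
Proof.
move=> rA [s0 As0].
pose T := (\max_s `|ipair (Y s0 - Y s) v|).+1.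
have [s sv] := incone_ex (v + T%:Z *: \sum_(a <- A) a).
exists s, T; split=> //.
have le := psi_le s0 (v + T%:Z *: \sum_(a <- A) a).
rewrite (psi_in sv) !ipairDr !ipairZr in le.
have lt : ipair (Y s0 - Y s) v < T%:Z.
  apply: le_lt_trans (lez_abs _) _; rewrite ltz_nat ltnS.
  exact: (leq_bigmax_cond (F := fun s => `|ipair (Y s0 - Y s) v|%N)).
have E0 : ipair (Y s0) (\sum_(a <- A) a) = \sum_(a <- A) psi a.
  rewrite ipair_sumr big_seq [RHS]big_seq; apply: eq_bigr => a aA.
  by rewrite (psi_in (allP As0 a aA)).
have ge : \sum_(a <- A) psi a <= ipair (Y s) (\sum_(a <- A) a).
  by rewrite ipair_sumr; apply: ler_sum => a _; exact: psi_le.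
rewrite ipairBl in lt; rewrite E0 in le.
have eq : ipair (Y s) (\sum_(a <- A) a) = \sum_(a <- A) psi a.
  by move: lt le ge; have : 0 < T%:Z by []; nia.
have : \sum_(a <- A) (ipair (Y s) a - psi a) = 0.
  by rewrite sumrB -ipair_sumr eq subrr.
move/eqP; rewrite psumr_eq0 => [/allP H|a _]; last by rewrite subr_ge0 psi_le.
apply/allP => a aA; apply: psi_eq_in; first exact: rA.
by have := H a aA; rewrite /= subr_eq0 => /eqP/esym.
Qed.

Lemma star_decomp A v : rays A -> uniq A -> (exists s, in_star A s) ->
  exists s c, [/\ in_star A s, rays c, in_star c s,
    forall u, u \in c -> u \notin A & zspan A (v - \sum_(u <- c) u)].
Proof.
move=> rA uA exA; have [s [T [As sv]]] := push v rA exA.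
pose e i := ipair (cocone s i) (v + T%:Z *: \sum_(a <- A) a).
have e0 i : 0 <= e i by have /forallP := sv; apply.
(* The coordinates of the pushed vector in the basis of [s]: rays of [A] are dropped, and the others
   are repeated according to their coefficient, so that the decomposition is a plain list. *)
exists s, (flatten [seq nseq `|e i|%N (ray s i) | i <- enum 'I_n & ray s i \notin A]).
have mem u : u \in flatten [seq nseq `|e i|%N (ray s i) | i <- enum 'I_n & ray s i \notin A] ->
    exists2 i, u = ray s i & ray s i \notin A.
  move=> /flatten_mapP [i]; rewrite mem_filter => /andP [nA _].
  by rewrite mem_nseq => /andP [_ /eqP ->]; exists i.
split=> //.
- by move=> u /mem [i -> _]; exists s, i.
- by apply/allP => u /mem [i -> _]; exact: ray_incone.
- by move=> u /mem [i -> ].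
have -> : v - \sum_(u <- flatten [seq nseq `|e i|%N (ray s i) | i <- enum 'I_n & ray s i \notin A]) u
    = \sum_(i | ray s i \in A) e i *: ray s i - T%:Z *: \sum_(a <- A) a.
  rewrite -[in LHS](addrK (T%:Z *: \sum_(a <- A) a) v) (ray_expand s (v + _)) -/e.
  rewrite (bigID (fun i => ray s i \in A)) /=.
  rewrite big_flatten /= big_map big_filter big_enum_cond /=.
  have -> : \sum_(i | ray s i \notin A) \sum_(u <- nseq `|e i| (ray s i)) u =
      \sum_(i | ray s i \notin A) e i *: ray s i.
    apply: eq_bigr => i _; rewrite big_nseq -Monoid.iteropE /= -[iterop _ _ _ _]/(ray s i *+ `|e i|%N).
    by rewrite -{2}(gez0_abs (e0 i)) -scaler_nat natz.
  by rewrite addrAC addrK.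
apply: zspanB; first by apply: zspan_sum => i iA; apply: zspanZ; exact: zspan_mem.
by apply: zspanZ; rewrite big_seq; apply: zspan_sum => a; exact: zspan_mem.
Qed.

Lemma Y_agree A s t z : in_star A s -> in_star A t -> zspan A z ->
  ipair (Y s) z = ipair (Y t) z.
Proof.
move=> /allP As /allP At [c ->]; rewrite !ipair_sumr big_seq [RHS]big_seq.
apply: eq_bigr => a aA; rewrite !ipairZr.
by rewrite -(psi_in (As a aA)) -(psi_in (At a aA)).
Qed.

(** The fundamental inequality. Each [u] is decomposed modulo [A] into rays of a cone [t u], which
    turns the left-over sum into a sum of nonnegative defects [Y s0 - psi]. Were it zero, all these
    rays would lie in the cone of [s0], and [star_independent] would leave none. By [Y_mod] it is a
    multiple of [p]. *)
Lemma star_bound A r s0 : rays A -> uniq A -> in_star A s0 ->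
  zspan A (\sum_(u <- r) u) -> (exists2 u, u \in r & ~ zspan A u) ->
  exists2 t : vec -> I, forall u, in_star A (t u) &
    p%:Z <= \sum_(u <- r) (ipair (Y s0) u - ipair (Y (t u)) u).
Proof.
move=> rA uA As0 Az [u0 u0r nAu0].
have /choice [t Ht] u := star_decomp u rA uA (ex_intro _ s0 As0).
have {Ht} /choice [c Hc] := Ht.
exists t => [u|]; first by case: (Hc u).
pose r' := flatten [seq c u | u <- r].
have memr x : x \in r' -> exists2 u, u \in r & x \in c u.
  by move=> /flatten_mapP [u ur xc]; exists u.
have rr' : rays r' by move=> x /memr [u _]; case: (Hc u) => _ + _ _ _; exact.
have E : \sum_(u <- r) (ipair (Y s0) u - ipair (Y (t u)) u) =
    \sum_(x <- r') (ipair (Y s0) x - psi x).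
  rewrite /r' big_flatten /= big_map; apply: eq_bigr => u _.
  have [At _ ct _ Au] := Hc u.
  have := Y_agree As0 At Au; rewrite !ipairBr => E.
  have -> : ipair (Y s0) u - ipair (Y (t u)) u =
    ipair (Y s0) (\sum_(x <- c u) x) - ipair (Y (t u)) (\sum_(x <- c u) x) by lia.
  rewrite !ipair_sumr -sumrB big_seq [RHS]big_seq; apply: eq_bigr => x xc.
  by rewrite (psi_in (allP ct x xc)).
have ge0 x : 0 <= ipair (Y s0) x - psi x by rewrite subr_ge0 psi_le.
have n0 : \sum_(x <- r') (ipair (Y s0) x - psi x) != 0.
  rewrite psumr_eq0//; apply/negP => /allP H.
  have r's0 : in_star r' s0.
    apply/allP => x xr; apply: psi_eq_in; first exact: rr'.
    by have := H x xr; rewrite /= subr_eq0 => /eqP/esym.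
  have r'nA u : u \in r' -> u \notin A by move=> /memr [v _]; case: (Hc v) => _ _ _ + _; exact.
  have Ar' : zspan A (\sum_(x <- r') x).
    have -> : \sum_(x <- r') x = \sum_(u <- r) u - \sum_(u <- r) (u - \sum_(x <- c u) x).
      by rewrite sumrB /r' big_flatten /= big_map opprB addrC subrK.
    by apply: zspanB => //; apply: zspan_sum => u _; case: (Hc u).
  have r'0 := star_independent rA As0 rr' r's0 r'nA Ar'.
  apply: nAu0; have [_ _ _ _] := Hc u0; case E0: (c u0) => [|x l].
    by rewrite big_nil subr0.
  have : x \in r' by apply/flatten_mapP; exists u0; rewrite // E0 mem_head.
  by rewrite r'0.
have [D ED] : exists D, \sum_(u <- r) (ipair (Y s0) u - ipair (Y (t u)) u) = p%:Z * D.
  apply: (big_ind (fun x => exists D, x = p%:Z * D)) => [|x y [D ->] [D' ->]|u _].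
  - by exists 0; rewrite mulr0.
  - by exists (D + D'); rewrite mulrDr.
  - have [D ED] := Y_mod s0 (t u); exists (ipair D u).
    by rewrite -ipairBl ED ipairZl.
have d0 : 0 <= \sum_(x <- r') (ipair (Y s0) x - psi x) by apply: sumr_ge0.
have pz : 0 < p%:Z :> int by [].
move: n0 d0; rewrite -E ED mulf_eq0 negb_or pmulr_rge0// => /andP [_ D0] D1.
by rewrite ler_pMr// -gtz0_ge1 lt_def D0.
Qed.

Lemma star_bound_psi A r s0 : rays A -> uniq A -> in_star A s0 ->
  zspan A (\sum_(u <- r) u) -> (exists2 u, u \in r & ~ zspan A u) ->
  p%:Z <= ipair (Y s0) (\sum_(u <- r) u) - \sum_(u <- r) psi u.
Proof.
move=> rA uA As0 Az nAr; have [t _ le] := star_bound rA uA As0 Az nAr.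
apply: le_trans le _; rewrite sumrB ipair_sumr lerD2l lerN2.
by apply: ler_sum => u _; exact: psi_le.
Qed.

Lemma ray_inj s : injective (ray s).
Proof.
move=> i j E; have := cocone_ray s i i; rewrite {1}E cocone_ray eqxx.
by case: eqP.
Qed.

(** A positive relation modulo [A] of least degree, the degree being the defect of [psi]. It plays
    the role of a minimal relation between the rays of the quotient fan: the whole of [r] lies in no
    cone around [A], but it does after removal of any member. *)
Lemma minimal_relation A s0 : rays A -> uniq A -> in_star A s0 -> (size A < n)%N ->
  exists r, [/\ rays r /\ uniq r, r != [::] /\ (forall u, u \in r -> u \notin A /\
      exists s, in_star A s /\ incone s u),
    zspan A (\sum_(u <- r) u),
    forall j : vec, j \in r -> exists s, in_star A s /\ in_star (rem j r) s &
    forall s, in_star A s -> ~~ in_star r s].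
Proof.
move=> rA uA As0 sA.
pose rel r := [/\ rays r, r != [::], zspan A (\sum_(u <- r) u) &
  forall u, u \in r -> u \notin A /\ exists s, in_star A s /\ incone s u].
pose deg r := ipair (Y s0) (\sum_(u <- r) u) - \sum_(u <- r) psi u.
have degE r s : rel r -> in_star A s ->
    deg r = \sum_(u <- r) (ipair (Y s) u - psi u).
  move=> [_ _ Az _] As; rewrite sumrB -ipair_sumr /deg.
  by rewrite (Y_agree As0 As Az).
have deg0 r : rel r -> 0 <= deg r.
  by move=> rr; rewrite (degE r s0 rr As0); apply: sumr_ge0 => u _; rewrite subr_ge0 psi_le.
have [r0 rr0] : exists r, rel r.
  have [i iA] : exists i, ray s0 i \notin A.
    apply: contrapT => /forallNP H; move: sA; rewrite ltnNge => /negP; apply.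
    rewrite -[X in (X <= _)%N]size_enum_ord -(size_map (ray s0)).
    apply: uniq_leq_size; first by rewrite map_inj_uniq ?enum_uniq//; exact: ray_inj.
    by move=> _ /mapP [i _ ->]; have := H i; case: (_ \in A).
  (* Decomposing the opposite of a ray outside [A] and adding the ray back gives a first
     relation. *)
  have [s [c [As rc cs cA Az]]] := star_decomp (- ray s0 i) rA uA (ex_intro _ s0 As0).
  exists (ray s0 i :: c); split=> //.
  - by move=> u; rewrite inE => /predU1P [->|/rc//]; exists s0, i.
  - by rewrite big_cons -[X in zspan _ X]opprK opprD; apply: zspanN.
  - move=> u; rewrite inE => /predU1P [->|uc].
      by split=> //; exists s0; split=> //; exact: ray_incone.
    by split; [exact: cA|exists s; split=> //; exact: (allP cs)].
pose P m := `[< exists r, rel r /\ `|deg r|%N = m >].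
have exP : exists m, P m by exists `|deg r0|%N; apply/asboolP; exists r0.
have [_ /asboolP [r [rr <-]] rmin] := ex_minnP exP.
have {}rmin r' : rel r' -> deg r <= deg r'.
  move=> rr'; have := rmin `|deg r'|%N; rewrite -lez_nat !gez0_abs ?deg0//.
  by apply; apply/asboolP; exists r'.
have [rar r0' Az rst] := rr.
have nin s : in_star A s -> ~~ in_star r s.
  move=> As; apply/negP => rs; move/eqP: r0'; apply.
  by apply: (star_independent rA As rar rs) => // u /rst [].
have step (j : vec) : j \in r -> exists s, in_star A s /\ in_star (rem j r) s.
  move=> jr; pose v := \sum_(u <- rem j r) u.
  have [s [c [As rc cs cA Avc]]] := star_decomp v rA uA (ex_intro _ s0 As0).
  exists s; split=> //; apply: contrapT => /negP nrs.
  have sumr : \sum_(u <- r) u = j + v by rewrite (big_rem j).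
  have rjc : rel (j :: c).
    split=> //.
    - by move=> u; rewrite inE => /predU1P [->|/rc//]; exact: rar.
    - have -> : \sum_(u <- j :: c) u = \sum_(u <- r) u - (v - \sum_(u <- c) u).
        by rewrite big_cons sumr opprB addrA (addrAC _ (\sum_(u <- c) u)) addrK.
      exact: zspanB.
    - move=> u; rewrite inE => /predU1P [->|uc]; first exact: rst.
      by split; [exact: cA|exists s; split=> //; exact: (allP cs)].
  (* Measured in [s], the rays of [c] have no defect, so minimality leaves no defect for those of
     [rem j r] either. They would then lie in the cone of [s], contrary to [nrs]. *)
  have := rmin _ rjc; rewrite (degE r s)// (degE (j :: c) s)// big_cons (big_rem j)//=.
  rewrite lerD2l [X in _ <= X]big_seq [X in _ <= X]big1; last first.
    by move=> u uc; rewrite (psi_in (allP cs u uc)) subrr.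
  have ge0 u : 0 <= ipair (Y s) u - psi u by rewrite subr_ge0 psi_le.
  move=> le0; have : \sum_(u <- rem j r) (ipair (Y s) u - psi u) == 0.
    by rewrite eq_le le0 sumr_ge0.
  rewrite psumr_eq0// => /allP H; case/negP: nrs; apply/allP => u ur.
  apply: psi_eq_in; first by apply: rar; exact: mem_rem ur.
  by have := H u ur; rewrite /= subr_eq0 => /eqP/esym.
exists r; split=> //.
(* A repeated member could be removed once without changing the underlying set, which would place
   all of [r] in one cone. *)
split=> //; apply: contraT => nu.
have [j [jr jrr]] : exists j : vec, j \in r /\ j \in rem j r.
  elim: (r) nu => //= x l IH; rewrite negb_and negbK => /orP [xl|/IH [j [jl jll]]].
    by exists x; rewrite mem_head eqxx.
  exists j; rewrite inE jl orbT; split=> //.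
  by case: eqVneq => // _; rewrite inE jll orbT.
have [s [As rs]] := step j jr; have /negP [] := nin s As.
apply/allP => u ur; have [->|uj] := eqVneq u j; first exact: (allP rs).
by apply: (allP rs); rewrite (perm_mem (perm_to_rem jr)) inE (negPf uj) in ur.
Qed.

(** * Counting rays by means of the alternating form *)

Variables (K : zmodType) (w : ('I_p -> vec) -> K).
Hypothesis p_le_n : (p <= n)%N.
Hypothesis Y_ge : forall s i, -1 <= ipair (Y s) (ray s i).

Hypothesis w_add : forall m (j : 'I_p) x y,
  w (put m j (x + y)) = w (put m j x) + w (put m j y).
Hypothesis w_neq0 : exists m, w m != 0.
Hypothesis w_van : forall s i m, ipair (Y s) (ray s i) = -1 ->
  (forall j : 'I_p, ipair (m j) (ray s i) = 0) -> w m = 0.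

Lemma w_slot0 m (j : 'I_p) : w (put m j 0) = 0.
Proof. by apply: (addrI (w (put m j 0))); rewrite -w_add !addr0. Qed.

Lemma w_slot_sum m (j : 'I_p) (J : Type) (r : seq J) (P : pred J) F :
  w (put m j (\sum_(x <- r | P x) F x)) = \sum_(x <- r | P x) w (put m j (F x)).
Proof. exact: (big_morph (fun x => w (put m j x)) (w_add m j) (w_slot0 m j)). Qed.

Lemma w_slotN m (j : 'I_p) x : w (put m j (- x)) = - w (put m j x).
Proof. by apply/eqP; rewrite -addr_eq0 -w_add addNr w_slot0. Qed.

Lemma w_slotZ m (j : 'I_p) c x : w (put m j x) = 0 -> w (put m j (c *: x)) = 0.
Proof.
move=> w0; have H (e : nat) : w (put m j (e%:Z *: x)) = 0.
  elim: e => [|e IH]; first by rewrite scale0r w_slot0.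
  by rewrite intS scalerDl scale1r w_add w0 IH addr0.
case: c => e; first exact: H.
by rewrite NegzE scaleNr w_slotN H oppr0.
Qed.

(** Each slot is expanded in the basis dual to [s]. Only basis vectors with a nonzero coefficient
    are chosen, and this control over [f] is what [weight_vanish] exploits. *)
Lemma w_basis s m : w m != 0 -> exists f : 'I_p -> 'I_n,
  w (fun j : 'I_p => cocone s (f j)) != 0 /\ forall j : 'I_p, ipair (m j) (ray s (f j)) != 0.
Proof.
move=> wm.
have [F q wF Fq|//|F HF wF] := @slot_induction _ p (fun F => w F != 0) (fun q x =>
    exists2 i, x = cocone s i & ipair (m q) (ray s i) != 0) m.
  apply: contrapT => H; move: wF; rewrite -(put_id F q) Fq (cocone_expand s (m q)).
  rewrite w_slot_sum big1 ?eqxx// => i _.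
  have [z|nz] := eqVneq (ipair (m q) (ray s i)) 0; first by rewrite z scale0r w_slot0.
  apply: w_slotZ; apply/eqP/negPn/negP => wi; apply: H.
  by exists (cocone s i) => //; exists i.
have /choice [f Hf] : forall j : 'I_p, exists i, F j = cocone s i /\ ipair (m j) (ray s i) != 0.
  by move=> j; have [i ? ?] := HF j; exists i.
exists f; split=> [|j]; last by case: (Hf j).
by rewrite (_ : (fun j : 'I_p => _) = F)//; apply/funext => j; case: (Hf j).
Qed.

Lemma psi_ge u : is_ray u -> -1 <= psi u.
Proof. by move=> [s [i ->]]; rewrite (psi_in (ray_incone s i)). Qed.

Lemma w_vanish u m : is_ray u -> psi u = -1 -> (forall j : 'I_p, ipair (m j) u = 0) -> w m = 0.
Proof.
move=> [s [i ->]]; rewrite (psi_in (ray_incone s i)); exact: w_van.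
Qed.

Definition minus u := psi u == -1.

(** Otherwise every slot of the basis tuple is orthogonal to [u], and the vanishing condition at a
    ray with [psi = -1] kills [w]. Since [f] has [p] slots, a cone has at most [p] such rays. *)
Lemma minus_row s f u : w (fun j : 'I_p => cocone s (f j)) != 0 -> is_ray u -> incone s u ->
  minus u -> exists j : 'I_p, u = ray s (f j).
Proof.
move=> wf ru us /eqP mu; have [i Ei] := ray_row ru us.
apply: contrapT => /forallNP H; case/eqP: wf; apply: (w_vanish ru mu) => j.
rewrite Ei cocone_ray; case: eqP => // E; case: (H j); by rewrite E.
Qed.

Lemma count_minus_cone s r : rays r -> uniq r -> in_star r s -> (count minus r <= p)%N.
Proof.
move=> rr ur rs; have [m0 wm0] := w_neq0; have [f [wf _]] := w_basis s wm0.
rewrite -size_filter -[X in (_ <= X)%N]size_enum_ord -(size_map (fun j : 'I_p => ray s (f j))).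
apply: uniq_leq_size; first exact: filter_uniq.
move=> u; rewrite mem_filter => /andP [mu ur'].
have [j ->] := minus_row wf (rr u ur') (allP rs u ur') mu.
by apply: map_f; rewrite mem_enum.
Qed.

Lemma count_minus_ge r : rays r -> - \sum_(u <- r) psi u <= (count minus r)%:Z.
Proof.
elim: r => [|u r IH] rr; first by rewrite big_nil.
rewrite big_cons /= opprD PoszD; apply: lerD; last first.
  by apply: IH => v vr; apply: rr; rewrite inE vr orbT.
have := psi_ge (rr u (mem_head _ _)).
by rewrite /minus; case: eqP => [->//|ne le] /=; lia.
Qed.

Lemma in_star_nil s : in_star [::] s. Proof. by []. Qed.

Lemma rays_nil : rays [::]. Proof. by []. Qed.

Lemma zspan_nil z : zspan [::] z -> z = 0.
Proof. by move=> [c ->]; rewrite big_nil. Qed.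

Lemma ray_neq0 u : is_ray u -> u != 0.
Proof.
move=> [s [i ->]]; apply/eqP => E; have := cocone_ray s i i.
by rewrite E ipair0r eqxx.
Qed.

Lemma first_circuit : exists C, [/\ rays C /\ uniq C, C != [::],
  \sum_(u <- C) u = 0, p%:Z <= - \sum_(u <- C) psi u &
  forall u, u \in C -> exists s, in_star (rem u C) s].
Proof.
have [s0 _] := incone_ex 0.
have [|C [rC [C0 _] /zspan_nil sC Cj _]] := minimal_relation rays_nil isT (in_star_nil s0).
  exact: leq_trans p_gt0 p_le_n.
exists C; split=> //; last by move=> u /Cj [s [_ ?]]; exists s.
have := @star_bound_psi [::] C s0 rays_nil isT isT; rewrite sC ipair0r sub0r; apply.
  exact: zspan0.
case: (C) C0 rC => // u l _ [rC _]; exists u; first exact: mem_head.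
by move/zspan_nil; apply/eqP/ray_neq0/rC; rewrite mem_head.
Qed.

Definition circuit C := [/\ rays C /\ uniq C, \sum_(u <- C) u = 0,
  p%:Z <= - \sum_(u <- C) psi u & forall u, u \in C -> exists s, in_star (rem u C) s].

Lemma rays_rem u C : rays C -> rays (rem u C).
Proof. by move=> rC v /mem_rem /rC. Qed.

(** The lower bound compares degree and [psi >= -1]. If more than [p] rays had value -1 and some ray
    had not, removing the latter would leave more than [p] of them in one cone. *)
Lemma circuit_minus C : circuit C -> (p <= count minus C)%N /\
  ((p < count minus C)%N -> all minus C).
Proof.
move=> [[rC uC] _ dC Cs]; split.
  by have := le_trans dC (count_minus_ge rC); rewrite lez_nat.
move=> lt; apply/allP => u uC'; apply: contraT => nm.
have [s Hs] := Cs u uC'.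
have := count_minus_cone (rays_rem (u := u) rC) (rem_uniq u uC) Hs.
have := permP (perm_to_rem uC') minus; rewrite /= (negPf nm) add0n => <-.
by rewrite leqNgt lt.
Qed.

(** If exactly [p] rays have value -1, they already account for the whole sum, so that the
    nonnegative values at the other rays must be zero. *)
Lemma circuit_psi_le0 C u : circuit C -> u \in C -> psi u <= 0.
Proof.
move=> cC uC; have [ge gt] := circuit_minus cC; have [[rC _] _ dC _] := cC.
have := ge; rewrite leq_eqVlt => /predU1P [Ep|/gt /allP /(_ u uC) /eqP ->//].
have le v : v \in C -> 0 <= psi v + (minus v)%:Z.
  by move=> /rC /psi_ge; rewrite /minus; case: eqP => [->//|ne le1] /=; lia.
have : \sum_(v <- C) (psi v + (minus v)%:Z) = 0.
  apply/eqP; rewrite eq_le; apply/andP; split; last first.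
    by rewrite big_seq; apply: sumr_ge0 => v; exact: le.
  have -> : \sum_(v <- C) (psi v + (minus v)%:Z) = \sum_(v <- C) psi v + p%:Z.
    rewrite big_split /= {1}Ep; congr (_ + _).
    elim: (C) => [|v r IH]; first by rewrite big_nil.
    by rewrite big_cons IH.
  by rewrite -lerBrDr sub0r -lerN2 opprK.
rewrite (big_rem u uC) /= => E.
have ge0 : 0 <= \sum_(v <- rem u C) (psi v + (minus v)%:Z).
  by rewrite big_seq; apply: sumr_ge0 => v /mem_rem; exact: le.
move: E ge0; move: (\sum_(v <- _) _) => x E x0.
by have : 0 <= (minus u)%:Z :> int by []; lia.
Qed.

Lemma star_nspan A s u : rays A -> in_star A s -> is_ray u -> incone s u ->
  u \notin A -> ~ zspan A u.
Proof.
move=> rA As ru us uA Au.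
have := @star_independent A [:: u] s rA As; rewrite big_seq1.
move=> /(_ _ _ _ Au) H; suff : [:: u] = [::] by [].
by apply: H => [v|/=|v]; rewrite ?inE ?us// => /eqP ->.
Qed.

Lemma circuit_shift C (i1 : vec) (c : vec -> int) : circuit C -> i1 \in C ->
  \sum_(a <- C) c a *: a = \sum_(a <- rem i1 C) (c a - c i1) *: a.
Proof.
move=> [_ C0 _ _] iC.
have -> : \sum_(a <- C) c a *: a = \sum_(a <- C) (c a - c i1) *: a.
  under [RHS]eq_bigr do rewrite scalerBl.
  by rewrite sumrB -scaler_sumr C0 scaler0 subr0.
by rewrite (big_rem i1)//= subrr scale0r add0r.
Qed.

Lemma argmin_seq (c : vec -> int) C : C != [::] ->
  exists2 i1 : vec, i1 \in C & forall a, a \in C -> c i1 <= c a.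
Proof.
elim: C => [//|x [|y l] IH] _.
  by exists x => [|a]; rewrite ?mem_head// inE => /eqP ->.
have [//|i1 il Hi] := IH; have [le|lt] := leP (c x) (c i1).
  exists x => [|a]; first exact: mem_head.
  by rewrite inE => /predU1P [->//|/Hi]; exact: le_trans.
exists i1 => [|a]; first by rewrite inE il orbT.
by rewrite inE => /predU1P [->|/Hi//]; exact: ltW.
Qed.

Lemma zspan_remE C (i1 : vec) z : circuit C -> i1 \in C -> zspan (rem i1 C) z -> zspan C z.
Proof.
move=> [[_ uC] _ _ _] iC [c ->]; rewrite big_seq; apply: zspan_sum => a aC.
by apply: zspanZ; apply: zspan_mem => //; exact: mem_rem aC.
Qed.

Lemma zspan_Erem C (i1 : vec) z : circuit C -> i1 \in C -> zspan C z -> zspan (rem i1 C) z.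
Proof.
move=> cC iC [c ->]; rewrite (circuit_shift _ cC iC).
by exists (fun a => c a - c i1).
Qed.

Lemma circuit_neq_nil C : circuit C -> C != [::].
Proof.
by move=> [_ _ dC _]; apply: contraTneq dC => ->; rewrite big_nil oppr0; lia.
Qed.

(** Subtracting the least coefficient [c i1] with the help of the relation of [C] makes all
    coefficients nonnegative and removes [i1]. The rest of [C] lies in one cone, where
    [star_bound_psi] can be evaluated through [psi]. *)
Lemma relation_over_circuit C (i0 : vec) s0 r : circuit C -> i0 \in C -> in_star (rem i0 C) s0 ->
  zspan (rem i0 C) (\sum_(u <- r) u) -> (exists2 u, u \in r & ~ zspan (rem i0 C) u) ->
  exists (i1 : vec) (c : vec -> int), [/\ i1 \in C, forall a, a \in C -> 0 <= c a,
    \sum_(u <- r) u = \sum_(a <- rem i1 C) c a *: a &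
    p%:Z - \sum_(a <- rem i1 C) c a * psi a <= - \sum_(u <- r) psi u].
Proof.
move=> cC i0C As0 Az [u ur nu]; have [[rC uC] C0 dC Cs] := cC.
have [c Ec] := zspan_remE cC i0C Az.
have [i1 i1C Hi1] := argmin_seq c (circuit_neq_nil cC).
exists i1, (fun a => c a - c i1).
have Ez : \sum_(u <- r) u = \sum_(a <- rem i1 C) (c a - c i1) *: a.
  by rewrite Ec; exact: circuit_shift.
split=> // [a /Hi1|]; first by rewrite subr_ge0.
have [s As] := Cs i1 i1C.
have := @star_bound_psi (rem i1 C) r s (rays_rem rC) (rem_uniq i1 uC) As.
rewrite {2}Ez ipair_sumr.
have -> : \sum_(a <- rem i1 C) ipair (Y s) ((c a - c i1) *: a) =
    \sum_(a <- rem i1 C) (c a - c i1) * psi a.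
  rewrite big_seq [RHS]big_seq; apply: eq_bigr => a aC.
  by rewrite ipairZr (psi_in (allP As a aC)).
move=> H; rewrite lerBlDl; apply: H.
  by rewrite Ez; exists (fun a => c a - c i1).
by exists u => // /(zspan_remE cC i1C) /(zspan_Erem cC i0C).
Qed.

Definition quadric_fan e1 e2 :=
  [/\ p = 2%N, rays [:: e1; - e1; e2; - e2] /\ all minus [:: e1; - e1; e2; - e2],
    exists s, in_star [:: e1; e2] s, exists s, in_star [:: e1; - e2] s &
    (exists s, in_star [:: - e1; e2] s) /\ (exists s, in_star [:: - e1; - e2] s)].

(** A circuit with at most [n] rays leaves room for a relation [r] modulo the cone on [A], which is
    [C] without [i0]. Both [C] and [r] contain at least [p] rays of value -1, whereas [A] together
    with [r] minus one ray lies in a cone and contains at most [p]. This competition fixes all the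
    sizes, and the form [w] excludes the remaining possibilities. *)
Lemma second_circuit C : circuit C -> (size C <= n)%N -> exists e1 e2, quadric_fan e1 e2.
Proof.
move=> cC sC; have [[rC uC] C0 dC Cs] := cC.
case EC: C (circuit_neq_nil cC) => [//|i0 A] _.
have remE : rem i0 C = A by rewrite EC /= eqxx.
have i0C : i0 \in C by rewrite EC mem_head.
have [s0] := Cs i0 i0C; rewrite remE => As0.
have rA : rays A by rewrite -remE; exact: rays_rem.
have uA : uniq A by rewrite -remE; exact: rem_uniq.
have i0A : i0 \notin A by move: uC; rewrite EC => /andP [].
have Ei0 : i0 = - \sum_(a <- A) a.
  by apply/eqP; rewrite -addr_eq0; move: C0; rewrite EC big_cons => ->.
have sA : (size A < n)%N by rewrite EC in sC.
have [r [[rr ur] [r0 rst] Az rj rn]] := minimal_relation rA uA As0 sA.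
have rA' u : u \in r -> u \notin A by case/rst.
have nsp u : u \in r -> ~ zspan A u.
  move=> ur'; have [uA' [s [As us]]] := rst u ur'.
  exact: (star_nspan rA As (rr u ur')).
have sr2 : (1 < size r)%N.
  case: r r0 rst rn {rj rr ur Az rA' nsp} => [//|x [|//]] _ H /=.
  have [_ [s [As xs]]] := H x (mem_head _ _) => /(_ s As).
  by rewrite xs.
have [u0 u0r] : exists u, u \in r by case: (r) r0 => // u l _; exists u; rewrite mem_head.
have [i1 [c [i1C c0 Ez bnd]]] : exists (i1 : vec) (c : vec -> int), [/\ i1 \in C, forall a, a \in C -> 0 <= c a,
    \sum_(u <- r) u = \sum_(a <- rem i1 C) c a *: a &
    p%:Z - \sum_(a <- rem i1 C) c a * psi a <= - \sum_(u <- r) psi u].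
  apply: (relation_over_circuit cC i0C (s0 := s0)); rewrite remE//.
  by exists u0 => //; exact: nsp.
have le0 : \sum_(a <- rem i1 C) c a * psi a <= 0.
  rewrite big_seq; apply: sumr_le0 => a /mem_rem aC.
  by rewrite mulr_ge0_le0// ?c0//; exact: circuit_psi_le0 aC.
have cr : (p <= count minus r)%N.
  rewrite -lez_nat; apply: le_trans (count_minus_ge rr); apply: le_trans bnd.
  by rewrite lerBrDr gerDl.
have cone (j : vec) : j \in r -> exists s, in_star (A ++ rem j r) s.
  by move=> /rj [s [As rs]]; exists s; rewrite /in_star all_cat; apply/andP.
have cnt (j : vec) : j \in r -> (count minus A + count minus (rem j r) <= p)%N.
  move=> jr; have [s Hs] := cone j jr; rewrite -count_cat; apply: count_minus_cone Hs.
    by move=> u; rewrite mem_cat => /orP [/rA//|/mem_rem /rr].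
  rewrite cat_uniq uA rem_uniq// andbT; apply/hasPn => u /mem_rem; exact: rA'.
have [ge _] := circuit_minus cC.
have cC' : count minus C = (minus i0 + count minus A)%N by rewrite EC.
have other u : exists j : vec, j \in r /\ j != u.
  apply: contrapT => /forallNP H.
  have all_u (j : vec) : j \in r -> j = u.
    by move=> jr; apply/eqP; apply: contraT => ju; case: (H j).
  move: sr2 ur all_u; case: (r) => [//|x [//|y l]] _ /= /andP [xl _] all_u.
  have xu := all_u x (mem_head _ _).
  have yu : y = u by apply: all_u; rewrite !inE eqxx orbT.
  by move: xl; rewrite xu yu inE eqxx.
have [rho rhor mrho] : exists2 u, u \in r & minus u.
  by apply/hasP; rewrite has_count; exact: leq_trans cr.
have [j [jr jrho]] := other rho.
have rhoj : rho \in rem j r by rewrite mem_rem_uniq// inE eq_sym jrho.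
have cj : (0 < count minus (rem j r))%N by rewrite -has_count; apply/hasP; exists rho.
(* Some ray of value -1 survives in [r] without [j], so [A] has at most [p - 1] of them, and the
   circuit needs [i0] to reach [p]. *)
have mi0 : minus i0.
  by move: (cnt j jr) cj ge; rewrite cC'; case: (minus i0) => //; clear; lia.
have cA : count minus A = p.-1.
  by move: (cnt j jr) cj ge; rewrite cC' mi0; clear; lia.
have [s Hs] := cone j jr.
have As : in_star A s by move: Hs; rewrite /in_star all_cat => /andP [].
have rhos : incone s rho.
  by move: Hs; rewrite /in_star all_cat => /andP [_ /allP]; apply.
have [m0 wm0] := w_neq0; have [f [wf _]] := w_basis s wm0.
have [l2 El2] := minus_row wf (rr rho rhor) rhos mrho.
have ri0 : is_ray i0 by exact: rC.
have psi0 : psi i0 = -1 by exact/eqP.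
have pairA (x : vec) : ipair x i0 = - \sum_(a <- A) ipair x a.
  by rewrite {1}Ei0 ipairNr ipair_sumr.
have cocA i : ray s i \notin A -> forall a, a \in A -> ipair (cocone s i) a = 0.
  move=> iA a aA; have [i' Ei'] := ray_row (rA a aA) (allP As a aA).
  by rewrite Ei' cocone_ray; case: eqP => // E; rewrite E -Ei' aA in iA.
have rhoA : ray s (f l2) \notin A by rewrite -El2 rA'.
(* With a single slot the basis vector must be the one dual to [rho]. It is orthogonal to [A], hence
   to [i0], which also has value -1. *)
have p_neq1 : p != 1%N.
  apply/eqP => p1; case/eqP: wf; apply: (w_vanish ri0 psi0) => l.
  have -> : l = l2 by apply: val_inj; move: (ltn_ord l) (ltn_ord l2) p1; clear=> /=; lia.
  by rewrite pairA big_seq big1 ?oppr0// => a aA; exact: cocA.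
have allm : all minus r.
  apply/allP => u ur'; apply: contraT => nm.
  have := cnt u ur'; have := permP (perm_to_rem ur') minus; rewrite /= (negPf nm) add0n => <-.
  by rewrite cA; move: cr p_neq1 p_gt0; clear; lia.
(* The count in the cone gives [(size r - 1) + (p - 1) <= p], so [r] has two members, and [p] lies
   between 2 and [size r]. *)
have sr : size r = 2%N /\ p = 2%N.
  have := cnt j jr; have : count minus (rem j r) = (size r).-1.
    rewrite -(size_rem jr); apply/eqP; rewrite -all_count; apply/allP => u /mem_rem.
    exact: (allP allm).
  move=> ->; rewrite cA; move: cr sr2 p_neq1 p_gt0; rewrite (eqP (_ : count minus r == size r)).
    by clear; lia.
  by rewrite -all_count.
have {sr} [sr p2] := sr.
have {cA} cA : count minus A = 1%N by rewrite cA p2.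
have [a aA ma] : exists2 a, a \in A & minus a.
  by apply/hasP; rewrite has_count cA.
have [l1 El1] := minus_row wf (rA a aA) (allP As a aA) ma.
have l12 : l1 != l2.
  by apply: contraTneq aA => E; rewrite El1 E.
have lcase l : l = l1 \/ l = l2.
  have [->|n1] := eqVneq l l1; [by left|right]; apply: val_inj.
  move: n1 l12 (ltn_ord l) (ltn_ord l1) (ltn_ord l2) p2; rewrite -!val_eqE /=.
  by clear; lia.
have Aa : A = [:: a].
  have all_a a' : a' \in A -> a' = a.
    move=> a'A; apply/eqP; apply: contraT => a'a.
    have [i' Ei'] := ray_row (rA a' a'A) (allP As a' a'A).
    have i'l : i' != f l1 by apply: contraNneq a'a => E; rewrite Ei' El1 E.
    (* Subtracting the vector dual to [a'] in the slot of [a] makes the tuple orthogonal to [i0],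
       the opposite of the sum of [A]. The value of [w] is unchanged, because the subtracted tuple
       is orthogonal to the ray [a] of value -1. So [w] would vanish. *)
    pose m := put (fun j : 'I_p => cocone s (f j)) l1 (cocone s (f l1) - cocone s i').
    have wm : w m = w (fun j : 'I_p => cocone s (f j)).
      rewrite /m w_add w_slotN.
      have -> : put (fun j : 'I_p => cocone s (f j)) l1 (cocone s (f l1)) = (fun j : 'I_p => cocone s (f j)).
        by apply/funext => l; rewrite /put; case: eqP => [->|].
      rewrite (_ : w (put _ _ (cocone s i')) = 0) ?subr0//.
      apply: (w_vanish (rA a aA) (eqP ma)) => l; rewrite /put El1.
      case: eqP => [_|ne]; first by rewrite cocone_ray (negPf i'l).
      have [//|->] := lcase l.
      by rewrite -El1; apply: cocA.
    case/eqP: wf; rewrite -wm; apply: (w_vanish ri0 psi0) => l.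
    rewrite pairA /m /put; case: eqP => [_|ne]; last first.
      have [//|->] := lcase l; rewrite big_seq big1 ?oppr0// => b bA; exact: cocA.
    under eq_bigr do rewrite ipairBl.
    have sumE b i : b \in A -> b = ray s i -> \sum_(x <- A) ipair (cocone s i) x = 1.
      move=> bA Eb; rewrite (big_rem b)//= Eb cocone_ray eqxx -Eb big_seq big1 ?addr0// => x.
      rewrite mem_rem_uniq// inE => /andP [xb xA].
      have [ix Ex] := ray_row (rA x xA) (allP As x xA).
      by rewrite Ex cocone_ray; case: eqP => // E; rewrite Ex -E -Eb eqxx in xb.
    by rewrite sumrB (sumE a _ aA El1) (sumE a' _ a'A Ei') subrr oppr0.
  case: (A) uA aA all_a => [//|x [|y l]] /= uA' _ H.
    by rewrite (H x) ?mem_head.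
  have xa := H x (mem_head _ _).
  have ya : y = a by apply: H; rewrite !inE eqxx orbT.
  by move: uA'; rewrite xa ya inE eqxx.
move: Ei0; rewrite Aa big_seq1 => Ei0.
have minusE u : minus u -> psi u = -1 by move/eqP.
(* The degree of [r] is 2 and is at least [2 + c b] for the remaining ray [b] of the circuit, whose
   value is -1; hence [c b = 0]. *)
have z0 : \sum_(u <- r) u = 0.
  have sumr : \sum_(u <- r) psi u = - 2%:Z.
    case: (r) sr allm => [//|x [//|y []]]//= _ /and3P [/eqP mx /eqP my _].
    by rewrite !big_cons big_nil mx my.
  have [b Eb [bC mb]] : exists2 b, rem i1 C = [:: b] & b \in C /\ minus b.
    move: i1C; rewrite EC Aa !inE => /orP [] /eqP ->.
      by exists a; rewrite /= ?eqxx// !inE eqxx orbT.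
    exists i0; rewrite ?mem_head//= eqxx.
    by case: eqP => // E; rewrite E Aa mem_head in i0A.
  move: bnd; rewrite Ez Eb !big_seq1 sumr p2 (minusE b mb) => le.
  have -> : c b = 0; last by rewrite scale0r.
  by move: (c0 b bC) le; clear; lia.
have [rho' Er] : exists rho', perm_eq r [:: rho; rho'].
  case: (r) sr rhor => [//|x [//|y []]]//= _; rewrite !inE => /orP [] /eqP ->.
    by exists y.
  by exists x; rewrite -(perm_rev [:: x; y]).
have Erho : rho' = - rho.
  move: z0; rewrite (perm_big _ Er) /= big_cons big_seq1 => /eqP.
  by rewrite addrC addr_eq0 => /eqP.
have rho'r : rho' \in r by rewrite (perm_mem Er) !inE eqxx orbT.
exists a, rho; split=> //.
- split.
    move=> u; rewrite !inE -Ei0 -Erho => /or4P [] /eqP ->; [exact: rA|by []|exact: rr|exact: rr].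
  by rewrite -Ei0 -Erho /= ma mi0 mrho (allP allm rho' rho'r).
- by exists s; rewrite /in_star /= (allP As a aA) rhos.
- have [t [At rt]] := rj rho rhor; exists t; rewrite /in_star /= (allP At a aA) -Erho.
  have rr' : rho' != rho by move: ur; rewrite (perm_uniq Er) /= inE andbT eq_sym.
  by rewrite (allP rt)// mem_rem_uniq// inE rr'.
- rewrite -Ei0.
  have aC : a \in C by rewrite EC Aa !inE eqxx orbT.
  have [t0 Ht0] := Cs a aC.
  have Era : rem a C = [:: i0].
    rewrite EC Aa /= eqxx; case: eqP => // E.
    by rewrite E Aa mem_head in i0A.
  rewrite Era in Ht0.
  have r0s : rays [:: i0] by move=> u; rewrite inE => /eqP ->.
  (* The inequality in the star of [i0]: the two terms are at most 1 each and add up to at least 2.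
     Equality puts [rho] and [rho'] into cones containing [i0]. *)
  have [||t Ht le] := @star_bound [:: i0] r t0 r0s isT Ht0.
  + by rewrite z0; exact: zspan0.
  + exists rho => // Hs0; apply: (nsp rho rhor).
    by rewrite -remE; apply: zspan_Erem => //; apply: (zspan_remE (i1 := a)) => //; rewrite ?Era.
  move: le; rewrite sumrB -ipair_sumr z0 ipair0r sub0r (perm_big _ Er) /= big_cons big_seq1 p2 => le.
  have g1 := psi_le (t rho) rho; have g2 := psi_le (t rho') rho'.
  rewrite (minusE _ mrho) in g1; rewrite (minusE _ (allP allm rho' rho'r)) in g2.
  split.
    exists (t rho); rewrite /in_star /=; have /andP [-> _] := Ht rho.
    by rewrite andbT; apply: psi_eq_in; [exact: rr|rewrite (minusE _ mrho); move: le g1 g2; clear; lia].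
  exists (t rho'); rewrite /in_star /= -Erho; have /andP [-> _] := Ht rho'.
  by rewrite andbT; apply: psi_eq_in; [exact: rr|rewrite (minusE _ (allP allm rho' rho'r)); move: le g1 g2; clear; lia].
Qed.

Lemma star_size r s : rays r -> uniq r -> in_star r s -> (size r <= n)%N.
Proof.
move=> rr ur rs; rewrite -[X in (_ <= X)%N]size_enum_ord -(size_map (ray s)).
apply: uniq_leq_size => // u ur'.
have [i ->] := ray_row (rr u ur') (allP rs u ur').
by apply: map_f; rewrite mem_enum.
Qed.

Lemma zspan2 a b z : a != b -> zspan [:: a; b] z -> exists c d : int, z = c *: a + d *: b.
Proof. by move=> _ [c ->]; rewrite big_cons big_seq1; exists (c a), (c b). Qed.

Lemma zspan2I a b c d : a != b -> zspan [:: a; b] (c *: a + d *: b).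
Proof.
move=> ab; have u : uniq [:: a; b] by rewrite /= inE ab.
by apply: zspanD; apply: zspanZ; apply: zspan_mem => //; rewrite !inE eqxx ?orbT.
Qed.

Lemma cone_opp a s : is_ray a -> incone s a -> incone s (- a) -> False.
Proof.
move=> ra sa /forallP sa'; have [i Ei] := ray_row ra sa.
by have := sa' i; rewrite ipairNr Ei cocone_ray eqxx.
Qed.

Definition flip (b : bool) u : vec := if b then u else - u.

Lemma flipZ c u : c *: u = `|c| *: flip (0 <= c) u.
Proof.
rewrite /flip; case: ifP => [c0|/negbT]; first by rewrite ger0_norm.
by rewrite -ltNge => c0; rewrite ltr0_norm// scalerN scaleNr opprK.
Qed.

Lemma zspan_flip a b x y z : flip x a != flip y b -> a != b ->
  zspan [:: flip x a; flip y b] z -> zspan [:: a; b] z.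
Proof.
move=> xy ab /(zspan2 xy) [c [d ->]].
have E q e u : q *: flip e u = (if e then q else - q) *: u.
  by case: e => //=; rewrite scalerN scaleNr.
by rewrite !E; exact: zspan2I.
Qed.

(** In dimension at least 3 there would be a relation modulo the plane of [e1] and [e2]. It contains
    a ray of value -1 that shares a cone with [e1] and [e2], three such rays while [p = 2]. *)
Lemma quadric_dim e1 e2 : quadric_fan e1 e2 -> (n <= 2)%N.
Proof.
move=> [p2 [rE mE] [s12 c12] [s13 c13] [[s21 c21] [s23 c23]]].
rewrite leqNgt; apply/negP => n3.
have r1 b : is_ray (flip b e1) by apply: rE; case: b; rewrite !inE eqxx ?orbT.
have r2 b : is_ray (flip b e2) by apply: rE; case: b; rewrite !inE eqxx ?orbT.
have m1 b : minus (flip b e1) by apply: (allP mE); case: b; rewrite !inE eqxx ?orbT.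
have m2 b : minus (flip b e2) by apply: (allP mE); case: b; rewrite !inE eqxx ?orbT.
have cones b c : exists s, in_star [:: flip b e1; flip c e2] s.
  by case: b; case: c; [exists s12|exists s13|exists s21|exists s23].
have neq b c : flip b e1 != flip c e2.
  apply/eqP => E; have [s /and3P [sa sb _]] := cones b (~~ c).
  apply: (cone_opp (r1 b) sa); rewrite E.
  by case: (c) sb => //=; rewrite opprK.
have uniq2 b c : uniq [:: flip b e1; flip c e2] by rewrite /= inE neq.
have rays2 b c : rays [:: flip b e1; flip c e2] by move=> u; rewrite !inE => /orP [] /eqP ->.
have [|r [[rr ur] [r0 rst] Az rj rn]] := minimal_relation (rays2 true true) (uniq2 true true) c12.
  exact: n3.
have [u0 u0r] : exists u, u \in r by case: (r) r0 => // u l _; exists u; rewrite mem_head.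
have nsp : ~ zspan [:: e1; e2] u0.
  have [uA [s [As us]]] := rst u0 u0r.
  exact: (star_nspan (rays2 true true) As (rr u0 u0r)).
have [c [d Ez]] := zspan2 (neq true true) Az.
(* The signs are chosen so that the sum of the relation lies in the cone of these two rays; there
   [psi] of the sum is nonpositive and only strengthens the bound. *)
have [s As] := cones (0 <= c) (0 <= d).
have Ez' : \sum_(u <- r) u = `|c| *: flip (0 <= c) e1 + `|d| *: flip (0 <= d) e2.
  by rewrite -!flipZ.
have := star_bound_psi (rays2 _ _) (uniq2 _ _) As (_ : zspan _ (\sum_(u <- r) u)).
rewrite Ez' => /(_ (zspan2I _ _ (neq _ _))) bnd.
have {bnd} bnd : 2%:Z <= - \sum_(u <- r) psi u.
  move: As => /and3P [sa sb _]; move: bnd; rewrite ipairDr !ipairZr -!psi_in//.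
  rewrite (eqP (m1 _)) (eqP (m2 _)) p2 => bnd.
  apply: le_trans (bnd _) _; last by rewrite gerDr !mulrN1 -opprD oppr_le0 addr_ge0.
  by exists u0 => //; move/(zspan_flip (neq _ _) (neq true true)).
have cr : (2 <= count minus r)%N.
  by rewrite -lez_nat; exact: le_trans bnd (count_minus_ge rr).
have [v vr mv] : exists2 u, u \in r & minus u by apply/hasP; rewrite has_count ltnW.
have [j jr jv] : exists2 j : vec, j \in r & j != v.
  apply: contrapT => H.
  have all_v (j : vec) : j \in r -> j = v.
    by move=> jr; apply/eqP; apply: contraT => jv; case: H; exists j.
  have : (size r <= 1)%N by rewrite (uniq_leq_size (s2 := [:: v]))// => u /all_v ->; rewrite inE.
  by rewrite leqNgt; move: (leq_trans cr (count_size minus r)) => ->.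
have [t [At rt]] := rj j jr.
have vA : v \notin [:: e1; e2] by case: (rst v vr).
have : (count minus [:: v; e1; e2] <= p)%N.
  apply: (count_minus_cone (s := t)).
  - by move=> u; rewrite inE => /predU1P [->|/(rays2 true true)//]; exact: rr.
  - by rewrite cons_uniq vA (uniq2 true true).
  - by rewrite /in_star /= (allP rt) ?mem_rem_uniq ?inE 1?eq_sym ?jv// -[_ && _]/(in_star [:: e1; e2] t) At.
by rewrite /= mv (m1 true) (m2 true) p2.
Qed.

Lemma Y_sum_mod s (r : seq vec) : exists D, \sum_(u <- r) psi u = ipair (Y s) (\sum_(u <- r) u) + p%:Z * D.
Proof.
elim: r => [|u r [D ED]]; first by exists 0; rewrite !big_nil ipair0r mulr0.
have [t tu] := incone_ex u; have [D' ED'] := Y_mod t s.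
exists (ipair D' u + D); rewrite !big_cons ED ipairDr (psi_in tu) mulrDr.
have -> : ipair (Y t) u = ipair (Y s) u + p%:Z * ipair D' u.
  by rewrite -ipairZl -ED' ipairBl addrC subrK.
by rewrite addrACA.
Qed.

(** For a circuit of [n + 1] rays the degree is a multiple of [p], and it equals [p] unless all rays
    have value -1. *)
Theorem fan_classification :
  (exists C, [/\ circuit C, size C = n.+1 &
     - \sum_(u <- C) psi u = p%:Z \/ [/\ p = 1%N, n = 1%N & - \sum_(u <- C) psi u = 2%:Z]]) \/
  (n = 2%N /\ exists e1 e2, quadric_fan e1 e2).
Proof.
have [C [[rC uC] C0 sumC dC Cs]] := first_circuit.
have cC : circuit C by [].
have [u uC'] : exists u, u \in C by case: (C) C0 => // u l _; exists u; rewrite mem_head.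
have [s Hs] := Cs u uC'.
have szle : (size C <= n.+1)%N.
  have := star_size (rays_rem rC) (rem_uniq u uC) Hs; rewrite size_rem//.
  by case: (size C).
have [le|gt] := leqP (size C) n.
  right; have [e1 [e2 q]] := second_circuit cC le.
  split; last by exists e1, e2.
  have [p2 _ _ _ _] := q; have := quadric_dim q; move: p_le_n p2; clear; lia.
left; exists C; have sz : size C = n.+1 by apply/eqP; rewrite eqn_leq szle.
split=> //; have [D] := Y_sum_mod s C; rewrite sumC ipair0r add0r => ED.
have [ge gt'] := circuit_minus cC.
have le := count_minus_ge rC.
have [E|lt] := leqP (count minus C) p.
  by left; move: le dC E; rewrite ED; clear; lia.
right; have {}lt := gt' lt.
have Ec : - \sum_(u <- C) psi u = n.+1%:Z.
  rewrite -sz; elim: (C) lt => [|x l IH] /=; first by rewrite big_nil.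
  by move=> /andP [/eqP mx /IH E]; rewrite big_cons mx opprD opprK E.
have pn : p = n.
  have := count_minus_cone (rays_rem (u := u) rC) (rem_uniq u uC) Hs.
  have -> : count minus (rem u C) = n.
    have : all minus (rem u C) by apply/allP => v /mem_rem /(allP lt).
    by rewrite all_count => /eqP ->; rewrite size_rem// sz.
  by move: p_le_n; clear; lia.
(* All rays have value -1, so the degree is [n + 1]; removing one ray leaves [n <= p] of them in a
   cone. Thus [n = p] divides [n + 1]. *)
have Dm : n.+1%:Z = n%:Z * - D by rewrite -Ec ED mulrN pn.
have n1 : n = 1%N.
  have : (n %| n.+1)%N.
    apply/dvdnP; exists `|D|%N; have := congr1 absz Dm; rewrite abszM abszN mulnC; exact.
  by rewrite -addn1 dvdn_addr// dvdn1 => /eqP.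
by split=> //; [rewrite pn|rewrite Ec n1].
Qed.

End Combinatorics.

(** * Charts of a toric variety *)

Section RegularMaps.
Variable k : fieldType.

Lemma regular_gen_alg (X : kspace k) (T : Type) (G : set (T -> k)) (f : X -> T)
    (U : set X) (h : T -> k) : open U -> (forall g, G g -> regular X U (g \o f)) ->
  gen_alg G h -> regular X U (h \o f).
Proof.
move=> oU HG; elim=> {h}[h /HG//|c|g h _ rg _ rh|g h _ rg _ rh].
- exact: regular_cst.
- exact: (regularD oU rg rh).
- exact: (regularM oU rg rh).
Qed.

Lemma gen_algX (T : Type) (G : set (T -> k)) f (e : nat) : gen_alg G f ->
  gen_alg G (fun t => f t ^+ e).
Proof.
move=> Gf; elim: e => [|e IH].
  by under eq_fun do rewrite expr0; exact: gen_alg_cst.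
by under eq_fun do rewrite exprS; exact: gen_algM.
Qed.

Lemma gen_alg_prod (T : Type) (G : set (T -> k)) (J : Type) (r : seq J) (F : J -> T -> k) :
  (forall j, gen_alg G (F j)) -> gen_alg G (fun t => \prod_(j <- r) F j t).
Proof.
move=> GF; elim: r => [|j r IH].
  by under eq_fun do rewrite big_nil; exact: gen_alg_cst.
by under eq_fun do rewrite big_cons; exact: gen_algM.
Qed.

Lemma regular_div (X : kspace k) (U : set X) (f g : X -> k) : open U ->
  regular X U f -> regular X U g -> (forall x, U x -> g x != 0) ->
  regular X U (fun x => f x / g x).
Proof. by move=> oU rf rg g0; apply: (regularM oU rf); exact: regularV. Qed.

Lemma regularX (X : kspace k) (U : set X) (f : X -> k) (e : nat) : open U ->
  regular X U f -> regular X U (fun x => f x ^+ e).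
Proof.
move=> oU rf; elim: e => [|e IH]; first exact: regular_cst.
rewrite (_ : (fun x => _) = (fun x => f x * f x ^+ e)); first exact: (regularM oU rf IH).
by apply/funext => x; rewrite exprS.
Qed.

Lemma regular_prod (X : kspace k) (U : set X) (J : Type) (r : seq J) (F : J -> X -> k) :
  open U -> (forall j, regular X U (F j)) ->
  regular X U (fun x => \prod_(j <- r) F j x).
Proof.
move=> oU rF; elim: r => [|j r IH].
  by under eq_fun do rewrite big_nil; exact: regular_cst.
by under eq_fun do rewrite big_cons; exact: (regularM oU (rF j) IH).
Qed.

(** Stated over an open set [U] because inverse charts are total functions with meaningless values
    outside their chart. *)
Lemma affine_pull (X : kspace k) (T : Type) (G : set (T -> k))
    (f : X -> affine_space G) (U : set X) : open U ->
  (forall g, G g -> regular X U (g \o f)) -> forall W : set (affine_space G), open W ->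
  open (U `&` f @^-1` W) /\
  (forall h, regular (affine_space G) W h -> regular X (U `&` f @^-1` W) (h \o f)).
Proof.
move=> oU HG W oW; have rA := regular_gen_alg oU HG.
have oUW : open (U `&` f @^-1` W).
  rewrite (_ : _ `&` _ = \bigcup_(b in [set b | gen_alg G b /\ forall y, b y != 0 -> W y])
      (U `&` [set x | (b \o f) x != 0])).
    by apply: bigcup_open => b [Gb _]; apply: open_regular_neq0 => //; exact: rA.
  apply/seteqP; split=> x.
    move=> [Ux Wx]; have [_ [b [Gb _ bx sb]]] := oW _ Wx.
    by exists b => //; split=> // y; exact: sb.
  by move=> [b [Gb sb] [Ux bx]]; split=> //; exact: sb.
split=> // h rh; apply: regular_local => // x [Ux Wx].
have [_ [a [b [Ga Gb _ bx E]]]] := rh _ Wx.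
have oV : open ((U `&` f @^-1` W) `&` (U `&` [set x | (b \o f) x != 0])).
  by apply: openI => //; apply: open_regular_neq0 => //; exact: rA.
exists ((U `&` f @^-1` W) `&` (U `&` [set x | (b \o f) x != 0])); split=> //.
apply: (@regular_ext _ _ _ (fun x => (a \o f) x / (b \o f) x)).
  by move=> y; rewrite inE => -[[_ Wy] [_ by0]]; rewrite /= E.
apply: regular_div => //.
- by apply: regular_sub (rA a Ga) => // y [[]].
- by apply: regular_sub (rA b Gb) => // y [[]].
- by move=> y [_ []].
Qed.

(** A property of a plain function, so that a map can be defined by choice, shown to be a morphism
    locally, and bundled at the end. *)
Definition is_morph (X Y : kspace k) (f : X -> Y) :=
  forall V : set Y, open V -> open (f @^-1` V) /\
    forall h, regular Y V h -> regular X (f @^-1` V) (h \o f).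

Lemma is_morphP (X Y : kspace k) (f : X -> Y) : is_morph f ->
  exists F : morph X Y, mfun F = f.
Proof.
move=> mf; have cf : continuous f by apply/continuousP => V /mf [].
have rf (V : set Y) h : open V -> regular Y V h -> regular X (f @^-1` V) (h \o f).
  by move=> /mf [_]; apply.
by exists (Morph cf rf).
Qed.

Lemma morph_is_morph (X Y : kspace k) (f : morph X Y) : is_morph f.
Proof.
move=> V oV; split=> [|h]; last exact: morph_regular.
by have /continuousP := @morph_continuous _ _ _ f; apply.
Qed.

Lemma is_morph_comp (X Y Z : kspace k) (f : X -> Y) (g : Y -> Z) :
  is_morph f -> is_morph g -> is_morph (g \o f).
Proof.
move=> mf mg V oV; have [oW rW] := mg V oV; have [oU rU] := mf _ oW.
by split=> // h /rW /rU.
Qed.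

Lemma is_morph_local (X Y : kspace k) (f : X -> Y) :
  (forall x, exists U : set X, [/\ open U, U x & forall V, open V ->
     open (U `&` f @^-1` V) /\
     forall h, regular Y V h -> regular X (U `&` f @^-1` V) (h \o f)]) ->
  is_morph f.
Proof.
move=> H V oV; have oW : open (f @^-1` V).
  have /choice [U HU] := H.
  rewrite (_ : _ @^-1` _ = \bigcup_(x in setT) (U x `&` f @^-1` V)).
    by apply: bigcup_open => x _; have [_ _ /(_ V oV) []] := HU x.
  apply/seteqP; split=> x; last by move=> [y _ []].
  by move=> Vx; exists x => //; split=> //; have [] := HU x.
split=> // h rh; apply: regular_local => // x Vx.
have [U [oU Ux /(_ V oV) [oUV /(_ h rh) r]]] := H x.
by exists (U `&` f @^-1` V); split=> // y [].
Qed.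

Lemma is_morph_affine (X : kspace k) (T : Type) (G : set (T -> k))
    (f : X -> affine_space G) :
  (forall g, G g -> regular X setT (g \o f)) -> is_morph f.
Proof.
move=> HG V oV; have [] := affine_pull openT HG oV.
by rewrite setTI.
Qed.

Lemma affine_regular_gen (T : Type) (G : set (T -> k)) (W : set (affine_space G)) h :
  gen_alg G h -> regular (affine_space G) W h.
Proof.
move=> Gh; rewrite frac_space_regular => x _; exists tt, h, (fun=> 1).
split=> //; [exact: gen_alg_cst|exact: oner_neq0|].
by move=> y _ _ _; rewrite divr1.
Qed.

Lemma is_morph_inj (I T : Type) (C : I -> kspace k) (j : forall i, C i -> T) i :
  is_morph (j i : C i -> glue_space j).
Proof. by move=> V oV; split=> [|h]; [exact: oV|exact]. Qed.

End RegularMaps.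

Section Cones.
Variable n : nat.
Implicit Types (sigma tau : set 'rV[rat]_n) (m : 'rV[int]_n).

Lemma toQD m m' : toQ (m + m') = toQ m + toQ m'.
Proof. by apply/rowP => i; rewrite !mxE rmorphD. Qed.

Lemma toQ0 : toQ 0 = 0 :> 'rV[rat]_n.
Proof. by apply/rowP => i; rewrite !mxE. Qed.

Lemma toQN m : toQ (- m) = - toQ m.
Proof. by apply/rowP => i; rewrite !mxE rmorphN. Qed.

Lemma toQMn m e : toQ (m *+ e) = e%:R *: toQ m.
Proof.
elim: e => [|e IH]; first by rewrite mulr0n toQ0 scale0r.
by rewrite mulrS toQD IH mulrS scalerDl scale1r.
Qed.

Lemma dual_monoid0 sigma : dual_monoid sigma 0.
Proof. by move=> u _; rewrite toQ0 pairing0l. Qed.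

Lemma dual_monoidD sigma m m' :
  dual_monoid sigma m -> dual_monoid sigma m' -> dual_monoid sigma (m + m').
Proof. by move=> Hm Hm' u su; rewrite toQD pairingDl addr_ge0; [|exact: Hm|exact: Hm']. Qed.

Lemma dual_monoidMn sigma m e : dual_monoid sigma m -> dual_monoid sigma (m *+ e).
Proof.
move=> Hm; elim: e => [|e IH]; first by rewrite mulr0n; exact: dual_monoid0.
by rewrite mulrS; exact: dual_monoidD.
Qed.

Lemma dual_monoidS sigma tau m : tau `<=` sigma -> dual_monoid sigma m -> dual_monoid tau m.
Proof. by move=> st Hm u /st; exact: Hm. Qed.

Definition cut sigma m := sigma `&` [set u | pairing (toQ m) u = 0].

Lemma face_cut sigma tau : is_face tau sigma -> exists2 m, dual_monoid sigma m & tau = cut sigma m.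
Proof.
move=> [m dm ->]; have [N N0 [l El]] := clear_denominators m.
have Nr : N%:R != 0 :> rat by rewrite pnatr_eq0 -lt0n.
exists l; first by move=> u su; rewrite El pairingZl mulr_ge0// dm.
apply/seteqP; split=> u [su /= Hu]; split=> //=.
  by rewrite El pairingZl Hu mulr0.
by move: Hu; rewrite El pairingZl => /eqP; rewrite mulf_eq0 (negPf Nr) => /eqP.
Qed.

Lemma cut_opp sigma m : dual_monoid (cut sigma m) (- m).
Proof. by move=> u [_ /= E]; rewrite toQN pairingC pairingNr pairingC E oppr0. Qed.

Lemma dual_monoid_gens sigma r (u : 'I_r -> 'rV[int]_n) m :
  sigma = [set x | exists2 c : 'I_r -> rat, forall i, 0 <= c i & x = \sum_i c i *: toQ (u i)] ->
  dual_monoid sigma m <-> forall i, 0 <= ipair m (u i).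
Proof.
move=> ->; split=> [H i|H _ [c c0 ->]].
  rewrite -(ler0z rat) -pairing_toQ; apply: H; exists (fun j => (j == i)%:R).
    by move=> j; case: eqP.
  by rewrite (bigD1 i)//= eqxx scale1r big1 ?addr0// => j /negPf ->; rewrite scale0r.
rewrite pairing_sumr; apply: sumr_ge0 => i _.
by rewrite pairingZr mulr_ge0// pairing_toQ ler0z.
Qed.

Lemma gen_in sigma r (u : 'I_r -> 'rV[int]_n) i :
  sigma = [set x | exists2 c : 'I_r -> rat, forall i, 0 <= c i & x = \sum_i c i *: toQ (u i)] ->
  sigma (toQ (u i)).
Proof.
move=> ->; exists (fun j => (j == i)%:R); first by move=> j; case: eqP.
by rewrite (bigD1 i)//= eqxx scale1r big1 ?addr0// => j /negPf ->; rewrite scale0r.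
Qed.

(** The monoid of a face is the localization at [m0]. On generators of the face [m] is already
    nonnegative; on the others [m0] is at least 1, and the maximum over the finitely many generators
    gives [N]. *)
Lemma cut_localization sigma m0 m : rational_polyhedral sigma -> dual_monoid sigma m0 ->
  dual_monoid (cut sigma m0) m -> exists N : nat, dual_monoid sigma (m + m0 *+ N).
Proof.
move=> [r [u Es]] d0 dm; exists (\max_i `|ipair m (u i)|).
apply/(dual_monoid_gens _ Es) => i; rewrite ipairC ipairDr -!(ipairC _ (u i)).
have /dual_monoid_gens := d0 => /(_ _ _ Es) /(_ i) ge.
have -> N : ipair (m0 *+ N) (u i) = ipair m0 (u i) * N%:Z.
  by rewrite -scaler_nat natz ipairZl mulrC.
move: ge; rewrite le_eqVlt => /predU1P [E0|gt].
  rewrite -E0 mul0r addr0 -(ler0z rat) -pairing_toQ; apply: dm; split.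
    exact: gen_in Es.
  by rewrite /= pairing_toQ -E0.
have := leq_bigmax_cond (F := fun i => `|ipair m (u i)|%N) i isT.
by move: (\max_i _) => N /=; rewrite -lez_nat => HN; nia.
Qed.

Lemma cone_separation sigma x : rational_polyhedral sigma -> ~ sigma x ->
  exists2 m, dual_monoid sigma m & pairing (toQ m) x < 0.
Proof.
move=> [r [u Es]] nx; have [[c c0 E]|[m m0 mx]] := farkas_rat (fun i => toQ (u i)) x.
  by case: nx; rewrite Es; exists c.
have [N N0 [l El]] := clear_denominators m; exists l.
  apply/(dual_monoid_gens _ Es) => i; rewrite -(ler0z rat) -pairing_toQ El pairingZl.
  by rewrite mulr_ge0.
by rewrite El pairingZl pmulr_rlt0 ?ltr0n.
Qed.

Lemma cone_dualP sigma (u : 'rV[int]_n) : rational_polyhedral sigma ->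
  (forall m, dual_monoid sigma m -> 0 <= ipair m u) -> sigma (toQ u).
Proof.
move=> rs H; apply: contrapT => /(cone_separation rs) [m /H].
by rewrite pairing_toQ -(ler0z rat) leNgt => /negPf ->.
Qed.

End Cones.

Section ToricCharts.
Variables (n : nat) (k : fieldType) (Sigma : fan n).
Local Notation X := (toric_variety k Sigma).
Local Notation chidx := (chart_index Sigma).
Implicit Types (s t : chidx) (m : 'rV[int]_n) (sigma tau : set 'rV[rat]_n).

Lemma chart_point_eq (sigma : set 'rV[rat]_n) (g h : chart_point k sigma) :
  (forall m, dual_monoid sigma m -> sval g m = sval h m) -> g = h.
Proof.
move=> E; apply: eq_sig_hprop => [? ? ?|]; first exact: Prop_irrelevance.
apply/funext => m; have [dm|nm] := pselect (dual_monoid sigma m); first exact: E.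
by have [_ _ ->//] := svalP g; have [_ _ ->//] := svalP h.
Qed.

Lemma chart0 sigma (g : chart_point k sigma) : sval g 0 = 1.
Proof. by have [] := svalP g. Qed.

Lemma chartD sigma (g : chart_point k sigma) m m' : dual_monoid sigma m ->
  dual_monoid sigma m' -> sval g (m + m') = sval g m * sval g m'.
Proof. by have [_ H _] := svalP g; exact: H. Qed.

Lemma chartMn sigma (g : chart_point k sigma) m e : dual_monoid sigma m ->
  sval g (m *+ e) = sval g m ^+ e.
Proof.
move=> dm; elim: e => [|e IH]; first by rewrite mulr0n chart0.
by rewrite mulrS chartD ?IH ?exprS//; exact: dual_monoidMn.
Qed.

Lemma chart_unit sigma (g : chart_point k sigma) m : dual_monoid sigma m ->
  dual_monoid sigma (- m) -> sval g m != 0.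
Proof.
move=> dm dm'; have := chart0 g; rewrite -(subrr m) chartD// => E.
by apply: contra_eq_neq E => ->; rewrite mul0r eq_sym oner_eq0.
Qed.

Section Restrict.
Variables (sigma tau : set 'rV[rat]_n) (sub : tau `<=` sigma) (g : chart_point k tau).

(** Restriction to the smaller dual monoid; geometrically it is the map from the chart of [tau] to
    the chart of [sigma]. *)
Definition restrict_fun m : k := if `[< dual_monoid sigma m >] then sval g m else 0.

Lemma restrict_hom : monoid_hom sigma restrict_fun.
Proof.
rewrite /restrict_fun; split=> [|m m' dm dm'|m nm].
- by rewrite asboolT ?chart0//; exact: dual_monoid0.
- rewrite !asboolT//; last exact: dual_monoidD.
  by rewrite chartD//; exact: dual_monoidS sub _.
- by rewrite asboolF.
Qed.

Definition restrict : chart_point k sigma := exist _ _ restrict_hom.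

Lemma restrictE m : dual_monoid sigma m -> sval restrict m = sval g m.
Proof. by move=> dm; rewrite /= /restrict_fun asboolT. Qed.

End Restrict.

(** A point at which the monomial [m0] is invertible lies in the chart of the face. A monomial of
    the face is evaluated after multiplication by some power of [m0], and the result does not depend
    on the power. *)
Lemma extend (sigma : set 'rV[rat]_n) m0 (g : chart_point k sigma) :
  rational_polyhedral sigma -> dual_monoid sigma m0 -> sval g m0 != 0 ->
  exists d : chart_point k (cut sigma m0),
    forall m, dual_monoid sigma m -> sval g m = sval d m.
Proof.
move=> rp d0 g0; have sub : cut sigma m0 `<=` sigma by move=> u [].
have /choice [N HN] : forall m, exists N : nat,
    dual_monoid (cut sigma m0) m -> dual_monoid sigma (m + m0 *+ N).
  move=> m; have [dm|nm] := pselect (dual_monoid (cut sigma m0) m); last by exists 0%N.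
  by have [N HN] := cut_localization rp d0 dm; exists N.
have wd m N1 N2 : dual_monoid sigma (m + m0 *+ N1) -> dual_monoid sigma (m + m0 *+ N2) ->
    sval g (m + m0 *+ N1) / sval g m0 ^+ N1 = sval g (m + m0 *+ N2) / sval g m0 ^+ N2.
  move=> d1 d2; apply/eqP; rewrite eqr_div ?expf_neq0//; apply/eqP.
  rewrite -!chartMn// -!chartD//; try exact: dual_monoidMn.
  by rewrite -!addrA (addrC (m0 *+ N1)).
pose d m := if `[< dual_monoid (cut sigma m0) m >] then
  sval g (m + m0 *+ N m) / sval g m0 ^+ N m else 0.
have dE m N1 : dual_monoid (cut sigma m0) m -> dual_monoid sigma (m + m0 *+ N1) ->
    d m = sval g (m + m0 *+ N1) / sval g m0 ^+ N1.
  by move=> dm d1; rewrite /d asboolT//; apply: wd => //; exact: HN.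
have hom : monoid_hom (cut sigma m0) d.
  split=> [|m m' dm dm'|m nm]; last by rewrite /d asboolF.
    rewrite (dE 0 0%N) ?mulr0n ?addr0 ?expr0 ?divr1 ?chart0//; exact: dual_monoid0.
  have d1 := HN m dm; have d2 := HN m' dm'.
  have E : m + m0 *+ N m + (m' + m0 *+ N m') = m + m' + m0 *+ (N m + N m').
    by rewrite mulrnDr addrACA.
  rewrite (dE (m + m') (N m + N m')%N); last 2 first.
  - exact: dual_monoidD.
  - by rewrite -E; exact: dual_monoidD.
  rewrite (dE m (N m))// (dE m' (N m'))// -E chartD// exprD invfM; ring.
exists (exist _ d hom) => m dm /=.
by rewrite (dE m 0%N) ?mulr0n ?addr0 ?expr0 ?divr1//; exact: dual_monoidS sub _.
Qed.

Lemma agree_cut (sigma : set 'rV[rat]_n) m0 (g : chart_point k sigma)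
    (d : chart_point k (cut sigma m0)) :
  rational_polyhedral sigma -> dual_monoid sigma m0 ->
  (forall m, dual_monoid sigma m -> sval g m = sval d m) ->
  sval g m0 != 0 /\ forall m (N : nat), dual_monoid (cut sigma m0) m ->
    dual_monoid sigma (m + m0 *+ N) ->
    sval d m = sval g (m + m0 *+ N) / sval g m0 ^+ N.
Proof.
move=> rp d0 E; have sub : cut sigma m0 `<=` sigma by move=> u [].
have d0' := dual_monoidS sub d0.
have g0 : sval g m0 != 0 by rewrite E//; apply: chart_unit => //; exact: cut_opp.
split=> // m N dm dN; apply: (canRL (mulfK _)); first by rewrite expf_neq0.
by rewrite !E// chartD ?chartMn//; exact: dual_monoidMn.
Qed.

Lemma meet_cut s t : exists2 m0, dual_monoid (sval s) m0 &
  sval s `&` sval t = cut (sval s) m0.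
Proof. by have [/face_cut] := fan_meet (svalP s) (svalP t). Qed.

Let cone_rational s : rational_polyhedral (sval s) := fan_rational (svalP s).

Definition pre s (g : chart_point k (sval s)) : pretoric k Sigma :=
  Tagged (fun s : chidx => chart_point k (sval s)) g.
Arguments pre : clear implicits.

Lemma glued_refl (x : pretoric k Sigma) : glued x x.
Proof.
case: x => s g; rewrite /glued /=.
have sub : sval s `&` sval s `<=` sval s by move=> u [].
have sub' : sval s `<=` sval s `&` sval s by move=> u su; split.
by exists (restrict sub' g); split=> m dm; rewrite restrictE//; apply: dual_monoidS dm.
Qed.

Lemma glued_sym (x y : pretoric k Sigma) : glued x y -> glued y x.
Proof.
case: x => s g; case: y => t h [/= d [E1 E2]]; rewrite /glued /=.
have sub : sval s `&` sval t `<=` sval t `&` sval s by move=> u [].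
have sub1 : sval t `&` sval s `<=` sval t by move=> u [].
have sub2 : sval t `&` sval s `<=` sval s by move=> u [].
exists (restrict sub d); split=> m dm; rewrite restrictE ?E1 ?E2//.
  exact: dual_monoidS dm.
exact: dual_monoidS dm.
Qed.

Lemma cutD (sigma : set 'rV[rat]_n) m1 m2 : dual_monoid sigma m1 -> dual_monoid sigma m2 ->
  cut sigma (m1 + m2) = cut sigma m1 `&` cut sigma m2.
Proof.
move=> d1 d2; apply/seteqP; split=> u /=.
  move=> [su /=]; rewrite toQD pairingDl => /eqP.
  by rewrite paddr_eq0 ?d1 ?d2// => /andP [/eqP ? /eqP ?].
by move=> [[su /= E1] [_ /= E2]]; split=> //=; rewrite toQD pairingDl E1 E2 addr0.
Qed.

(** Seen in the middle chart, the point makes both [m1] and [m2] invertible, hence also [m1 + m2].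
    The face cut out by the sum is contained in both common faces, and the point of its chart
    witnesses the gluing. *)
Lemma glued_trans (x y z : pretoric k Sigma) : glued x y -> glued y z -> glued x z.
Proof.
case: x => s g; case: y => t h; case: z => r l [/= d [E1 E2]] [/= d' [E3 E4]].
have [m1 dm1 C1] := meet_cut t s; have [m2 dm2 C2] := meet_cut t r.
have rt := cone_rational t.
move: d E1 E2; rewrite setIC C1 => d E1 E2; move: d' E3 E4; rewrite C2 => d' E3 E4.
have [h1 D1] := agree_cut rt dm1 E2; have [h2 D2] := agree_cut rt dm2 E3.
have dm12 := dual_monoidD dm1 dm2.
have [|e Ee] := @extend _ (m1 + m2) h rt dm12; first by rewrite chartD// mulf_neq0.
have sub12 : cut (sval t) (m1 + m2) `<=` cut (sval t) m1 by rewrite cutD// => u [].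
have sub12' : cut (sval t) (m1 + m2) `<=` cut (sval t) m2 by rewrite cutD// => u [].
have subt : cut (sval t) (m1 + m2) `<=` sval t by move=> u [].
have key (m0 m : 'rV[int]_n) (dd : chart_point k (cut (sval t) m0)) :
    dual_monoid (sval t) m0 -> cut (sval t) (m1 + m2) `<=` cut (sval t) m0 ->
    (forall m, dual_monoid (sval t) m -> sval h m = sval dd m) ->
    dual_monoid (cut (sval t) m0) m -> sval dd m = sval e m.
  move=> dm0 sub E dm; have [h0 D] := agree_cut rt dm0 E.
  have [N dN] := cut_localization rt dm0 dm.
  rewrite (D m N)//; apply: (canLR (mulfK _)); first by rewrite expf_neq0.
  rewrite !Ee// -chartMn ?chartD//; try exact: dual_monoidS dN.
  - exact: dual_monoidS dm.
  - by apply: dual_monoidMn; exact: dual_monoidS dm0.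
  - exact: dual_monoidS dm0.
have sub : cut (sval t) (m1 + m2) `<=` sval s `&` sval r.
  by rewrite cutD// -C1 -C2 => u [[_ ?] [_ ?]].
rewrite /glued /=; exists (restrict sub e); split=> m dm.
  rewrite restrictE; last by apply: dual_monoidS dm => u [].
  have dm' : dual_monoid (cut (sval t) m1) m by apply: dual_monoidS dm; rewrite -C1 => u [].
  by rewrite E1//; exact: key.
rewrite restrictE; last by apply: dual_monoidS dm => u [].
have dm' : dual_monoid (cut (sval t) m2) m by apply: dual_monoidS dm; rewrite -C2 => u [].
by rewrite E4//; exact: key.
Qed.

Definition emb s (g : chart_point k (sval s)) : X := toric_inj (g : toric_chart k (sval s)).

Lemma emb_eq s t (g : chart_point k (sval s)) (h : chart_point k (sval t)) :
  emb g = emb h <-> glued (pre s g) (pre t h).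
Proof.
split=> [E|G].
  have : glued (pre s g) = glued (pre t h) by exact: (congr1 sval E).
  by move=> ->; exact: glued_refl.
apply: eq_sig_hprop => [? ? ?|]; first exact: Prop_irrelevance.
apply/funext => z; apply/propext; split; apply: glued_trans => //.
exact: glued_sym.
Qed.

Lemma emb_inj s : injective (@emb s).
Proof.
move=> g h /emb_eq [d [/= E1 E2]]; apply: chart_point_eq => m dm.
by rewrite E1// E2.
Qed.

Lemma emb_surj (x : X) : exists s (g : chart_point k (sval s)), x = emb g.
Proof.
case: x => A [[s g] EA]; exists s, g.
by apply: eq_sig_hprop => [? ? ?|]; [exact: Prop_irrelevance|exact: EA].
Qed.

Definition chart_open s : set X := [set x | exists g : chart_point k (sval s), x = emb g].

Lemma emb_open s (g : chart_point k (sval s)) : chart_open s (emb g).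
Proof. by exists g. Qed.

Lemma chart_one_hom (sigma : set 'rV[rat]_n) :
  monoid_hom sigma (fun m => if `[< dual_monoid sigma m >] then 1 else 0 : k).
Proof.
split=> [|m m' dm dm'|m nm]; last by rewrite asboolF.
  by rewrite asboolT//; exact: dual_monoid0.
by rewrite !asboolT ?mulr1//; exact: dual_monoidD.
Qed.

Definition chart_one sigma : chart_point k sigma := exist _ _ (chart_one_hom sigma).

(** The value outside the chart is a dummy; regularity is only claimed on [chart_open s]. *)
Definition chart_inv s (x : X) : toric_chart k (sval s) :=
  if pselect (chart_open s x) is left H then projT1 (cid H) else chart_one (sval s).

Lemma chart_invK s x : chart_open s x -> emb (chart_inv s x) = x.
Proof.
by move=> sx; rewrite /chart_inv; case: pselect => // H; rewrite -(projT2 (cid H)).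
Qed.

Lemma embK s (g : chart_point k (sval s)) : chart_inv s (emb g) = g.
Proof. by apply: (@emb_inj s); apply: chart_invK; exact: emb_open. Qed.

Definition chi s m (x : X) : k := sval (chart_inv s x) m.

Lemma chi_emb s m (g : chart_point k (sval s)) : chi s m (emb g) = sval g m.
Proof. by rewrite /chi embK. Qed.

Lemma gen_chi (sigma : set 'rV[rat]_n) m : dual_monoid sigma m ->
  gen_alg [set f : chart_point k sigma -> k |
    exists2 m, dual_monoid sigma m & f = fun g => sval g m] (fun g => sval g m).
Proof. by move=> dm; apply: gen_alg_gen; exists m. Qed.

(* In the chart of t, the chart of s is the locus where the monomial cutting out the common face is nonzero. *)
Lemma chart_in_chart s t : exists2 m0, dual_monoid (sval t) m0 &
  (forall g : chart_point k (sval t), chart_open s (emb g) <-> sval g m0 != 0) /\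
  forall m, dual_monoid (sval s) m -> exists N : nat, dual_monoid (sval t) (m + m0 *+ N) /\
    forall g : chart_point k (sval t), sval g m0 != 0 ->
      chi s m (emb g) = sval g (m + m0 *+ N) / sval g m0 ^+ N.
Proof.
have [m0 dm0 C0] := meet_cut t s; exists m0 => //.
have rt := cone_rational t.
have sub : cut (sval t) m0 `<=` sval s by rewrite -C0 => u [].
have ext (g : chart_point k (sval t)) : sval g m0 != 0 -> exists h : chart_point k (sval s),
   emb g = emb h /\ forall m (N : nat), dual_monoid (sval s) m -> dual_monoid (sval t) (m + m0 *+ N) ->
     sval h m = sval g (m + m0 *+ N) / sval g m0 ^+ N.
  move=> g0; have [d Ed] := extend rt dm0 g0.
  exists (restrict sub d); split.
    apply/emb_eq; rewrite /glued /=; move: d Ed; rewrite -C0 => d Ed.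
    exists d; split=> // m dm; by rewrite /restrict_fun asboolT.
  move=> m N dm dN; have [_ D] := agree_cut rt dm0 Ed.
  by rewrite restrictE// (D m N)//; exact: dual_monoidS dm.
split=> [g|m dm].
  split=> [[h /emb_eq [/= d [Eg _]]]|/ext [h [E _]]]; last by exists h.
  by move: d Eg; rewrite C0 => d Eg; have [] := agree_cut rt dm0 Eg.
have [N dN] := cut_localization rt dm0 (dual_monoidS sub dm).
exists N; split=> // g /ext [h [E H]].
by rewrite E chi_emb (H m N).
Qed.

Lemma chart_openP s : open (chart_open s).
Proof.
rewrite glue_space_open => t; rewrite frac_space_open => g sg.
have [m0 dm0 [H _]] := chart_in_chart s t.
exists tt, (fun g => sval g m0); split=> //; first exact: gen_chi.
  exact/H.
by move=> h _ h0; apply/H.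
Qed.

Lemma emb_morph s : is_morph (@emb s : toric_chart k (sval s) -> X).
Proof. exact: is_morph_inj. Qed.

Lemma chi_regular s m : dual_monoid (sval s) m -> regular X (chart_open s) (chi s m).
Proof.
move=> dm; rewrite glue_space_regular => t.
have [m0 dm0 [H1 H2]] := chart_in_chart s t; have [N [dN E]] := H2 m dm.
have [oW _] := @emb_morph t _ (@chart_openP s).
refine (@regular_ext _ (toric_chart k (sval t)) _
  (fun g : chart_point k (sval t) => sval g (m + m0 *+ N) / sval g m0 ^+ N) _ _ _).
  by move=> g; rewrite inE => /H1 g0; rewrite /= -E.
apply: regular_div; first exact: oW.
- by apply: affine_regular_gen; exact: gen_chi.
- by apply: regularX; [exact: oW|apply: affine_regular_gen; exact: gen_chi].
- by move=> g /H1 g0; rewrite expf_neq0.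
Qed.

Lemma chart_inv_pull s (W : set (toric_chart k (sval s))) : open W ->
  open (chart_open s `&` chart_inv s @^-1` W) /\
  forall h, regular (toric_chart k (sval s)) W h ->
    regular X (chart_open s `&` chart_inv s @^-1` W) (h \o chart_inv s).
Proof.
apply: affine_pull; first exact: chart_openP.
by move=> _ [m dm ->]; exact: chi_regular.
Qed.

End ToricCharts.

(** Hyperplanes are avoided one at a time. If the vector found so far lies on the hyperplane of [d],
    it is scaled by a [T] that exceeds all the pairings with [d], and then [d] itself is added. *)
Lemma generic_vector n (D : seq 'rV[int]_n) : exists u, forall d, d \in D -> d != 0 -> ipair d u != 0.
Proof.
elim: D => [|d D [u Hu]]; first by exists 0.
have [d0|d0] := eqVneq d 0.
  by exists u => e; rewrite inE => /predU1P [->|/Hu//]; rewrite d0 eqxx.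
have dd : 0 < ipair d d.
  rewrite -(ltr0z rat) -pairing_toQ pairing_norm_gt0//; apply: contra d0 => /eqP/rowP E.
  by apply/eqP/rowP => i; have := E i; rewrite !mxE => /eqP; rewrite intr_eq0 => /eqP.
have [du|du] := eqVneq (ipair d u) 0; last first.
  by exists u => e; rewrite inE => /predU1P [->//|/Hu].
pose T := (\max_(e <- D) `|ipair e d|).+1.
exists (T%:Z *: u + d) => e; rewrite inE ipairDr ipairZr => /predU1P [-> _|eD e0].
  by rewrite du mulr0 add0r gt_eqF.
have := Hu e eD e0; have : (`|ipair e d| < T)%N by rewrite ltnS; exact: leq_bigmax_seq.
rewrite -ltz_nat; move: (ipair e u) (ipair e d) T => a b T; clear => lt a0.
by apply/eqP => E; nia.
Qed.

Lemma poly_cofinite_eq (F : closedFieldType) (r p q : {poly F}) : r != 0 ->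
  (forall t, r.[t] != 0 -> p.[t] = q.[t]) -> p = q.
Proof.
move=> r0 H; apply: (mulfI r0); apply/eqP; rewrite -subr_eq0; apply: contraT.
move=> /closed_nonrootP [t]; rewrite rootE hornerD hornerN !hornerM.
have [->|rt] := eqVneq r.[t] 0; first by rewrite !mul0r subrr eqxx.
by rewrite H// subrr eqxx.
Qed.

(** * Laurent polynomials and density of the torus *)

Section Laurent.
Variables (n : nat) (k : closedFieldType).
Local Notation M := 'rV[int]_n.
Implicit Types (m u : M) (l : seq (k * M)).

Definition is_char (x : M -> k) := x 0 = 1 /\ forall m m', x (m + m') = x m * x m'.

Lemma char_neq0 x m : is_char x -> x m != 0.
Proof.
move=> [x0 xD]; have := x0; rewrite -(subrr m) xD => E.
by apply: contra_eq_neq E => ->; rewrite mul0r eq_sym oner_eq0.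
Qed.

Lemma charN x m : is_char x -> x (- m) = (x m)^-1.
Proof.
move=> cx; have [x0 xD] := cx; apply: (mulfI (char_neq0 m cx)).
by rewrite -xD subrr x0 divff ?char_neq0.
Qed.

Definition one_param u (t : k) : M -> k := fun m => t ^ ipair m u.

Lemma one_param_char u t : t != 0 -> is_char (one_param u t).
Proof.
move=> t0; split=> [|m m']; rewrite /one_param.
  by rewrite ipairC ipair0r expr0z.
by rewrite ipairDl expfzDr.
Qed.

Definition leval l (x : M -> k) : k := \sum_(c <- l) c.1 * x c.2.

Definition lcoef l m : k := \sum_(c <- l | c.2 == m) c.1.

Lemma leval_coef l x : leval l x = \sum_(m <- undup [seq c.2 | c <- l]) lcoef l m * x m.
Proof.
rewrite /lcoef; under [RHS]eq_bigr do rewrite mulr_suml.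
rewrite (exchange_big_dep xpredT)//= /leval [LHS]big_seq [RHS]big_seq.
apply: eq_bigr => c cl; rewrite big_mkcond (bigD1_seq c.2) ?undup_uniq//=; last first.
  by rewrite mem_undup map_f.
by rewrite eqxx big1 ?addr0// => m cm; rewrite eq_sym (negPf cm).
Qed.

(** Restriction to a one-parameter subgroup whose direction separates the exponents reduces the
    claim to polynomials in one variable. *)
Lemma laurent_eq0 l : (forall x, is_char x -> leval l x = 0) -> forall m, lcoef l m = 0.
Proof.
move=> H m; pose E := undup [seq c.2 | c <- l].
have [mE|nE] := boolP (m \in E); last first.
  rewrite /lcoef big_seq_cond big1// => c /andP [cl /eqP Ec].
  by case/negP: nE; rewrite mem_undup -Ec map_f.
have [u Hu] := generic_vector [seq a - b | a <- E, b <- E].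
have inj a b : a \in E -> b \in E -> ipair a u = ipair b u -> a = b.
  move=> aE bE ab; apply/eqP; rewrite -subr_eq0; apply: contraT => nz.
  have dD : a - b \in [seq a - b | a <- E, b <- E] by exact: allpairs_f.
  by have := Hu _ dD nz; rewrite ipairBl ab subrr eqxx.
pose N := \max_(a <- E) `|ipair a u|%N.
pose e a := absz (N%:Z + ipair a u).
have eE a : a \in E -> (e a)%:Z = N%:Z + ipair a u.
  move=> aE; rewrite /e gez0_abs//.
  have : (`|ipair a u| <= N)%N by exact: (leq_bigmax_seq (F := fun a => `|ipair a u|%N)).
  by clear; lia.
pose P := \sum_(a <- E) (lcoef l a)%:P * 'X^(e a) : {poly k}.
have P0 : P = 0.
  apply: (@poly_cofinite_eq _ 'X); first by rewrite polyX_eq0.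
  move=> t; rewrite hornerX horner0 => t0.
  have := H _ (one_param_char u t0); rewrite leval_coef => E0.
  rewrite horner_sum; transitivity (t ^+ N * \sum_(a <- E) lcoef l a * one_param u t a).
    rewrite mulr_sumr [LHS]big_seq [RHS]big_seq; apply: eq_bigr => a aE.
    rewrite hornerM hornerC hornerXn /one_param mulrCA; congr (_ * _).
    by rewrite -[t ^+ e a]/(t ^ (e a)%:Z) eE// expfzDr.
  by rewrite E0 mulr0.
have := congr1 (fun p : {poly k} => p`_(e m)) P0; rewrite coef0 coef_sum.
rewrite (bigD1_seq m) ?undup_uniq//= coefCM coefXn eqxx mulr1 big_seq_cond big1 ?addr0//.
move=> a /andP [aE am]; rewrite coefCM coefXn; case: eqP => [E1|]; last by rewrite mulr0.
case/eqP: am; apply: inj => //; apply: (addrI N%:Z); by rewrite -!eE// E1.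
Qed.

Lemma leval_cat l l' x : leval (l ++ l') x = leval l x + leval l' x.
Proof. by rewrite /leval big_cat. Qed.

Definition lmul l l' : seq (k * M) := [seq (a.1 * b.1, a.2 + b.2) | a <- l, b <- l'].

Lemma leval_mul l l' (x : M -> k) :
  (forall a b, a \in l -> b \in l' -> x (a.2 + b.2) = x a.2 * x b.2) ->
  leval (lmul l l') x = leval l x * leval l' x.
Proof.
move=> H; rewrite /leval big_allpairs_dep /= mulr_suml big_seq [RHS]big_seq.
apply: eq_bigr => a al; rewrite mulr_sumr big_seq [RHS]big_seq.
by apply: eq_bigr => b bl; rewrite H// mulrACA.
Qed.

Lemma leval_char_mul l l' x : is_char x -> leval (lmul l l') x = leval l x * leval l' x.
Proof. by move=> [_ xD]; apply: leval_mul. Qed.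

Lemma lcoef_eq l l' : (forall x, is_char x -> leval l x = leval l' x) ->
  forall m, lcoef l m = lcoef l' m.
Proof.
move=> H m; pose l'' := [seq (- c.1, c.2) | c <- l'].
have E x : leval l'' x = - leval l' x.
  by rewrite /leval big_map -sumrN; apply: eq_bigr => c _; rewrite mulNr.
have := @laurent_eq0 (l ++ l'') _ m; rewrite /lcoef big_cat big_map /=.
rewrite sumrN => H'; apply/eqP; rewrite -subr_eq0; apply/eqP/H' => x cx.
by rewrite leval_cat E H// subrr.
Qed.

Definition lshift m l : seq (k * M) := [seq (c.1, c.2 + m) | c <- l].

Lemma leval_shift m l x : is_char x -> leval (lshift m l) x = x m * leval l x.
Proof.
move=> [_ xD]; rewrite /leval big_map mulr_sumr; apply: eq_bigr => c _ /=.
by rewrite xD mulrA mulrC.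
Qed.

Lemma lcoef_shift m l m' : lcoef (lshift m l) (m' + m) = lcoef l m'.
Proof. by rewrite /lcoef big_map; apply: eq_bigl => c /=; rewrite (inj_eq (addIr m)). Qed.

Lemma lcoef_mem l m : lcoef l m != 0 -> exists2 c, c \in l & c.2 = m.
Proof.
move=> H; apply: contrapT => nex; case/eqP: H; rewrite /lcoef big_seq_cond big1// => c.
by move=> /andP [cl /eqP E]; case: nex; exists c.
Qed.

Definition lsupp (S : set M) l := forall c, c \in l -> S c.2.

Lemma laurent_neq0 l : (exists x, leval l x != 0) -> exists2 x, is_char x & leval l x != 0.
Proof.
move=> [x]; apply: contraNP => nex; rewrite leval_coef big1// => m _.
rewrite laurent_eq0 ?mul0r// => y cy; apply/eqP; apply: contraT => ly.
by case: nex; exists y.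
Qed.

Lemma chart_laurent (sigma : set 'rV[rat]_n) (f : chart_point k sigma -> k) :
  gen_alg [set f : chart_point k sigma -> k |
    exists2 m, dual_monoid sigma m & f = fun g => sval g m] f ->
  exists l, lsupp (dual_monoid sigma) l /\ forall g, f g = leval l (sval g).
Proof.
elim=> {f}[f [m dm ->]|c|f g _ [l [sl El]] _ [l' [sl' El']]|f g _ [l [sl El]] _ [l' [sl' El']]].
- exists [:: (1, m)]; split=> [c|g]; first by rewrite inE => /eqP ->.
  by rewrite /leval big_seq1 mul1r.
- exists [:: (c, 0)]; split=> [d|g]; first by rewrite inE => /eqP ->; exact: dual_monoid0.
  by rewrite /leval big_seq1 chart0 mulr1.
- exists (l ++ l'); split=> [c|h]; first by rewrite mem_cat => /orP [/sl|/sl'].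
  by rewrite leval_cat El El'.
- exists (lmul l l'); split=> [c /allpairsP [[a b] [/sl al /sl' bl ->]]|h].
    exact: dual_monoidD.
  by rewrite El El' leval_mul// => a b /sl al /sl' bl; exact: chartD.
Qed.

Section TorusChart.
Variables (sigma : set 'rV[rat]_n) (x : M -> k) (cx : is_char x).

Lemma torus_hom : monoid_hom sigma (fun m => if `[< dual_monoid sigma m >] then x m else 0).
Proof.
case: cx => x0 xD; split=> [|m m' dm dm'|m nm]; last by rewrite asboolF.
  by rewrite asboolT//; exact: dual_monoid0.
by rewrite !asboolT//; exact: dual_monoidD.
Qed.

Definition torus_chart : chart_point k sigma := exist _ _ torus_hom.

Lemma torus_chartE m : dual_monoid sigma m -> sval torus_chart m = x m.
Proof. by move=> dm; rewrite /= asboolT. Qed.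

End TorusChart.

Lemma leval_torus (sigma : set 'rV[rat]_n) l x (cx : is_char x) :
  lsupp (dual_monoid sigma) l -> leval l (sval (torus_chart sigma cx)) = leval l x.
Proof.
move=> sl; rewrite /leval big_seq [RHS]big_seq; apply: eq_bigr => c /sl dc.
by rewrite torus_chartE.
Qed.

Variable Sigma : fan n.
Local Notation X := (toric_variety k Sigma).
Local Notation chidx := (chart_index Sigma).

Definition tor (s : chidx) x (cx : is_char x) : X := emb (torus_chart (sval s) cx).

Lemma tor_indep s t x (cx cx' : is_char x) : tor s cx = tor t cx'.
Proof.
apply/emb_eq; rewrite /glued /=; exists (torus_chart (sval s `&` sval t) cx).
have sub1 : sval s `&` sval t `<=` sval s by move=> u [].
have sub2 : sval s `&` sval t `<=` sval t by move=> u [].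
by split=> m dm; rewrite asboolT// torus_chartE//;
  [exact: dual_monoidS sub1 dm|exact: dual_monoidS sub2 dm].
Qed.

Lemma tor_open s t x (cx : is_char x) : chart_open t (tor s cx).
Proof. by exists (torus_chart (sval t) cx); exact: tor_indep. Qed.

Lemma chi_tor s t x (cx : is_char x) m : dual_monoid (sval t) m -> chi t m (tor s cx) = x m.
Proof. by move=> dm; rewrite (tor_indep s t cx cx) chi_emb torus_chartE. Qed.

Lemma chart_torus_dense (sigma : set 'rV[rat]_n) (f : toric_chart k sigma -> k) g :
  gen_alg [set f : chart_point k sigma -> k |
    exists2 m, dual_monoid sigma m & f = fun g => sval g m] f ->
  f g != 0 -> exists x (cx : is_char x), f (torus_chart sigma cx) != 0.
Proof.
move=> /chart_laurent [l [sl El]] fg.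
have [|x cx Hx] := @laurent_neq0 l; first by exists (sval g); rewrite -El.
by exists x, cx; rewrite El leval_torus.
Qed.

Lemma torus_dense (W : set X) s : open W -> W !=set0 -> exists x (cx : is_char x), W (tor s cx).
Proof.
move=> oW [x Wx]; have [t [g Eg]] := emb_surj x.
have [oV _] := @emb_morph _ _ _ t W oW.
have [|_ [b [Gb _ bg sb]]] := oV g; first by rewrite /preimage /= -Eg.
have [y [cy by0]] := chart_torus_dense Gb bg.
by exists y, cy; rewrite (tor_indep s t cy cy); apply: sb.
Qed.

(** The torus point without a proof argument; the value at functions that are not characters is a
    dummy. *)
Definition tpt (s : chidx) (x : M -> k) : X :=
  if pselect (is_char x) is left cx then tor s cx else emb (chart_one k (sval s)).

Lemma tptE s x (cx : is_char x) : tpt s x = tor s cx.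
Proof. by rewrite /tpt; case: pselect => // cx'; exact: tor_indep. Qed.

Lemma tpt_open s t x : is_char x -> chart_open t (tpt s x).
Proof. by move=> cx; rewrite (tptE _ cx); exact: tor_open. Qed.

Lemma chi_tpt s t x m : is_char x -> dual_monoid (sval t) m -> chi t m (tpt s x) = x m.
Proof. by move=> cx dm; rewrite (tptE _ cx) chi_tor. Qed.

Lemma tpt_dense (W : set X) s : open W -> W !=set0 -> exists2 x, is_char x & W (tpt s x).
Proof. by move=> oW /(torus_dense s oW) [x [cx Wx]]; exists x => //; rewrite (tptE _ cx). Qed.

End Laurent.

(** * Completeness and smoothness *)

Lemma coef1M (R : nzRingType) (p q : {poly R}) : (p * q)`_1 = p`_0 * q`_1 + p`_1 * q`_0.
Proof. by rewrite coefM !big_ord_recl big_ord0 addr0. Qed.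

Section ProjectiveCharts.
Variables (k : fieldType) (N : nat).
Local Notation P := (proj_space k N).
Implicit Types (V : P) (l i j : 'I_N.+1) (y : affine_nspace k N).

Definition proj_inv l V : affine_nspace k N := \row_j (htrans l (lift l j) V).

Lemma hcover_chart l i y : hcover i (proj_chart l y) <-> chart_vec l y 0 i != 0.
Proof.
rewrite /hcover /=; have [c c0 ->] := hcoord_chart l y.
by rewrite mulf_eq0 (negPf c0).
Qed.

Lemma htrans_chart l i j y : htrans i j (proj_chart l y) = chart_vec l y 0 j / chart_vec l y 0 i.
Proof. by rewrite /htrans; have [c c0 E] := hcoord_chart l y; rewrite !E -mulf_div divff// mul1r. Qed.

Lemma proj_invK l V : hcover l V -> proj_chart l (proj_inv l V) = V.
Proof.
move=> Vl; apply: val_inj => /=; set v := vpick (sval (V : proj_point k N)).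
have vl : v 0 l != 0 by [].
have E : chart_vec l (proj_inv l V) = (v 0 l)^-1 *: v.
  apply/rowP => i; rewrite !mxE; case: unliftP => [j ->|->]; last by rewrite mulVf.
  by rewrite mxE mulrC.
apply/eqP; rewrite eqEdim; apply/andP; split.
  by rewrite E -memvE memvZ// memv_pick.
by rewrite (eqP (svalP (V : proj_point k N))) (eqP (chart_vec_dim l _)).
Qed.

Lemma proj_chartK l y : proj_inv l (proj_chart l y) = y.
Proof. by apply/rowP => j; rewrite mxE htrans_chart chart_vec1 divr1 mxE liftK. Qed.

Lemma hcover_self l y : hcover l (proj_chart l y).
Proof. by apply/hcover_chart; rewrite chart_vec1 oner_neq0. Qed.

Lemma htrans_regular1 i j : regular P (hcover i) (htrans i j).
Proof.
rewrite glue_space_regular => l; rewrite frac_space_regular => y Hy.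
exists tt, (fun y => chart_vec l y 0 j), (fun y => chart_vec l y 0 i).
split=> //; [exact: chart_vec_alg|exact: chart_vec_alg|exact/hcover_chart|].
by move=> z _ _ z0; rewrite /= htrans_chart.
Qed.

Lemma proj_inv_pull l (W : set (affine_nspace k N)) : open W ->
  open (hcover l `&` proj_inv l @^-1` W) /\
  forall h, regular (affine_nspace k N) W h ->
    regular P (hcover l `&` proj_inv l @^-1` W) (h \o proj_inv l).
Proof.
apply: affine_pull; first exact: hcover_open.
move=> _ [j ->]; rewrite (_ : _ \o _ = htrans l (lift l j)); first exact: htrans_regular1.
by apply/funext => V; rewrite /= mxE.
Qed.

Lemma proj_chart_morph l : is_morph (proj_chart l : affine_nspace k N -> P).
Proof. exact: is_morph_inj. Qed.

End ProjectiveCharts.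

Section Curves.
Variables (k : closedFieldType) (T : Type) (G : set (T -> k)).

Lemma curve_gen_alg (c : k -> T) (r : {poly k}) (D : k -> Prop) :
  (forall t, D t -> r.[t] != 0) ->
  (forall g, G g -> exists (p : {poly k}) (e : nat), forall t, D t -> g (c t) = p.[t] / r.[t] ^+ e) ->
  forall a, gen_alg G a ->
    exists (p : {poly k}) (e : nat), forall t, D t -> a (c t) = p.[t] / r.[t] ^+ e.
Proof.
move=> Dr HG a; elim=> {a}[g /HG//|x|f g _ [p [e Ef]] _ [q [e' Eg]]|f g _ [p [e Ef]] _ [q [e' Eg]]].
- by exists x%:P, 0%N => t _; rewrite hornerC expr0 divr1.
- exists (p * r ^+ e' + q * r ^+ e), (e + e')%N => t Dt.
  rewrite Ef// Eg// hornerD !hornerM !horner_exp addf_div ?expf_neq0 ?Dr//.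
  by rewrite exprD.
- exists (p * q), (e + e')%N => t Dt.
  by rewrite Ef// Eg// hornerM mulf_div exprD.
Qed.

End Curves.

(** Dividing homogeneous coordinates by the common power of ['X] extends a rational curve in
    projective space over [t = 0]. *)
Lemma vanishing_order (k : closedFieldType) (J : finType) (p : J -> {poly k}) (j0 : J) : p j0 != 0 ->
  exists (e : nat) (q : J -> {poly k}), (forall j, p j = 'X^e * q j) /\ exists j, (q j).[0] != 0.
Proof.
move=> p0; have [m] := ubnP (size (p j0)); elim: m => // m IH in p p0 *.
rewrite ltnS => sm; have [[j pj]|H] := pselect (exists j, (p j).[0] != 0).
  by exists 0%N, p; split=> [i|]; [rewrite expr0 mul1r|exists j].
have /choice [q Hq] : forall j, exists q, p j = q * 'X.
  move=> j; have : root (p j) 0 by rewrite rootE; apply: contraT => ?; case: H; exists j.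
  by move=> /factor_theorem [q]; rewrite subr0; exists q.
have q0 : q j0 != 0 by apply: contraNneq p0 => E; rewrite Hq E mul0r.
have [|e [q' [Eq Hj]]] := IH q q0.
  by apply: leq_trans sm; rewrite Hq size_mulX.
by exists e.+1, q'; split=> // j; rewrite Hq Eq exprS; ring.
Qed.

Section Completeness.
Variables (n : nat) (k : closedFieldType) (Sigma : fan n).
Local Notation X := (toric_variety k Sigma).
Local Notation chidx := (chart_index Sigma).
Variables (N : nat) (f : morph X (proj_space k N)).
Hypothesis fc : closed_embedding f.
Variables (u : 'rV[int]_n) (s0 : chidx).

Let gam t : X := tpt s0 (one_param u t).

Let char (t : k) : t != 0 -> is_char (one_param u t).
Proof. exact: one_param_char. Qed.

Let curve t : chart_point k (sval s0) := chart_inv s0 (gam t).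

Let curveE (t : k) m : t != 0 -> dual_monoid (sval s0) m -> sval (curve t) m = t ^ ipair m u.
Proof. by move=> /char ct dm; exact: (chi_tpt s0 ct dm). Qed.

Let curve_emb (t : k) : t != 0 -> emb (curve t) = gam t.
Proof. by move=> /char ct; apply: chart_invK; exact: tpt_open. Qed.

Let curve_alg a : gen_alg [set f : chart_point k (sval s0) -> k |
    exists2 m, dual_monoid (sval s0) m & f = fun g => sval g m] a ->
  exists (p : {poly k}) (e : nat), forall t, t != 0 -> a (curve t) = p.[t] / t ^+ e.
Proof.
move=> Ga; have [||p [e H]] := @curve_gen_alg _ _ _ curve 'X (fun t => t != 0) _ _ a Ga.
- by move=> t; rewrite hornerX.
- move=> _ [m dm ->]; case E: (ipair m u) => [e|e].
    exists 'X^e, 0%N => t t0; by rewrite expr0 divr1 hornerXn curveE// E.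
  by exists 1, e.+1 => t t0; rewrite hornerX hornerC curveE// E div1r.
- by exists p, e => t t0; rewrite H// hornerX.
Qed.

(** The homogeneous coordinates of the embedded curve are rational in [t]; [r] collects the finitely
    many parameters to be discarded, among them 0. *)
Let fgam_rational : exists (r : {poly k}) (p : 'I_N.+1 -> {poly k}) l,
  [/\ r != 0, p l != 0 & forall t, r.[t] != 0 -> [/\ t != 0, hcover l (f (gam t)) &
    forall j, htrans l j (f (gam t)) = (p j).[t] / (p l).[t]]].
Proof.
have [l Hl] := hcover_covers (f (gam 1)).
pose V := f @^-1` hcover l.
have [oV rV] := morph_is_morph f (@hcover_open k N l).
have [oW rW] := emb_morph s0 oV.
have W1 : (@emb _ _ _ s0 @^-1` V) (curve 1) by rewrite /preimage /= curve_emb ?oner_neq0.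
have [_ [b [Gb _ b1 sb]]] := oW _ W1.
have [pb [eb Eb]] := curve_alg Gb.
have /choice [q Hq] : forall j, exists q : {poly k} * {poly k}, (q.2).[1] != 0 /\
    forall t, t != 0 -> (q.2).[t] != 0 -> V (gam t) ->
      htrans l j (f (gam t)) = (q.1).[t] / (q.2).[t].
  move=> j; have rj := rW _ (rV _ (@htrans_regular1 k N l j)).
  have [_ [a [c [Ga Gc _ c1 E]]]] := rj _ W1.
  have [pa [ea Ea]] := curve_alg Ga; have [pc [ec Ec]] := curve_alg Gc.
  have c1' := c1; rewrite Ec ?oner_neq0// in c1'.
  exists (pa * 'X^ec, pc * 'X^ea) => /=; split.
    by rewrite hornerM hornerXn expr1n mulr1; move: c1'; rewrite expr1n divr1.
  move=> t t0; rewrite !hornerM !hornerXn mulf_eq0 negb_or => /andP [pct _] Vt.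
  have := E (curve t); rewrite /preimage /= curve_emb// => /(_ Vt I).
  rewrite Ec// mulf_eq0 negb_or pct invr_eq0 expf_neq0// => /(_ isT) ->.
  by rewrite Ea// invf_div mulf_div [pc.[t] * _]mulrC.
pose D := \prod_j (q j).2.
have D1 : D.[1] != 0.
  by rewrite horner_prod; apply/prodf_neq0 => j _; case: (Hq j).
pose p j := (q j).1 * \prod_(i | i != j) (q i).2.
have pE j t : t != 0 -> D.[t] != 0 -> V (gam t) ->
    htrans l j (f (gam t)) = (p j).[t] / D.[t].
  move=> t0; rewrite /D (bigD1 j)//= hornerM mulf_eq0 negb_or => /andP [qt Dt] Vt.
  by rewrite (Hq j).2// /p hornerM -mulf_div divff// mulr1.
exists ('X * pb * D), (fun j => if j == l then D else p j), l; rewrite eqxx; split.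
- apply: contraNneq D1 => /(congr1 (horner^~ 1)); rewrite !hornerM hornerX hornerC mul1r => /eqP.
  rewrite mulf_eq0 => /orP [|//] pb1; move: b1; rewrite Eb ?oner_neq0// (eqP pb1).
  by rewrite mul0r eqxx.
- by apply: contraNneq D1 => ->; rewrite horner0.
- move=> t; rewrite !hornerM hornerX !mulf_eq0 !negb_or => /andP [/andP [t0 pbt] Dt].
  have Vt : V (gam t).
    have := sb (curve t) I; rewrite /preimage /= curve_emb//; apply.
    by rewrite Eb// mulf_neq0// invr_eq0 expf_neq0.
  split=> // j; case: eqP => [->|_]; last exact: pE.
  by rewrite divff// /htrans divff.
Qed.

Let limit_point : exists (r : {poly k}) (q : 'I_N.+1 -> {poly k}) l,
  [/\ r != 0, (q l).[0] != 0 & forall t, r.[t] != 0 -> [/\ t != 0, (q l).[t] != 0 &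
    f (gam t) = proj_chart l (\row_j ((q (lift l j)).[t] / (q l).[t]) : affine_nspace k N)]].
Proof.
have [r [p [l [r0 pl0 H]]]] := fgam_rational.
have [e [q [Eq [i qi]]]] := vanishing_order pl0.
have qi0 : q i != 0 by apply: contraNneq qi => ->; rewrite horner0.
have ql0 : q l != 0 by apply: contraNneq pl0 => E; rewrite Eq E mulr0.
exists (r * q i * q l), q, i; split=> //; first by rewrite !mulf_neq0.
move=> t; rewrite !hornerM !mulf_eq0 !negb_or => /andP [/andP [rt qit] qlt].
have [t0 hl Ht] := H t rt; split=> //.
have E j : htrans l j (f (gam t)) = (q j).[t] / (q l).[t].
  by rewrite Ht !Eq !hornerM hornerXn -mulf_div divff ?mul1r// expf_neq0.
have hi : hcover i (f (gam t)).
  have := E i; rewrite /htrans /hcover /=; apply: contra_eq_neq => ->.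
  by rewrite mul0r eq_sym mulf_neq0// invr_eq0.
rewrite -[LHS](proj_invK hi); congr (proj_chart i _); apply/rowP => j; rewrite !mxE.
have := E (lift i j); have := E i; rewrite /htrans => E1 E2.
transitivity ((hcoord (f (gam t)) (lift i j) / hcoord (f (gam t)) l) /
    (hcoord (f (gam t)) i / hcoord (f (gam t)) l)).
  by rewrite invf_div mulrA divfK.
by rewrite E1 E2 invf_div mulrA divfK.
Qed.

(** The embedded one-parameter subgroup has a limit at [t = 0], which belongs to the closed image,
    say to the chart of [s]. The monomials of this chart extend to functions regular near the limit,
    so that [t] to the power of the pairing of [m] with [u] has no pole, for every [m] in the dual
    monoid. *)
Lemma limit_in_cone : exists s : chidx, sval s (toQ u).
Proof.
have [r [q [l [r0 ql0 H]]]] := limit_point.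
pose y t : affine_nspace k N := \row_j ((q (lift l j)).[t] / (q l).[t]).
have yalg a : gen_alg [set f : 'rV[k]_N -> k | exists i, f = fun y => y 0 i] a ->
    exists (p : {poly k}) (e : nat), forall t, (q l).[t] != 0 -> a (y t) = p.[t] / (q l).[t] ^+ e.
  apply: curve_gen_alg => // _ [i ->]; exists (q (lift l i)), 1%N => t qt.
  by rewrite mxE expr1.
have near (W : set (proj_space k N)) : open W -> W (proj_chart l (y 0)) ->
    exists2 b : {poly k}, b.[0] != 0 & forall t, b.[t] != 0 -> W (proj_chart l (y t)).
  move=> oW W0; have [oW' _] := proj_chart_morph l oW.
  have [_ [b [Gb _ b0 sb]]] := oW' _ W0.
  have [p [e Hp]] := yalg b Gb.
  exists (p * q l) => [|t].
    by rewrite hornerM mulf_neq0//; move: b0; rewrite Hp// mulf_eq0 negb_or => /andP [].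
  rewrite hornerM mulf_eq0 negb_or => /andP [pt qt]; apply: (sb _ I).
  by rewrite Hp// mulf_neq0// invr_eq0 expf_neq0.
have [finj fcl fst] := fc.
(* The complement of the image is open; if it contained the limit, it would contain nearly all
   points of the curve. *)
have [x Ex] : exists x, f x = proj_chart l (y 0).
  apply: contrapT => /forallNP nx.
  have cl : closed (f @` setT) by apply: fcl; exact: closedT.
  have n0 : (~` (f @` setT)) (proj_chart l (y 0)) by move=> [x _ E]; exact: (nx x E).
  have [b b0 Hb] := near _ (closed_openC cl) n0.
  have bn0 : b * r != 0 by rewrite mulf_neq0//; apply: contraNneq b0 => ->; rewrite horner0.
  have /closed_nonrootP [t] := bn0.
  rewrite rootE hornerM mulf_eq0 negb_or => /andP [bt rt].
  have [t0 _ E] := H t rt; by case: (Hb t bt); exists (gam t) => //; exact: E.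
have [s [g Eg]] := emb_surj x; exists s.
have sx : chart_open s x by exists g.
apply: cone_dualP (fan_rational (svalP s)) _ => m dm.
have [V [h [oV Vx rh sV Eh]]] := fst _ _ x (@chart_openP _ _ _ s) (@chi_regular _ _ _ s m dm) sx.
rewrite Ex in Vx; have [b b0 Hb] := near V oV Vx.
have [oV' rV'] := proj_chart_morph l oV.
have [_ [a [c [Ga Gc _ c0 Eac]]]] := rV' h rh _ Vx.
have [pa [ea Ea]] := yalg a Ga; have [pc [ec Ec]] := yalg c Gc.
have pc0 : pc.[0] != 0 by move: c0; rewrite Ec// mulf_eq0 negb_or => /andP [].
rewrite leNgt; apply/negP => neg.
have [e Ee] : exists e : nat, ipair m u = - e.+1%:Z.
  by case: (ipair m u) neg => // e _; exists e; rewrite NegzE.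
(* A negative exponent turns the expression of the monomial as a local quotient into this polynomial
   identity, whose left side is nonzero at 0. *)
suff E : pc * q l ^+ ea = 'X * ('X^e * (pa * q l ^+ ec)).
  move/(congr1 (horner^~ 0)): E; rewrite !hornerM hornerX mul0r horner_exp => /eqP.
  by rewrite mulf_eq0 (negPf pc0) expf_eq0 (negPf ql0) andbF.
apply: (@poly_cofinite_eq _ (r * b * pc)).
  by rewrite !mulf_neq0//; [apply: contraNneq b0 => ->|apply: contraNneq pc0 => ->]; rewrite horner0.
move=> t; rewrite !hornerM !mulf_eq0 !negb_or => /andP [/andP [rt bt] pct].
have [t0 qt Et] := H t rt; have Vt := Hb t bt.
have := Eh (gam t); rewrite Et => /(_ Vt); rewrite (chi_tpt s0 (char t0) dm).
have cn0 : c (y t) != 0 by rewrite Ec// mulf_neq0// invr_eq0 expf_neq0.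
have := Eac (y t) Vt I cn0 => /= -> ; rewrite Ea// Ec// /one_param Ee -exprnN.
rewrite invf_div mulf_div => /eqP; rewrite -[_ ^- _]div1r eqr_div; last 2 first.
- by rewrite expf_neq0.
- by rewrite mulf_neq0// expf_neq0.
by rewrite mul1r !horner_exp !hornerX => /eqP E; rewrite mulrC E exprS; ring.
Qed.

End Completeness.

Section FullDimension.
Variables (n : nat) (Sigma : fan n).
Local Notation chidx := (chart_index Sigma).
Implicit Types (s t : chidx) (u m : 'rV[int]_n) (sigma : set 'rV[rat]_n).

Definition fulldim sigma := forall m, (forall x, sigma x -> pairing (toQ m) x = 0) -> m = 0.

Hypothesis complete : forall u, exists s, sval s (toQ u).

(** If [u] lay in no full-dimensional cone, the vectors [e u + v] with generic [v] would escape
    every cone for large [e], against completeness. *)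
Lemma fulldim_cover u : exists2 s : chidx, fulldim (sval s) & sval s (toQ u).
Proof.
apply: contrapT => nex.
have /finite_seqP [l El] := @fan_finite _ Sigma.
have inl (s : chidx) : sval s \in l by case: s => sigma /=; rewrite El.
have /choice [mm Hmm] : forall sigma : set 'rV[rat]_n, exists m, ~ fulldim sigma ->
    m != 0 /\ forall x, sigma x -> pairing (toQ m) x = 0.
  move=> sigma; have [fd|nfd] := pselect (fulldim sigma); first by exists 0.
  have [m Hm] : exists m, ~ ((forall x, sigma x -> pairing (toQ m) x = 0) -> m = 0).
    by apply: contrapT => /forallNP H; apply: nfd => m; apply: contrapT; exact: H.
  exists m => _; split; last by apply: contrapT => H; apply: Hm.
  by apply/eqP => m0; apply: Hm.
have [v Hv] := generic_vector [seq mm sigma | sigma <- l].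
have toQe (e : nat) w : toQ (w *+ e + v) = e%:R *: toQ w + toQ v by rewrite toQD toQMn.
suff [E HE] : exists E : nat, forall sigma, sigma \in l -> forall e : nat, (E <= e)%N ->
    cones Sigma sigma -> ~ sigma (toQ (u *+ e + v)).
  have [s Hs] := complete (u *+ E + v).
  exact: (HE _ (inl s) E (leqnn E) (svalP s) Hs).
have : forall sigma, sigma \in l -> mm sigma \in [seq mm sigma | sigma <- l].
  by move=> sigma; exact: map_f.
move: [seq mm sigma | sigma <- l] Hv => D Hv; clear inl El.
elim: l => [|sigma l IH] Hl; first by exists 0%N.
have [|E HE] := IH; first by move=> t tl; apply: Hl; rewrite inE tl orbT.
suff [E' HE'] : exists E' : nat, forall e : nat, (E' <= e)%N ->
    cones Sigma sigma -> ~ sigma (toQ (u *+ e + v)).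
  exists (maxn E E') => t; rewrite inE => /predU1P [->|tl] e; rewrite geq_max => /andP [? ?].
    exact: HE'.
  exact: HE.
have [cs|ncs] := pselect (cones Sigma sigma); last by exists 0%N.
have [fd|nfd] := pselect (fulldim sigma); last first.
  have [m0 mz] := Hmm _ nfd.
  have [[e0 se0]|H] := pselect (exists e, sigma (toQ (u *+ e + v))); last first.
    by exists 0%N => e _ _ H'; apply: H; exists e.
  (* Two values of [e] in a degenerate cone would make a functional that kills the cone vanish at
     [u], hence at [v], which was chosen generic. *)
  exists e0.+1 => e lt _ se; have := mz _ se; have := mz _ se0.
  rewrite !toQe !pairingDr !pairingZr !pairing_toQ.
  have := Hv _ (Hl _ (mem_head _ _)) m0; rewrite -(intr_eq0 rat).
  move: (_%:~R) (_%:~R) => a b b0 E1 E2; case/eqP: b0.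
  have e0e : e0%:R != e%:R :> rat by rewrite eqr_nat; apply: contraTneq lt => ->; rewrite ltnn.
  have : (e%:R - e0%:R) * a = 0 by rewrite mulrBl; lra.
  move/eqP; rewrite mulf_eq0 subr_eq0 eq_sym (negPf e0e) /= => /eqP a0.
  by move: E1; rewrite a0 mulr0 add0r.
have [|m dm] := @cone_separation n sigma (toQ u) (fan_rational cs).
  by move=> su; apply: nex; exists (exist _ sigma cs).
rewrite pairing_toQ ltrz0 => mu.
exists (`|ipair m v|).+1%N => e lt _ se; have := dm _ se.
rewrite pairing_toQ ler0z ipairDr -scaler_nat natz ipairZr leNgt => /negP; apply.
by rewrite -ltz_nat in lt; move: lt mu; move: (ipair m u) (ipair m v) => a b; clear; nia.
Qed.

End FullDimension.

(** * Tangent vectors at a torus-fixed point *)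

Section FixedPoint.
Variables (n : nat) (k : closedFieldType) (Sigma : fan n).
Local Notation X := (toric_variety k Sigma).
Local Notation M := 'rV[int]_n.
Variable s : chart_index Sigma.
Hypothesis fd : fulldim (sval s).
Local Notation Lam := (dual_monoid (sval s)).
Implicit Types (m h : M) (l : seq (k * M)) (F : X -> k).

Lemma dual_pointed m : Lam m -> Lam (- m) -> m = 0.
Proof.
move=> dm dm'; apply: fd => x sx; apply/eqP; rewrite eq_le dm// andbT.
by have := dm' x sx; rewrite toQN pairingC pairingNr pairingC oppr_ge0.
Qed.

Lemma dual_sum_eq0 m m' : Lam m -> Lam m' -> m + m' = 0 -> m = 0 /\ m' = 0.
Proof.
move=> dm dm' /eqP; rewrite addr_eq0 => /eqP E.
have z : m' = 0 by apply: dual_pointed; rewrite // -E.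
by rewrite E z oppr0.
Qed.

(** The dual monoid of a full-dimensional cone has no nonzero units, so sending all its nonzero
    elements to 0 is multiplicative. *)
Lemma fixed_hom : monoid_hom (sval s) (fun m => (m == 0)%:R : k).
Proof.
split=> [|m m' dm dm'|m nm]; first by rewrite eqxx.
  have [E|ne] := eqVneq (m + m') 0.
    by have [-> ->] := dual_sum_eq0 dm dm' E; rewrite eqxx mulr1.
  case: eqP => [E|_]; last by rewrite mul0r.
  by move: ne; rewrite E add0r => /negPf ->; rewrite mulr0.
by case: eqP => // E; case: nm; rewrite E; exact: dual_monoid0.
Qed.

Definition fixed_chart : chart_point k (sval s) := exist _ _ fixed_hom.

Definition fixed_point : X := emb fixed_chart.

Lemma leval_fixed l : leval l (sval fixed_chart) = lcoef l 0.
Proof.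
rewrite /leval /lcoef [RHS]big_mkcond; apply: eq_bigr => c _ /=.
by case: eqP; rewrite ?mulr1 ?mulr0.
Qed.

(** The elements of the Hilbert basis of the dual monoid. *)
Definition irreducible h := [/\ Lam h, h != 0 &
  forall a b, Lam a -> Lam b -> h = a + b -> a = 0 \/ b = 0].

Section TangentVector.
Variables (h : M) (irr : irreducible h).

Let lcoef_mulE l l' m : lcoef (lmul l l') m =
  \sum_(a <- l) \sum_(b <- l') (a.1 * b.1) * (a.2 + b.2 == m)%:R.
Proof.
rewrite /lcoef big_mkcond big_allpairs_dep /=; apply: eq_bigr => a _; apply: eq_bigr => b _.
by case: eqP; rewrite ?mulr1 ?mulr0.
Qed.

Let lcoefE l m : lcoef l m = \sum_(a <- l) a.1 * (a.2 == m)%:R.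
Proof.
by rewrite /lcoef big_mkcond; apply: eq_bigr => a _; case: eqP; rewrite ?mulr1 ?mulr0.
Qed.

Let lcoef1 (c : k) m m' : lcoef [:: (c, m)] m' = c * (m == m')%:R.
Proof. by rewrite lcoefE big_seq1. Qed.

Let lcoef_mul0 l l' : lsupp Lam l -> lsupp Lam l' ->
  lcoef (lmul l l') 0 = lcoef l 0 * lcoef l' 0.
Proof.
move=> sl sl'; rewrite lcoef_mulE !lcoefE mulr_suml big_seq [RHS]big_seq.
apply: eq_bigr => a /sl da; rewrite mulr_sumr big_seq [RHS]big_seq.
apply: eq_bigr => b /sl' db; rewrite mulrACA -natrM mulnb; congr (_ * (nat_of_bool _)%:R).
apply/eqP/andP => [/(dual_sum_eq0 da db) [-> ->]//|[/eqP -> /eqP ->]].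
by rewrite addr0.
Qed.

(** An irreducible [h] splits only as [0 + h] and [h + 0], so taking the coefficient of [h] obeys
    the Leibniz rule. *)
Let lcoef_mulh l l' : lsupp Lam l -> lsupp Lam l' ->
  lcoef (lmul l l') h = lcoef l 0 * lcoef l' h + lcoef l h * lcoef l' 0.
Proof.
move=> sl sl'; rewrite lcoef_mulE !lcoefE !mulr_suml -big_split /= big_seq [RHS]big_seq.
apply: eq_bigr => a /sl da; rewrite !mulr_sumr -big_split /= big_seq [RHS]big_seq.
apply: eq_bigr => b /sl' db; rewrite [a.1 * _ * (b.1 * (b.2 == h)%:R)]mulrACA [a.1 * _ * (b.1 * (b.2 == 0)%:R)]mulrACA -mulrDr -!natrM -natrD; congr (_ * _%:R).
have [dh h0 Hh] := irr.
have [->|a0] := eqVneq a.2 0.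
  by rewrite add0r [0 == h]eq_sym (negPf h0) mul1n mul0n addn0.
rewrite mul0n add0n; have [->|b0] := eqVneq b.2 0; first by rewrite addr0 muln1.
rewrite muln0; case: eqP => // E; have [] := Hh a.2 b.2 da db (esym E) => /eqP.
  by rewrite (negPf a0).
by rewrite (negPf b0).
Qed.

Definition rep F la lb := [/\ lsupp Lam la, lsupp Lam lb, lcoef lb 0 != 0 &
  forall g : chart_point k (sval s), leval lb (sval g) != 0 ->
    F (emb g) = leval la (sval g) / leval lb (sval g)].

(** The quotient rule for the derivation that reads off the coefficient of [h]. *)
Definition dquot la lb : k :=
  (lcoef la h * lcoef lb 0 - lcoef la 0 * lcoef lb h) / lcoef lb 0 ^+ 2.

Let supp_mul l l' : lsupp Lam l -> lsupp Lam l' -> lsupp Lam (lmul l l').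
Proof. by move=> sl sl' c /allpairsP [[a b] [/sl al /sl' bl ->]]; exact: dual_monoidD. Qed.

Let leval_mulc l l' (g : chart_point k (sval s)) : lsupp Lam l -> lsupp Lam l' ->
  leval (lmul l l') (sval g) = leval l (sval g) * leval l' (sval g).
Proof. by move=> sl sl'; rewrite leval_mul// => a b /sl al /sl' bl; exact: chartD. Qed.

Let rep_unique F la lb la' lb' : rep F la lb -> rep F la' lb' -> dquot la lb = dquot la' lb'.
Proof.
move=> [sa sb b0 E] [sa' sb' b'0 E'].
(* The extra factors [lmul lb lb'] make both sides vanish at the characters where a denominator
   does, so the identity holds on the whole torus. *)
pose p := lmul (lmul (lmul la lb') (lmul lb lb')) (lmul lb lb').
pose q := lmul (lmul (lmul la' lb) (lmul lb lb')) (lmul lb lb').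
have sbb := supp_mul sb sb'.
have eq m : lcoef p m = lcoef q m.
  apply: lcoef_eq => x cx; rewrite !leval_char_mul//.
  have [->|nb] := eqVneq (leval lb x) 0; first by rewrite !(mul0r, mulr0).
  have [->|nb'] := eqVneq (leval lb' x) 0; first by rewrite !(mul0r, mulr0).
  have := E (torus_chart (sval s) cx); have := E' (torus_chart (sval s) cx).
  rewrite !leval_torus// => -> // /(_ nb) /eqP; rewrite eqr_div// => /eqP Eq.
  by rewrite -Eq.
have := eq h; have := eq 0; rewrite /p /q.
have s1 := supp_mul sa sb'; have s2 := supp_mul sa' sb.
have s3 := supp_mul s1 sbb; have s4 := supp_mul s2 sbb.
rewrite !(lcoef_mulh, lcoef_mul0) //.
rewrite /dquot; move: (lcoef lb 0) (lcoef lb' 0) b0 b'0 => B B' B0 B'0.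
move: (lcoef lb h) (lcoef lb' h) (lcoef la h) (lcoef la' h) (lcoef la 0) (lcoef la' 0).
move=> b b' a a' A A' E0 Eh.
have E1 : A * B' = A' * B.
  apply: (mulIf (mulf_neq0 B0 B'0)); apply: (mulIf (mulf_neq0 B0 B'0)); exact: E0.
have E2 : A * b' + a * B' = A' * b + a' * B.
  apply: (mulIf (mulf_neq0 B0 B'0)); apply: (mulIf (mulf_neq0 B0 B'0)).
  have ring_id x y z t G g : z * G * g + (z * g + x * G) * G = t * G * g + (t * g + y * G) * G ->
      z = t -> x * G * G = y * G * G :> k.
    by move=> + zt; rewrite zt => /addrI; rewrite !mulrDl => /addrI.
  exact: ring_id Eh E1.
have EA : A = A' * B / B' by rewrite -E1 mulfK.
have Ea : a = (A' * b + a' * B - A * b') / B' by rewrite -E2 addrAC subrr add0r mulfK.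
by rewrite Ea EA; field; rewrite B0 B'0.
Qed.

Definition tangent_of F : k := xget 0 [set v | exists la lb, rep F la lb /\ v = dquot la lb].

Lemma tangent_ofE F la lb : rep F la lb -> tangent_of F = dquot la lb.
Proof.
move=> r; rewrite /tangent_of; case: xgetP => [v _ [la' [lb' [r' ->]]]|/(_ (dquot la lb)) []].
  exact: rep_unique r' r.
by exists la, lb.
Qed.

Lemma rep_ex F : regular_at fixed_point F -> exists la lb, rep F la lb.
Proof.
move=> [U [oU Ux rF]]; have [oW rW] := emb_morph s oU.
have [_ [a [b [Ga Gb _ b0 E]]]] := rW F rF fixed_chart Ux.
have [_ [c [Gc _ c0 sc]]] := oW fixed_chart Ux.
have [la [sa Ea]] := chart_laurent Ga; have [lb [sb Eb]] := chart_laurent Gb.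
have [lc [sc' Ec]] := chart_laurent Gc.
exists (lmul la lc), (lmul lb lc); split; try exact: supp_mul.
  by rewrite lcoef_mul0// -!leval_fixed -Eb -Ec mulf_neq0.
move=> g; rewrite !leval_mulc// -Ea -Eb -Ec mulf_eq0 negb_or => /andP [bg cg].
by rewrite -mulf_div divff// mulr1; apply: E => //; exact: sc.
Qed.

Lemma rep_fixed F la lb : rep F la lb -> F fixed_point = lcoef la 0 / lcoef lb 0.
Proof. by move=> [sa sb b0 E]; rewrite /fixed_point E leval_fixed ?leval_fixed. Qed.

Let repD F G la lb la' lb' : rep F la lb -> rep G la' lb' ->
  rep (fun x => F x + G x) (lmul la lb' ++ lmul la' lb) (lmul lb lb').
Proof.
move=> [sa sb b0 E] [sa' sb' b'0 E']; split.
- by move=> c; rewrite mem_cat => /orP []; apply: supp_mul.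
- exact: supp_mul.
- by rewrite lcoef_mul0// mulf_neq0.
- move=> g; rewrite leval_cat !leval_mulc// mulf_eq0 negb_or => /andP [bg bg'].
  by rewrite E// E'// addf_div.
Qed.

Let repM F G la lb la' lb' : rep F la lb -> rep G la' lb' ->
  rep (fun x => F x * G x) (lmul la la') (lmul lb lb').
Proof.
move=> [sa sb b0 E] [sa' sb' b'0 E']; split; try exact: supp_mul.
  by rewrite lcoef_mul0// mulf_neq0.
move=> g; rewrite !leval_mulc// mulf_eq0 negb_or => /andP [bg bg'].
by rewrite E// E'// mulf_div.
Qed.

Let repC c : rep (fun=> c) [:: (c, 0)] [:: (1, 0)].
Proof.
split; try by move=> x; rewrite inE => /eqP ->; exact: dual_monoid0.
  by rewrite lcoef1 eqxx mulr1 oner_neq0.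
by move=> g _; rewrite /leval !big_seq1 !chart0 !mulr1 divr1.
Qed.

Lemma tangent_of_vector : tangent_vector fixed_point tangent_of.
Proof.
have h0 : h != 0 by case: irr.
split=> [F G rF rG [U [oU Ux EU]]|c F G rF rG|F G rF rG].
- have [la [lb r]] := rep_ex rF; rewrite (tangent_ofE r); symmetry.
  have [oW _] := emb_morph s oU; have [_ [c [Gc _ c0 sc]]] := oW fixed_chart Ux.
  have [lc [sc' Ec]] := chart_laurent Gc.
  have [sa sb b0 E] := r.
  have lc0 : lcoef lc 0 != 0 by rewrite -leval_fixed -Ec.
  rewrite (@tangent_ofE G (lmul la lc) (lmul lb lc)); last first.
    split; try exact: supp_mul; first by rewrite lcoef_mul0// mulf_neq0.
    move=> g; rewrite !leval_mulc// mulf_eq0 negb_or => /andP [bg cg].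
    rewrite -mulf_div divff// mulr1 -E// EU// inE; apply: sc => //.
    by rewrite Ec.
  by rewrite /dquot !lcoef_mulh// !lcoef_mul0//; field; rewrite ?b0 ?b'0 ?lc0.
- have [la [lb r]] := rep_ex rF; have [la' [lb' r']] := rep_ex rG.
  have rc := repM (repC c) r.
  rewrite (tangent_ofE r) (tangent_ofE r') (tangent_ofE (repD rc r')) /dquot.
  have [sa sb b0 _] := r; have [sa' sb' b'0 _] := r'; have [sac sbc bc0 _] := rc.
  have cat m l l' : lcoef (l ++ l') m = lcoef l m + lcoef l' m by rewrite /lcoef big_cat.
  have [sc s1 _ _] := repC c.
  rewrite !cat !lcoef_mulh// !lcoef_mul0//.
  rewrite !lcoef1 eqxx [0 == h]eq_sym (negPf h0) !(mulr1, mulr0, mul1r).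
  by rewrite -[false%:R]/(0 : k); field; rewrite ?b0 ?b'0 ?lc0.
- have [la [lb r]] := rep_ex rF; have [la' [lb' r']] := rep_ex rG.
  rewrite (tangent_ofE r) (tangent_ofE r') (tangent_ofE (repM r r')) /dquot.
  rewrite (rep_fixed r) (rep_fixed r').
  have [sa sb b0 _] := r; have [sa' sb' b'0 _] := r'.
  by rewrite !lcoef_mulh// !lcoef_mul0//; field; rewrite ?b0 ?b'0 ?lc0.
Qed.

Lemma tangent_of_chi m : Lam m -> tangent_of (chi s m) = (m == h)%:R.
Proof.
move=> dm; have h0 : h != 0 by case: irr.
rewrite (@tangent_ofE _ [:: (1, m)] [:: (1, 0)]); last first.
  split; try by move=> x; rewrite inE => /eqP ->//; exact: dual_monoid0.
    by rewrite lcoef1 eqxx mulr1 oner_neq0.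
  by move=> g _; rewrite chi_emb /leval !big_seq1 chart0 !mul1r divr1.
rewrite /dquot !lcoef1 eqxx [0 == h]eq_sym (negPf h0).
by rewrite !(mulr1, mulr0, mul1r) expr1n divr1 subr0.
Qed.

End TangentVector.
End FixedPoint.

Section Unimodular.
Variables (n : nat) (k : closedFieldType) (Sigma : fan n).
Local Notation X := (toric_variety k Sigma).
Local Notation M := 'rV[int]_n.
Variable s : chart_index Sigma.
Hypothesis fd : fulldim (sval s).
Hypothesis smooth : smooth_of_dim X n.
Local Notation Lam := (dual_monoid (sval s)).
Local Notation irred := (irreducible s).
Implicit Types (m h : M).

(** The tangent vectors of distinct irreducible elements are dual to the corresponding monomials,
    hence independent, in a tangent space spanned by [n] vectors. *)
Lemma irreducible_bound (hs : seq M) : uniq hs -> (forall h, h \in hs -> irred h) ->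
  (size hs <= n)%N.
Proof.
move=> uh Hh; rewrite leqNgt; apply/negP => lt.
have [t [_ _ span]] := smooth (fixed_point k fd).
pose hh (i : 'I_(size hs)) := tnth (in_tuple hs) i.
have irr i : irred (hh i) by apply: Hh; exact: mem_tnth.
have /choice [c Hc] : forall i, exists c : 'I_n -> k, forall F, regular_at (fixed_point k fd) F ->
    tangent_of s (hh i) F = \sum_j c j * t j F.
  by move=> i; exact: span (tangent_of_vector k fd (irr i)).
pose C := \matrix_(i < size hs, j < n) c i j.
have K0 : kermx C != 0.
  rewrite -mxrank_eq0 mxrank_ker subn_eq0 -ltnNge.
  by apply: leq_ltn_trans lt; exact: rank_leq_col.
pose d := nz_row (kermx C).
have d0 : d != 0 by rewrite nz_row_eq0.
have dC : d *m C = 0 by apply/sub_kermxP; exact: nz_row_sub.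
case/eqP: d0; apply/rowP => l; rewrite mxE.
have reg : regular_at (fixed_point k fd) (chi s (hh l)).
  exists (chart_open s); split; [exact: chart_openP|exact: emb_open|].
  by apply: chi_regular; case: (irr l).
transitivity (\sum_i d 0 i * tangent_of s (hh i) (chi s (hh l))).
  rewrite (bigD1 l)//= (tangent_of_chi k fd (irr l)); last by case: (irr l).
  rewrite eqxx mulr1 big1 ?addr0// => i il.
  rewrite (tangent_of_chi k fd (irr i)); last by case: (irr l).
  suff -> : (hh l == hh i) = false by rewrite mulr0.
  by rewrite /hh !(tnth_nth 0) /= nth_uniq// eq_sym; exact/negbTE.
under eq_bigr => i _ do rewrite Hc// mulr_sumr.
rewrite exchange_big big1//= => j _.
under eq_bigr do rewrite mulrA.
rewrite -mulr_suml; have /rowP /(_ j) := dC; rewrite !mxE.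
by under eq_bigr do rewrite !mxE; move=> ->; rewrite mul0r.
Qed.

Lemma irreducible_list : exists hs : seq M, [/\ uniq hs, (size hs <= n)%N,
  forall h, h \in hs -> irred h & forall h, irred h -> h \in hs].
Proof.
pose P r := `[< exists hs : seq M, [/\ uniq hs, size hs = r & forall h, h \in hs -> irred h] >].
have P0 : exists r, P r by exists 0%N; apply/asboolP; exists [::].
have Pb r : P r -> (r <= n)%N.
  by move=> /asboolP [hs [uh <- Hh]]; exact: irreducible_bound.
have [r /asboolP [hs [uh sh Hh]] rmax] := ex_maxnP P0 Pb.
exists hs; split=> //; first exact: irreducible_bound.
move=> h irr; apply: contraT => nh.
have := rmax r.+1; rewrite ltnn; apply; apply/asboolP; exists (h :: hs); split.
- by rewrite /= nh.
- by rewrite /= sh.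
- by move=> h'; rewrite inE => /predU1P [->|/Hh].
Qed.

(** The sum [ht] of the pairings with the generators is additive, and it is positive off 0 because
    the cone is full-dimensional, so decomposition terminates. *)
Lemma irreducible_sum m : Lam m -> exists r : seq M,
  (forall h, h \in r -> irred h) /\ m = \sum_(h <- r) h.
Proof.
have [r0 [u Eu]] := fan_rational (svalP s).
have Lge a i : Lam a -> 0 <= ipair a (u i) by move/(dual_monoid_gens _ Eu).
pose ht a := \sum_i `|ipair a (u i)|%N.
have htD a b : Lam a -> Lam b -> ht (a + b) = (ht a + ht b)%N.
  move=> da db; rewrite /ht -big_split; apply: eq_bigr => i _ /=.
  have := Lge a i da; have := Lge b i db; rewrite ipairDl.
  by move: (ipair a _) (ipair b _) => x y; clear; lia.
have ht0 a : Lam a -> ht a = 0%N -> a = 0.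
  move=> da /eqP; rewrite sum_nat_eq0 => /forallP H; apply: fd => x; rewrite Eu => -[c _ ->].
  rewrite pairing_sumr big1// => i _; rewrite pairingZr pairing_toQ.
  by have := H i; rewrite /= absz_eq0 => /eqP ->; rewrite mulr0.
have [N] := ubnP (ht m); elim: N => // N IH in m *; rewrite ltnS => hN dm.
have [->|m0] := eqVneq m 0; first by exists [::]; rewrite big_nil.
have [irr|nirr] := pselect (irred m).
  by exists [:: m]; rewrite big_seq1; split=> // h; rewrite inE => /eqP ->.
have [a [b [da db E a0 b0]]] : exists a b, [/\ Lam a, Lam b, m = a + b, a != 0 & b != 0].
  apply: contrapT => nex; apply: nirr; split=> // a b da db E.
  have [->|a0] := eqVneq a 0; first by left.
  have [->|b0] := eqVneq b 0; first by right.
  by case: nex; exists a, b.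
have pos c : Lam c -> c != 0 -> (0 < ht c)%N.
  by move=> dc; rewrite lt0n; apply: contra => /eqP /(ht0 c dc) ->.
have hE := htD a b da db; rewrite -E in hE.
have pa := pos a da a0; have pb := pos b db b0.
have la : (ht a < N)%N by move: hE hN pa pb; clear; lia.
have lb : (ht b < N)%N by move: hE hN pa pb; clear; lia.
have [r1 [H1 E1]] := IH a la da; have [r2 [H2 E2]] := IH b lb db.
rewrite E E1 E2.
exists (r1 ++ r2); rewrite big_cat; split=> // h; rewrite mem_cat => /orP []; [exact: H1|exact: H2].
Qed.

(** Strong convexity separates the opposite of each nonzero generator from the cone, which gives an
    element of the monoid positive on all nonzero generators; a multiple of it absorbs [m]. *)
Lemma dual_difference m : exists a, Lam a /\ Lam (m + a).
Proof.
have [r [u Eu]] := fan_rational (svalP s).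
have /choice [b Hb] : forall i, exists b, Lam b /\ (u i != 0 -> 0 < ipair b (u i)).
  move=> i; have [->|u0] := eqVneq (u i) 0; first by exists 0; split=> //; exact: dual_monoid0.
  have nu : ~ sval s (toQ (- u i)).
    rewrite toQN => H; have := fan_convex (svalP s) (gen_in i Eu) H.
    move/rowP => E; case/eqP: u0; apply/rowP => j; have := E j; rewrite !mxE => /eqP.
    by rewrite intr_eq0 => /eqP.
  have [a da] := cone_separation (fan_rational (svalP s)) nu.
  rewrite pairing_toQ ltrz0 ipairNr oppr_lt0 => ga; by exists a.
pose b0 := \sum_i b i.
have db0 : Lam b0.
  rewrite /b0; apply: big_ind => [||i _]; [exact: dual_monoid0|exact: dual_monoidD|by case: (Hb i)].
have bpos i : u i != 0 -> 1 <= ipair b0 (u i).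
  move=> u0; rewrite /b0 ipairC ipair_sumr (bigD1 i)//=.
  have := (Hb i).2 u0; rewrite ipairC.
  have : 0 <= \sum_(j < r | j != i) ipair (u i) (b j); last first.
    by move: (\sum_(_ < _ | _) _) (ipair _ _) => x y; clear; lia.
  apply: sumr_ge0 => j _; rewrite ipairC.
  by have /dual_monoid_gens := (Hb j).1 => /(_ _ _ Eu).
exists (b0 *+ (\max_i `|ipair m (u i)|)%N); split; first exact: dual_monoidMn.
apply/(dual_monoid_gens _ Eu) => i; rewrite ipairDl -scaler_nat natz ipairZl.
have [->|u0] := eqVneq (u i) 0; first by rewrite !ipair0r mulr0.
have := bpos i u0.
have := leq_bigmax_cond (F := fun i => `|ipair m (u i)|%N) i isT.
move: (\max_i _) (ipair m _) (ipair b0 _) => N x y; clear => /=; rewrite -lez_nat; nia.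
Qed.

(** There are at most [n] irreducible elements by smoothness, and at least [n] because they generate
    a lattice of rank [n]. The equation [r = n] is kept propositional and substituted later. *)
Lemma hilbert_matrix : exists r (H : 'M[int]_(r, n)), [/\ r = n,
  forall m, exists c, m = c *m H, forall i, Lam (row i H) &
  forall m, Lam m -> exists2 c : 'rV[int]_r, forall i, 0 <= c 0 i & m = c *m H].
Proof.
have [hs [uh sh Hh Hi]] := irreducible_list.
pose r := size hs; pose H := \matrix_(i < r) tnth (in_tuple hs) i.
have sumE (l : seq M) : (forall h, h \in l -> irred h) ->
    \sum_(h <- l) h = (\row_(i < r) (count_mem (tnth (in_tuple hs) i) l)%:Z) *m H.
  move=> Hl; rewrite mulmx_sum_row.
  rewrite (eq_bigr (fun i => (count_mem (tnth (in_tuple hs) i) l)%:Z *: tnth (in_tuple hs) i)); last first.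
    by move=> i _; rewrite mxE rowK.
  rewrite -(big_tuple _ _ (in_tuple hs) xpredT (fun x => (count_mem x l)%:Z *: x)) /=.
  elim: l Hl => [|h l IH] Hl.
    by rewrite big_nil big1// => x _; rewrite scale0r.
  rewrite big_cons IH; last by move=> x xl; apply: Hl; rewrite inE xl orbT.
  rewrite [RHS](eq_bigr (fun x => (h == x)%:Z *: x + (count_mem x l)%:Z *: x)); last first.
    by move=> x _ /=; rewrite PoszD scalerDl.
  rewrite big_split /=; congr (_ + _).
  rewrite (bigD1_seq h)//=; last by apply/Hi/Hl; rewrite mem_head.
  by rewrite eqxx scale1r big1 ?addr0// => x xh; rewrite eq_sym (negPf xh) scale0r.
have span m : exists c : 'rV[int]_r, m = c *m H.
  have [a [da dma]] := dual_difference m.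
  have [l1 [H1 E1]] := irreducible_sum da; have [l2 [H2 E2]] := irreducible_sum dma.
  exists (\row_i (count_mem (tnth (in_tuple hs) i) l2)%:Z - \row_i (count_mem (tnth (in_tuple hs) i) l1)%:Z).
  by rewrite mulmxBl -!sumE// -E1 -E2 addrK.
have /choice [G HG] := fun i : 'I_n => span (row i 1%:M).
pose G' := \matrix_(i < n) G i.
have GH : G' *m H = 1%:M by apply/row_matrixP => i; rewrite row_mul rowK -HG.
have rn : r = n.
  apply/eqP; rewrite eqn_leq sh /=.
  have : (map_mx (intr : int -> rat) G' *m map_mx intr H) = 1%:M by rewrite -map_mxM GH map_mx1.
  move/(congr1 (mxrank (F := _))); rewrite mxrank1 => E.
  by rewrite -{1}E; apply: leq_trans (mxrankM_maxr _ _) (rank_leq_row _).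
exists r, H; split=> // [i|m dm]; first by rewrite rowK; case: (Hh _ (mem_tnth i (in_tuple hs))).
have [l [Hl El]] := irreducible_sum dm.
exists (\row_(i < r) (count_mem (tnth (in_tuple hs) i) l)%:Z) => [i|]; first by rewrite mxE.
by rewrite -sumE.
Qed.

Lemma smooth_unimodular : exists2 U : 'M[int]_n, U \in unitmx &
  forall m, Lam m <-> forall i, 0 <= ipair m (row i U).
Proof.
have [r [H [rn span HL Hc]]] := hilbert_matrix; subst r.
have /choice [G HG] := fun i : 'I_n => span (row i 1%:M).
have GH : \matrix_(i < n) G i *m H = 1%:M.
  by apply/row_matrixP => i; rewrite row_mul rowK -HG.
have [_ uH] := mulmx1_unit GH.
have coord c i : ipair (c *m H) (row i (invmx H)^T) = c 0 i.
  rewrite -[in RHS](mulmxK uH c) [RHS]mxE; apply: eq_bigr => l _.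
  by rewrite !mxE.
exists (invmx H)^T; first by rewrite unitmx_tr unitmx_inv.
move=> m; split=> [/Hc [c c0 ->] i|]; first by rewrite coord.
have [c ->] := span m => Hp; rewrite mulmx_sum_row.
apply: big_ind => [||i _]; [exact: dual_monoid0|exact: dual_monoidD|].
have := Hp i; rewrite coord => /gez0_abs <-; rewrite -natz scaler_nat.
exact: dual_monoidMn.
Qed.

End Unimodular.

(** * Equivariant trivializations and ampleness *)

Section AffineCharts.
Variables (n : nat) (k : closedFieldType) (Sigma : fan n).
Local Notation X := (toric_variety k Sigma).
Local Notation M := 'rV[int]_n.
Local Notation An := (affine_nspace k n).
Variables (I : finType) (idx : I -> chart_index Sigma) (U : I -> 'M[int]_n).
Hypothesis unimodular : forall i, U i \in unitmx.
Hypothesis dualE : forall i m, dual_monoid (sval (idx i)) m <->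
  forall j, 0 <= ipair m (ray U i j).
Implicit Types (i : I) (m : M) (y : 'rV[k]_n).
Local Notation Lam i := (dual_monoid (sval (idx i))).

Lemma cocone_dual i j : Lam i (cocone U i j).
Proof. by apply/dualE => l; rewrite (cocone_ray unimodular); case: eqP. Qed.

Lemma charMz (x : M -> k) m (c : int) : is_char x -> x (c *: m) = x m ^ c.
Proof.
move=> cx; have [x0 xD] := cx.
have H (e : nat) : x (e%:Z *: m) = x m ^+ e.
  elim: e => [|e IH]; first by rewrite scale0r x0.
  by rewrite intS scalerDl scale1r xD IH exprS.
case: c => e; first by rewrite H.
by rewrite NegzE scaleNr charN// H exprnN.
Qed.

Lemma char_prod (x : M -> k) (J : Type) (r : seq J) (F : J -> M) : is_char x ->
  x (\sum_(j <- r) F j) = \prod_(j <- r) x (F j).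
Proof. by move=> [x0 xD]; exact: (big_morph x xD x0). Qed.

Lemma char_expand i (x : M -> k) m : is_char x ->
  x m = \prod_j x (cocone U i j) ^ ipair m (ray U i j).
Proof.
move=> cx; rewrite {1}(cocone_expand unimodular i m) char_prod//.
by apply: eq_bigr => j _; rewrite charMz.
Qed.

(** Natural exponents are used so that the monomial makes sense where coordinates vanish; for [m] in
    the dual monoid the absolute value changes nothing. *)
Definition mono i m y : k := \prod_j y 0 j ^+ `|ipair m (ray U i j)|%N.

Definition chart_fun i y m : k := if `[< Lam i m >] then mono i m y else 0.

Lemma chart_fun_hom i y : monoid_hom (sval (idx i)) (chart_fun i y).
Proof.
rewrite /chart_fun; split=> [|m m' dm dm'|m nm]; last by rewrite asboolF.
  rewrite asboolT /mono; last exact: dual_monoid0.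
  by rewrite big1// => j _; rewrite ipairC ipair0r expr0.
rewrite !asboolT//; last exact: dual_monoidD.
rewrite /mono -big_split; apply: eq_bigr => j _ /=.
rewrite -exprD ipairDl; congr (_ ^+ _).
have /dualE /(_ j) := dm; have /dualE /(_ j) := dm'.
by move: (ipair m _) (ipair m' _) => a b; clear; lia.
Qed.

Definition chart_of i y : toric_chart k (sval (idx i)) := exist _ _ (chart_fun_hom i y).

Definition phi i y : X := emb (chart_of i y).

Definition crd i (x : X) : An := \row_j chi (idx i) (cocone U i j) x.

Lemma phi_open i y : chart_open (idx i) (phi i y).
Proof. exact: emb_open. Qed.

Lemma chi_phi i m y : Lam i m -> chi (idx i) m (phi i y) = mono i m y.
Proof. by move=> dm; rewrite /phi chi_emb /= /chart_fun asboolT. Qed.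

Lemma mono_cocone i j y : mono i (cocone U i j) y = y 0 j.
Proof.
rewrite /mono (bigD1 j)//= (cocone_ray unimodular) eqxx expr1 big1 ?mulr1// => l lj.
by rewrite (cocone_ray unimodular) eq_sym (negPf lj) expr0.
Qed.

Lemma crd_phi i y : crd i (phi i y) = y.
Proof. by apply/rowP => j; rewrite mxE chi_phi ?mono_cocone//; exact: cocone_dual. Qed.

Lemma phi_crd i x : chart_open (idx i) x -> phi i (crd i x) = x.
Proof.
move=> [g ->]; rewrite /phi; congr emb; apply: chart_point_eq => m dm.
rewrite /= /chart_fun asboolT// /mono {2}(cocone_expand unimodular i m).
have -> (l : seq 'I_n) : sval g (\sum_(j <- l) ipair m (ray U i j) *: cocone U i j) =
    \prod_(j <- l) sval g (cocone U i j) ^+ `|ipair m (ray U i j)|.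
  have dj j : Lam i (ipair m (ray U i j) *: cocone U i j).
    have /dualE /(_ j) /gez0_abs <- := dm; rewrite -natz scaler_nat.
    by apply: dual_monoidMn; exact: cocone_dual.
  elim: l => [|j l IH]; first by rewrite !big_nil chart0.
  rewrite !big_cons chartD//; last first.
    by apply: big_ind => //; [exact: dual_monoid0|exact: dual_monoidD].
  rewrite IH; congr (_ * _); rewrite -chartMn; last exact: cocone_dual.
  have /dualE /(_ j) /gez0_abs E := dm.
  by rewrite -{1}E -natz scaler_nat.
by apply: eq_bigr => j _; rewrite mxE chi_emb.
Qed.

Lemma phi_morph i : is_morph (phi i : An -> X).
Proof.
apply: (is_morph_comp (f := chart_of i : An -> toric_chart k (sval (idx i)))); last exact: emb_morph.
apply: is_morph_affine => _ [m dm ->]; apply: affine_regular_gen.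
have -> : (fun g : chart_point k (sval (idx i)) => sval g m) \o chart_of i = (fun y => mono i m y).
  by apply/funext => y; rewrite /= /chart_fun asboolT.
apply: gen_alg_prod => j; apply: gen_algX; apply: gen_alg_gen; by exists j.
Qed.

Lemma crd_pull i (W : set An) : open W ->
  open (chart_open (idx i) `&` crd i @^-1` W) /\
  forall h, regular An W h -> regular X (chart_open (idx i) `&` crd i @^-1` W) (h \o crd i).
Proof.
apply: affine_pull; first exact: chart_openP.
move=> _ [j ->]; rewrite (_ : _ \o _ = chi (idx i) (cocone U i j)).
  by apply: chi_regular; exact: cocone_dual.
by apply/funext => x; rewrite /= mxE.
Qed.

Definition torus_char i y : M -> k := fun m => \prod_j y 0 j ^ ipair m (ray U i j).

Lemma torus_char_char i y : big_torus y -> is_char (torus_char i y).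
Proof.
move=> Ty; split=> [|m m'].
  by rewrite /torus_char big1// => j _; rewrite ipairC ipair0r expr0z.
rewrite /torus_char -big_split; apply: eq_bigr => j _ /=.
by rewrite ipairDl expfzDr.
Qed.

Lemma crd_tpt i s x : is_char x -> crd i (tpt s x) = \row_j x (cocone U i j).
Proof.
move=> cx; apply/rowP => j; rewrite !mxE chi_tpt//; exact: cocone_dual.
Qed.

Lemma phi_torus i s y : big_torus y -> phi i y = tpt s (torus_char i y).
Proof.
move=> Ty; have cx := torus_char_char i Ty.
rewrite -[RHS](@phi_crd i); last exact: tpt_open.
congr (phi i _); rewrite crd_tpt//; apply/rowP => j; rewrite mxE /torus_char.
rewrite (bigD1 j)//= (cocone_ray unimodular) eqxx expr1z big1 ?mulr1// => l lj.
by rewrite (cocone_ray unimodular) eq_sym (negPf lj) expr0z.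
Qed.

Lemma tpt_phi i s x : is_char x ->
  big_torus (\row_j x (cocone U i j)) /\ tpt s x = phi i (\row_j x (cocone U i j)).
Proof.
move=> cx; split; first by move=> j; rewrite mxE char_neq0.
by rewrite -(crd_tpt i s cx) phi_crd//; exact: tpt_open.
Qed.

Section Trivialization.
Variable L : line_bundle X.
Local Notation C := (lb_cover L).

Lemma local_trivialization : exists a : lb_index L -> I -> X -> k,
  [/\ forall c i, regular X (C c `&` chart_open (idx i)) (a c i),
      forall c i x, C c x -> chart_open (idx i) x -> a c i x != 0 &
      forall c d i x, C c x -> C d x -> chart_open (idx i) x ->
        lb_trans L c d x * a d i x = a c i x].
Proof.
have /choice [e He] : forall i, exists e : lb_index L -> An -> k,
  [/\ forall c, regular An (phi i @^-1` C c) (e c),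
      forall c y, C c (phi i y) -> e c y != 0 &
      forall c d y, C c (phi i y) -> C d (phi i y) ->
        lb_trans L c d (phi i y) * e d y = e c y].
  move=> i; have [F EF] := is_morphP (@phi_morph i).
  have [e [H1 H2 H3]] := affine_picard (lb_pullback F L).
  exists e; split=> [c|c y Cy|c d y Cc Cd].
  - by have := H1 c; rewrite /= EF.
  - by apply: H2; rewrite /= /preimage /= EF.
  - by have := H3 c d y; rewrite /= /preimage /= EF; apply.
exists (fun c i x => e i c (crd i x)); split.
- move=> c i; have [H1 _ _] := He i.
  have [oW _] := @phi_morph i _ (@lb_open _ _ L c).
  have [oV rV] := crd_pull i oW.
  have sub x : (C c `&` chart_open (idx i)) x -> (chart_open (idx i) `&` crd i @^-1` (phi i @^-1` C c)) x.
    by move=> [Cx ix]; split=> //; rewrite /preimage /= phi_crd.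
  apply: (regular_sub oV _ sub (rV _ (H1 c))).
  by apply: openI; [exact: lb_open|exact: chart_openP].
- by move=> c i x Cx ix; have [_ H2 _] := He i; apply: H2; rewrite phi_crd.
- move=> c d i x Cc Cd ix; have [_ _ H3] := He i.
  by have := H3 c d (crd i x); rewrite phi_crd//; apply.
Qed.

(** Over each chart [L] is trivial. Two trivializations differ on the torus by an invertible
    function, which is a scalar times a character; the scalar is absorbed and the exponent, negated,
    is [mm i]. *)
Lemma toric_trivialization : I -> exists (a : lb_index L -> I -> X -> k) (mm : I -> M),
  [/\ forall c i, regular X (C c `&` chart_open (idx i)) (a c i),
      forall c i x, C c x -> chart_open (idx i) x -> a c i x != 0,
      forall c d i x, C c x -> C d x -> chart_open (idx i) x ->
        lb_trans L c d x * a d i x = a c i x &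
      forall c i j s x, is_char x -> C c (tpt s x) ->
        a c i (tpt s x) = x (mm j - mm i) * a c j (tpt s x)].
Proof.
move=> i0; have [a [a1 a2 a3]] := local_trivialization.
have /choice [c0 Hc0] := lb_covers L.
pose rho i x := a (c0 x) i x / a (c0 x) i0 x.
have rhoE c i x : C c x -> chart_open (idx i) x -> chart_open (idx i0) x ->
    rho i x = a c i x / a c i0 x.
  move=> Cx ix ix0; rewrite /rho -(a3 _ _ i x (Hc0 x) Cx ix) -(a3 _ _ i0 x (Hc0 x) Cx ix0).
  by rewrite -mulf_div divff ?mul1r//; exact: lb_neq0.
have /choice [gm Hgm] : forall i, exists gm : k * M, gm.1 != 0 /\
    forall c s x, is_char x -> C c (tpt s x) ->
      a c i (tpt s x) = gm.1 * x gm.2 * a c i0 (tpt s x).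
  move=> i; pose W := phi i @^-1` chart_open (idx i0).
  have oW0 : open (chart_open (idx i0) : set X) by exact: chart_openP.
  have [oW _] := @phi_morph i _ oW0.
  have [| | |g [e [g0 E]]] := @torus_unit k n W (rho i \o phi i) oW.
  - by move=> y Ty; rewrite /W /preimage /= (phi_torus i (idx i0) Ty); apply: tpt_open; exact: torus_char_char.
  - apply: regular_local => // y Wy; have Cy := Hc0 (phi i y).
    have oV : open (C (c0 (phi i y)) `&` (chart_open (idx i) `&` chart_open (idx i0))).
      by apply: openI; [exact: lb_open|apply: openI; exact: chart_openP].
    have [oV' rV] := @phi_morph i _ oV.
    exists (phi i @^-1` (C (c0 (phi i y)) `&` (chart_open (idx i) `&` chart_open (idx i0)))).
    split=> //; first by split=> //; split=> //; exact: phi_open.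
      by move=> z [_ []].
    apply: (rV (rho i)); apply: (@regular_ext _ _ _ (fun x => a (c0 (phi i y)) i x / a (c0 (phi i y)) i0 x)).
      by move=> x; rewrite inE => -[Cx [ix ix0]]; rewrite (rhoE (c0 (phi i y))).
    apply: regular_div => //.
    + apply: regular_sub (a1 _ _) => //; first by apply: openI; [exact: lb_open|exact: chart_openP].
      by move=> x [? []].
    + apply: regular_sub (a1 _ _) => //; first by apply: openI; [exact: lb_open|exact: chart_openP].
      by move=> x [? []].
    + by move=> x [Cx [ix ix0]]; exact: a2.
  - move=> y Ty; have ty : chart_open (idx i0) (phi i y).
      by rewrite (phi_torus i (idx i0) Ty); apply: tpt_open; exact: torus_char_char.
    by rewrite /= /rho mulf_neq0 ?invr_eq0//; apply: a2 => //; exact: phi_open.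
  exists (g, \sum_j e j *: cocone U i j); split=> // c s x cx Cx.
  have [Ty Ex] := tpt_phi i s cx.
  have := E _ Ty; rewrite /= -Ex (rhoE c)//; try exact: tpt_open.
  move=> /(canRL (divfK _)) ->; last by apply: a2 => //; exact: tpt_open.
  congr (_ * _ * _); rewrite char_prod//; apply: eq_bigr => j _.
  by rewrite charMz// mxE.
exists (fun c i x => a c i x / (gm i).1), (fun i => - (gm i).2); split.
- move=> c i; apply: regular_div; first by apply: openI; [exact: lb_open|exact: chart_openP].
  + exact: a1.
  + exact: regular_cst.
  + by move=> x _; case: (Hgm i).
- by move=> c i x Cx ix; rewrite mulf_neq0 ?invr_eq0 ?a2//; case: (Hgm i).
- by move=> c d i x Cc Cd ix; rewrite mulrA a3.
- move=> c i j s x cx Cx; have [gi0 Ei] := Hgm i; have [gj0 Ej] := Hgm j.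
  rewrite (Ei c s x cx Cx) (Ej c s x cx Cx) opprK cx.2 charN//.
  by field; rewrite gi0 gj0 char_neq0.
Qed.

End Trivialization.
End AffineCharts.

(** * Convexity from a projective embedding *)

Section Ampleness.
Variables (n : nat) (k : closedFieldType) (Sigma : fan n).
Local Notation X := (toric_variety k Sigma).
Local Notation M := 'rV[int]_n.
Local Notation An := (affine_nspace k n).
Variables (I : finType) (idx : I -> chart_index Sigma) (U : I -> 'M[int]_n).
Hypothesis unimodular : forall i, U i \in unitmx.
Hypothesis dualE : forall i m, dual_monoid (sval (idx i)) m <->
  forall j, 0 <= ipair m (ray U i j).
Local Notation Lam i := (dual_monoid (sval (idx i))).
Local Notation phi := (phi dualE).

Lemma chart_regular_laurent i (h : X -> k) : regular X (chart_open (idx i)) h ->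
  exists l, lsupp (Lam i) l /\ forall g : chart_point k (sval (idx i)), h (emb g) = leval l (sval g).
Proof.
move=> rh; have oU : open (chart_open (idx i) : set X) by exact: chart_openP.
have [_ rW] := @phi_morph _ _ _ _ _ _ dualE i _ oU.
have Ga : gen_alg [set f | exists j, f = fun y : 'rV[k]_n => y 0 j] (h \o phi i).
  apply: affine_regularT; apply: (regular_sub _ _ _ (rW h rh)); [|exact: openT|].
    by have [] := @phi_morph _ k _ _ _ _ dualE i _ oU.
  by move=> y _; exact: phi_open.
have Gc : gen_alg [set f : chart_point k (sval (idx i)) -> k |
    exists2 m, Lam i m & f = fun g => sval g m]
    ((h \o phi i) \o (fun g : chart_point k (sval (idx i)) => crd idx U i (emb g))).
  elim: Ga => [_ [j ->]|c|f g _ Gf _ Gg|f g _ Gf _ Gg].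
  - rewrite (_ : _ \o _ = fun g => sval g (cocone U i j)).
      by apply: gen_chi; exact: cocone_dual.
    by apply/funext => g; rewrite /= mxE chi_emb.
  - exact: gen_alg_cst.
  - exact: gen_algD.
  - exact: gen_algM.
have [l [sl El]] := chart_laurent Gc; exists l; split=> // g.
by rewrite -El /= phi_crd//; exact: emb_open.
Qed.

Lemma laurent_phi (l : seq (k * M)) i (y : 'rV[k]_n) : lsupp (Lam i) l ->
  leval l (sval (chart_of dualE i y)) = \sum_(c <- l) c.1 * mono U i c.2 y.
Proof.
move=> sl; rewrite /leval big_seq [RHS]big_seq; apply: eq_bigr => c /sl dc.
by rewrite /= /chart_fun asboolT.
Qed.

Definition axis (r : 'I_n) (t : k) : 'rV[k]_n := \row_j ((j == r)%:R * t).

Definition axis_poly i (r : 'I_n) (l : seq (k * M)) : {poly k} :=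
  \sum_(c <- l) c.1 *: (if [forall j, (j != r) ==> (ipair c.2 (ray U i j) == 0)]
    then 'X^`|ipair c.2 (ray U i r)| else 0).

Lemma mono_axis i r m (t : k) : mono U i m (axis r t) =
  (if [forall j, (j != r) ==> (ipair m (ray U i j) == 0)] then t ^+ `|ipair m (ray U i r)| else 0).
Proof.
rewrite /mono; case: ifP => [/forallP H|/negbT].
  rewrite (bigD1 r)//= mxE eqxx mul1r big1 ?mulr1// => j jr.
  by have := H j; rewrite jr /= => /eqP ->; rewrite expr0.
rewrite negb_forall => /existsP [j]; rewrite negb_imply => /andP [jr nz].
rewrite (bigD1 j)//= mxE (negPf jr) mul0r expr0n absz_eq0 (negPf nz).
by rewrite mul0r.
Qed.

Lemma axis_polyE i r (l : seq (k * M)) t : lsupp (Lam i) l ->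
  leval l (sval (chart_of dualE i (axis r t))) = (axis_poly i r l).[t].
Proof.
move=> sl; rewrite laurent_phi// horner_sum; apply: eq_bigr => c _.
by rewrite hornerZ mono_axis; case: ifP; rewrite ?hornerXn ?horner0.
Qed.

Lemma axis_poly1 i r (l : seq (k * M)) : lsupp (Lam i) l -> (axis_poly i r l)`_1 = lcoef l (cocone U i r).
Proof.
move=> sl; rewrite coef_sum /lcoef [RHS]big_mkcond big_seq [RHS]big_seq.
apply: eq_bigr => c /sl /dualE dc; rewrite coefZ.
have -> : (c.2 == cocone U i r) = [forall j, (j != r) ==> (ipair c.2 (ray U i j) == 0)] && (ipair c.2 (ray U i r) == 1).
  apply/eqP/andP => [->|[/forallP H /eqP E]].
    split; last by rewrite (cocone_ray unimodular) eqxx.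
    by apply/forallP => j; apply/implyP => jr; rewrite (cocone_ray unimodular) [r == j]eq_sym (negPf jr).
  rewrite (cocone_expand unimodular i c.2) (bigD1 r)//= E scale1r big1 ?addr0// => j jr.
  by have := H j; rewrite jr /= => /eqP ->; rewrite scale0r.
case: ifP => _ /=; last by rewrite coef0 mulr0.
rewrite coefXn; have := dc r; move: (ipair _ _) => z z0.
have -> : (1%N == `|z|%N) = (z == 1) by move: z0; clear; lia.
by case: eqP; rewrite ?mulr1 ?mulr0.
Qed.

Lemma laurent_origin (l : seq (k * M)) i : lsupp (Lam i) l ->
  leval l (sval (chart_of dualE i 0)) = lcoef l 0.
Proof.
move=> sl; rewrite laurent_phi// /lcoef [RHS]big_mkcond big_seq [RHS]big_seq.
apply: eq_bigr => c /sl /dualE dc; case: eqP => [->|ne].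
  by rewrite /mono big1 ?mulr1// => j _; rewrite ipairC ipair0r expr0.
have [j nz] : exists j, ipair c.2 (ray U i j) != 0.
  apply: contrapT => /forallNP H; apply: ne; rewrite (cocone_expand unimodular i c.2) big1// => j _.
  by have /negP/negPn/eqP -> := H j; rewrite scale0r.
by rewrite /mono (bigD1 j)//= mxE expr0n absz_eq0 (negPf nz) mul0r mulr0.
Qed.

Variable L : line_bundle X.
Local Notation C := (lb_cover L).
Variables (a : lb_index L -> I -> X -> k) (mm : I -> M).
Hypothesis a_reg : forall c i, regular X (C c `&` chart_open (idx i)) (a c i).
Hypothesis a_neq0 : forall c i x, C c x -> chart_open (idx i) x -> a c i x != 0.
Hypothesis a_trans : forall c d i x, C c x -> C d x -> chart_open (idx i) x ->
  lb_trans L c d x * a d i x = a c i x.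
Hypothesis a_torus : forall c i j s x, is_char x -> C c (tpt s x) ->
  a c i (tpt s x) = x (mm j - mm i) * a c j (tpt s x).

Variables (d N : nat) (f : morph X (proj_space k N)).
Hypothesis d_gt0 : (0 < d)%N.
Hypothesis fc : closed_embedding f.
Hypothesis fiso : lb_iso (lb_exp L d%:Z) (lb_pullback f (O1 k N)).

(** [sec j i] is the [j]-th homogeneous coordinate pulled back along [f], seen as a section of the
    [d]-th power of [L] and divided by the frame over the chart [i]. *)
Lemma pulled_sections : exists sec : 'I_N.+1 -> I -> X -> k,
  [/\ forall j i, regular X (chart_open (idx i)) (sec j i),
      forall j i x, chart_open (idx i) x -> (hcover j (f x) <-> sec j i x != 0),
      forall j l i x, chart_open (idx i) x -> hcover l (f x) ->
        htrans l j (f x) = sec j i x / sec l i x &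
      forall j i i' s x, is_char x ->
        sec j i (tpt s x) = x (d%:Z *: (mm i - mm i')) * sec j i' (tpt s x)].
Proof.
have [al [r1 r2 r3]] := fiso.
have /choice [c0 Hc] := lb_covers L.
have /choice [l0 Hl] : forall x, exists l, hcover l (f x) by move=> x; exact: hcover_covers.
pose sec j i x := (a (c0 x) i x ^+ d)^-1 * al (c0 x) (l0 x) x * htrans (l0 x) j (f x).
have secE c l j i x : C c x -> hcover l (f x) -> chart_open (idx i) x ->
    sec j i x = (a c i x ^+ d)^-1 * al c l x * htrans l j (f x).
  move=> Cc Cl ix; rewrite /sec; have Hcx := Hc x; have Hlx := Hl x.
  have := r3 (c0 x) c (l0 x) l x Hcx Cc Hlx Cl => /= E.
  rewrite -(a_trans Hcx Cc ix) exprMn invfM.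
  have -> : htrans (l0 x) j (f x) = htrans (l0 x) l (f x) * htrans l j (f x).
    by rewrite /htrans [RHS]mulrC mulrA divfK.
  have t0 : lb_trans L (c0 x) c x ^+ d != 0 by rewrite expf_neq0// lb_neq0.
  have -> : al c l x = al (c0 x) (l0 x) x * htrans (l0 x) l (f x) / lb_trans L (c0 x) c x ^+ d.
    rewrite -[htrans _ _ _]/(lb_trans (O1 k N) (l0 x) l (f x)) -E.
    by rewrite -[lb_trans L _ _ _ ^ _]/(lb_trans L (c0 x) c x ^+ d) mulrC mulKf.
  by ring.
exists sec; split.
- move=> j i; apply: regular_local; first exact: chart_openP.
  move=> x ix; have Hcx := Hc x; have Hlx := Hl x.
  have oV : open (f @^-1` hcover (l0 x)).
    by have [] := morph_is_morph f (@hcover_open k N (l0 x)).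
  have oU : open (chart_open (idx i) : set X) by exact: chart_openP.
  have oC := @lb_open _ _ L (c0 x).
  have oW := openI (openI oC oU) oV.
  exists ((C (c0 x) `&` chart_open (idx i)) `&` f @^-1` hcover (l0 x)); split=> //.
    by move=> y [[]].
  apply: (@regular_ext _ _ _ (fun y => (a (c0 x) i y ^+ d)^-1 * al (c0 x) (l0 x) y * htrans (l0 x) j (f y))).
    by move=> y; rewrite inE => -[[Cy iy] ly]; rewrite (secE (c0 x) (l0 x)).
  have ra : regular X ((C (c0 x) `&` chart_open (idx i)) `&` f @^-1` hcover (l0 x)) (a (c0 x) i).
    by refine (regular_sub (openI oC oU) oW _ (@a_reg (c0 x) i)) => y [].
  apply: regularM => //; first apply: regularM => //.
  + apply: regularV => //; first exact: regularX.
    by move=> y [[Cy iy] _]; rewrite expf_neq0// a_neq0.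
  + by refine (regular_sub (openI oC oV) oW _ (r1 (c0 x) (l0 x))) => y [[]].
  + have [_ rf] := morph_is_morph f (@hcover_open k N (l0 x)).
    by refine (regular_sub oV oW _ (rf _ (@htrans_regular1 k N (l0 x) j))) => y [].
- move=> j i x ix; have Hcx := Hc x; have Hlx := Hl x.
  rewrite /sec mulf_eq0 mulf_eq0 invr_eq0 (negPf (expf_neq0 d (a_neq0 Hcx ix))) /=.
  rewrite (negPf (r2 _ _ _ Hcx Hlx)) /= /htrans mulf_eq0 invr_eq0.
  by rewrite [hcoord _ (l0 x) == 0](negPf Hlx) orbF.
- move=> j l i x ix lx; have Hcx := Hc x.
  rewrite !(secE (c0 x) l)// -mulf_div divff ?mul1r; last first.
    by rewrite mulf_neq0// ?r2// invr_eq0 expf_neq0// a_neq0.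
  by rewrite {3}/htrans divff ?divr1.
- move=> j i i' s x cx; have Hcx := Hc (tpt s x).
  rewrite /sec (@a_torus _ i i' _ _ cx Hcx) exprMn invfM (charMz _ _ cx) -!mulrA; congr (_ * _).
  by rewrite -exprVn -charN// opprB.
Qed.

(** Polynomials without linear term form a subalgebra, so along a curve with such coordinates no
    algebraic expression acquires a linear term. *)
Lemma curve_gen_alg1 (T : Type) (G : set (T -> k)) (c : k -> T) (r : {poly k}) (D : k -> Prop) :
  r`_1 = 0 -> (forall t, D t -> r.[t] != 0) ->
  (forall g, G g -> exists (p : {poly k}) (e : nat), p`_1 = 0 /\ forall t, D t -> g (c t) = p.[t] / r.[t] ^+ e) ->
  forall h, gen_alg G h ->
    exists (p : {poly k}) (e : nat), p`_1 = 0 /\ forall t, D t -> h (c t) = p.[t] / r.[t] ^+ e.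
Proof.
move=> r1 Dr HG h.
have rX e : (r ^+ e)`_1 = 0.
  elim: e => [|e IH]; first by rewrite expr0 coef1.
  by rewrite exprS coef1M IH r1 mul0r mulr0 addr0.
elim=> {h}[g /HG//|x|h g _ [p [e [p1 Ef]]] _ [q [e' [q1 Eg]]]|h g _ [p [e [p1 Ef]]] _ [q [e' [q1 Eg]]]].
- by exists x%:P, 0%N; rewrite coefC; split=> // t _; rewrite hornerC expr0 divr1.
- exists (p * r ^+ e' + q * r ^+ e), (e + e')%N; split.
    by rewrite coefD !coef1M !rX p1 q1 !(mul0r, mulr0, addr0).
  move=> t Dt; rewrite Ef// Eg// hornerD !hornerM !horner_exp addf_div ?expf_neq0 ?Dr//.
  by rewrite exprD.
- exists (p * q), (e + e')%N; split; first by rewrite coef1M p1 q1 mul0r mulr0 addr0.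
  by move=> t Dt; rewrite Ef// Eg// hornerM mulf_div exprD.
Qed.

(* If every section had zero r-th linear term at the fixed point, f would not be immersive there. *)
Lemma linear_term (sec : 'I_N.+1 -> I -> X -> k) (l : 'I_N.+1 -> seq (k * M)) i r :
  (forall j x, chart_open (idx i) x -> (hcover j (f x) <-> sec j i x != 0)) ->
  (forall j l x, chart_open (idx i) x -> hcover l (f x) ->
        htrans l j (f x) = sec j i x / sec l i x) ->
  (forall j, lsupp (Lam i) (l j) /\
     forall g : chart_point k (sval (idx i)), sec j i (emb g) = leval (l j) (sval g)) ->
  exists j, lcoef (l j) (cocone U i r) != 0.
Proof.
move=> s2 s3 Hl; apply: contrapT => /forallNP H.
pose q j := axis_poly i r (l j).
have q1 j : (q j)`_1 = 0.
  by rewrite axis_poly1; [apply/eqP; have /negP/negPn := H j|case: (Hl j)].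
have secE j t : sec j i (phi i (axis r t)) = (q j).[t].
  by have [sl E] := Hl j; rewrite E axis_polyE.
have ix t : chart_open (idx i) (phi i (axis r t)) by exact: phi_open.
have [l0 Hl0] := hcover_covers (f (phi i (axis r 0))).
have ql0 : (q l0).[0] != 0 by rewrite -secE; apply/s2.
pose z t : affine_nspace k N := \row_j ((q (lift l0 j)).[t] / (q l0).[t]).
have fz t : (q l0).[t] != 0 -> f (phi i (axis r t)) = proj_chart l0 (z t).
  rewrite -secE => /s2 hl; have hl' := hl (ix t); rewrite -[LHS](proj_invK hl').
  congr (proj_chart l0 _); apply/rowP => j; rewrite !mxE (s3 _ _ _ (ix t) hl').
  by rewrite !secE.
have zalg h : gen_alg [set f : 'rV[k]_N -> k | exists i, f = fun y => y 0 i] h ->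
    exists (p : {poly k}) (e : nat), p`_1 = 0 /\ forall t, (q l0).[t] != 0 -> h (z t) = p.[t] / (q l0).[t] ^+ e.
  apply: curve_gen_alg1 => // _ [j ->]; exists (q (lift l0 j)), 1%N; split=> // t qt.
  by rewrite mxE expr1.
have [_ _ fst] := fc.
have oU : open (chart_open (idx i) : set X) by exact: chart_openP.
have dr : Lam i (cocone U i r) by exact: cocone_dual.
have [V [h [oV Vx rh sV Eh]]] := fst _ _ _ oU (@chi_regular _ _ _ (idx i) _ dr) (ix 0).
rewrite fz// in Vx.
have [oV' rV'] := proj_chart_morph l0 oV.
have [_ [b [Gb _ b0 sb]]] := oV' _ Vx.
have [_ [u [v [Gu Gv _ v0 Euv]]]] := rV' h rh _ Vx.
have [pb [eb [_ Eb]]] := zalg b Gb.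
have [pu [eu [pu1 Eu]]] := zalg u Gu; have [pv [ev [pv1 Ev]]] := zalg v Gv.
have pv0 : pv.[0] != 0 by move: v0; rewrite Ev// mulf_eq0 negb_or => /andP [].
have pb0 : pb.[0] != 0 by move: b0; rewrite Eb// mulf_eq0 negb_or => /andP [].
have nz (p : {poly k}) : p.[0] != 0 -> p != 0 by apply: contraNneq => ->; rewrite horner0.
have E : 'X * (pv * q l0 ^+ eu) = pu * q l0 ^+ ev.
  apply: (@poly_cofinite_eq _ (q l0 * pb * pv)); first by rewrite !mulf_neq0// nz.
  move=> t; rewrite !hornerM !mulf_eq0 !negb_or => /andP [/andP [qt bt] vt].
  have bz : b (z t) != 0 by rewrite Eb// mulf_neq0// invr_eq0 expf_neq0.
  have vz : v (z t) != 0 by rewrite Ev// mulf_neq0// invr_eq0 expf_neq0.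
  have Vt : V (proj_chart l0 (z t)) := sb _ Logic.I bz.
  have := Eh (phi i (axis r t)); rewrite fz// => /(_ Vt).
  rewrite chi_phi; last exact: cocone_dual.
  rewrite mono_cocone// mxE eqxx mul1r => Et.
  have := Euv (z t) Vt Logic.I vz; rewrite /= -Et Eu// Ev// => Et'.
  rewrite hornerX !horner_exp {1}Et'.
  have Qu := expf_neq0 eu qt; have Qv := expf_neq0 ev qt.
  by field; rewrite Qu Qv vt.
(* The linear coefficient is nonzero on the left and zero on the right. *)
have := congr1 (fun p : {poly k} => p`_1) E.
have qX e : (q l0 ^+ e)`_1 = 0.
  elim: e => [|e IH]; first by rewrite expr0 coef1.
  by rewrite exprS coef1M IH q1 mul0r mulr0 addr0.
rewrite coefXM /= [RHS]coef1M qX pu1 mul0r mulr0 addr0 -!horner_coef0 hornerM horner_exp => /eqP.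
by rewrite mulf_eq0 (negPf pv0) expf_eq0 (negPf ql0) andbF.
Qed.

(** A change of chart shifts exponents by [d] times [mm i' - mm i], and exponents occurring over
    [i'] lie in its dual monoid. A section nonzero at the fixed point gives the inequality; a
    section whose linear term there is dual to [r'] gives the equality case. *)
Lemma ample_convex i i' r :
  0 <= ipair (mm i' - mm i) (ray U i' r) /\
  (ipair (mm i' - mm i) (ray U i' r) = 0 -> forall r', 0 <= ipair (cocone U i r') (ray U i' r)).
Proof.
have [sec [s1 s2 s3 s4]] := pulled_sections.
have /choice [l Hl] : forall ji : 'I_N.+1 * I, exists l, lsupp (Lam ji.2) l /\
    forall g : chart_point k (sval (idx ji.2)), sec ji.1 ji.2 (emb g) = leval l (sval g).
  by move=> [j i0]; exact: chart_regular_laurent.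
have shift j m : lcoef (l (j, i)) m = lcoef (l (j, i')) (m + d%:Z *: (mm i' - mm i)).
  rewrite -(lcoef_shift (d%:Z *: (mm i' - mm i)) (l (j, i))); apply: lcoef_eq => x cx.
  have [sl El] := Hl (j, i); have [sl' El'] := Hl (j, i').
  rewrite leval_shift// -(leval_torus cx sl) -(leval_torus cx sl') -El -El' /=.
  have -> : emb (torus_chart (sval (idx i')) cx) = tpt (idx i) x.
    by rewrite (tptE _ cx); exact: tor_indep.
  rewrite (s4 j i' i)//; congr (_ * _); congr (sec j i _).
  by rewrite (tptE _ cx).
have supp j m : lcoef (l (j, i)) m != 0 -> 0 <= ipair (m + d%:Z *: (mm i' - mm i)) (ray U i' r).
  rewrite shift => /lcoef_mem [c cl <-]; have [sl' _] := Hl (j, i').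
  by have /dualE := sl' c cl; apply.
have ge r' : exists2 z : int, z = ipair (cocone U i r') (ray U i' r) & 0 <= z + d%:Z * ipair (mm i' - mm i) (ray U i' r).
  exists (ipair (cocone U i r') (ray U i' r)) => //.
  have [j /supp] := @linear_term sec (fun j => l (j, i)) i r'
    (fun j x => s2 j i x) (fun j l x => s3 j l i x) (fun j => Hl (j, i)).
  by rewrite ipairDl ipairZl.
have ge0 : 0 <= ipair (mm i' - mm i) (ray U i' r).
  have [j /s2 H] := hcover_covers (f (phi i 0)).
  have := H i (phi_open _ _ _); have [sl El] := Hl (j, i); rewrite /phi El laurent_origin// => /supp.
  by rewrite add0r ipairZl pmulr_rge0.
split=> // E0 r'; have [z <-] := ge r'; by rewrite E0 mulr0 addr0.
Qed.

End Ampleness.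

(** * Weights of polyvector fields *)

Section PolyvectorTheory.
Variables (k : fieldType) (X : kspace k) (p : nat).
Implicit Types (x : X) (U V : set X) (f g : X -> k) (F : 'I_p -> X -> k).

Lemma regular_sum (I : Type) (r : seq I) (F : I -> X -> k) U : open U ->
  (forall i, regular X U (F i)) -> regular X U (fun x => \sum_(i <- r) F i x).
Proof.
move=> oU rF; elim: r => [|i r IH].
  by under eq_fun do rewrite big_nil; exact: regular_cst.
by under eq_fun do rewrite big_cons; exact: regularD.
Qed.

Lemma regular_at_lin x (c : k) f g : regular_at x f -> regular_at x g ->
  regular_at x (fun y => c * f y + g y).
Proof.
move=> [U [oU Ux rf]] [V [oV Vx rg]]; exists (U `&` V); have oW := openI oU oV.
split=> //; apply: regularD => //; last by refine (regular_sub oV oW _ rg) => y [].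
apply: regularM => //; first exact: regular_cst.
by refine (regular_sub oU oW _ rf) => y [].
Qed.

Lemma regular_atM x f g : regular_at x f -> regular_at x g ->
  regular_at x (fun y => f y * g y).
Proof.
move=> [U [oU Ux rf]] [V [oV Vx rg]]; exists (U `&` V); have oW := openI oU oV.
split=> //; apply: regularM => //; first by refine (regular_sub oU oW _ rf) => y [].
by refine (regular_sub oV oW _ rg) => y [].
Qed.

Lemma tangent_vector_eq x t t' : (forall f, regular_at x f -> t' f = t f) ->
  tangent_vector x t -> tangent_vector x t'.
Proof.
move=> E [t1 t2 t3]; split=> [f g rf rg|c f g rf rg|f g rf rg].
- by rewrite !E//; exact: t1.
- by rewrite !E ?t2//; exact: regular_at_lin.
- by rewrite !E ?t3//; exact: regular_atM.
Qed.

Lemma tangent_vector_sum x (I : Type) (r : seq I) (c : I -> k) t :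
  (forall i, tangent_vector x (t i)) ->
  tangent_vector x (fun f => \sum_(i <- r) t i f * c i).
Proof.
move=> tv; split=> [f g rf rg E|d f g rf rg|f g rf rg].
- by apply: eq_bigr => i _; have [t1 _ _] := tv i; rewrite (t1 f g).
- rewrite mulr_sumr -big_split; apply: eq_bigr => i _ /=; have [_ t2 _] := tv i.
  by rewrite t2// mulrDl mulrA.
- rewrite !mulr_sumr -big_split; apply: eq_bigr => i _ /=; have [_ _ t3] := tv i.
  by rewrite t3// mulrDl !mulrA.
Qed.

Lemma tangent_vector_cst x t c : tangent_vector x t -> t (fun=> c) = 0.
Proof.
move=> [_ t2 t3]; have r1 d : regular_at x (fun=> d) by exists setT; split=> //; [exact: openT|exact: regular_cst].
have t0 : t (fun=> 0) = 0.
  have := t2 1 (fun=> 0) (fun=> 0) (r1 _) (r1 _).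
  rewrite (_ : (fun _ => _) = fun=> 0); last by apply/funext => y; rewrite mulr0 addr0.
  by rewrite mul1r -[X in X = _]addr0 => /addrI.
have t1 : t (fun=> 1) = 0.
  have := t3 (fun=> 1) (fun=> 1) (r1 _) (r1 _).
  rewrite (_ : (fun _ => _) = fun=> 1); last by apply/funext => y; rewrite mulr1.
  by rewrite mul1r -[X in X = _]addr0 => /addrI.
have := t2 c (fun=> 1) (fun=> 0) (r1 _) (r1 _).
rewrite (_ : (fun _ => _) = fun=> c); last by apply/funext => y; rewrite mulr1 addr0.
by rewrite t0 t1 mulr0 addr0.
Qed.

Lemma tangent_vector_gen_alg x t (T : Type) (G : set (T -> k)) (h : X -> T) (f : T -> k) :
  tangent_vector x t -> (forall g : T -> k, G g -> regular_at x (g \o h) /\ t (g \o h) = 0) ->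
  gen_alg G f -> regular_at x (f \o h) /\ t (f \o h) = 0.
Proof.
move=> tv HG; have [_ t2 t3] := tv.
elim=> {f}[f /HG//|c|f g _ [rf tf] _ [rg tg]|f g _ [rf tf] _ [rg tg]].
- split; last exact: (tangent_vector_cst c tv).
  by exists setT; split=> //; [exact: openT|exact: regular_cst].
- rewrite (_ : _ \o _ = fun y => 1 * (f \o h) y + (g \o h) y); last first.
    by apply/funext => y; rewrite mul1r.
  by split; [exact: regular_at_lin|rewrite t2// tf tg mulr0 addr0].
- by split; [exact: regular_atM|rewrite t3// tf tg !mulr0 addr0].
Qed.

(** Expansion along column [q]: the cofactors do not involve that slot, so in it the wedge is a
    combination of tangent vectors. *)
Lemma wedge_put (v : 'I_p -> X -> (X -> k) -> k) x F q f :
  wedge v x (put F q f) = \sum_i v i x f * cofactor (\matrix_(i, j) v i x (F j)) i q.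
Proof.
rewrite /wedge (expand_det_col _ q); apply: eq_bigr => i _.
rewrite mxE /put eqxx; congr (_ * (_ * \det _)); apply/matrixP => a b.
by rewrite !mxE [lift q b == q]eq_sym (negPf (neq_lift q b)).
Qed.

Variables (U : set X) (P : X -> ('I_p -> X -> k) -> k).
Hypothesis PU : polyvector_field U P.

Lemma polyvector_tangent x F q : U x -> (forall l, regular_at x (F l)) ->
  tangent_vector x (fun f => P x (put F q f)).
Proof.
move=> Ux rF; have [V [N [a [v [[oV Vx sV] ra vf EP]]]]] := PU Ux.
apply: (@tangent_vector_eq _ (fun f => \sum_l (\sum_i v l i x f *
    cofactor (\matrix_(i, j) v l i x (F j)) i q) * a l x)).
  move=> f rf; rewrite EP//; last by move=> l; rewrite /put; case: eqP.
  by apply: eq_bigr => l _; rewrite wedge_put mulrC.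
apply: tangent_vector_sum => l; apply: tangent_vector_sum => i.
by have [H _] := vf l i; exact: H.
Qed.

Lemma polyvector_regular V F : open V -> V `<=` U ->
  (forall l, regular X V (F l)) -> regular X V (fun x => P x F).
Proof.
move=> oV sV rF; apply: regular_local => // x Vx.
have [W [N [a [v [[oW Wx sW] ra vf EP]]]]] := PU (sV x Vx).
have oVW := openI oV oW.
exists (V `&` W); split=> //.
apply: (@regular_ext _ _ _ (fun y => \sum_l a l y * wedge (v l) y F)).
  move=> y; rewrite inE => -[Vy Wy]; rewrite EP// => l; by exists V.
apply: regular_sum => // l; apply: regularM => //.
  by refine (regular_sub oW oVW _ (ra l)) => y [].
have rM i j : regular X (V `&` W) (fun y => (\matrix_(i, j) v l i y (F j)) i j).
  rewrite (_ : (fun y => _) = fun y => v l i y (F j)); last first.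
    by apply/funext => y; rewrite mxE.
  have [_ H] := vf l i; apply: H => //.
  by refine (regular_sub oV oVW _ (rF _)) => y [].
rewrite /wedge /determinant; apply: regular_sum => // s.
apply: regularM => //; first exact: regular_cst.
by apply: regular_prod => // i; exact: rM.
Qed.

Lemma polyvector_local x F F' : U x -> (forall l, regular_at x (F l)) ->
  (forall l, regular_at x (F' l)) ->
  (forall l, exists V : set X, [/\ open V, V x & {in V, F l =1 F' l}]) -> P x F = P x F'.
Proof.
move=> Ux rF rF' EF; have [V [N [a [v [[oV Vx sV] ra vf EP]]]]] := PU Ux.
rewrite !EP//; apply: eq_bigr => l _; congr (_ * \det _); apply/matrixP => i j.
by rewrite !mxE; have [/(_ x Vx) [t1 _ _] _] := vf l i; exact: t1.
Qed.

Lemma polyvector_alternate x F i j : U x -> (forall l, regular_at x (F l)) ->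
  i != j -> F i = F j -> P x F = 0.
Proof.
move=> Ux rF ij E; have [V [N [a [v [[oV Vx sV] ra vf EP]]]]] := PU Ux.
rewrite EP// big1// => l _; rewrite /wedge -det_tr.
by rewrite (determinant_alternate ij) ?mulr0// => a'; rewrite !mxE E.
Qed.

End PolyvectorTheory.

Section ToricPolyvectors.
Variables (n : nat) (k : closedFieldType) (Sigma : fan n).
Local Notation X := (toric_variety k Sigma).
Local Notation M := 'rV[int]_n.
Local Notation An := (affine_nspace k n).
Variables (I : finType) (idx : I -> chart_index Sigma) (U : I -> 'M[int]_n).
Hypothesis unimodular : forall i, U i \in unitmx.
Hypothesis dualE : forall i m, dual_monoid (sval (idx i)) m <->
  forall j, 0 <= ipair m (ray U i j).
Local Notation Lam i := (dual_monoid (sval (idx i))).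
Local Notation phi := (phi dualE).

Variable i0 : I.
Local Notation pt := (tpt (idx i0)).

Definition torus : set X := [set y | exists2 x : M -> k, is_char x & y = pt x].

Definition tchi m (y : X) : k :=
  \prod_j chi (idx i0) (cocone U i0 j) y ^ ipair m (ray U i0 j).

Lemma torus_chart_neq0 y : torus y <->
  chart_open (idx i0) y /\ forall j, chi (idx i0) (cocone U i0 j) y != 0.
Proof.
split=> [[x cx ->]|[iy y0]].
  split=> [|j]; first exact: tpt_open.
  by rewrite chi_tpt ?char_neq0//; exact: (cocone_dual unimodular dualE).
have Ty : big_torus (crd idx U i0 y) by move=> j; rewrite mxE.
exists (torus_char U i0 (crd idx U i0 y)); first exact: torus_char_char.
by rewrite -(phi_torus unimodular dualE i0 (idx i0) Ty) phi_crd.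
Qed.

Lemma torus_open : open torus.
Proof.
have oU : open (chart_open (idx i0) : set X) by exact: chart_openP.
rewrite (_ : torus = chart_open (idx i0) `&` [set y | \prod_j chi (idx i0) (cocone U i0 j) y != 0]).
  apply: open_regular_neq0 => //; apply: regular_prod => // j.
  by apply: chi_regular; exact: (cocone_dual unimodular dualE).
apply/seteqP; split=> y.
  by move=> /torus_chart_neq0 [iy y0]; split=> //=; apply/prodf_neq0.
by move=> [iy /= /prodf_neq0 y0]; apply/torus_chart_neq0; split=> // j; exact: y0.
Qed.

Lemma tchi_pt t x m : is_char x -> tchi m (tpt t x) = x m.
Proof.
move=> cx; rewrite (char_expand unimodular i0 m cx); apply: eq_bigr => j _.
by rewrite chi_tpt//; exact: (cocone_dual unimodular dualE).
Qed.

Lemma tchi_regular m : regular X torus (tchi m).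
Proof.
have oU : open (chart_open (idx i0) : set X) by exact: chart_openP.
have oT := torus_open.
apply: regular_prod => // j; apply: regularXz => //.
  have dj : Lam i0 (cocone U i0 j) by exact: (cocone_dual unimodular dualE).
  by refine (regular_sub oU oT _ (@chi_regular _ _ _ _ _ dj)) => y /torus_chart_neq0 [].
by move=> y /torus_chart_neq0 [].
Qed.

Lemma tchi_regular_at x m : is_char x -> regular_at (pt x) (tchi m).
Proof.
by move=> cx; exists torus; split; [exact: torus_open|exists x|exact: tchi_regular].
Qed.

(** In lowest terms the denominator has no zero on the torus, so it is a monomial up to a scalar. *)
Lemma torus_regular_laurent h : regular X torus h ->
  exists l, forall x, is_char x -> h (pt x) = leval l x.
Proof.
move=> rh; have [oW rW] := @phi_morph _ _ _ _ _ _ dualE i0 _ torus_open.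
have Wpt x : is_char x -> phi i0 (\row_j x (cocone U i0 j)) = pt x.
  by move=> cx; have [_ ->] := tpt_phi unimodular dualE i0 (idx i0) cx.
have [|a [b [b0 _ H]]] := regular_coprime oW _ (rW h rh).
  exists (\row_j one_param 0 1 (cocone U i0 j)); rewrite /preimage /= Wpt.
    by exists (one_param 0 1) => //; apply: one_param_char; exact: oner_neq0.
  by apply: one_param_char; exact: oner_neq0.
have [| | |c [e [c0 Ec]]] := @torus_unit k n setT (peval b) openT.
- by [].
- by apply: affine_regular_gen; exact: peval_alg.
- move=> y Ty; have [|//] := H y; rewrite /preimage /= (phi_torus unimodular dualE i0 (idx i0) Ty).
  by exists (torus_char U i0 y) => //; exact: torus_char_char.
have [l El] : exists l, forall x, is_char x -> peval a (\row_j x (cocone U i0 j)) = leval l x.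
  elim: (peval_alg a) => [_ [j ->]|d|f g _ [l El] _ [l' El']|f g _ [l El] _ [l' El']].
  - by exists [:: (1, cocone U i0 j)] => x _; rewrite /leval big_seq1 mul1r mxE.
  - by exists [:: (d, 0)] => x [x0 _]; rewrite /leval big_seq1 /= x0 mulr1.
  - by exists (l ++ l') => x cx; rewrite leval_cat El// El'.
  - by exists (lmul l l') => x cx; rewrite leval_char_mul// El// El'.
exists [seq (c^-1 * d.1, d.2) | d <- lshift (- \sum_j e j *: cocone U i0 j) l] => x cx.
have Tx : big_torus (\row_j x (cocone U i0 j)) by move=> j; rewrite mxE char_neq0.
have [|_] := H (\row_j x (cocone U i0 j)); first by rewrite /preimage /= Wpt//; exists x.
rewrite /= Wpt// => ->; rewrite El// Ec// /leval big_map /=.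
under [RHS]eq_bigr do rewrite -mulrA.
rewrite -mulr_sumr -/(leval _ x) leval_shift// charN// char_prod// invfM.
rewrite [RHS]mulrA [RHS]mulrC; congr (_ * (_ * _^-1)); apply: eq_bigr => j _.
by rewrite mxE charMz.
Qed.

Variable L : line_bundle X.
Local Notation C := (lb_cover L).
Variables (a : lb_index L -> I -> X -> k) (mm : I -> M).
Hypothesis a_reg : forall c i, regular X (C c `&` chart_open (idx i)) (a c i).
Hypothesis a_neq0 : forall c i x, C c x -> chart_open (idx i) x -> a c i x != 0.
Hypothesis a_trans : forall c d i x, C c x -> C d x -> chart_open (idx i) x ->
  lb_trans L c d x * a d i x = a c i x.
Hypothesis a_torus : forall c i j s x, is_char x -> C c (tpt s x) ->
  a c i (tpt s x) = x (mm j - mm i) * a c j (tpt s x).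

Variables (p : nat) (s : lb_index L -> X -> ('I_p -> X -> k) -> k).
Hypothesis s_poly : forall c, polyvector_field (C c) (s c).
Hypothesis s_trans : forall c d x (F : 'I_p -> X -> k), C c x -> C d x ->
  (forall l, regular_at x (F l)) ->
  s c x F = lb_trans L c d x ^ (- p%:Z) * s d x F.
Variable c0 : X -> lb_index L.
Hypothesis c0P : forall x, C (c0 x) x.

(* The section read in the trivialization of L over the chart i. *)
Definition chart_section i x (F : 'I_p -> X -> k) := a (c0 x) i x ^+ p * s (c0 x) x F.
Local Notation S := chart_section.

Lemma chart_sectionE c i x F : C c x -> chart_open (idx i) x ->
  (forall l, regular_at x (F l)) -> S i x F = a c i x ^+ p * s c x F.
Proof.
move=> Cx ix rF; have C0 := c0P x; rewrite /S -(a_trans C0 Cx ix) (s_trans C0 Cx rF) exprMn.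
have t0 := expf_neq0 p (lb_neq0 C0 Cx).
by rewrite -exprnN mulrACA divff// mul1r.
Qed.

Lemma chart_section_tangent i x F q : chart_open (idx i) x ->
  (forall l, regular_at x (F l)) -> tangent_vector x (fun f => S i x (put F q f)).
Proof.
move=> ix rF; apply: (@tangent_vector_eq _ _ _ (fun f =>
    \sum_(u <- [:: tt]) s (c0 x) x (put F q f) * (a (c0 x) i x ^+ p))).
  by move=> f _; rewrite big_seq1 mulrC.
apply: (@tangent_vector_sum _ _ _ _ _ _ (fun u : unit => fun f => s (c0 x) x (put F q f))) => _.
by apply: (polyvector_tangent (@s_poly (c0 x))).
Qed.

Lemma chart_section_regular i V F : open V -> V `<=` chart_open (idx i) ->
  (forall l, regular X V (F l)) -> regular X V (fun x => S i x F).
Proof.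
move=> oV sV rF; apply: regular_local => // x Vx.
have oC := @lb_open _ _ L (c0 x); have oVC := openI oV oC.
have oU : open (chart_open (idx i) : set X) by exact: chart_openP.
have rF' l : regular X (V `&` C (c0 x)) (F l).
  by refine (regular_sub oV oVC _ (rF l)) => y [].
exists (V `&` C (c0 x)); split=> //.
apply: (@regular_ext _ _ _ (fun y => a (c0 x) i y ^+ p * s (c0 x) y F)).
  move=> y; rewrite inE => -[Vy Cy]; rewrite (chart_sectionE Cy (sV y Vy))// => l.
  by exists V.
apply: regularM => //.
  apply: regularX => //; refine (regular_sub (openI oC oU) oVC _ (@a_reg (c0 x) i)) => y [Vy Cy].
  by split=> //; exact: sV.
by apply: (polyvector_regular (@s_poly (c0 x))).
Qed.

Lemma chart_section_local i x F F' : chart_open (idx i) x -> (forall l, regular_at x (F l)) ->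
  (forall l, regular_at x (F' l)) ->
  (forall l, exists V : set X, [/\ open V, V x & {in V, F l =1 F' l}]) -> S i x F = S i x F'.
Proof.
move=> ix rF rF' E; congr (_ * _); by apply: (polyvector_local (@s_poly (c0 x))).
Qed.

(* A tangent vector t satisfies t(fg)/(fg) = t(f)/f + t(g)/g, so this normalization is additive in each m j. *)
Definition torus_section i x (m : 'I_p -> M) : k :=
  S i (pt x) (fun j => tchi (m j)) / x (\sum_j m j).
Local Notation R := torus_section.

Lemma torus_section_add i x m q u v : is_char x ->
  R i x (put m q (u + v)) = R i x (put m q u) + R i x (put m q v).
Proof.
move=> cx; pose F j := tchi (m j).
have rF l : regular_at (pt x) (F l) by exact: tchi_regular_at.
have E u' : (fun j => tchi (put m q u' j)) = put F q (tchi u').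
  by apply/funext => j; rewrite /put; case: eqP.
have Es u' : \sum_j put m q u' j = u' + \sum_(j | j != q) m j.
  rewrite (bigD1 q)//= {1}/put eqxx; congr (_ + _); apply: eq_bigr => j jq.
  by rewrite /put (negPf jq).
have ix : chart_open (idx i) (pt x) by exact: tpt_open.
have rp g l : regular_at (pt x) g -> regular_at (pt x) (put F q g l).
  by rewrite /put; case: eqP.
have [_ _ tM] := chart_section_tangent q ix rF.
rewrite /R !E !Es.
have -> : S i (pt x) (put F q (tchi (u + v))) = S i (pt x) (put F q (fun y => tchi u y * tchi v y)).
  apply: chart_section_local => // l; try by apply: rp; try apply: regular_atM; exact: tchi_regular_at.
  exists torus; split; [exact: torus_open|by exists x|].
  move=> y; rewrite inE => -[x' cx' ->]; rewrite /put; case: eqP => // _.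
  by rewrite !tchi_pt// cx'.2.
rewrite (tM _ _ (tchi_regular_at u cx) (tchi_regular_at v cx)) !tchi_pt// !cx.2.
have xu := char_neq0 u cx; have xv := char_neq0 v cx.
have xs := char_neq0 (\sum_(j | j != q) m j) cx.
by field; rewrite xu xv xs.
Qed.

Lemma torus_section_alternate i x m j j' : is_char x -> j != j' -> m j = m j' -> R i x m = 0.
Proof.
move=> cx jj E; rewrite /R /S.
rewrite (polyvector_alternate (@s_poly (c0 (pt x))) _ _ jj) ?mulr0 ?mul0r//.
  by move=> l; exact: tchi_regular_at.
by rewrite E.
Qed.

Lemma torus_section_trans i i' x m : is_char x ->
  R i x m = x (p%:Z *: (mm i' - mm i)) * R i' x m.
Proof.
move=> cx; rewrite /R /S (@a_torus _ i i' _ _ cx (c0P _)) exprMn charMz//.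
by rewrite -!mulrA.
Qed.

Lemma torus_section_laurent m : exists l, forall x, is_char x -> R i0 x m = leval l x.
Proof.
have [|l El] := @torus_regular_laurent (fun y => S i0 y (fun j => tchi (m j))).
  apply: chart_section_regular; first exact: torus_open.
    by move=> y /torus_chart_neq0 [].
  by move=> l; exact: tchi_regular.
exists (lshift (- \sum_j m j) l) => x cx.
by rewrite leval_shift// charN// mulrC /R El.
Qed.

Lemma torus_section_chart i (m : 'I_p -> M) : (forall j, Lam i (m j)) ->
  exists l, lsupp (Lam i) l /\ forall x, is_char x -> R i x m = leval l x / x (\sum_j m j).
Proof.
move=> dm; have oU : open (chart_open (idx i) : set X) by exact: chart_openP.
have rF j : regular X (chart_open (idx i)) (chi (idx i) (m j)) by apply: chi_regular; exact: dm.
have rS : regular X (chart_open (idx i)) (fun y => S i y (fun j => chi (idx i) (m j))).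
  exact: chart_section_regular.
have [l [sl El]] := @chart_regular_laurent _ _ _ _ _ _ unimodular dualE i _ rS.
exists l; split=> // x cx; rewrite -(leval_torus cx sl) -El /R.
have -> : emb (torus_chart (sval (idx i)) cx) = pt x by rewrite (tptE _ cx); exact: tor_indep.
congr (_ / _); apply: chart_section_local.
- exact: tpt_open.
- by move=> l'; exact: tchi_regular_at.
- by move=> l'; exists (chart_open (idx i)); split=> //; exact: tpt_open.
- move=> l'; exists torus; split; [exact: torus_open|by exists x|].
  by move=> y; rewrite inE => -[x' cx' ->]; rewrite tchi_pt// chi_tpt.
Qed.

(** The derivation kills numerator and denominator of a local quotient; the Leibniz rule for their
    relation kills the quotient as well. *)
Lemma tangent_vector_chart i (x : X) t (f : X -> k) : chart_open (idx i) x -> tangent_vector x t ->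
  (forall m, Lam i m -> t (chi (idx i) m) = 0) -> regular_at x f -> t f = 0.
Proof.
move=> ix tv t0 rf; have [V [oV Vx rV]] := rf.
have oU : open (chart_open (idx i) : set X) by exact: chart_openP.
have [oW rW] := @emb_morph _ _ _ (idx i) _ oV.
have [g Eg] := ix; have Vg : (@emb _ _ _ (idx i) @^-1` V) g by rewrite /preimage /= -Eg.
have [_ [u [v [Gu Gv _ v0 E]]]] := rW f rV g Vg.
have HG : forall h, [set f | exists2 m, Lam i m & f = fun g : chart_point k (sval (idx i)) => sval g m] h ->
    regular_at x (h \o chart_inv (idx i)) /\ t (h \o chart_inv (idx i)) = 0.
  move=> _ [m dm ->]; split; last exact: t0.
  by exists (chart_open (idx i)); split=> //; exact: chi_regular.
have [ru tu] := tangent_vector_gen_alg tv HG Gu; have [rv tv0] := tangent_vector_gen_alg tv HG Gv.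
have [oW' _] := @chart_inv_pull _ _ _ (idx i) _ oW.
have [t1 _ t3] := tv.
have rv' : regular X (chart_open (idx i)) (v \o chart_inv (idx i)).
  apply: (regular_gen_alg oU _ Gv) => _ [m dm ->]; exact: (@chi_regular _ _ _ (idx i) _ dm).
have oN := open_regular_neq0 oU rv'.
have vx : v (chart_inv (idx i) x) != 0 by rewrite Eg embK.
have := t1 _ _ (regular_atM rf rv) ru; rewrite t3// tu tv0 mulr0 add0r => H.
apply/eqP; have := H; rewrite /= => {}H.
suff /H /eqP : exists W : set X, [/\ open W, W x & {in W, (fun y => f y * (v \o chart_inv (idx i)) y) =1 u \o chart_inv (idx i)}].
  by rewrite mulf_eq0 (negPf vx).
exists (V `&` (chart_open (idx i) `&` [set y | (v \o chart_inv (idx i)) y != 0])); split=> //; first exact: openI.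
move=> y; rewrite inE => -[Vy [iy /= vy]]; have := E (chart_inv (idx i) y).
rewrite /preimage /= chart_invK// => -> //.
by rewrite divfK.
Qed.

Hypothesis s_neq0 : exists c x (F : 'I_p -> X -> k),
  [/\ C c x, forall l, regular_at x (F l) & s c x F != 0].
Hypothesis cover : forall x : X, exists i, chart_open (idx i) x.

(** In each slot the section is a tangent vector, and a nonzero one is detected by some monomial of
    the chart. After all slots are replaced by monomials, nonvanishing is an open condition and is
    met on the torus. *)
Lemma torus_section_neq0 : exists m x, is_char x /\ R i0 x m != 0.
Proof.
have [c [x [F [Cx rF sF]]]] := s_neq0; have [i ix] := cover x.
have SF : S i x F != 0.
  by rewrite (chart_sectionE Cx ix rF) mulf_neq0// expf_neq0// a_neq0.
pose P (F : 'I_p -> X -> k) := (forall l, regular_at x (F l)) /\ S i x F != 0.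
have rchi m : Lam i m -> regular_at x (chi (idx i) m).
  by move=> dm; exists (chart_open (idx i)); split=> //; [exact: chart_openP|exact: chi_regular].
have [| |F' HF' [_ SF']] := @slot_induction _ p P (fun _ f => exists2 m, Lam i m & f = chi (idx i) m) F.
- move=> F1 q [rF1 SF1] _; apply: contrapT => H; move/eqP: SF1; apply.
  rewrite -(put_id F1 q).
  apply: (tangent_vector_chart ix (chart_section_tangent q ix rF1)) => // m dm.
  apply/eqP/negPn/negP => SH; apply: H; exists (chi (idx i) m); first by exists m.
  by split=> // l; rewrite /put; case: eqP => // _; exact: rchi.
- by [].

have /choice [m Hm] : forall j, exists m, Lam i m /\ F' j = chi (idx i) m.
  by move=> j; have [m dm E] := HF' j; exists m.
have EF' : F' = (fun j => chi (idx i) (m j)) by apply/funext => j; case: (Hm j).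
have oU : open (chart_open (idx i) : set X) by exact: chart_openP.
have rS : regular X (chart_open (idx i)) (fun y => S i y (fun j => chi (idx i) (m j))).
  by apply: chart_section_regular => // l; apply: chi_regular; case: (Hm l).
have [|y cy [iy /= Sy]] := @tpt_dense _ _ _ _ (idx i0) (open_regular_neq0 oU rS).
  by exists x; split=> //=; rewrite -EF'.
exists m, y; split=> //; rewrite (@torus_section_trans i0 i)// mulf_neq0 ?char_neq0//.
rewrite /R mulf_neq0// ?invr_eq0 ?char_neq0//.
rewrite (_ : S i _ _ = S i (pt y) (fun j => chi (idx i) (m j)))//; apply: chart_section_local => //.
- by move=> l'; exact: tchi_regular_at.
- by move=> l'; exists (chart_open (idx i)); split=> //; apply: chi_regular; case: (Hm l').
- move=> l'; exists torus; split; [exact: torus_open|by exists y|].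
  by move=> z; rewrite inE => -[x' cx' ->]; rewrite tchi_pt// chi_tpt//; case: (Hm l').
Qed.

(* w is the coefficient of one monomial in the torus section. *)
Lemma polyvector_weight : exists (Y : I -> M) (w : ('I_p -> M) -> k),
  [/\ forall i i', Y i - Y i' = p%:Z *: (mm i' - mm i),
      forall m q u v, w (put m q (u + v)) = w (put m q u) + w (put m q v),
      exists m, w m != 0,
      forall m j j', j != j' -> m j = m j' -> w m = 0 &
      forall i m, (forall j, Lam i (m j)) -> w m != 0 -> Lam i (Y i + \sum_j m j)].
Proof.
have /choice [l Hl] := torus_section_laurent.
have [m0 [x0 [cx0 R0]]] := torus_section_neq0.
have [mu Hmu] : exists mu, lcoef (l m0) mu != 0.
  apply: contrapT => /forallNP H; move: R0; rewrite (Hl _ _ cx0) leval_coef big1 ?eqxx// => m _.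
  by have /negP/negPn/eqP -> := H m; rewrite mul0r.
(* Passing from the chart [i0] to the chart [i] multiplies the torus section by the character
   [p%:Z *: (mm i0 - mm i)], which shifts the chosen weight [mu]. *)
exists (fun i => mu + p%:Z *: (mm i0 - mm i)), (fun m => lcoef (l m) mu); split.
- by move=> i i'; rewrite [mu + _]addrC addrKA -scalerBr opprB addrC addrA subrK.
- move=> m q u v.
  rewrite (_ : lcoef (l (put m q u)) mu + _ = lcoef (l (put m q u) ++ l (put m q v)) mu); last first.
    by rewrite /lcoef big_cat.
  apply: lcoef_eq => x cx; rewrite leval_cat -!Hl//.
  exact: torus_section_add.
- by exists m0.
- move=> m j j' jj E; rewrite (@lcoef_eq _ _ _ [::]) ?/lcoef ?big_nil// => x cx.
  by rewrite -Hl// (torus_section_alternate _ cx jj E) /leval big_nil.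
- move=> i m dm; have [l' [sl' El']] := torus_section_chart dm.
  rewrite (@lcoef_eq _ _ _ (lshift (p%:Z *: (mm i - mm i0) - \sum_j m j) l')).
    rewrite -{1}(subrK (p%:Z *: (mm i - mm i0) - \sum_j m j) mu) lcoef_shift => /lcoef_mem [c cl Ec].
    suff -> : mu + p%:Z *: (mm i0 - mm i) + \sum_j m j = c.2 by exact: sl'.
    by rewrite Ec opprB -addrA [p%:Z *: _ + _]addrC -[mm i0 - _]opprB scalerN.
  move=> x cx; rewrite -Hl// (@torus_section_trans i0 i)// leval_shift// El'// cx.2 charN//.
  by rewrite mulrA mulrAC.
Qed.

End ToricPolyvectors.

Section ChartCover.
Variables (n : nat) (k : closedFieldType) (Sigma : fan n).
Local Notation X := (toric_variety k Sigma).
Local Notation M := 'rV[int]_n.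
Implicit Types s t : chart_index Sigma.

(** The sum of the generators is interior to [t]: a functional nonnegative on [t] that vanishes
    there vanishes on [t], so a face containing the sum is all of [t]. *)
Lemma cone_generic t : exists u : M, forall s, sval s (toQ u) -> sval t `<=` sval s.
Proof.
have [r [g Eg]] := fan_rational (svalP t); exists (\sum_i g i) => s su.
have [_ [m dm Em]] := fan_meet (svalP s) (svalP t).
have gt i : sval t (toQ (g i)) := gen_in i Eg.
have toQs : toQ (\sum_i g i) = \sum_i toQ (g i).
  by apply: (big_morph _ (@toQD n) (@toQ0 n)).
have tsum : sval t (toQ (\sum_i g i)).
  by rewrite toQs Eg; exists (fun=> 1) => //; apply: eq_bigr => i _; rewrite scale1r.
have : (sval s `&` sval t) (toQ (\sum_i g i)) by [].
rewrite Em => -[_ /=]; rewrite toQs pairing_sumr => /eqP.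
rewrite psumr_eq0 => [/allP H|i _]; last exact: dm.
move=> x tx; suff : (sval s `&` sval t) x by case.
rewrite Em; split=> //=; have tx' := tx; move: tx'; rewrite {1}Eg => -[c _ ->].
rewrite pairing_sumr big1// => i _.
by have := H i (mem_index_enum _); rewrite /= pairingZr => /eqP ->; rewrite mulr0.
Qed.

Lemma chart_open_sub s t (x : X) : sval t `<=` sval s -> chart_open t x -> chart_open s x.
Proof.
move=> ts [g ->]; exists (restrict ts g); apply/emb_eq; rewrite /glued /=.
have sub : sval t `<=` sval t `&` sval s by move=> u tu; split=> //; exact: ts.
exists (restrict sub g); split=> m dm.
  by rewrite restrictE//; apply: dual_monoidS dm => u [].
rewrite [LHS]restrictE// restrictE//; by apply: dual_monoidS dm => u [].
Qed.

Lemma cone_mem s (u : M) : (forall m, dual_monoid (sval s) m -> 0 <= ipair m u) -> sval s (toQ u).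
Proof.
move=> H; apply: contrapT => nu.
have [m dm] := @cone_separation n _ (toQ u) (fan_rational (svalP s)) nu.
by rewrite pairing_toQ ltrz0 ltNge H.
Qed.

Lemma chart_cover (I : Type) (idx : I -> chart_index Sigma) :
  (forall v, exists i, forall m, dual_monoid (sval (idx i)) m -> 0 <= ipair m v) ->
  forall x : X, exists i, chart_open (idx i) x.
Proof.
move=> H x; have [t [g Ex]] := emb_surj x.
have [u Hu] := cone_generic t; have [i Hi] := H u; exists i.
apply: (@chart_open_sub _ t); last by rewrite Ex; exact: emb_open.
by apply: Hu; exact: cone_mem.
Qed.

Lemma maximal_cones : smooth_of_dim X n -> projective X ->
  exists (I : finType) (idx : I -> chart_index Sigma) (U : I -> 'M[int]_n),
  [/\ forall i, U i \in unitmx,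
      forall i m, dual_monoid (sval (idx i)) m <-> forall j, 0 <= ipair m (ray U i j) &
      forall v, exists i, forall m, dual_monoid (sval (idx i)) m -> 0 <= ipair m v].
Proof.
move=> smooth [N [f fc]].
have [sigma0 c0] := @fan_nonempty _ Sigma.
have complete u : exists s : chart_index Sigma, sval s (toQ u).
  exact: (limit_in_cone fc u (exist _ sigma0 c0)).
have /finite_seqP [l El] := @fan_finite _ Sigma.
pose P sigma := `[< cones Sigma sigma /\ fulldim sigma >].
pose l' := [seq sigma <- l | P sigma].
have Hl (i : seq_sub l') : cones Sigma (ssval i) /\ fulldim (ssval i).
  by have := ssvalP i; rewrite mem_filter => /andP [/asboolP].
pose idx (i : seq_sub l') : chart_index Sigma := exist _ (ssval i) (Hl i).1.
have /choice [U HU] : forall i, exists U : 'M[int]_n, U \in unitmx /\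
    forall m, dual_monoid (sval (idx i)) m <-> forall j, 0 <= ipair m (row j U).
  move=> i; have [U uU dU] := @smooth_unimodular n k Sigma (idx i) (Hl i).2 smooth.
  by exists U.
exists (adhoc_seq_sub_finType l'), idx, U; split.
- by move=> i; case: (HU i).
- by move=> i m; case: (HU i).
- move=> v; have [s fs sv] := fulldim_cover complete v.
  have sl : sval s \in l'.
    rewrite mem_filter; apply/andP; split; first by apply/asboolP; split=> //; exact: svalP.
    by clear fs sv; case: s => sigma /=; rewrite El.
  exists (SeqSub sl) => m dm; have := dm _ sv.
  by rewrite pairing_toQ ler0z.
Qed.

End ChartCover.

Lemma permuted_rows n (W U : 'M[int]_n) (g : 'I_n -> 'I_n) : injective g ->
  (forall j, row j W = row (g j) U) -> U \in unitmx ->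
  W \in unitmx /\ forall m, (forall j, 0 <= ipair m (row j W)) <-> (forall j, 0 <= ipair m (row j U)).
Proof.
move=> gI EW uU; split.
  have -> : W = row_perm (perm.perm gI) U.
    apply/row_matrixP => j; rewrite EW; apply/rowP => l; rewrite !mxE.
    by rewrite perm.permE.
  by rewrite row_permE unitmx_mul unitmx_perm.
have [h hK gK] := injF_bij gI.
by move=> m; split=> H j; [rewrite -(gK j) -EW|rewrite EW].
Qed.

Section WeightBounds.
Variables (n p : nat) (I : finType) (U : I -> 'M[int]_n) (Y : I -> 'rV[int]_n).
Local Notation vec := 'rV[int]_n.
Hypothesis unimodular : forall s, U s \in unitmx.
Variables (K : zmodType) (w : ('I_p -> vec) -> K).
Hypothesis w_add : forall m q u v, w (put m q (u + v)) = w (put m q u) + w (put m q v).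
Hypothesis w_alt : forall m j j', j != j' -> m j = m j' -> w m = 0.
Hypothesis w_neq0 : exists m, w m != 0.
Hypothesis w_dual : forall s m, (forall j r, 0 <= ipair (m j) (ray U s r)) -> w m != 0 ->
  forall r, 0 <= ipair (Y s + \sum_j m j) (ray U s r).

(** Testing [w_dual] on a tuple of dual basis vectors counts how often the index [r] occurs.
    Alternation allows it at most once, which bounds the weight by -1; a tuple avoiding [r] excludes
    -1. *)
Let cocone_ge s (f : 'I_p -> 'I_n) r : w (fun j => cocone U s (f j)) != 0 ->
  0 <= ipair (Y s) (ray U s r) + \sum_j (f j == r)%:R.
Proof.
have dm j r' : 0 <= ipair (cocone U s (f j)) (ray U s r').
  by rewrite (cocone_ray unimodular); case: eqP.
move=> wf; have := w_dual dm wf r; rewrite ipairDl (ipairC (\sum_j _)) ipair_sumr.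
by under eq_bigr do rewrite ipairC (cocone_ray unimodular).
Qed.

Lemma weight_ge s i : -1 <= ipair (Y s) (ray U s i).
Proof.
have [m wm] := w_neq0; have [f [wf _]] := w_basis unimodular w_add s wm.
have := cocone_ge i wf; suff : \sum_j (f j == i)%:R <= 1 :> int.
  by move: (\sum_j _) (ipair _ _); clear; lia.
have [[j0 fj0]|nex] := pselect (exists j, f j = i).
  rewrite (bigD1 j0)//= fj0 eqxx big1 ?addr0// => j jj.
  by case: eqP => // fj; move: wf; rewrite (w_alt jj) ?eqxx// fj fj0.
by rewrite big1// => j _; case: eqP => // fj; case: nex; exists j.
Qed.

Lemma weight_vanish s i m : ipair (Y s) (ray U s i) = -1 ->
  (forall j, ipair (m j) (ray U s i) = 0) -> w m = 0.
Proof.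
move=> Yi m0; apply/eqP/negPn/negP => wm; have [f [wf Hf]] := w_basis unimodular w_add s wm.
have := cocone_ge i wf; rewrite Yi big1// => j _.
by case: eqP => // fj; have := Hf j; rewrite fj m0 eqxx.
Qed.

End WeightBounds.

Section Frames.
Variables (n : nat) (k : closedFieldType) (Sigma : fan n).
Local Notation X := (toric_variety k Sigma).
Local Notation M := 'rV[int]_n.

Definition cone_frame (J : finType) (idx : J -> chart_index Sigma) (U : J -> 'M[int]_n) :=
  [/\ forall i, U i \in unitmx,
      forall i m, dual_monoid (sval (idx i)) m <-> forall j, 0 <= ipair m (ray U i j) &
      forall v, exists i, forall m, dual_monoid (sval (idx i)) m -> 0 <= ipair m v].

Definition trivialized (J : Type) (idx : J -> chart_index Sigma) (L : line_bundle X)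
    (a : lb_index L -> J -> X -> k) (mm : J -> M) :=
  [/\ forall c i, regular X (lb_cover L c `&` chart_open (idx i)) (a c i),
      forall c i x, lb_cover L c x -> chart_open (idx i) x -> a c i x != 0,
      forall c d i x, lb_cover L c x -> lb_cover L d x -> chart_open (idx i) x ->
        lb_trans L c d x * a d i x = a c i x &
      forall c i j s x, is_char x -> lb_cover L c (tpt s x) ->
        a c i (tpt s x) = x (mm j - mm i) * a c j (tpt s x)].

Lemma trivialized_sub (I J : Type) (idx : I -> chart_index Sigma) (sg : J -> I) L a mm :
  trivialized idx (L := L) a mm -> trivialized (idx \o sg) (fun c j => a c (sg j)) (mm \o sg).
Proof. by move=> [a1 a2 a3 a4]; split=> *; [exact: a1|exact: a2|exact: a3|exact: a4]. Qed.

Definition simplex_rows (u : 'I_n.+1 -> M) (l : 'I_n.+1) : 'M[int]_n :=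
  \matrix_j u (lift l j).

Definition pick_pair (ab : 'I_2 * 'I_2) (i : 'I_n) : 'I_2 := if i == 0%N :> nat then ab.1 else ab.2.

(** The cone labelled by [ab] contains in each direction the ray other than the one numbered by
    [ab], as the chart of the projective line where a homogeneous coordinate is nonzero meets only
    the divisor of the other. *)
Definition quadrant_rows (e : 'I_n -> 'I_2 -> M) (ab : 'I_2 * 'I_2) : 'M[int]_n :=
  \matrix_i e i (lift (pick_pair ab i) ord0).

Definition simplex_fan (L : line_bundle X) (d : int) :=
  exists (idx : 'I_n.+1 -> chart_index Sigma) (u : 'I_n.+1 -> M) a mm,
  [/\ cone_frame idx (simplex_rows u), trivialized idx (L := L) a mm, \sum_l u l = 0 &
      forall l l' j, j != l -> ipair (mm l - mm l') (u j) = d *+ (j == l')].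

Definition quadrant_fan (L : line_bundle X) :=
  exists (idx : 'I_2 * 'I_2 -> chart_index Sigma) (e : 'I_n -> 'I_2 -> M) a mm,
  [/\ cone_frame idx (quadrant_rows e), trivialized idx (L := L) a mm,
      forall i, e i ord0 + e i (lift ord0 ord0) = 0 &
      forall x y i, ipair (mm x - mm y) (e i (pick_pair y i)) = (pick_pair x i != pick_pair y i)%:R].

End Frames.

Section Selection.
Variables (n p : nat) (k : closedFieldType) (Sigma : fan n).
Local Notation X := (toric_variety k Sigma).
Local Notation M := 'rV[int]_n.
Variables (I : finType) (idx : I -> chart_index Sigma) (U : I -> 'M[int]_n).
Hypothesis unimodular : forall i, U i \in unitmx.
Hypothesis dualE : forall i m, dual_monoid (sval (idx i)) m <->
  forall j, 0 <= ipair m (ray U i j).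
Variables (L : line_bundle X) (a : lb_index L -> I -> X -> k) (mm : I -> M).
Hypothesis tr : trivialized idx a mm.
Variable Y : I -> M.
Hypothesis Ymm : forall i i', Y i - Y i' = p%:Z *: (mm i' - mm i).
Hypothesis cover : forall u, exists s, forall i, 0 <= ipair (cocone U s i) u.
Hypothesis Y_min : forall s t i, ipair (Y s) (ray U s i) <= ipair (Y t) (ray U s i).
Hypothesis Y_strict : forall s t i, ipair (Y s) (ray U s i) = ipair (Y t) (ray U s i) ->
  forall j, 0 <= ipair (cocone U t j) (ray U s i).
Hypothesis p_gt0 : (0 < p)%N.
Local Notation psi := (psi Y cover).
Local Notation incone := (incone U).
Local Notation is_ray := (is_ray U).

(** Used to trade the given basis of a cone for a permuted one with prescribed labels. *)
Lemma star_rows s (u : 'I_n -> M) : (forall j, is_ray (u j)) -> (forall j, incone s (u j)) ->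
  injective u -> exists g : 'I_n -> 'I_n, injective g /\ forall j, u j = ray U s (g j).
Proof.
move=> ru su ui; have /choice [g Hg] : forall j, exists i, u j = ray U s i.
  by move=> j; apply: (ray_row unimodular cover Y_min Y_strict).
by exists g; split=> // j j' E; apply: ui; rewrite !Hg E.
Qed.

Lemma cone_frame_sub (J : finType) (sg : J -> I) (W : J -> 'M[int]_n) :
  (forall x j, is_ray (ray W x j)) -> (forall x j, incone (sg x) (ray W x j)) ->
  (forall x, injective (ray W x)) ->
  (forall v, exists x, forall m, (forall j, 0 <= ipair m (ray W x j)) -> 0 <= ipair m v) ->
  cone_frame (idx \o sg) W.
Proof.
move=> rW sW iW cW.
have H x : W x \in unitmx /\ forall m, (forall j, 0 <= ipair m (row j (W x))) <->
    (forall j, 0 <= ipair m (row j (U (sg x)))).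
  by have [g [gi Eg]] := star_rows (rW x) (sW x) (@iW x); exact: permuted_rows gi Eg _.
have D x m : dual_monoid (sval (idx (sg x))) m <-> forall j, 0 <= ipair m (ray W x j).
  by split=> [/dualE|] h; [apply/(H x).2|apply/dualE/(H x).2].
split=> //; first by move=> x; case: (H x).
by move=> v; have [x Hx] := cW v; exists x => m /D /Hx.
Qed.

Lemma psi_diff s t u : incone t u -> p%:Z * ipair (mm s - mm t) u = psi u - ipair (Y s) u.
Proof.
by move=> tu; rewrite (psi_in unimodular cover Y_min tu) -ipairBl Ymm ipairZl.
Qed.

(** Each circuit ray may be omitted to obtain a cone of the fan, and these [n + 1] cones cover
    everything, as on projective space. *)
Lemma circuit_simplex C (d : int) : circuit p Y cover C -> size C = n.+1 ->
  - \sum_(u <- C) psi u = p%:Z * d -> simplex_fan L d.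
Proof.
move=> [[rC uC] sC _ starC] szC degC.
pose u (l : 'I_n.+1) := nth 0 C l.
have uC' l : u l \in C by apply: mem_nth; rewrite szC.
have ui : injective u.
  by move=> l l' /eqP; rewrite /u nth_uniq ?szC// => /eqP E; exact: val_inj.
have sumu (F : M -> int) : \sum_(x <- C) F x = \sum_l F (u l).
  by rewrite (big_nth 0) szC big_mkord.
have sumu0 : \sum_l u l = 0.
  by rewrite -[RHS]sC [RHS](big_nth 0) szC big_mkord.
have /choice [sg Hsg] : forall l, exists s, forall j, j != l -> incone s (u j).
  move=> l; have [s /allP Hs] := starC _ (uC' l); exists s => j jl.
  by apply: Hs; rewrite mem_rem_uniq// inE uC' andbT (inj_eq ui).
have psiE l j : j != l -> psi (u j) = ipair (Y (sg l)) (u j).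
  by move=> jl; apply: (psi_in unimodular cover Y_min); exact: Hsg.
exists (idx \o sg), u, (fun c l => a c (sg l)), (mm \o sg); split=> //.
- have rowE x j : ray (simplex_rows u) x j = u (lift x j) by rewrite /ray rowK.
  have rW x j : is_ray (ray (simplex_rows u) x j) by rewrite rowE; exact: rC.
  have sW x j : incone (sg x) (ray (simplex_rows u) x j).
    by rewrite rowE; apply: Hsg; rewrite eq_sym neq_lift.
  have iW x : injective (ray (simplex_rows u) x).
    by move=> j j'; rewrite !rowE => /ui /lift_inj.
  apply: cone_frame_sub => // v.
  have uW x : simplex_rows u x \in unitmx.
    by have [g [gi Eg]] := star_rows (rW x) (sW x) (@iW x); case: (permuted_rows gi Eg (unimodular _)).
  pose c l := if unlift ord0 l is Some j then ipair (cocone (simplex_rows u) ord0 j) v else 0.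
  have Ev : v = \sum_l c l *: u l.
    rewrite big_ord_recl /c unlift_none scale0r add0r [LHS](ray_expand uW ord0 v).
    by apply: eq_bigr => j _; rewrite liftK rowE.
  (* Subtracting the least coefficient with the help of the relation [sumu0] leaves a nonnegative
     combination without the ray [u l]. *)
  case: (@Order.TotalTheory.arg_minP _ _ _ ord0 xpredT c isT) => l _ Hl.
  exists l => m Hm.
  have -> : v = \sum_j (c j - c l) *: u j.
    under eq_bigr do rewrite scalerBl.
    by rewrite sumrB -Ev -scaler_sumr sumu0 scaler0 subr0.
  rewrite ipair_sumr; apply: sumr_ge0 => j _; rewrite ipairZr.
  case: (unliftP l j) => [j' ->|->]; last by rewrite subrr mul0r.
  by rewrite mulr_ge0 ?subr_ge0 ?Hl// -rowE.
- exact: trivialized_sub.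
- move=> l l' j jl /=; have p0 : p%:Z != 0 by rewrite eqz_nat -lt0n.
  have E := @psi_diff (sg l') (sg l) (u j) (Hsg l j jl).
  apply: (mulfI p0); rewrite -[X in X - _]opprK -opprD ipairNl mulrN addrC E.
  case: eqP => [jl'|/eqP jl']; last by rewrite (psiE _ _ jl') subrr oppr0 mulr0n mulr0.
  (* The ray omitted from the cone [l'] is minus the sum of the others, so the defect of [Y] there
     is the total degree of the circuit. *)
  rewrite mulr1n -degC jl' sumu (bigD1 l')//=.
  under eq_bigr => i il do rewrite (psiE _ _ il).
  rewrite -ipair_sumr; congr (- (_ + _)).
  have := sumu0; rewrite (bigD1 l')//= => /eqP; rewrite addrC addr_eq0 => /eqP ->.
  by rewrite ipairNr.
Qed.

Lemma quadric_quadrant e1 e2 : quadric_fan p Y cover e1 e2 -> n = 2%N -> quadrant_fan L.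
Proof.
move=> [p2 [rE mE] [s12 c12] [s13 c13] [[s21 c21] [s23 c23]]] n2.
pose sgn (b : 'I_2) (x : M) := if b == ord0 then - x else x.
pose e (i : 'I_n) (b : 'I_2) := sgn b (if i == 0%N :> nat then e1 else e2).
have re i b : is_ray (e i b).
  by apply: rE; rewrite /e /sgn; do 2!case: ifP; rewrite !inE eqxx ?orbT.
have pe i b : psi (e i b) = -1.
  by apply/eqP; apply: (allP mE); rewrite /e /sgn; do 2!case: ifP; rewrite !inE eqxx ?orbT.
have sgnN (b : 'I_2) x : sgn (lift b (ord0 : 'I_1)) x = - sgn b x.
  by rewrite /sgn; case: b => [[|[|]]] //= lt; rewrite ?opprK.
have eN i (b : 'I_2) : e i (lift b (ord0 : 'I_1)) = - e i b by exact: sgnN.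
have stars b c : exists s, incone s (sgn b e1) /\ incone s (sgn c e2).
  rewrite /sgn; case: ifP => _; case: ifP => _.
  - by exists s23; have /and3P [] := c23.
  - by exists s21; have /and3P [] := c21.
  - by exists s13; have /and3P [] := c13.
  - by exists s12; have /and3P [] := c12.
have neq b c : sgn b e1 <> sgn c e2.
  move=> E; have [s [sb sc]] := stars b (lift c (ord0 : 'I_1)); rewrite sgnN -E in sc.
  apply: (cone_opp unimodular cover Y_min Y_strict _ sb) => //.
  by apply: rE; rewrite /sgn; case: ifP; rewrite !inE eqxx ?orbT.
have i1 (i : 'I_n) : i != 0%N :> nat -> i = 1%N :> nat.
  by have := ltn_ord i; move: n2 (nat_of_ord i) => ->; case=> [|[|]].
have pick_surj (b : 'I_n -> 'I_2) : exists x, forall i, pick_pair x i = b i.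
  have lt0 : (0 < n)%N by rewrite n2. have lt1 : (1 < n)%N by rewrite n2.
  exists (b (Ordinal lt0), b (Ordinal lt1)) => i; rewrite /pick_pair /=.
  case: eqP => [i0|/eqP /i1 i0]; congr b; exact: val_inj.
have /choice [sg Hsg] : forall x : 'I_2 * 'I_2, exists s, forall i, incone s (e i (lift (pick_pair x i) (ord0 : 'I_1))).
  move=> x; have [s [sb sc]] := stars (lift x.1 (ord0 : 'I_1)) (lift x.2 (ord0 : 'I_1)).
  by exists s => i; rewrite /e /pick_pair; case: eqP.
have rowE x j : ray (quadrant_rows e) x j = e j (lift (pick_pair x j) (ord0 : 'I_1)) by rewrite /ray rowK.
have rW x j : is_ray (ray (quadrant_rows e) x j) by rewrite rowE.
have sW x j : incone (sg x) (ray (quadrant_rows e) x j) by rewrite rowE.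
have iW x : injective (ray (quadrant_rows e) x).
  move=> j j'; rewrite !rowE /e; case: (eqVneq (j : nat) 0%N) => [j0|/i1 j0];
    case: (eqVneq (j' : nat) 0%N) => [j'0|/i1 j'0].
  - by move=> _; apply: val_inj; rewrite /= j0.
  - by move/neq.
  - by move/esym/neq.
  - by move=> _; apply: val_inj; rewrite /= j0.
exists (idx \o sg), e, (fun c l => a c (sg l)), (mm \o sg); split.
- apply: cone_frame_sub => // v.
  have uW x : quadrant_rows e x \in unitmx.
    by have [g [gi Eg]] := star_rows (rW x) (sW x) (@iW x); case: (permuted_rows gi Eg (unimodular _)).
  pose c (i : 'I_n) := ipair (cocone (quadrant_rows e) (ord0, ord0) i) v.
  have [x Hx] := pick_surj (fun i => if 0 <= c i then ord0 else lift ord0 (ord0 : 'I_1)).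
  exists x => m Hm; rewrite (ray_expand uW (ord0, ord0) v) ipair_sumr.
  apply: sumr_ge0 => i _; rewrite ipairZr -/(c i).
  have := Hm i; rewrite !rowE Hx.
  have -> : pick_pair (ord0, ord0) i = ord0 by rewrite /pick_pair; case: ifP.
  case: ifP => [c0|/negbT]; first by move=> ?; rewrite mulr_ge0.
  rewrite -ltNge => c0; rewrite eN ipairNr oppr_ge0 => ?.
  by rewrite mulr_le0// ltW.
- exact: trivialized_sub.
- by move=> i; rewrite eN subrr.
- move=> x y i /=; have liftN (b c : 'I_2) : b != c -> c = lift b (ord0 : 'I_1).
    by case: b c => [[|[|]]] // ? [[|[|]]] // ? //= _; exact: val_inj.
  pose r := e i (lift (pick_pair y i) (ord0 : 'I_1)).
  have := @psi_diff (sg x) (sg y) r (Hsg y i); rewrite p2.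
  have Er : e i (pick_pair y i) = - r by rewrite /r eN opprK.
  case: (eqVneq (pick_pair x i) (pick_pair y i)) => [E|ne].
    rewrite -(psi_in unimodular cover Y_min (s := sg x)); last by rewrite /r -E.
    by rewrite subrr Er ipairNr; move: (ipair _ _); clear; lia.
  have rx : incone (sg x) (- r) by rewrite -Er (liftN _ _ ne).
  have -> : ipair (Y (sg x)) r = - psi (- r).
    by rewrite (psi_in unimodular cover Y_min rx) ipairNr opprK.
  by rewrite -Er !pe Er ipairNr; move: (ipair _ _); clear; lia.
Qed.

End Selection.

Theorem toric_classification n p (k : closedFieldType) (Sigma : fan n)
    (L : line_bundle (toric_variety k Sigma)) :
  smooth_of_dim (toric_variety k Sigma) n -> projective (toric_variety k Sigma) ->
  ample L -> (1 <= p)%N -> (p <= n)%N -> H0_polyvector_neq0 p (lb_exp L (- p%:Z)) ->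
  [\/ simplex_fan L 1, [/\ p = 1%N, n = 1%N & simplex_fan L 2] |
      [/\ p = 2%N, n = 2%N & quadrant_fan L]].
Proof.
move=> smooth proj amp p0 pn [s [s1 s2] [c [x [F HF]]]].
have [I [idx [U [uU dU cU]]]] := maximal_cones smooth proj.
have [i0 _] := cU 0.
have [a [mm tr]] := toric_trivialization uU dU L i0; have [a1 a2 a3 a4] := tr.
have [d d0 [N [f [fc fiso]]]] := amp.
have conv := ample_convex uU dU a1 a2 a3 a4 d0 fc fiso.
have /choice [c0 c0P] := lb_covers L.
have [Y [w [Ymm w_add w_neq0 w_alt w_dual]]] := polyvector_weight uU dU i0 a1 a2 a3 a4 s1 s2 c0P
  (ex_intro _ c (ex_intro _ x (ex_intro _ F HF))) (chart_cover cU).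
have w_dual' i m : (forall j r, 0 <= ipair (m j) (ray U i r)) -> w m != 0 ->
    forall r, 0 <= ipair (Y i + \sum_j m j) (ray U i r).
  by move=> dm wm; apply/dU; apply: w_dual => // j; apply/dU.
have cover u : exists i, forall r, 0 <= ipair (cocone U i r) u.
  by have [i Hi] := cU u; exists i => r; apply: Hi; exact: cocone_dual.
have Yd i i' u : ipair (Y i') u - ipair (Y i) u = p%:Z * ipair (mm i - mm i') u.
  by rewrite -ipairBl Ymm ipairZl.
have Y_min i i' r : ipair (Y i) (ray U i r) <= ipair (Y i') (ray U i r).
  by rewrite -subr_ge0 Yd mulr_ge0//; case: (conv i' i r).
have Y_strict i i' r : ipair (Y i) (ray U i r) = ipair (Y i') (ray U i r) ->
    forall j, 0 <= ipair (cocone U i' j) (ray U i r).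
  move=> E; have := Yd i i' (ray U i r); rewrite -E subrr => /esym/eqP.
  by rewrite mulf_eq0 eqz_nat -[p == 0%N]negbK -lt0n p0 /= => /eqP; case: (conv i' i r).
have Y_mod i i' : exists D, Y i - Y i' = p%:Z *: D by exists (mm i' - mm i).
have ge := weight_ge uU w_add w_alt w_neq0 w_dual'.
have van := weight_vanish uU w_add w_dual'.
have [[C [cC szC deg]]|[n2 [e1 [e2 q]]]] := fan_classification uU cover Y_min Y_strict Y_mod p0
  pn ge w_add w_neq0 van.
  have simp e : - \sum_(u <- C) psi Y cover u = p%:Z * e -> simplex_fan L e.
    exact: (circuit_simplex uU dU tr Ymm Y_min Y_strict p0 cC szC).
  case: deg => [E|[p1 n1 E]]; first by constructor 1; apply: simp; rewrite mulr1.
  by constructor 2; split=> //; apply: simp; rewrite p1 mul1r.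
constructor 3; have := q => -[p2 _ _ _ _]; split=> //.
exact: (quadric_quadrant uU dU tr Ymm Y_min Y_strict q n2).
Qed.

(** * Isomorphisms in Cox coordinates *)

Section Atlas.
Variable k : fieldType.

(** Charts by a fixed space with total inverses. Toric varieties, projective space and the quadric
    are all compared through it. *)
Definition atlas (X A : kspace k) (I : Type) (V : I -> set X) (c : I -> X -> A) (e : I -> A -> X) :=
  [/\ forall x, exists i, V i x, forall i, is_morph (e i),
      forall i y, V i (e i y) /\ c i (e i y) = y, forall i x, V i x -> e i (c i x) = x &
      forall i W, open W -> open (V i `&` c i @^-1` W) /\
        forall h, regular A W h -> regular X (V i `&` c i @^-1` W) (h \o c i)].

Lemma atlas_map (X Y A : kspace k) (I : Type) V c e V' c' e' :
  @atlas X A I V c e -> @atlas Y A I V' c' e' ->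
  (forall i j y z, e i y = e j z -> e' i y = e' j z) ->
  exists f : morph X Y, forall i y, f (e i y) = e' i y.
Proof.
move=> [/choice [i0 Hi0] eM eV eK eP] [_ eM' _ _ _] E.
pose f x := e' (i0 x) (c (i0 x) x).
have fE i x : V i x -> f x = e' i (c i x).
  by move=> Vx; apply: E; rewrite !eK.
have [|F EF] := @is_morphP _ X Y f.
  apply: is_morph_local => x; exists (V (i0 x)); split=> //.
    rewrite -[V _]setIT -(preimage_setT (c (i0 x))); by case: (eP (i0 x) setT openT).
  move=> W oW; have [oW' rW'] := eM' (i0 x) W oW; have [oP rP] := eP (i0 x) _ oW'.
  have -> : V (i0 x) `&` f @^-1` W = V (i0 x) `&` c (i0 x) @^-1` (e' (i0 x) @^-1` W).
    by apply/seteqP; split=> z [Vz]; rewrite /preimage /= (fE _ _ Vz).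
  split=> // h rh; apply: (regular_ext _ (rP _ (rW' h rh))) => z.
  by rewrite inE => -[Vz _] /=; rewrite (fE _ _ Vz).
by exists F => i y; rewrite EF; have [Ve ce] := eV i y; rewrite (fE i)// ce.
Qed.

(** Gluing needs to be compared in one direction only: overlaps of [X] go to overlaps of [Y], where
    the gluing of [Y] names the matching point, and injectivity of the charts does the rest. *)
Lemma atlas_iso (X Y A : kspace k) (I : Type) V c e V' c' e' :
  @atlas X A I V c e -> @atlas Y A I V' c' e' ->
  (forall i j y z, e' i y = e' j z -> e i y = e j z) ->
  (forall i j z, V i (e j z) -> V' i (e' j z)) ->
  exists f : morph X Y, [/\ is_iso f, forall i y, f (e i y) = e' i y &
    forall i x, V' i (f x) <-> V i x].
Proof.
move=> aX aY E B; have [cov _ eV eK _] := aX; have [cov' _ eV' eK' _] := aY.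
have E' i j y z : e i y = e j z -> e' i y = e' j z.
  move=> H; have Vj : V i (e j z) by rewrite -H; case: (eV i y).
  have H' := eK' _ _ (B _ _ _ Vj); have := E _ _ _ _ H'; rewrite -H.
  move=> /(congr1 (c i)); rewrite (eV i _).2 (eV i _).2 => H2.
  by rewrite -H' H2.
have [f Hf] := atlas_map aX aY E'; have [g Hg] := atlas_map aY aX E.
exists f; split=> //.
  exists g; split=> [x|y].
    by have [i Vx] := cov x; rewrite -(eK i x Vx) Hf Hg.
  by have [i Vy] := cov' y; rewrite -(eK' i y Vy) Hg Hf.
move=> i x; split=> [Vx|Vx]; last by rewrite -(eK i x Vx) Hf; case: (eV' i (c i x)).
have [j Vj] := cov x; have := eK' i _ Vx; rewrite -{2}(eK j x Vj) Hf => /E H.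
by rewrite -(eK j x Vj) -H; case: (eV i (c' i (f x))).
Qed.

Lemma proj_atlas n : @atlas (proj_space k n) (affine_nspace k n) _ (@hcover k n) (@proj_inv k n) (@proj_chart k n).
Proof.
split.
- exact: hcover_covers.
- exact: proj_chart_morph.
- by move=> i y; split; [exact: hcover_self|exact: proj_chartK].
- exact: proj_invK.
- by move=> i W; exact: proj_inv_pull.
Qed.

End Atlas.

Section Cox.
Variables (n : nat) (k : closedFieldType) (Sigma : fan n).
Local Notation X := (toric_variety k Sigma).
Local Notation M := 'rV[int]_n.
Implicit Types s t : chart_index Sigma.

Lemma toric_atlas (J : finType) (idx : J -> chart_index Sigma) U (fr : cone_frame idx U)
    (dualE : forall i m, dual_monoid (sval (idx i)) m <-> forall j, 0 <= ipair m (ray U i j)) :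
  @atlas k X (affine_nspace k n) J (fun i => chart_open (idx i)) (crd idx U) (phi dualE).
Proof.
have [uU _ cU] := fr; split.
- exact: chart_cover.
- exact: phi_morph.
- by move=> i y; split; [exact: phi_open|exact: crd_phi].
- by move=> i x; exact: phi_crd.
- by move=> i W; exact: crd_pull.
Qed.

Lemma chart_meet_unit s t (g : chart_point k (sval t)) m : chart_open s (emb g) ->
  dual_monoid (sval t) m -> dual_monoid (sval s) (- m) -> sval g m != 0.
Proof.
move=> [g' /emb_eq [d [E1 _]]] dm dm'; rewrite E1//; apply: chart_unit.
  by apply: dual_monoidS dm => u [].
by apply: dual_monoidS dm' => u [].
Qed.

Variables (J : finType) (u : J -> M).

Definition adapted (sigma : set 'rV[rat]_n) (h : J -> k) := forall j, h j = 0 -> sigma (toQ (u j)).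

(** The point with Cox coordinates [h]. Adaptedness makes the exponent of a vanishing coordinate
    nonnegative. *)
Definition cox_fun (sigma : set 'rV[rat]_n) (h : J -> k) m : k :=
  if `[< dual_monoid sigma m >] then \prod_j h j ^ ipair m (u j) else 0.

Lemma cox_hom sigma h : adapted sigma h -> monoid_hom sigma (cox_fun sigma h).
Proof.
move=> ad; rewrite /cox_fun; split=> [|m m' dm dm'|m nm]; last by rewrite asboolF.
  rewrite asboolT; last exact: dual_monoid0.
  by rewrite big1// => j _; rewrite ipairC ipair0r expr0z.
rewrite !asboolT//; last exact: dual_monoidD.
rewrite -big_split; apply: eq_bigr => j _ /=; rewrite ipairDl.
have [h0|h0] := eqVneq (h j) 0; last by rewrite expfzDr.
have := dm _ (ad j h0); have := dm' _ (ad j h0); rewrite !pairing_toQ !ler0z.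
by case: (ipair m _) => // x; case: (ipair m' _) => // y _ _; rewrite -exprD.
Qed.

Definition cox sigma h (ad : adapted sigma h) : chart_point k sigma := exist _ _ (cox_hom ad).

Lemma cox_glue s t h (ads : adapted (sval s) h) (adt : adapted (sval t) h) :
  emb (cox ads) = emb (cox adt) :> X.
Proof.
apply/emb_eq; rewrite /glued /=.
have ad : adapted (sval s `&` sval t) h by move=> j hj; split; [exact: ads|exact: adt].
have sub1 : sval s `&` sval t `<=` sval s by move=> v [].
have sub2 : sval s `&` sval t `<=` sval t by move=> v [].
exists (cox ad); split=> m dm /=; rewrite /cox_fun !asboolT//; exact: dual_monoidS dm.
Qed.

End Cox.

Section ToricBundleIso.
Variables (n : nat) (k : closedFieldType) (Sigma : fan n).
Local Notation X := (toric_variety k Sigma).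
Local Notation M := 'rV[int]_n.

(** The frames [a c (sg j)] serve as the isomorphism. Their compatibility with the transition
    functions is an equality of regular functions, which is checked on the dense torus. *)
Lemma toric_lb_iso (J : finType) (idx : J -> chart_index Sigma) (L : line_bundle X)
    a mm (Y : kspace k) (f : morph X Y) (N : line_bundle Y) (sg : lb_index N -> J) :
  trivialized idx (L := L) a mm ->
  (forall j x, lb_cover N j (f x) <-> chart_open (idx (sg j)) x) ->
  (forall j j' s x, is_char x ->
     lb_trans N j j' (f (tpt s x)) = x (mm (sg j) - mm (sg j'))) ->
  lb_iso L (lb_pullback f N).
Proof.
move=> [a1 a2 a3 a4] fc ft; exists (fun c j => a c (sg j)).
have cE j : f @^-1` lb_cover N j = chart_open (idx (sg j)) :> set X.
  by apply/seteqP; split=> x /fc.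
have aE c j j' x : lb_cover L c x -> lb_cover N j (f x) -> lb_cover N j' (f x) ->
    a c (sg j') x = a c (sg j) x * lb_trans N j j' (f x).
  move=> Cx jx j'x.
  pose W : set X := lb_cover L c `&` (f @^-1` lb_cover N j `&` f @^-1` lb_cover N j').
  have [oj _] := morph_is_morph f (@lb_open _ _ N j).
  have [oj' _] := morph_is_morph f (@lb_open _ _ N j').
  have oc := @lb_open _ _ L c; have ojj := openI oj oj'; have oW : open W := openI oc ojj.
  have ra i : W `<=` chart_open (idx i) -> regular X W (a c i).
    have oi : open (chart_open (idx i) : set X) by exact: chart_openP.
    by move=> sW; refine (regular_sub (openI oc oi) oW _ (a1 c i)) => y Wy; split; [case: Wy|exact: sW].
  have rt : regular X W (fun y => lb_trans N j j' (f y)).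
    have [_ rN] := morph_is_morph f (openI (@lb_open _ _ N j) (@lb_open _ _ N j')).
    by refine (regular_sub ojj oW _ (rN _ (@lb_regular _ _ N j j'))) => y [].
  have rD : regular X W (fun y => a c (sg j') y + (- 1) * (a c (sg j) y * lb_trans N j j' (f y))).
    apply: regularD => //; first by apply: ra => y [_ [_]]; rewrite cE.
    apply: regularM => //; first exact: regular_cst.
    by apply: regularM => //; apply: ra => y [_ []]; rewrite cE.
  apply/eqP; rewrite -subr_eq0 -mulN1r; apply: contraT => nz.
  have [|y cy [Wy /=]] := @tpt_dense _ _ _ _ (idx (sg j)) (open_regular_neq0 oW rD).
    by exists x; split.
  by case/negP; rewrite ft// (a4 c (sg j') (sg j))//; [rewrite mulN1r [X in _ - X]mulrC subrr|case: Wy].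
split.
- by move=> c j; rewrite /= cE; exact: a1.
- by move=> c j x Cx /fc; exact: a2.
- move=> c c' j j' x Cx Cx' jx j'x /=; rewrite a3//; last exact/fc.
  exact: aE.
Qed.

End ToricBundleIso.

Lemma expz_sum (k : fieldType) (c : k) (J : Type) (r : seq J) (F : J -> int) : c != 0 ->
  \prod_(j <- r) c ^ F j = c ^ \sum_(j <- r) F j.
Proof.
move=> c0; apply/esym/(big_morph (fun e => c ^ e)) => // a b.
by rewrite expfzDr.
Qed.

Section SimplexIso.
Variables (n : nat) (k : closedFieldType) (Sigma : fan n).
Local Notation X := (toric_variety k Sigma).
Local Notation M := 'rV[int]_n.

(** In the chart [l] the point with affine coordinates [y] has the homogeneous coordinates of
    [proj_chart l y] as Cox coordinates. Hence equality in projective space implies equality in the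
    toric variety. *)
Lemma simplex_iso (L : line_bundle X) d : simplex_fan L d -> polarized_iso L (Od k n d).
Proof.
move=> [idx [u [a [mm [fr tr sumu Hd]]]]]; have [uU dU _] := fr.
pose U := simplex_rows u.
have rowE l j : ray U l j = u (lift l j) by rewrite /ray rowK.
have mem l j : j != l -> sval (idx l) (toQ (u j)).
  move=> jl; apply: cone_mem => m /dU H.
  by case: (unliftP l j) jl => [j' ->|->]; [rewrite -rowE|rewrite eqxx].
have adapt l (V : proj_space k n) : hcover l V -> adapted u (sval (idx l)) (hcoord V).
  by move=> lV j hj; apply: mem; apply: contraTneq lV => <-; rewrite /hcover /= hj eqxx.
have phiE l y (V : proj_space k n) (ad : adapted u (sval (idx l)) (hcoord V)) :
    V = proj_chart l y -> phi dU l y = emb (cox ad).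
  move=> EV; congr emb; apply: chart_point_eq => m dm; rewrite /= /chart_fun /cox_fun !asboolT//.
  (* The unknown scale [c] of the homogeneous coordinates disappears because the rays sum to
     zero. *)
  have [c c0 Ec] := hcoord_chart l y; rewrite -EV in Ec.
  under [RHS]eq_bigr do rewrite Ec expfzMl.
  rewrite big_split /= (expz_sum (index_enum _) (ipair m \o u) c0) -ipair_sumr sumu ipair0r expr0z mul1r.
  rewrite (bigD1_ord l)//= chart_vec1 exp1rz mul1r /mono; apply: eq_bigr => j _.
  rewrite mxE liftK -rowE; have /dU /(_ j) := dm.
  by case: (ipair _ _).
have [f [isof fE fV]] : exists f : morph X (proj_space k n), [/\ is_iso f,
    forall i y, f (phi dU i y) = proj_chart i y & forall i x, hcover i (f x) <-> chart_open (idx i) x].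
  apply: (atlas_iso (toric_atlas k fr dU) (proj_atlas k n)).
    move=> l l' y z E; have Hl := adapt l _ (hcover_self l y).
    have Hl' : adapted u (sval (idx l')) (hcoord (proj_chart l y)).
      by rewrite E; apply: adapt; exact: hcover_self.
    by rewrite (phiE l y _ Hl erefl) (phiE l' z _ Hl' E); exact: cox_glue.
  move=> l l' z lz; apply/hcover_chart; rewrite mxE.
  case: unliftP => [j Ej|_]; last exact: oner_neq0.
  have dm : dual_monoid (sval (idx l')) (cocone U l' j) by exact: (cocone_dual uU dU).
  rewrite -(mono_cocone uU l' j) -(chi_phi _ _ dm) chi_emb.
  (* The coordinate of the chart [l'] dual to the ray [u l] is invertible on the overlap, since its
     inverse is a monomial of the chart [l]. *)
  apply: (chart_meet_unit lz dm); apply/dU => r; rewrite rowE.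
  have Hr i : i != l' -> ipair (cocone U l' j) (u i) = (i == l)%:R.
    case: (unliftP l' i) => [i' -> _|->]; last by rewrite eqxx.
    by rewrite -rowE (cocone_ray uU) Ej (inj_eq lift_inj) eq_sym.
  rewrite ipairNl; have [El|ne] := eqVneq (lift l r) l'.
    rewrite El; have := sumu; rewrite (bigD1 l')//= => /eqP; rewrite addr_eq0 => /eqP ->.
    rewrite ipairNr opprK ipair_sumr; apply: sumr_ge0 => i il.
    by rewrite Hr.
  by rewrite Hr// [_ == l]eq_sym (negPf (neq_lift _ _)) oppr0.
exists f => //.
apply: (@toric_lb_iso _ _ _ _ _ _ _ _ _ f (Od k n d) (fun l : 'I_n.+1 => l) tr) => [j x|l l' s x cx]; first exact: fV.
have [Tx ->] := tpt_phi uU dU l s cx.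
rewrite fE /= htrans_chart chart_vec1 divr1 mxE.
have -> : mm l - mm l' = \sum_r (d *+ (lift l r == l')) *: cocone U l r.
  rewrite [LHS](cocone_expand uU l); apply: eq_bigr => r _.
  by rewrite rowE Hd// eq_sym neq_lift.
case: unliftP => [j ->|->].
  rewrite (bigD1 j)//= eqxx mulr1n big1 ?addr0 => [|r rj].
    by rewrite charMz// mxE.
  by rewrite (inj_eq lift_inj) (negPf rj) scale0r.
rewrite exp1rz big1 ?cx.1// => r _.
by rewrite eq_sym (negPf (neq_lift _ _)) scale0r.
Qed.

End SimplexIso.

Lemma is_morph_pair (k : fieldType) (X A B : kspace k) (f : X -> A) (g : X -> B) :
  is_morph f -> is_morph g -> is_morph (fun x => (f x, g x) : prod_space A B).
Proof.
move=> mf mg W oW; pose F x : prod_space A B := (f x, g x).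
pose N (UV : open_pair A B) : set X := f @^-1` (sval UV.1) `&` g @^-1` (sval UV.2).
have oN UV : open (N UV).
  by apply: openI; [case: (mf _ (svalP UV.1))|case: (mg _ (svalP UV.2))].
have rN UV (b : A * B -> k) : gen_alg (rectangle_fun UV) b -> regular X (N UV) (b \o F).
  apply: regular_gen_alg => // h [[h' rh ->]|[h' rh ->]].
    have [o r] := mf _ (svalP UV.1).
    by refine (regular_sub o (oN UV) _ (r _ rh)) => y [].
  have [o r] := mg _ (svalP UV.2).
  by refine (regular_sub o (oN UV) _ (r _ rh)) => y [].
have oFW : open (F @^-1` W).
  rewrite openE => x Wx; rewrite /interior nbhsE /=.
  have [UV [b [Gb Dx bx sb]]] := oW _ Wx.
  exists (N UV `&` [set y | (b \o F) y != 0]).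
    by split=> //; exact: open_regular_neq0 (rN _ _ Gb).
  by move=> y [Ny by0]; exact: sb.
split=> // h rh; apply: regular_local => // x Wx.
have [UV [a [b [Ga Gb Dx bx E]]]] := rh _ Wx.
have oNb : open (N UV `&` [set y | (b \o F) y != 0]) by exact: open_regular_neq0 (rN _ _ Gb).
have oV := openI oFW oNb.
exists (F @^-1` W `&` (N UV `&` [set y | (b \o F) y != 0])); split=> //.
apply: (@regular_ext _ _ _ (fun y => (a \o F) y / (b \o F) y)).
  by move=> y; rewrite inE => -[Wy [Ny by0]]; rewrite /= (E (F y)).
apply: regular_div => //; last by move=> y [_ []].
  by refine (regular_sub (oN UV) oV _ (rN _ _ Ga)) => y [_ []].
by refine (regular_sub (oN UV) oV _ (rN _ _ Gb)) => y [_ []].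
Qed.

Section Quadric.
Variable k : closedFieldType.
Local Notation P1 := (proj_space k 1).
Local Notation P11 := (prod_space P1 P1).
Local Notation A2 := (affine_nspace k 2).
Local Notation other b := (lift b (ord0 : 'I_1)).
Local Notation i0 := (ord0 : 'I_2).
Local Notation i1 := (lift (ord0 : 'I_2) (ord0 : 'I_1)).

Definition component (z : P11) (i : 'I_2) : P1 := if i == 0%N :> nat then z.1 else z.2.

Definition quad_cover (x : 'I_2 * 'I_2) : set P11 := [set z | hcover x.1 z.1 /\ hcover x.2 z.2].

Definition quad_crd (x : 'I_2 * 'I_2) (z : P11) : A2 :=
  \row_i htrans (pick_pair x i) (other (pick_pair x i)) (component z i).

Definition quad_chart (x : 'I_2 * 'I_2) (y : A2) : P11 :=
  (proj_chart x.1 (const_mx (y 0 i0)), proj_chart x.2 (const_mx (y 0 i1))).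

Lemma component_chart x y i : component (quad_chart x y) i = proj_chart (pick_pair x i) (const_mx (y 0 i)).
Proof.
rewrite /component /pick_pair; case: eqP => [E|/eqP E]; congr proj_chart; congr const_mx; congr (y 0 _);
  apply: val_inj => //=.
by case: i E => [[|[|]]].
Qed.

Lemma const_proj_inv (a : 'I_2) (V : P1) : const_mx (htrans a (other a) V) = proj_inv a V.
Proof. by apply/rowP => j; rewrite !mxE (ord1 j). Qed.

Lemma quad_cover_open x : open (quad_cover x).
Proof.
have [o1 _] := morph_is_morph (pr1 P1 P1) (@hcover_open k 1 x.1).
have [o2 _] := morph_is_morph (pr2 P1 P1) (@hcover_open k 1 x.2).
exact: openI.
Qed.

Lemma quad_atlas : atlas quad_cover quad_crd quad_chart.
Proof.
split.
- move=> z; have [a Ha] := hcover_covers z.1; have [b Hb] := hcover_covers z.2.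
  by exists (a, b).
- move=> x; have cst i : is_morph (fun y : A2 => const_mx (y 0 i) : affine_nspace k 1).
    apply: is_morph_affine => _ [j ->]; apply: affine_regular_gen; apply: gen_alg_gen.
    by exists i; apply/funext => y; rewrite /= mxE.
  apply: is_morph_pair; apply: (is_morph_comp (cst _)); exact: proj_chart_morph.
- move=> x y; split; first by split; exact: hcover_self.
  apply/rowP => i; rewrite mxE component_chart htrans_chart chart_vec1 divr1.
  by rewrite mxE liftK mxE.
- move=> x z [H1 H2]; rewrite /quad_chart !mxE /component /pick_pair /=.
  by rewrite !const_proj_inv !proj_invK//; case: z H1 H2.
- move=> x W; apply: affine_pull; first exact: quad_cover_open.
  move=> _ [i ->]; rewrite (_ : _ \o _ = fun z => htrans (pick_pair x i) (other (pick_pair x i)) (component z i)); last first.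
    by apply/funext => z; rewrite /= mxE.
  rewrite /component /pick_pair; case: ifP => _.
    have [o r] := morph_is_morph (pr1 P1 P1) (@hcover_open k 1 x.1).
    by refine (regular_sub o (@quad_cover_open x) _ (r _ (@htrans_regular1 k 1 x.1 _))) => z [].
  have [o r] := morph_is_morph (pr2 P1 P1) (@hcover_open k 1 x.2).
  by refine (regular_sub o (@quad_cover_open x) _ (r _ (@htrans_regular1 k 1 x.2 _))) => z [].
Qed.

(** As for the simplex, with the homogeneous coordinates of both factors as Cox coordinates; here
    the scale of each factor cancels because its two rays are opposite. *)
Lemma quadrant_iso (Sigma : fan 2) (L : line_bundle (toric_variety k Sigma)) :
  quadrant_fan L -> polarized_iso L (O11 k).
Proof.
move=> [idx [e [a [mm [fr tr eN Hd]]]]]; have [uU dU _] := fr.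
pose U := quadrant_rows e; pose X := toric_variety k Sigma.
have rowE x j : ray U x j = e j (other (pick_pair x j)) by rewrite /ray rowK.
have eother i (b : 'I_2) : e i (other b) = - e i b.
  apply/eqP; rewrite -addr_eq0; have := eN i.
  have i1E (c : 'I_2) : c != ord0 -> c = i1 by case: c => [[|[|]]] // ? _; exact: val_inj.
  have [->|/i1E ->] := eqVneq b ord0; first by rewrite addrC => ->.
  by rewrite (_ : other i1 = ord0) => [->//|]; exact: val_inj.
have liftN (b c : 'I_2) : b != c -> c = other b.
  by case: b c => [[|[|]]] // ? [[|[|]]] // ? //= _; exact: val_inj.
pose u (ib : 'I_2 * 'I_2) := e ib.1 ib.2.
pose hc (z : P11) (ib : 'I_2 * 'I_2) := hcoord (component z ib.1) ib.2.
have qc x z i : quad_cover x z -> hcover (pick_pair x i) (component z i).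
  by rewrite /component /pick_pair => -[]; case: ifP.
have adapt x z : quad_cover x z -> adapted u (sval (idx x)) (hc z).
  move=> xz [i b] hib; rewrite /hc /= in hib; apply: cone_mem => m /dU H; rewrite /u /=.
  rewrite (liftN (pick_pair x i) b) -?rowE//; apply: contraTneq (qc x z i xz) => ->.
  by rewrite /hcover /= hib eqxx.
have phiE x y (z : P11) (ad : adapted u (sval (idx x)) (hc z)) :
    z = quad_chart x y -> phi dU x y = emb (cox ad).
  move=> Ez; congr emb; apply: chart_point_eq => m dm; rewrite /= /chart_fun /cox_fun !asboolT//.
  rewrite /mono -(pair_bigA _ (fun i b => hc z (i, b) ^ ipair m (u (i, b)))) /=.
  apply: eq_bigr => i _; rewrite /hc /u /= Ez component_chart.
  have [c c0 Ec] := hcoord_chart (pick_pair x i) (const_mx (y 0 i) : affine_nspace k 1).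
  under [RHS]eq_bigr do rewrite Ec expfzMl.
  rewrite big_split /= (expz_sum (index_enum _) (ipair m \o e i) c0) -ipair_sumr.
  rewrite (bigD1_ord (pick_pair x i))//= big_ord1 eother subrr ipair0r expr0z mul1r.
  rewrite (bigD1_ord (pick_pair x i))//= big_ord1 chart_vec1 exp1rz mul1r.
  rewrite mxE liftK mxE -rowE; have /dU /(_ i) := dm.
  by case: (ipair _ _).
have [f [isof fE fV]] : exists f : morph X P11, [/\ is_iso f,
    forall x y, f (phi dU x y) = quad_chart x y & forall x z, quad_cover x (f z) <-> chart_open (idx x) z].
  apply: (atlas_iso (toric_atlas k fr dU) quad_atlas).
    move=> x x' y z E.
    have cE w t : quad_cover w (quad_chart w t) by split; exact: hcover_self.
    have H := adapt _ _ (cE x y); have H' := adapt _ _ (cE x' z); rewrite -E in H'.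
    by rewrite (phiE x y _ H erefl) (phiE x' z _ H' E); exact: cox_glue.
  move=> x x' z xz.
  have H i : hcover (pick_pair x i) (proj_chart (pick_pair x' i) (const_mx (z 0 i) : affine_nspace k 1)).
    apply/hcover_chart; rewrite mxE; case: unliftP => [j Ej|_]; last exact: oner_neq0.
    have dm : dual_monoid (sval (idx x')) (cocone U x' i) by exact: (cocone_dual uU dU).
    rewrite mxE -(mono_cocone uU x' i) -(chi_phi _ _ dm) chi_emb.
    apply: (chart_meet_unit xz dm); apply/dU => r; rewrite ipairNl rowE.
    have Hr : ipair (cocone U x' i) (e r (other (pick_pair x' r))) = (i == r)%:R.
      by rewrite -rowE (cocone_ray uU).
    move: Hr; have [<-|ne] := eqVneq i r.
      by rewrite Ej (ord1 j) !eother !ipairNr opprK => ->.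
    have [->|/liftN ->] := eqVneq (pick_pair x r) (pick_pair x' r); first by move=> ->; rewrite oppr0.
    by rewrite !eother opprK ipairNr opprK => ->.
  by split; [exact: (H i0)|exact: (H i1)].
exists f => //.
apply: (@toric_lb_iso _ _ _ _ _ _ _ _ _ f (O11 k) (fun x : 'I_2 * 'I_2 => x) tr) => [x z|x x' s c cc].
  exact: fV.
have [Tx ->] := tpt_phi uU dU x s cc.
have E i : htrans (pick_pair x i) (pick_pair x' i) (component (quad_chart x (\row_j c (cocone U x j))) i) =
    c ((pick_pair x i != pick_pair x' i)%:R *: cocone U x i).
  rewrite component_chart htrans_chart chart_vec1 divr1 mxE.
  have [<-|ne] := eqVneq (pick_pair x i) (pick_pair x' i).
    by rewrite unlift_none scale0r cc.1.
  by rewrite (liftN _ _ ne) liftK scale1r !mxE.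
rewrite fE; transitivity (\prod_i htrans (pick_pair x i) (pick_pair x' i)
    (component (quad_chart x (\row_j c (cocone U x j))) i)).
  by rewrite big_ord_recl big_ord1.
under eq_bigr do rewrite E.
rewrite -char_prod//; congr c; rewrite [RHS](cocone_expand uU x); apply: eq_bigr => i _.
congr (_ *: _); rewrite rowE; have := Hd x x' i.
have [<-|/liftN ->] := eqVneq (pick_pair x i) (pick_pair x' i); last by move=> ->.
by rewrite eother ipairNr => ->; rewrite oppr0.
Qed.

End Quadric.

(** * Polyvector fields on the model varieties *)

Section LineDerivative.
Variables (k : closedFieldType) (n : nat).
Local Notation An := (affine_nspace k n).
Local Notation gens := [set f : 'rV[k]_n -> k | exists i, f = fun y => y 0 i].
Implicit Types (y w : 'rV[k]_n) (G : 'rV[k]_n -> k).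

Definition line_rep (g : k -> k) (p q : {poly k}) :=
  q`_0 != 0 /\ forall t, q.[t] != 0 -> g t = p.[t] / q.[t].

(** The derivative of [p / q] at 0, written with coefficients and therefore valid in every
    characteristic. *)
Definition quot_deriv (p q : {poly k}) : k := (p`_1 * q`_0 - p`_0 * q`_1) / q`_0 ^+ 2.

Lemma line_rep_unique g p q p' q' : line_rep g p q -> line_rep g p' q' ->
  quot_deriv p q = quot_deriv p' q'.
Proof.
move=> [q0 E] [q0' E'].
have nz (r : {poly k}) : r`_0 != 0 -> r != 0 by apply: contraNneq => ->; rewrite coef0.
have H : p * q' = p' * q.
  apply: (@poly_cofinite_eq _ (q * q')); first by rewrite mulf_neq0// nz.
  move=> t; rewrite hornerM mulf_eq0 negb_or => /andP [qt qt'].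
  have := E t qt; rewrite E'// !hornerM => /eqP.
  by rewrite eqr_div// => /eqP ->.
have H0 := congr1 (fun r : {poly k} => r`_0) H; have H1 := congr1 (fun r : {poly k} => r`_1) H.
rewrite /= !coef0M in H0; rewrite /= !coef1M in H1.
have Ep' : p'`_0 = p`_0 * q'`_0 / q`_0 by rewrite H0 mulfK.
have Ep1 : p'`_1 = (p`_0 * q'`_1 + p`_1 * q'`_0 - p'`_0 * q`_1) / q`_0.
  by rewrite H1 addrAC subrr add0r mulfK.
by rewrite /quot_deriv Ep1 Ep'; field; rewrite q0 q0'.
Qed.

Definition line_deriv g : k :=
  xget 0 [set d | exists p q, line_rep g p q /\ d = quot_deriv p q].

Lemma line_derivE g p q : line_rep g p q -> line_deriv g = quot_deriv p q.
Proof.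
move=> r; rewrite /line_deriv; case: xgetP => [d _ [p' [q' [r' ->]]]|/(_ (quot_deriv p q)) []].
  exact: line_rep_unique r' r.
by exists p, q.
Qed.

Definition directional y w G := line_deriv (fun t => G (y + t *: w)).

Lemma gen_alg_line y w G : gen_alg gens G -> exists p : {poly k}, forall t, G (y + t *: w) = p.[t].
Proof.
elim=> {G}[_ [i ->]|c|f g _ [p Ep] _ [q Eq]|f g _ [p Ep] _ [q Eq]].
- by exists ((y 0 i)%:P + w 0 i *: 'X) => t; rewrite hornerD hornerC hornerZ hornerX !mxE mulrC.
- by exists c%:P => t; rewrite hornerC.
- by exists (p + q) => t; rewrite hornerD Ep Eq.
- by exists (p * q) => t; rewrite hornerM Ep Eq.
Qed.

Lemma regular_line_rep (V : set An) y w G : open V -> V y -> regular An V G ->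
  exists p q, line_rep (fun t => G (y + t *: w)) p q /\ forall t, q.[t] != 0 -> V (y + t *: w).
Proof.
move=> oV Vy rG; have [_ [b [Gb _ by0 sb]]] := oV y Vy.
have [_ [u [v [Gu Gv _ vy E]]]] := rG y Vy.
have [pb Eb] := gen_alg_line y w Gb; have [pu Eu] := gen_alg_line y w Gu.
have [pv Ev] := gen_alg_line y w Gv.
have y0 : y + 0 *: w = y by rewrite scale0r addr0.
exists (pu * pb), (pv * pb); split; last first.
  by move=> t; rewrite hornerM mulf_eq0 negb_or => /andP [_]; rewrite -Eb; exact: sb.
split=> [|t]; first by rewrite -horner_coef0 hornerM -Eb -Ev y0 mulf_neq0.
rewrite !hornerM mulf_eq0 negb_or => /andP [vt bt].
rewrite -mulf_div divff// mulr1 -Eu -Ev; apply: E => //; last by rewrite Ev.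
by apply: sb => //; rewrite Eb.
Qed.

Lemma directional_tangent y w : @tangent_vector k An y (directional y w).
Proof.
split=> [f g [V [oV Vy rf]] _ [W [oW Wy EW]]|c f g [V [oV Vy rf]] [W [oW Wy rg]]|
    f g [V [oV Vy rf]] [W [oW Wy rg]]].
- have oVW := openI oV oW.
  have rf' : regular An (V `&` W) f by refine (regular_sub oV oVW _ rf) => z [].
  have [p [q [r sV]]] := @regular_line_rep (V `&` W) y w f oVW (conj Vy Wy) rf'.
  rewrite /directional (line_derivE r); symmetry; apply: line_derivE.
  case: r => q0 E; split=> // t qt; rewrite -E// EW// inE; by case: (sV t qt).
- have [p [q [[q0 E] _]]] := regular_line_rep w oV Vy rf.
  have [p' [q' [[q0' E'] _]]] := regular_line_rep w oW Wy rg.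
  rewrite /directional (line_derivE (conj q0 E)) (line_derivE (conj q0' E')).
  rewrite (@line_derivE _ (c *: (p * q') + p' * q) (q * q')).
    rewrite /quot_deriv !coefD !coefZ !coef1M !coef0M; field; by rewrite q0 q0'.
  split=> [|t]; first by rewrite coef0M mulf_neq0.
  rewrite hornerM mulf_eq0 negb_or => /andP [qt qt']; rewrite E// E'//.
  rewrite hornerD hornerZ !hornerM; by field; rewrite qt qt'.
- have [p [q [[q0 E] _]]] := regular_line_rep w oV Vy rf.
  have [p' [q' [[q0' E'] _]]] := regular_line_rep w oW Wy rg.
  have y0 : y + 0 *: w = y by rewrite scale0r addr0.
  have fy : f y = p`_0 / q`_0 by rewrite -{1}y0 E -?horner_coef0 ?horner_coef0.
  have gy : g y = p'`_0 / q'`_0 by rewrite -{1}y0 E' -?horner_coef0 ?horner_coef0.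
  rewrite /directional (line_derivE (conj q0 E)) (line_derivE (conj q0' E')) fy gy.
  rewrite (@line_derivE _ (p * p') (q * q')).
    rewrite /quot_deriv !coef1M !coef0M; field; by rewrite q0 q0'.
  split=> [|t]; first by rewrite coef0M mulf_neq0.
  by rewrite !hornerM mulf_eq0 negb_or => /andP [qt qt']; rewrite E// E'// mulf_div.
Qed.

Lemma directional_coord y w i : directional y w (fun z => z 0 i) = w 0 i.
Proof.
rewrite /directional (@line_derivE _ ((y 0 i)%:P + w 0 i *: 'X) 1).
  rewrite /quot_deriv coef1 !coefD !coefZ !coefX !coefC /=; by field; rewrite oner_neq0.
split=> [|t _]; first by rewrite coef1 oner_neq0.
by rewrite hornerD hornerC hornerZ hornerX hornerC !mxE divr1 mulrC.
Qed.

End LineDerivative.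

Section TangentQuotient.
Variables (k : fieldType) (X : kspace k).

Lemma tangent_vector_quot (x : X) t f a b : tangent_vector x t -> regular_at x f ->
  regular_at x a -> regular_at x b -> b x != 0 ->
  (exists V, [/\ open V, V x & forall y, V y -> f y * b y = a y]) ->
  t f = (t a - f x * t b) / b x.
Proof.
move=> [t1 _ t3] rf ra rb b0 [V [oV Vx E]].
have /t1 H : exists V, [/\ open V, V x & {in V, (fun y => f y * b y) =1 a}].
  by exists V; split=> // y; rewrite inE; exact: E.
apply: (canRL (mulfK b0)); rewrite -H//; last exact: regular_atM.
by rewrite t3//; ring.
Qed.

End TangentQuotient.

Section AffineFields.
Variables (k : closedFieldType) (n : nat).
Local Notation An := (affine_nspace k n).
Local Notation gens := [set f : 'rV[k]_n -> k | exists i, f = fun y => y 0 i].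

Lemma affine_regular_at (g : An -> k) (y : An) : gen_alg gens g -> regular_at y g.
Proof.
by move=> Gg; exists setT; split=> //; [exact: openT|exact: affine_regular_gen].
Qed.

Variable w : 'rV[k]_n -> 'rV[k]_n.
Hypothesis w_alg : forall i, gen_alg gens (fun y => w y 0 i).

Lemma directional_gen_alg g : gen_alg gens g -> gen_alg gens (fun y => directional y (w y) g).
Proof.
elim=> {g}[_ [i ->]|c|f g Gf IHf Gg IHg|f g Gf IHf Gg IHg].
- rewrite (_ : (fun y => _) = fun y => w y 0 i); first exact: w_alg.
  by apply/funext => y; exact: directional_coord.
- rewrite (_ : (fun y => _) = fun=> 0); first exact: gen_alg_cst.
  by apply/funext => y; exact: (tangent_vector_cst c (directional_tangent y (w y))).
- rewrite (_ : (fun y => _) = fun y => directional y (w y) f + directional y (w y) g).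
    exact: gen_algD.
  apply/funext => y; have [_ t2 _] := directional_tangent y (w y).
  have := t2 1 f g (affine_regular_at y Gf) (affine_regular_at y Gg).
  by rewrite mul1r => <-; congr directional; apply/funext => z; rewrite mul1r.
- rewrite (_ : (fun y => _) = fun y => f y * directional y (w y) g + g y * directional y (w y) f).
    by apply: gen_algD; exact: gen_algM.
  apply/funext => y; have [_ _ t3] := directional_tangent y (w y).
  exact: t3 (affine_regular_at y Gf) (affine_regular_at y Gg).
Qed.

Lemma directional_field : vector_field (X := An) setT (fun y => directional y (w y)).
Proof.
split=> [y _|V g oV _ rg]; first exact: directional_tangent.
move=> y Vy; have [i [a [b [Ga Gb Dy by0 E]]]] := rg y Vy.
exists i, (fun y => directional y (w y) a * b y + (- 1) * (a y * directional y (w y) b)),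
  (fun y => b y * b y); split=> //.
- apply: gen_algD; first by apply: gen_algM => //; exact: directional_gen_alg.
  apply: gen_algM; first exact: gen_alg_cst.
  by apply: gen_algM => //; exact: directional_gen_alg.
- exact: gen_algM.
- by rewrite mulf_neq0.
- move=> z Vz Dz; rewrite mulf_eq0 orbb => bz.
  rewrite (@tangent_vector_quot _ _ _ _ g a b (directional_tangent z (w z)))//.
  + by rewrite E//; field.
  + by exists V.
  + exact: affine_regular_at.
  + exact: affine_regular_at.
  + have ob : open ([set: An] `&` [set z | b z != 0]).
      by apply: open_regular_neq0; [exact: openT|exact: affine_regular_gen].
    exists (V `&` ([set: An] `&` [set z | b z != 0])); split=> //; first exact: openI.
    by move=> z' [Vz' [_ bz']]; rewrite E// divfK.
Qed.

End AffineFields.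

Section AtlasFields.
Variables (k : closedFieldType) (n : nat) (X : kspace k) (I : Type).
Local Notation An := (affine_nspace k n).
Local Notation gens := [set f : 'rV[k]_n -> k | exists i, f = fun y => y 0 i].
Variables (V : I -> set X) (c : I -> X -> An) (e : I -> An -> X).
Hypothesis at_ : atlas V c e.

Lemma atlas_field i v : vector_field (X := An) setT v ->
  vector_field (V i) (fun x f => v (c i x) (f \o e i)).
Proof.
have [_ eM eV eK eP] := at_; have eMi := eM i.
have reg x f : V i x -> regular_at x f -> regular_at (c i x) (f \o e i).
  move=> Vx [W [oW Wx rf]]; have [oW' rW'] := eMi W oW.
  by exists (e i @^-1` W); split=> //; [rewrite /preimage /= eK|exact: rW'].
move=> [vt vr]; split=> [x Vx|W f oW sW rf].
  have [t1 t2 t3] := vt (c i x) Logic.I; split=> [f g rf rg [W [oW Wx EW]]|d f g rf rg|f g rf rg].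
  - apply: t1; [exact: reg|exact: reg|]; have [oW' _] := eMi W oW.
    exists (e i @^-1` W); split=> //; first by rewrite /preimage /= eK.
    by move=> z; rewrite inE => Wz; rewrite /= EW// inE.
  - by rewrite -t2; [|exact: reg|exact: reg].
  - by have /= := t3 _ _ (reg _ _ Vx rf) (reg _ _ Vx rg); rewrite eK.
have [oW' rW'] := eMi W oW; have [oP rP] := eP i _ oW'.
have EW : W = V i `&` c i @^-1` (e i @^-1` W).
  apply/seteqP; split=> x; last by move=> [Vx]; rewrite /preimage /= eK.
  by move=> Wx; have Vx := sW x Wx; split=> //; rewrite /preimage /= eK.
rewrite EW; apply: (rP (fun y => v y (f \o e i))).
by apply: vr => //; exact: rW'.
Qed.

(** Tangent vectors that agree on the coordinates agree on polynomials in them, hence on local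
    quotients by the quotient rule. *)
Lemma atlas_tangent_eq i x t t' f : V i x -> tangent_vector x t -> tangent_vector x t' ->
  (forall l, t (fun z => c i z 0 l) = t' (fun z => c i z 0 l)) -> regular_at x f -> t f = t' f.
Proof.
have [_ eM eV eK eP] := at_; move=> Vx tv tv' Et [W [oW Wx rf]].
have [oW' rW'] := eM i W oW.
have Vy : (e i @^-1` W) (c i x) by rewrite /preimage /= eK.
have [_ [a [b [Ga Gb _ b0 E]]]] := rW' f rf _ Vy.
have oV : open (V i) by rewrite -[V i]setIT -(preimage_setT (c i)); case: (eP i setT openT).
have rg (g : 'rV[k]_n -> k) : gen_alg gens g ->
    regular X (V i) (g \o c i).
  move=> Gg; have [_ r] := eP i setT openT.
  have := r g (affine_regular_gen Gg); by rewrite preimage_setT setIT.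
have ra (g : 'rV[k]_n -> k) : gen_alg gens g ->
    regular_at x (g \o c i) by move=> Gg; exists (V i); split=> //; exact: rg.
have tE (g : 'rV[k]_n -> k) : gen_alg gens g -> t (g \o c i) = t' (g \o c i).
  have [_ t2 t3] := tv; have [_ t2' t3'] := tv'.
  elim=> {g}[_ [l ->]|d|g h Gg IHg Gh IHh|g h Gg IHg Gh IHh]; first exact: Et.
  - by rewrite (tangent_vector_cst d tv) (tangent_vector_cst d tv').
  - rewrite (_ : _ \o c i = fun z => 1 * (g \o c i) z + (h \o c i) z); last first.
      by apply/funext => z; rewrite mul1r.
    by rewrite t2 ?t2' ?IHg ?IHh//; exact: ra.
  - by rewrite t3 ?t3'; [|exact: ra..]; rewrite /= in IHg IHh *; rewrite IHg IHh.
have H : exists V, [/\ open V, V x & forall y, V y -> f y * (b \o c i) y = (a \o c i) y].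
  exists (W `&` (V i `&` [set z | (b \o c i) z != 0])); split=> //.
    by apply: openI => //; apply: open_regular_neq0 => //; exact: rg.
  move=> y [Wy [Vy' by0]]; have := E (c i y); rewrite /preimage /= eK// => -> //.
  by rewrite divfK.
have rfx : regular_at x f by exists W.
rewrite (tangent_vector_quot tv rfx (ra _ Ga) (ra _ Gb) b0 H).
by rewrite (tangent_vector_quot tv' rfx (ra _ Ga) (ra _ Gb) b0 H) !tE.
Qed.

End AtlasFields.

Section AtlasSections.
Variables (k : closedFieldType) (n p : nat) (X : kspace k) (I : Type).
Local Notation An := (affine_nspace k n).
Variables (V : I -> set X) (c : I -> X -> An) (e : I -> An -> X).
Hypothesis at_ : atlas V c e.
Variables (N : line_bundle X) (sg : lb_index N -> I).
Hypothesis coverE : forall j, lb_cover N j = V (sg j).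
Variables (v : I -> 'I_p -> An -> (An -> k) -> k) (eps : I -> k) (mlt : I -> I -> 'I_p -> X -> k).
Hypothesis v_field : forall i a, vector_field setT (v i a).
Hypothesis v_trans : forall i j a x l, V i x -> V j x ->
  v i a (c i x) (fun z => z 0 l) = mlt i j a x * v j a (c j x) (fun z => c i (e j z) 0 l).
Hypothesis eps_trans : forall i j x, V (sg i) x -> V (sg j) x ->
  eps (sg i) * \prod_a mlt (sg i) (sg j) a x = lb_trans N i j x * eps (sg j).

(** Between two charts the fields change by the scalars [mlt], so their wedge product changes by the
    product of these. With the constants [eps] this is the transition function of [N], and a nonzero
    determinant at one point shows that the section is nonzero. *)
Lemma atlas_H0 j (y : An) (g : 'I_p -> 'I_n) : eps (sg j) != 0 ->
  \det (\matrix_(a, b) v (sg j) a y (fun z => z 0 (g b))) != 0 -> H0_polyvector_neq0 p N.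
Proof.
move=> ej dj; have [_ _ eV eK eP] := at_.
pose v' i a x f := v i a (c i x) (f \o e i).
have v'_field i a : vector_field (V i) (v' i a) by exact: (@atlas_field _ _ _ _ _ _ _ at_ i _ (v_field i a)).
have oV i : open (V i) by rewrite -[V i]setIT -(preimage_setT (c i)); case: (eP i setT openT).
have coord i l : (fun z => c i z 0 l) \o e i = (fun z => z 0 l).
  by apply/funext => z; rewrite /= (eV i z).2.
exists (fun i x F => eps (sg i) * wedge (v' (sg i)) x F).
  split=> [i x|i i' x F]; rewrite !coverE => Vx.
    exists (V (sg i)), 1%N, (fun _ _ => eps (sg i)), (fun _ => v' (sg i)).
    split=> [|l|l a|z F Vz rF]; [by split|exact: regular_cst|exact: v'_field|by rewrite big_ord1].
  move=> Vx' rF; rewrite mulrA -eps_trans// -!mulrA; congr (_ * _).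
  rewrite /wedge; set B := (X in _ = _ * \det X).
  have <- : diag_mx (\row_a mlt (sg i) (sg i') a x) *m B = \matrix_(a, b) v' (sg i) a x (F b).
    apply/matrixP => a b; rewrite mul_diag_mx !mxE.
    have [/(_ x Vx) tv _] := v'_field (sg i) a.
    have [/(_ x Vx') tv' _] := v'_field (sg i') a.
    have tm : tangent_vector x (fun f => mlt (sg i) (sg i') a x * v' (sg i') a x f).
      apply: (@tangent_vector_eq _ _ _ (fun f => \sum_(u <- [:: tt]) v' (sg i') a x f * mlt (sg i) (sg i') a x)).
        by move=> f _; rewrite big_seq1 mulrC.
      exact: (@tangent_vector_sum _ _ _ _ _ _ (fun _ : unit => v' (sg i') a x)).
    rewrite (atlas_tangent_eq at_ Vx tv tm _ (rF b))// => l.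
    by rewrite /v' coord; exact: v_trans.
  rewrite det_mulmx det_diag; congr (_ * _).
  by apply: eq_bigr => a _; rewrite mxE.
exists j, (e (sg j) y), (fun b z => c (sg j) z 0 (g b)).
have [Ve ce] := eV (sg j) y; split; first by rewrite coverE.
  move=> b; exists (V (sg j)); split=> //; have [_ r] := eP (sg j) setT openT.
  have Gg : gen_alg [set f : 'rV[k]_n -> k | exists i, f = fun y => y 0 i] (fun y => y 0 (g b)).
    by apply: gen_alg_gen; exists (g b).
  by have := r _ (affine_regular_gen Gg); rewrite preimage_setT setIT.
rewrite mulf_neq0// /wedge; congr (\det _ != 0) : dj.
by apply/matrixP => a b; rewrite !mxE /v' coord ce.
Qed.

End AtlasSections.

Section ProjectiveSections.
Variables (k : closedFieldType) (n : nat).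
Local Notation An := (affine_nspace k n).
Local Notation gens := [set f : 'rV[k]_n -> k | exists i, f = fun y => y 0 i].

(* The vector field x_i d/dx_a in the affine coordinates of the chart x_i != 0. *)
Definition homogeneous_field (i a : 'I_n.+1) (y : 'rV[k]_n) : 'rV[k]_n :=
  \row_r ((a == lift i r)%:R - (a == i)%:R * y 0 r).

Lemma homogeneous_field_alg i a r : gen_alg gens (fun y => homogeneous_field i a y 0 r).
Proof.
rewrite (_ : (fun y => _) = fun y : 'rV[k]_n => (a == lift i r)%:R + (- 1) * ((a == i)%:R * y 0 r)); last first.
  by apply/funext => y; rewrite mxE mulN1r.
apply: gen_algD; first exact: gen_alg_cst.
apply: gen_algM; first exact: gen_alg_cst.
by apply: gen_algM; [exact: gen_alg_cst|apply: gen_alg_gen; exists r].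
Qed.

(** The effect of the field on the quotient of the [b]-th by the [j]-th homogeneous coordinate. The
    formula treats the constant quotient [b = j] on the same footing. *)
Lemma homogeneous_chart_vec j a b y :
  directional y (homogeneous_field j a y) (fun z => chart_vec j z 0 b) =
  (a == b)%:R - (a == j)%:R * chart_vec j y 0 b.
Proof.
have [r ->|->] := unliftP j b.
  rewrite (_ : (fun z => _) = fun z : 'rV[k]_n => z 0 r); last by apply/funext => z; rewrite mxE liftK.
  by rewrite directional_coord !mxE liftK.
rewrite (_ : (fun z => _) = fun=> 1); last by apply/funext => z; rewrite chart_vec1.
rewrite (tangent_vector_cst 1 (directional_tangent y _)).
by rewrite chart_vec1 mulr1 subrr.
Qed.

Lemma proj_H0 p : (p <= n)%N -> H0_polyvector_neq0 p (lb_exp (O1 k n) (- p%:Z)).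
Proof.
move=> pn; pose inj (a : 'I_p) : 'I_n.+1 := widen_ord (leqW pn) a.
pose v (i : 'I_n.+1) (a : 'I_p) (y : An) := directional y (homogeneous_field i (inj a) y).
(* The fields are numbered by [a < p], hence differ from the last index; in the chart [ord_max] they
   are coordinate fields and their determinant is 1. *)
apply: (@atlas_H0 k n p _ _ _ _ _ (proj_atlas k n) (lb_exp (O1 k n) (- p%:Z)) (fun i : 'I_n.+1 => i)
  _ v (fun=> 1) (fun i j _ x => htrans j i x) _ _ _ ord_max 0 (widen_ord pn)) => //.
- by move=> i a; apply: directional_field; exact: homogeneous_field_alg.
- move=> i j a x r ix jx; rewrite /v directional_coord mxE.
  pose y := proj_inv j x; have Ex : x = proj_chart j y by rewrite proj_invK.
  have vi : chart_vec j y 0 i != 0 by apply/hcover_chart; rewrite -Ex.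
  have rc b : regular_at y (fun z : An => chart_vec j z 0 b).
    by apply: affine_regular_at; exact: chart_vec_alg.
  have oi : open [set z : An | chart_vec j z 0 i != 0].
    have rb : regular An setT (fun z : An => chart_vec j z 0 i).
      by apply: affine_regular_gen; exact: chart_vec_alg.
    by have := open_regular_neq0 openT rb; rewrite setTI.
  have E (z : An) : proj_inv i (proj_chart j z) 0 r = chart_vec j z 0 (lift i r) / chart_vec j z 0 i.
    by rewrite mxE htrans_chart.
  rewrite (@tangent_vector_quot _ _ _ _ _ (fun z : An => chart_vec j z 0 (lift i r))
    (fun z : An => chart_vec j z 0 i) (directional_tangent y _))//.
  + have -> : proj_inv i x 0 r = chart_vec j y 0 (lift i r) / chart_vec j y 0 i.
      by rewrite {1}Ex E.
    have -> : htrans j i x = chart_vec j y 0 i by rewrite {1}Ex htrans_chart chart_vec1 divr1.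
    by rewrite !homogeneous_chart_vec E; field.
  + have rV : regular An [set z : An | chart_vec j z 0 i != 0]
        (fun z => chart_vec j z 0 (lift i r) / chart_vec j z 0 i).
      by apply: regular_div => //; apply: affine_regular_gen; exact: chart_vec_alg.
    exists [set z : An | chart_vec j z 0 i != 0]; split=> //.
    by apply: regular_ext rV => z _; rewrite E.
  + exists [set z : An | chart_vec j z 0 i != 0]; split=> // z vz.
    by rewrite E divfK.
- move=> i j x ix jx /=; rewrite prodr_const card_ord mul1r mulr1 -exprnN -exprVn.
  by rewrite /htrans invf_div.
- exact: oner_neq0.
- rewrite (_ : \matrix_(a, b) _ = 1%:M) ?det1 ?oner_neq0//; apply/matrixP => a b.
  rewrite /v !mxE directional_coord !mxE mulr0 subr0.
  rewrite -[_ == lift _ _]val_eqE /= /bump leqNgt (leq_trans (ltn_ord b) pn).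
  by rewrite add0n.
Qed.

End ProjectiveSections.

Section LineSections.
Variable k : closedFieldType.
Local Notation P1 := (proj_space k 1).
Local Notation other b := (lift b (ord0 : 'I_1)).
Implicit Types (a b : 'I_2) (V : P1).

Lemma directional_inv n (y w : 'rV[k]_n) m : y 0 m != 0 ->
  directional y w (fun z => (z 0 m)^-1) = - w 0 m / y 0 m ^+ 2.
Proof.
move=> y0; have Gm : gen_alg [set f : 'rV[k]_n -> k | exists i, f = fun y => y 0 i] (fun z => z 0 m).
  by apply: gen_alg_gen; exists m.
have rm : regular (affine_nspace k n) setT (fun z => z 0 m) by exact: affine_regular_gen.
have om : open [set z : affine_nspace k n | z 0 m != 0].
  by have := open_regular_neq0 openT rm; rewrite setTI.
rewrite (@tangent_vector_quot _ _ _ _ _ (fun=> 1) (fun z : affine_nspace k n => z 0 m)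
  (directional_tangent y w))//.
- rewrite directional_coord (tangent_vector_cst 1 (directional_tangent y w)).
  by field.
- exists [set z : affine_nspace k n | z 0 m != 0]; split=> //.
  apply: regularV => //; refine (regular_sub openT om _ rm) => z _ //.
- by exists setT; split=> //; [exact: openT|exact: regular_cst].
- exact: affine_regular_at.
- exists [set z : affine_nspace k n | z 0 m != 0]; split=> // z z0.
  by rewrite mulVf.
Qed.

Lemma other_eq a b : a != b -> other b = a /\ other a = b.
Proof.
by case: a b => [[|[|]]] // ? [[|[|]]] // ? //= _; split; exact: val_inj.
Qed.

(* The factor by which d/dy changes under y |-> 1/y. *)
Definition line_mult a b V : k := if a == b then 1 else - htrans b (other b) V ^+ 2.

Lemma line_mult_neq0 a b V : hcover a V -> hcover b V -> line_mult a b V != 0.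
Proof.
move=> aV bV; rewrite /line_mult; have [_|/other_eq [-> _]] := eqVneq a b; first exact: oner_neq0.
by rewrite oppr_eq0 expf_neq0// htrans_neq0.
Qed.

(** The differential of [1 / y] brings a minus sign, which the constants with alternating sign on
    the two charts absorb. *)
Lemma line_mult_trans a b V : hcover a V -> hcover b V ->
  (-1) ^+ a * line_mult a b V = htrans a b V ^- 2 * (-1) ^+ b.
Proof.
move=> aV bV; rewrite /line_mult; have [<-|ab] := eqVneq a b.
  by rewrite mulr1 /htrans divff// expr1n invr1 mul1r.
have [-> _] := other_eq ab; have -> : htrans b a V = (htrans a b V)^-1 by rewrite /htrans invf_div.
have -> : (-1) ^+ a = - (-1) ^+ b :> k.
  by case: a b ab {aV bV} => [[|[|]]] // ? [[|[|]]] // ? //= _; rewrite expr0 expr1 ?opprK.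
by rewrite mulrN mulNr opprK mulrC exprVn.
Qed.

Lemma line_directional n (y w : 'rV[k]_n) m a b V : hcover a V -> hcover b V ->
  y 0 m = htrans b (other b) V ->
  directional y w (fun z => htrans a (other a) (proj_chart b (const_mx (z 0 m) : affine_nspace k 1))) =
  w 0 m / line_mult a b V.
Proof.
move=> aV bV ym; rewrite /line_mult; have [<-|ab] := eqVneq a b.
  rewrite divr1 -(directional_coord y w m); congr directional; apply/funext => z.
  by rewrite htrans_chart chart_vec1 divr1 mxE liftK mxE.
have [oba oab] := other_eq ab.
have -> : (fun z : 'rV[k]_n => htrans a (other a) (proj_chart b (const_mx (z 0 m) : affine_nspace k 1))) =
    (fun z => (z 0 m)^-1).
  apply/funext => z; rewrite htrans_chart oab chart_vec1 div1r; congr (_^-1).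
  by rewrite -oba mxE liftK mxE.
rewrite directional_inv ym; last by rewrite oba htrans_neq0.
by rewrite invrN mulrN mulNr.
Qed.

Lemma O2_H0 : H0_polyvector_neq0 1 (lb_exp (Od k 1 2) (- 1%:Z)).
Proof.
pose v (i : 'I_2) (_ : 'I_1) (y : affine_nspace k 1) := directional y (const_mx 1).
apply: (@atlas_H0 k 1 1 _ _ _ _ _ (proj_atlas k 1) (lb_exp (Od k 1 2) (- 1%:Z)) (fun i : 'I_2 => i)
  _ v (fun i => (-1) ^+ i) (fun i j _ x => line_mult i j x) _ _ _ ord0 0 (fun=> ord0)) => //.
- move=> i a; apply: directional_field => r.
  rewrite (_ : (fun _ => _) = fun=> 1); first exact: gen_alg_cst.
  by apply/funext => y; rewrite mxE.
- move=> i j a x l ix jx; rewrite (ord1 l) /v directional_coord mxE.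
  have -> : (fun z : affine_nspace k 1 => proj_inv i (proj_chart j z) 0 0) =
      (fun z => htrans i (other i) (proj_chart j (const_mx (z 0 0) : affine_nspace k 1))).
    apply/funext => z; rewrite mxE; congr (htrans _ _ (proj_chart _ _)).
    by apply/rowP => r; rewrite mxE (ord1 r).
  rewrite (line_directional _ ix jx); last by rewrite mxE.
  by rewrite mxE div1r divff// line_mult_neq0.
- by move=> i j x ix jx /=; rewrite big_ord1 line_mult_trans.
- by rewrite expr0 oner_neq0.
- rewrite (_ : \matrix_(a, b) _ = 1%:M) ?det1 ?oner_neq0//; apply/matrixP => a b.
  by rewrite !mxE /v directional_coord mxE !ord1.
Qed.

(** Each coordinate field changes by the multiplier of its own factor, so the two calculations on
    the line multiply. *)
Lemma O11_H0 : H0_polyvector_neq0 2 (lb_exp (O11 k) (- 2%:Z)).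
Proof.
pose v (x : 'I_2 * 'I_2) (a : 'I_2) (y : affine_nspace k 2) := directional y (\row_l (l == a)%:R).
pose mlt (x x' : 'I_2 * 'I_2) (a : 'I_2) z := line_mult (pick_pair x a) (pick_pair x' a) (component z a).
apply: (@atlas_H0 k 2 2 _ _ _ _ _ (quad_atlas k) (lb_exp (O11 k) (- 2%:Z)) (fun x : 'I_2 * 'I_2 => x)
  _ v (fun x => (-1) ^+ x.1 * (-1) ^+ x.2) mlt _ _ _ (ord0, ord0) 0 id) => //.
- move=> x a; apply: directional_field => r.
  rewrite (_ : (fun _ => _) = fun=> (r == a)%:R); first exact: gen_alg_cst.
  by apply/funext => y; rewrite mxE.
- move=> x x' a z l xz x'z.
  have qc w i : quad_cover w z -> hcover (pick_pair w i) (component z i).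
    by rewrite /component /pick_pair => -[]; case: ifP.
  rewrite /v directional_coord mxE.
  have -> : (fun t : affine_nspace k 2 => quad_crd x (quad_chart x' t) 0 l) =
      (fun t => htrans (pick_pair x l) (other (pick_pair x l))
        (proj_chart (pick_pair x' l) (const_mx (t 0 l) : affine_nspace k 1))).
    by apply/funext => t; rewrite mxE component_chart.
  rewrite (line_directional _ (qc x l xz) (qc x' l x'z)); last by rewrite mxE.
  rewrite mxE; have [->|] := eqVneq l a; last by rewrite mul0r mulr0.
  by rewrite div1r divff// line_mult_neq0//; exact: qc.
- move=> x x' z [x1 x2] [x1' x2'] /=.
  rewrite big_ord_recl big_ord1 /mlt /pick_pair /component /=.
  rewrite mulrACA !line_mult_trans// mulrACA; congr (_ * _).
  by rewrite -invfM -exprMn.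
- by rewrite !expr0 mul1r oner_neq0.
- rewrite (_ : \matrix_(a, b) _ = 1%:M) ?det1 ?oner_neq0//; apply/matrixP => a b.
  by rewrite !mxE /v directional_coord mxE eq_sym.
Qed.

End LineSections.

Theorem theorem1p2 (k : closedFieldType) :
  (forall (n : nat) (Sigma : fan n) (L : line_bundle (toric_variety k Sigma))
          (p : nat),
     smooth_of_dim (toric_variety k Sigma) n ->
     projective (toric_variety k Sigma) ->
     ample L ->
     (1 <= p)%N -> (p <= n)%N ->
     H0_polyvector_neq0 p (lb_exp L (- p%:Z)) ->
     [\/ polarized_iso L (O1 k n),
         [/\ p = 1%N, n = 1%N & polarized_iso L (Od k 1 2)] |
         [/\ p = 2%N, n = 2%N & polarized_iso L (O11 k)]])
  /\
  [/\ forall n p : nat, (1 <= p)%N -> (p <= n)%N ->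
        H0_polyvector_neq0 p (lb_exp (O1 k n) (- p%:Z)),
      H0_polyvector_neq0 1 (lb_exp (Od k 1 2) (- 1%:Z)) &
      H0_polyvector_neq0 2 (lb_exp (O11 k) (- 2%:Z))].
Proof.
split; last by split; [move=> n p _; exact: proj_H0|exact: O2_H0|exact: O11_H0].
move=> n Sigma L p smooth proj amp p_gt0 p_le_n H.
have [F|[p1 n1 F]|[p2 n2 F]] := toric_classification smooth proj amp p_gt0 p_le_n H.
- by constructor 1; exact: (simplex_iso F).
- by constructor 2; split=> //; subst n; exact: simplex_iso.
- by constructor 3; split=> //; subst n; exact: quadrant_iso.
Qed.
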